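(* Let $G$ be a Carnot group and let $\gamma:[-T,T]\to G$, $T>0$, be a length-minimizing curve parametrized by arclength. Then there exists an infinitesimal sequence $\eta_i\downarrow 0$ (of positive numbers) such that \[ \lim_{i\to\infty}\mathrm{Exc}(\gamma;[-\eta_i,\eta_i])=0. \]
   Context: A Carnot group is a finite-dimensional connected, simply connected, nilpotent Lie group $G$ whose Lie algebra $\mathfrak g$ (of left-invariant vector fields) is stratified, i.e. equipped with a fixed decomposition $\mathfrak g=\mathfrak g_1\oplus\dots\oplus\mathfrak g_s$ with $\mathfrak g_j=[\mathfrak g_1,\mathfrak g_{j-1}]$ for $j=2,\dots,s$ and $[\mathfrak g,\mathfrak g_s]=\{0\}$. Here $s\ge2$ is the step and $r=\dim\mathfrak g_1\ge2$ is the rank. $X_1,\dots,X_r$ is a fixed basis of $\mathfrak g_1$, $\langle\cdot,\cdot\rangle$ is the scalar product on $\mathfrak g_1$ making it orthonormal, and $S^{r-1}=\{v\in\mathfrak g_1:\langle v,v\rangle=1\}$. A Lipschitz curve $\gamma:I\to G$ is horizontal if $\dot\gamma(t)=\sum_{i=1}^r h_i(t)X_i(\gamma(t))$ for a.e. $t\in I$, with $h_1,\dots,h_r\in L^\infty(I)$. Its length is $L(\gamma)=\int_I|h|\,dt$, $|h|=(h_1^2+\dots+h_r^2)^{1/2}$, and it is parametrized by arclength if $|h|=1$ a.e. The distance $d(x,y)$ is the infimum of the lengths of horizontal curves joining $x$ to $y$. A horizontal curve $\gamma:[a,b]\to G$ is length-minimizing if $L(\gamma)=d(\gamma(a),\gamma(b))$.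 For a horizontal curve $\gamma:[-T,T]\to G$, identify $\dot\gamma(t)$ with the element $\sum_{i=1}^rh_i(t)X_i\in\mathfrak g_1$. The excess of $\gamma$ over a Borel set $B\subseteq[-T,T]$ of positive Lebesgue measure is \[ \mathrm{Exc}(\gamma;B)=\inf_{v\in S^{r-1}}\Big(\frac1{\mathcal L^1(B)}\int_B\langle v,\dot\gamma(t)\rangle^2\,dt\Big)^{1/2}. \] *)

(* Defs.v *)
From HB Require Import structures.
From mathcomp Require Import all_boot all_order all_algebra.
From mathcomp Require Import all_classical all_reals all_analysis.
Import Order.TTheory GRing.Theory Num.Theory.
Import numFieldNormedType.Exports.

Set Implicit Arguments.
Unset Strict Implicit.
Unset Printing Implicit Defensive.

Local Open Scope classical_set_scope.
Local Open Scope ring_scope.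

(* Groups carrying a topology; the compatibility of the two is a field of
   [lie_group] below. *)
#[short(type="groupTopologicalType")]
HB.structure Definition GroupTopological := {G of Group G & Topological G}.

Section smooth.
Context {R : realType} {V W : normedModType R}.

Fixpoint Ck_on (k : nat) (U : set V) (f : V -> W) : Prop :=
  (forall x, U x -> {for x, continuous f}) /\
  if k is k'.+1 then
    forall v, (forall x, U x -> derivable f x v) /\ Ck_on k' U ('D_v f)
  else True.

(* Meant for open [U], where it is the usual notion of a C^oo function. *)
Definition smooth_on (U : set V) (f : V -> W) := forall k, Ck_on k U f.

Definition vf_bracket (X Y : V -> V) (x : V) : V :=
  'D_(X x) Y x - 'D_(Y x) X x.

End smooth.

(* [chart_map] and [chart_inv] are total functions, relevant only on [chart_dom]
   and [chart_img] respectively. *)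
Record chart (R : realType) (n : nat) (G : topologicalType) := Chart {
  chart_dom : set G;
  chart_map :> G -> 'rV[R]_n;
  chart_inv : 'rV[R]_n -> G;
  chart_img := chart_map @` chart_dom;
  open_chart_dom : open chart_dom;
  open_chart_img : open chart_img;
  chart_mapK : forall p, chart_dom p -> chart_inv (chart_map p) = p;
  chart_map_continuous : forall p, chart_dom p -> {for p, continuous chart_map};
  chart_inv_continuous : forall x, chart_img x -> {for x, continuous chart_inv}
}.

(* Points of R^n x R^n are written as row vectors of length n + n.
   The chart [chart1] at the identity serves to identify the tangent space at
   the identity with R^n. *)
Record lie_group (R : realType) (n : nat) := LieGroup {
  lg_sort :> groupTopologicalType;
  atlas : set (chart R n lg_sort);
  chart1 : chart R n lg_sort;
  lg_hausdorff : hausdorff_space lg_sort;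
  lg_second_countable : @second_countable lg_sort;
  atlas_cover : forall p : lg_sort, exists2 c, atlas c & chart_dom c p;
  atlas_chart1 : atlas chart1;
  chart1_dom1 : chart_dom chart1 (1%g : lg_sort);
  atlas_smooth : forall c c', atlas c -> atlas c' ->
    smooth_on (c @` (chart_dom c `&` chart_dom c'))
      (fun x => c' (chart_inv c x));
  mulg_continuous :
    continuous (fun pq : lg_sort * lg_sort => (pq.1 * pq.2)%g);
  invg_continuous : continuous (fun p : lg_sort => p^-1%g);
  mulg_smooth : forall a b c, atlas a -> atlas b -> atlas c ->
    smooth_on
      [set z : 'rV[R]_(n + n) |
        [/\ chart_img a (lsubmx z), chart_img b (rsubmx z) &
            chart_dom c (chart_inv a (lsubmx z) * chart_inv b (rsubmx z))%g]]
      (fun z => c (chart_inv a (lsubmx z) * chart_inv b (rsubmx z))%g);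
  invg_smooth : forall a c, atlas a -> atlas c ->
    smooth_on [set x | chart_img a x /\ chart_dom c (chart_inv a x)^-1%g]
      (fun x => c (chart_inv a x)^-1%g)
}.

Section lie_algebra.
Context {R : realType} {n : nat} (G : lie_group R n).

(* A vector v of R^n stands for the tangent vector at the identity whose
   coordinates in [chart1] are v, hence for the left-invariant vector field
   extending it.  [lvf v c p] is the vector of coordinates in the chart c of the
   value at p of that field, i.e. of the image of v under the differential at
   the identity of the left translation by p. *)
Definition lvf (v : 'rV[R]_n) (c : chart R n G) (p : G) : 'rV[R]_n :=
  'D_v (fun x => c (p * chart_inv (chart1 G) x)%g) (chart1 G 1%g).

(* The commutator of two left-invariant fields is left-invariant, so it is
   determined by its value at the identity. *)
Definition lie_bracket (u v : 'rV[R]_n) : 'rV[R]_n :=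
  vf_bracket (fun x => lvf u (chart1 G) (chart_inv (chart1 G) x))
             (fun x => lvf v (chart1 G) (chart_inv (chart1 G) x))
             (chart1 G 1%g).

(* W = [U, V]: W is the linear span of the brackets [u, v]. *)
Definition is_bracket_space (U V W : {vspace 'rV[R]_n}) :=
  (forall u v, u \in U -> v \in V -> lie_bracket u v \in W) /\
  (forall W' : {vspace 'rV[R]_n},
    (forall u v, u \in U -> v \in V -> lie_bracket u v \in W') ->
    (W <= W')%VS).

End lie_algebra.

Fixpoint upper_central (G : groupType) (k : nat) : set G :=
  if k is k'.+1 then [set x | forall y, upper_central k' [~ x, y]%g]
  else [set 1%g].

Definition nilpotent_groupType (G : groupType) :=
  exists k, upper_central k = [set: G].

Definition simply_connected (R : realType) (G : topologicalType) :=
  forall (x : G) (f : R -> G),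
    {within `[0, 1], continuous f} -> f 0 = x -> f 1 = x ->
    exists H : R * R -> G,
      {within `[0, 1] `*` `[0, 1], continuous H} /\
      forall t, t \in `[0, 1] ->
        [/\ H (0, t) = f t, H (1, t) = x, H (t, 0) = x & H (t, 1) = x].

(* Only the values of [layer] at 1, ..., s are relevant. *)
Record carnot_group (R : realType) (n s r : nat) := CarnotGroup {
  cg_lie_group :> lie_group R n;
  cg_connected : connected [set: cg_lie_group];
  cg_simply_connected : simply_connected R cg_lie_group;
  cg_nilpotent : nilpotent_groupType cg_lie_group;
  layer : nat -> {vspace 'rV[R]_n};
  layer_direct : directv (\sum_(j < s) layer j.+1)%VS;
  layer_total : (\sum_(j < s) layer j.+1)%VS = fullv;
  layer_bracket : forall j, (2 <= j <= s)%N ->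
    is_bracket_space cg_lie_group (layer 1) (layer j.-1) (layer j);
  layer_last : is_bracket_space cg_lie_group fullv (layer s) 0%VS;
  layer_step : layer s != 0%VS;
  cg_step : (2 <= s)%N;
  cg_rank : (2 <= r)%N;
  hbasis : r.-tuple 'rV[R]_n;
  hbasisP : basis_of (layer 1) hbasis
}.

Section curves.
Context {R : realType} {n s r : nat} (G : carnot_group R n s r).
Local Notation mu := (@lebesgue_measure R).

(* Lipschitz continuity in charts, which on a compact interval is the same as
   Lipschitz continuity for the distance of any Riemannian metric on G. *)
Definition lipschitz_curve (a b : R) (gamma : R -> G) :=
  forall t0 (c : chart R n G), t0 \in `[a, b] -> atlas c ->
    chart_dom c (gamma t0) ->
    exists e K : R, 0 < e /\
      forall t u, t \in `[a, b] -> u \in `[a, b] ->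
        `|t - t0| < e -> `|u - t0| < e ->
        [/\ chart_dom c (gamma t), chart_dom c (gamma u) &
            `|c (gamma t) - c (gamma u)| <= K * `|t - u|].

Definition Linfty_on (a b : R) (f : R -> R) :=
  measurable_fun `[a, b] f /\
  exists M : R, {ae mu, forall t, t \in `[a, b] -> `|f t| <= M}.

(* The restriction of gamma to [a, b] is horizontal with controls h. *)
Definition horizontal (a b : R) (gamma : R -> G) (h : 'I_r -> R -> R) :=
  [/\ lipschitz_curve a b gamma,
      forall i, Linfty_on a b (h i) &
      {ae mu, forall t, t \in `[a, b] ->
        forall c : chart R n G, atlas c -> chart_dom c (gamma t) ->
          is_derive t 1 (fun u => c (gamma u))
            (\sum_(i < r) h i t *: lvf (hbasis G)`_i c (gamma t))}].

Definition control_norm (h : 'I_r -> R -> R) (t : R) : R :=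
  Num.sqrt (\sum_(i < r) h i t ^+ 2).

Definition arclength (a b : R) (h : 'I_r -> R -> R) :=
  {ae mu, forall t, t \in `[a, b] -> control_norm h t = 1}.

Definition curve_length (a b : R) (h : 'I_r -> R -> R) : \bar R :=
  (\int[mu]_(t in `[a, b]) (control_norm h t)%:E)%E.

Definition cc_dist (x y : G) : \bar R :=
  ereal_inf [set l | exists (a b : R) (gamma : R -> G) (h : 'I_r -> R -> R),
    [/\ a <= b, horizontal a b gamma h, gamma a = x, gamma b = y &
        l = curve_length a b h]].

Definition length_minimizing (a b : R) (gamma : R -> G) (h : 'I_r -> R -> R) :=
  curve_length a b h = cc_dist (gamma a) (gamma b).

Definition hdot (u v : 'rV[R]_n) : R :=
  \sum_(i < r) coord (hbasis G) i u * coord (hbasis G) i v.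

Definition hsphere : set 'rV[R]_n :=
  [set v | v \in layer G 1 /\ hdot v v = 1].

Definition hvelocity (h : 'I_r -> R -> R) (t : R) : 'rV[R]_n :=
  \sum_(i < r) h i t *: (hbasis G)`_i.

(* The excess over B of a horizontal curve with controls h; it depends on the
   curve through its velocity only. *)
Definition excess (h : 'I_r -> R -> R) (B : set R) : R :=
  inf [set Num.sqrt ((fine (mu B))^-1 *
                     \int[mu]_(t in B) hdot v (hvelocity h t) ^+ 2)
      | v in hsphere].

End curves.

(* Main.v *)
Require Import Defs.
From HB Require Import structures.
From mathcomp Require Import all_boot all_order all_algebra.
From mathcomp Require Import all_classical all_reals all_analysis measurable_realfun.
From mathcomp Require Import ring lra zify.
Set Implicit Arguments.
Unset Strict Implicit.
Unset Printing Implicit Defensive.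
Import Order.TTheory GRing.Theory Num.Theory.
Import numFieldNormedType.Exports.
Local Open Scope classical_set_scope.
Local Open Scope ring_scope.

(** Suppose that the excess over [-eta, eta] is at least some eps for all eta in
    (0, eta0]. A horizontal curve with the endpoints of gamma and shorter than gamma is
    then built in finitely many steps, one for each degree of the stratification.

    Cut ([shortcut_chord]). Project an arc of gamma over [-eta, eta] to the first
    layer. A unit vector orthogonal to the chord of the projection shows, by the bound
    on the excess, that the velocity has a component of mean square at least eps^2
    off the chord; so the chord is shorter than the arc by a fixed fraction of eta.
    The segment with the same projection ends at the right point up to an error of
    degree 2.

    Correct ([shortcut_succ]). Suppose that a shortcut at scale eta, with a gain of
    order eta, ends at the right point up to an error of degree j + 1. The error is a
    sum of brackets [y_a, X_a], with y_a in the layer of degree j. At a much larger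
    scale zeta, the increments D_i of the projection of gamma along a fine grid span the
    first layer quantitatively: this is the second use of the bound on the excess
    ([spanning_grid]), together with the fact that fine inscribed polygons are almost
    as long as a minimizer ([polygon_length]). Hence the X_a are combinations of the
    D_i, and the error is a sum of brackets [w_i, D_i]. Conjugating the i-th arc of the
    grid by an element with leading term w_i creates such a bracket, so the error is
    removed and only terms of degree j + 2 are left. The conjugating elements are
    endpoints of words of segments, of length eta (eta / zeta)^(1 / j) up to a constant,
    which is negligible compared with the gain once zeta / eta is a large constant.
    After the last degree no error is left, and minimality is contradicted
    ([no_excess_bound]). The sequence of the theorem is then chosen step by step.

    The construction takes place in a group of unipotent matrices, where dilations
    are conjugations by diagonal matrices and leading terms are read on the entries.
    The Lie algebra is represented faithfully by the adjoint representation extended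
    by the derivation which multiplies the layer of degree j by j ([rho]); the
    exponentials of its elements generate the group. A horizontal curve of G lifts
    to a curve of matrices with the same controls: along a basis sorted by degree,
    the curve is written as an ordered product of one-parameter subgroups, factor
    after factor ([peel]). Conversely the matrix determines the element of G, as
    its first column gives the parameters of the ordered product ([Gm_inj]); so a
    word of matrices with the endpoint of the lift of gamma is a horizontal curve
    of G joining the endpoints of gamma ([word_min]). The link between G and its Lie
    algebra is the derivative of the adjoint action along a curve ([dat_A]), from which
    the Jacobi identity and the compatibility of the two exponentials ([rho_A])
    follow. *)

(** * One-variable calculus: derivatives, Lipschitz curves, almost everywhere *)

Section calculus.
Context {R : realType}.
Local Notation mu := (@lebesgue_measure R).

(** Derivative at a point in epsilon-delta form: the arguments below estimate
    increments of curves of matrices, and this form gives the estimate at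
    once. *)
Definition dat {V : normedModType R} (f : R -> V) (t : R) (v : V) :=
  forall e, 0 < e -> exists2 d, 0 < d &
    forall u, `|u - t| < d -> `|f u - f t - (u - t) *: v| <= e * `|u - t|.

Definition lip {V : normedModType R} (f : R -> V) (a b : R) :=
  exists K, forall t u, a <= t <= b -> a <= u <= b ->
    `|f t - f u| <= K * `|t - u|.

Definition aei (a b : R) (P : R -> Prop) := {ae mu, forall t, a < t < b -> P t}.

(** The points reached from [a] have a supremum; it is reached, and it can be
    overtaken unless it is [b]. This packages compactness for relations which,
    unlike mere continuity, carry an estimate, possibly of a different kind
    around exceptional points. *)
Lemma local_to_global (Q : R -> R -> Prop) (a b : R) : a <= b ->
  (forall u v w, u <= v -> v <= w -> Q u v -> Q v w -> Q u w) ->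
  (forall t, a <= t <= b -> exists2 d, 0 < d & forall u v,
     a <= u -> v <= b -> t - d < u -> u <= t -> t <= v -> v < t + d -> Q u v) ->
  Q a b.
Proof.
move=> ab Qt Ql.
pose S := [set x | a <= x <= b /\ Q a x].
have Sa : S a.
  split; first by rewrite lexx.
  have [|d d0 H] := Ql a; first by rewrite lexx.
  by apply: H => //; [rewrite ltrBlDr ltrDl|rewrite ltrDl].
have hS : has_sup S.
  by split; [exists a|exists b => x [/andP[_ ?] _]].
set m := sup S.
have am : a <= m by apply: ub_le_sup => //; case: hS.
have mb : m <= b by apply: ge_sup => [|x [/andP[_ ?] _]//]; exists a.
have [|d d0 H] := Ql m; first by rewrite am mb.
have [x [/andP[ax xb] Qx] mx] := sup_adherent d0 hS.
have xm : x <= m by apply: ub_le_sup; [case: hS|split; rewrite ?ax].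
have [bm|bm] := leP b m.
  have mE : m = b by apply/eqP; rewrite eq_le mb bm.
  apply: (Qt _ x) => //.
  by apply: H => //; rewrite mE ltrDl.
pose v := Num.min b (m + d / 2).
have mv : m < v by rewrite lt_min bm ltrDl divr_gt0.
have vb : v <= b by rewrite ge_min lexx.
have vd : v < m + d.
  by apply: (le_lt_trans (y := m + d / 2)); [rewrite ge_min lexx orbT|lra].
suff : v <= m by rewrite leNgt mv.
apply: ub_le_sup; first by case: hS.
split; first by rewrite vb andbT (le_trans am) // ltW.
apply: (Qt _ x) => //; first exact/(le_trans xm)/ltW.
by apply: H => //; exact: ltW.
Qed.

(** Outside the null set where nothing is known, the derivative makes
    increments at most [e] times the length. The null set is covered by an
    open set [U] of measure at most [e], in which the Lipschitz constant pays
    for the increments. *)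
Lemma lip_nonincreasing (f : R -> R) (a b : R) : a <= b -> lip f a b ->
  aei a b (fun t => exists2 v, v <= 0 & dat f t v) -> f b <= f a.
Proof.
move=> ab [K0 fK0] [N [mN N0 hN]].
pose K := Num.max K0 1.
have K1 : 0 < K by rewrite lt_max ltr01 orbT.
have fK t u : a <= t <= b -> a <= u <= b -> `|f t - f u| <= K * `|t - u|.
  move=> ht hu; apply: le_trans (fK0 _ _ ht hu) _.
  by rewrite ler_wpM2r // le_max lexx.
suff H e : 0 < e -> f b - f a <= e * (b - a + K).
  rewrite -subr_le0; apply/ler_addgt0Pl => e e0; rewrite addr0.
  have bK : 0 < b - a + K by rewrite ltr_wpDl // subr_ge0.
  by have := H (e / (b - a + K)) (divr_gt0 e0 bK); rewrite divfK // gt_eqF.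
move=> e0.
(* The endpoints, where no derivative is given, join the null set. *)
pose N' := N `|` [set a; b].
have mN' : measurable N' by apply: measurableU => //; apply: measurableU.
have N'0 : mu N' = 0%E.
  apply/eqP; rewrite eq_le measure_ge0 andbT.
  apply: le_trans (measureU2 _ mN _) _; first exact: measurableU.
  rewrite [X in (X + _)%E]N0 add0e; apply: le_trans (measureU2 _ _ _) _ => //.
  by rewrite [X in (X + _)%E]lebesgue_measure_set1 [X in (_ + X)%E]lebesgue_measure_set1 adde0.
have [|U [oU NU Ue]] := lebesgue_regularity_outer mN' _ e0.
  by rewrite [X in (X < _)%E]N'0 ltry.
have mU : measurable U by exact: measurable_realfun.open_measurable.
have muU : (mu U <= e%:E)%E.
  have -> : U = (U `\` N') `|` N'.
    by apply/seteqP; split => x; [case: (pselect (N' x)); [right|left]|case=> [[]//|/NU]].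
  apply: le_trans (measureU2 _ _ _) _ => //; first exact: measurableD.
  by rewrite [X in (_ + X)%E]N'0 adde0 ltW.
pose A u v := U `&` `]u, v]%classic.
have mA u v : measurable (A u v) by exact: measurableI.
have key : ((f b - f a)%:E <= (e * (b - a))%:E + K%:E * mu (A a b))%E.
  apply: (@local_to_global (fun u v =>
    ((f v - f u)%:E <= (e * (v - u))%:E + K%:E * mu (A u v))%E)) => //.
    move=> u v w uv vw h1 h2.
    have -> : A u w = A u v `|` A v w.
      rewrite /A -setIUr; congr (_ `&` _); apply/seteqP; split => x /=; rewrite !in_itv /=.
        by move=> /andP[-> ->]; case: (leP x v) => ?; [left|right].
      by case=> /andP[h3 h4]; [rewrite h3 (le_trans h4)|rewrite h4 (le_lt_trans uv)].
    rewrite measureU; [|exact: mA|exact: mA|]; last first.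
      apply/seteqP; split=> // x [[_ /=]] + [_ /=]; rewrite !in_itv /=.
      by move=> /andP[_ xv] /andP[vx _]; move: (lt_le_trans vx xv); rewrite ltxx.
    rewrite ge0_muleDr //.
    have -> : (f w - f u)%:E = ((f v - f u)%:E + (f w - f v)%:E)%E.
      by rewrite -EFinD; congr EFin; ring.
    have -> : (e * (w - u))%:E = ((e * (v - u))%:E + (e * (w - v))%:E)%E.
      by rewrite -EFinD; congr EFin; ring.
    by rewrite addeACA leeD.
  move=> t /andP[at_ tb].
  have [tU|tU] := pselect (U t).
    have /nbhs_ballP[d /= d0 dU] := open_nbhs_nbhs (conj oU tU).
    exists d => // u v au vb tu ut tv vt.
    have uv := le_trans ut tv.
    have -> : A u v = `]u, v]%classic.
      apply/seteqP; split => x /=; first by case.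
      rewrite in_itv /= => /andP[ux xv]; split=> /=; last by rewrite in_itv /= ux xv.
      by apply: dU; rewrite /ball /= ltr_norml; apply/andP; split; lra.
    rewrite lebesgue_measure_itv /= lte_fin.
    case: ltgtP uv => // [uv|->] _; last by rewrite !subrr mulr0 mule0 adde0.
    rewrite (_ : (v%:E + (- u)%:E)%E = (v - u)%:E) // -EFinM -EFinD lee_fin.
    have := fK v u; rewrite (le_trans au (ltW uv)) vb au (le_trans (ltW uv) vb).
    move=> /(_ isT isT); rewrite (gtr0_norm (x := v - u)) ?subr_gt0 // => h.
    apply: le_trans (ler_norm _) _; apply: le_trans h _.
    by rewrite lerDr mulr_ge0 ?subr_ge0 // ltW.
  have [ta [tb' Nt]] : t <> a /\ t <> b /\ ~ N t.
    by split; [|split] => h; apply: tU; apply: NU; [right; left|right; right|left].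
  have [v v0 dv] : exists2 v, v <= 0 & dat f t v.
    apply: contrapT => hv; apply: Nt; apply: hN => /= /(_ _) h; apply: hv; apply: h.
    by rewrite !lt_neqAle at_ tb !andbT; apply/andP; split; apply/eqP => // h; apply: ta.
  have [d d0 hd] := dv _ e0.
  exists d => // u w au wb tu ut tw wt.
  apply: (@le_trans _ _ (e * (w - u))%:E); last by rewrite leeDl // mule_ge0 // lee_fin ltW.
  rewrite lee_fin.
  have h1 := hd u; have h2 := hd w.
  have {}h1 : f t - f u <= e * (t - u).
    have : `|u - t| < d by rewrite ltr_norml; apply/andP; split; lra.
    move=> /h1; rewrite ler_norml => /andP[h _].
    move: h; rewrite (ler0_norm (x := u - t)) ?subr_le0 // /GRing.scale /= => h.
    have : 0 <= (u - t) * v by rewrite mulr_le0 ?subr_le0.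
    lra.
  have {}h2 : f w - f t <= e * (w - t).
    have : `|w - t| < d by rewrite ltr_norml; apply/andP; split; lra.
    move=> /h2; rewrite ler_norml => /andP[_ h].
    move: h; rewrite (ger0_norm (x := w - t)) ?subr_ge0 // /GRing.scale /= => h.
    have : (w - t) * v <= 0 by rewrite mulr_ge0_le0 ?subr_ge0.
    lra.
  lra.
move: key.
have Ale : (mu (A a b) <= e%:E)%E.
  by apply: le_trans muU; apply: le_measure; rewrite ?inE; [exact: mA|exact: mU|exact: subIsetl].
move=> /le_trans /(_ (leeD2l _ (lee_wpmul2l _ Ale))).
rewrite lee_fin ltW // => /(_ isT).
by rewrite -EFinM -EFinD lee_fin; lra.
Qed.

Lemma dat_derive {V : normedModType R} (f : R -> V) t v :
  dat f t v <-> is_derive t 1 f v.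
Proof.
have E (x : R) (w : V) : x != 0 -> v - x^-1 *: w = - (x^-1 *: (w - x *: v)).
  by move=> x0; rewrite scalerBr scalerA mulVf // scale1r opprB.
split => [h|[dv hv]].
  suff H : (fun h0 => h0^-1 *: ((f \o shift t) (h0 *: 1) - f t)) @ 0^' --> v.
    split; first by apply/cvg_ex; exists v.
    by apply/cvg_lim.
  apply/cvgrPdist_le => e e0; have [d d0 hd] := h _ e0.
  near=> x.
  have x0 : x != 0 by near: x; exact: nbhs_dnbhs_neq.
  have xd : `|x| < d by near: x; apply: dnbhs0_lt.
  have := hd (x + t); rewrite addrK => /(_ xd) h1.
  rewrite /= (_ : x%:A = x) ?[_%:A]mulr1 // E // normrN normrZ normfV.
  by rewrite ler_pdivrMl ?normr_gt0 // mulrC.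
move=> e e0.
move: dv => /cvg_ex[l hl].
have lv : l = v by rewrite -hv /derive; apply/esym/cvg_lim.
move: hl; rewrite lv => /cvgrPdist_le /(_ _ e0) /nbhs_ballP[d /= d0 hd].
exists d => // u ud; have [->|ut] := eqVneq u t.
  by rewrite !subrr scale0r subr0 !normr0 mulr0.
have ut0 : u - t != 0 by rewrite subr_eq0.
have := hd (u - t); rewrite /ball /= sub0r normrN => /(_ ud ut0).
rewrite [(_%:A)]mulr1 subrK E // normrN normrZ normfV.
by rewrite ler_pdivrMl ?normr_gt0 // mulrC.
Unshelve. all: by end_near. Qed.

Lemma dat_eq {V : normedModType R} (f : R -> V) t v w : dat f t v -> v = w -> dat f t w.
Proof. by move=> ? <-. Qed.

Lemma dat_unique {V : normedModType R} (f : R -> V) t v w :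
  dat f t v -> dat f t w -> v = w.
Proof. by move=> /dat_derive[_ <-] /dat_derive[_ <-]. Qed.

Lemma dat_ext {V : normedModType R} (f g : R -> V) t v d0 : 0 < d0 ->
  (forall u, `|u - t| < d0 -> f u = g u) -> dat f t v -> dat g t v.
Proof.
move=> d00 fg h e /h[d1 d10 hd]; exists (Num.min d0 d1); first by rewrite lt_min d00.
move=> u; rewrite lt_min => /andP[u0 u1]; rewrite -!fg ?subrr ?normr0 //; exact: hd.
Qed.

Lemma dat_cst {V : normedModType R} (c : V) t : dat (fun=> c) t 0.
Proof.
by move=> e e0; exists 1 => // u _; rewrite subrr scaler0 subr0 normr0 mulr_ge0 // ltW.
Qed.

Lemma dat_id t : dat (fun x : R => x) t 1.
Proof.
by move=> e e0; exists 1 => // u _; rewrite [_%:A]mulr1 subrr normr0 mulr_ge0 // ltW.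
Qed.

Lemma datD {V : normedModType R} (f g : R -> V) t v w :
  dat f t v -> dat g t w -> dat (fun x => f x + g x) t (v + w).
Proof. by move=> /dat_derive hf /dat_derive hg; apply/dat_derive; exact: is_deriveD. Qed.

Lemma datB {V : normedModType R} (f g : R -> V) t v w :
  dat f t v -> dat g t w -> dat (fun x => f x - g x) t (v - w).
Proof. by move=> /dat_derive hf /dat_derive hg; apply/dat_derive; exact: is_deriveB. Qed.

Lemma datM (f g : R -> R) t v w :
  dat f t v -> dat g t w -> dat (fun x => f x * g x) t (v * g t + f t * w).
Proof.
move=> /dat_derive hf /dat_derive hg; apply/dat_derive.
have := is_deriveM hf hg => /is_derive_eq; apply.
by rewrite /GRing.scale /= addrC mulrC.
Qed.

Lemma datMc (f : R -> R) c t v : dat f t v -> dat (fun x => c * f x) t (c * v).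
Proof.
by move=> h; have := datM (dat_cst c t) h => /dat_eq; apply; rewrite mul0r add0r.
Qed.

Lemma dat_sum {V : normedModType R} n (f : 'I_n -> R -> V) t v :
  (forall i, dat (f i) t (v i)) -> dat (fun x => \sum_i f i x) t (\sum_i v i).
Proof.
move=> h; apply/dat_derive; have := is_derive_sum (h := f) (dh := v) (x := t) (v := 1).
rewrite fct_sumE; apply => i; exact/dat_derive.
Qed.

Lemma dat_comp {V : normedModType R} (f : R -> V) (g : R -> R) t v w :
  dat f (g t) v -> dat g t w -> dat (fun x => f (g x)) t (w *: v).
Proof.
move=> hf hg e e0.
pose e1 := e / (2 * (`|w| + 1)).
have pw := normr_ge0 w; have pv := normr_ge0 v.
have e10 : 0 < e1 by rewrite divr_gt0 // mulr_gt0 //; lra.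
have [d d0 hd] := hf _ e10.
pose e2 := Num.min 1 (e / (2 * (`|v| + 1))).
have e20 : 0 < e2 by rewrite lt_min ltr01 divr_gt0 // mulr_gt0 //; lra.
have [d' d0' hd'] := hg _ e20.
exists (Num.min d' (d / (`|w| + 1))).
  by rewrite lt_min d0' divr_gt0 //; lra.
move=> u; rewrite lt_min => /andP[/hd' h1 h2].
rewrite ltr_pdivlMr in h2; last by lra.
have h3 : `|g u - g t| <= (`|w| + 1) * `|u - t|.
  have -> : g u - g t = (g u - g t - (u - t) *: w) + (u - t) * w by rewrite subrK.
  apply: le_trans (ler_normD _ _) _; rewrite normrM.
  have : e2 <= 1 by rewrite ge_min lexx.
  have pu := normr_ge0 (u - t).
  by move=> h; have := ler_wpM2r pu h; lra.
have /hd h4 : `|g u - g t| < d by apply: le_lt_trans h3 _; rewrite mulrC.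
have -> : f (g u) - f (g t) - (u - t) *: (w *: v) =
  (f (g u) - f (g t) - (g u - g t) *: v) + (g u - g t - (u - t) * w) *: v.
  rewrite scalerA [X in _ = _ + X]scalerBl.
  by move: ((g u - g t) *: v) => z; rewrite addrA subrK.
apply: le_trans (ler_normD _ _) _; rewrite normrZ.
have pu := normr_ge0 (u - t).
have h5 : e1 * `|g u - g t| <= e / 2 * `|u - t|.
  apply: le_trans (ler_wpM2l (ltW e10) h3) _; rewrite mulrA ler_wpM2r //.
  have w1 : `|w| + 1 != 0 by rewrite gt_eqF //; lra.
  by rewrite (_ : e1 * _ = e / 2) // /e1; field.
have h6 : `|g u - g t - (u - t) * w| * `|v| <= e / 2 * `|u - t|.
  apply: le_trans (ler_wpM2r pv h1) _; rewrite mulrAC ler_wpM2r //.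
  have : e2 <= e / (2 * (`|v| + 1)) by rewrite ge_min lexx orbT.
  move=> /(ler_wpM2r pv) /le_trans; apply.
  rewrite mulrAC ler_pdivrMr; last by lra.
  by rewrite (_ : e / 2 * _ = e * (`|v| + 1)); [apply: ler_wpM2l; lra|field].
lra.
Qed.

Lemma dat_lip {V : normedModType R} (f : R -> V) t v : dat f t v ->
  exists2 d, 0 < d & forall u, `|u - t| < d -> `|f u - f t| <= (`|v| + 1) * `|u - t|.
Proof.
move=> /(_ 1 ltr01) [d d0 hd]; exists d => // u /hd; rewrite mul1r => h.
rewrite -[f u - f t](subrK ((u - t) *: v)).
by apply: le_trans (ler_normD _ _) _; rewrite normrZ; lra.
Qed.

Lemma dat_continuous {V : normedModType R} (f : R -> V) t v :
  dat f t v -> {for t, continuous f}.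
Proof.
move=> /dat_lip[d d0 hd]; apply/cvgrPdist_le => e e0.
have pv := normr_ge0 v.
apply/nbhs_ballP; exists (Num.min d (e / (`|v| + 1))).
  by rewrite /= lt_min d0 divr_gt0 //; lra.
move=> u; rewrite /ball /= lt_min distrC => /andP[/hd h1].
have v1 : 0 < `|v| + 1 by lra.
rewrite distrC ltr_pdivlMr // [`|f t - _|]distrC => h2.
by rewrite distrC in h2; lra.
Qed.

Lemma aei_and a b (P Q : R -> Prop) : aei a b P -> aei a b Q -> aei a b (fun t => P t /\ Q t).
Proof. by move=> hP hQ; apply: (@filterS2 _ _ (ae_filter_ringOfSetsType mu) _ _ _ _ hP hQ) => t h1 h2 ab; split; [exact: h1|exact: h2]. Qed.

Lemma aei_imp a b (P Q : R -> Prop) : (forall t, a < t < b -> P t -> Q t) -> aei a b P -> aei a b Q.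
Proof. by move=> PQ; apply: (@filterS _ _ (ae_filter_ringOfSetsType mu)) => t h ab; apply: PQ => //; exact: h. Qed.

Lemma aei_all a b (P : R -> Prop) : (forall t, a < t < b -> P t) -> aei a b P.
Proof. by move=> h; apply: aeW => t; exact: h. Qed.

Lemma aei_forall n a b (P : 'I_n -> R -> Prop) :
  (forall i, aei a b (P i)) -> aei a b (fun t => forall i, P i t).
Proof.
move=> h; have := @filter_forall _ _ _ _ (ae_filter_ringOfSetsType mu) h.
by apply: (@filterS _ _ (ae_filter_ringOfSetsType mu)) => t H ab i; exact: H.
Qed.

Lemma aei_sub a b c d (P : R -> Prop) : a <= c -> d <= b -> aei a b P -> aei c d P.
Proof.
move=> ac db; apply: (@filterS _ _ (ae_filter_ringOfSetsType mu)) => t h /andP[ct td]; apply: h.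
by rewrite (le_lt_trans ac) // (lt_le_trans td).
Qed.

(** ** Matrix-valued curves *)

Section matrix_norm.
Context {m n : nat}.
Implicit Types A : 'M[R]_(m, n).

Lemma norm_entry A i j : `|A i j| <= `|A|.
Proof.
rewrite [leRHS]mx_normrE; apply: (le_trans _ (le_bigmax _ _ (i, j))) => //=.
Qed.

Lemma norm_mx_le A c : 0 <= c -> (forall i j, `|A i j| <= c) -> `|A| <= c.
Proof. by move=> c0 h; rewrite [leLHS]mx_normrE; apply: bigmax_le => // -[i j] _ /=. Qed.

End matrix_norm.

Lemma norm_mulmx p q r (A : 'M[R]_(p, q)) (B : 'M[R]_(q, r)) :
  `|A *m B| <= q%:R * `|A| * `|B|.
Proof.
apply: norm_mx_le => [|i j]; first by rewrite !mulr_ge0.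
rewrite mxE; apply: le_trans (ler_norm_sum _ _ _) _.
rewrite -mulrA mulr_natl -[X in _ *+ X](card_ord q) -sumr_const.
by apply: ler_sum => k _; rewrite normrM ler_pM ?norm_entry.
Qed.

Lemma dat_mxP p q (f : R -> 'M[R]_(p, q)) t v :
  dat f t v <-> forall i j, dat (fun x => f x i j) t (v i j).
Proof.
split=> [h i j e /h[d d0 hd]|h e e0].
  exists d => // u /hd; apply: le_trans; apply: le_trans (norm_entry _ i j).
  by rewrite !mxE.
have H : forall ij : 'I_p * 'I_q, exists d, 0 < d /\ forall u, `|u - t| < d ->
    `|f u ij.1 ij.2 - f t ij.1 ij.2 - (u - t) *: v ij.1 ij.2| <= e * `|u - t|.
  by move=> [i j] /=; have [d d0 hd] := h i j _ e0; exists d.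
have [d hd] := choice H.
exists (\big[Num.min/1]_ij d ij).
  by elim/big_ind: _ => // [x y x0 y0|ij _]; [rewrite lt_min x0|case: (hd ij)].
move=> u hu; apply: norm_mx_le => [|i j]; first by rewrite mulr_ge0 // ltW.
rewrite !mxE; apply: (proj2 (hd (i, j))).
by apply: lt_le_trans hu _; exact: (bigmin_le_cond _ d (j := (i, j))).
Qed.

Lemma dat_mulmx p q r (f : R -> 'M[R]_(p, q)) (g : R -> 'M[R]_(q, r)) t v w :
  dat f t v -> dat g t w -> dat (fun x => f x *m g x) t (v *m g t + f t *m w).
Proof.
move=> /dat_mxP hf /dat_mxP hg; apply/dat_mxP => i j.
have := dat_sum (fun k => datM (hf i k) (hg k j)).
rewrite big_split !mxE /=; apply: dat_ext ltr01 _ => u _.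
by rewrite mxE.
Qed.

End calculus.

Section primitives.
Context {R : realType}.
Local Notation mu := (@lebesgue_measure R).

(** Bounded controls: the class of functions whose indefinite integrals are
    the Lipschitz functions used as coordinates of horizontal curves. *)
Definition bmeas (f : R -> R) (a b : R) :=
  measurable_fun `[a, b] f /\ exists M, forall t, a <= t <= b -> `|f t| <= M.

Lemma bmeas_integrable f a b c d : bmeas f a b -> a <= c -> d <= b ->
  mu.-integrable `[c, d] (EFin \o f).
Proof.
move=> [mf [M fM]] ac db; apply: measurable_bounded_integrable => //.
- by rewrite /= lebesgue_measure_itv /=; case: ifP; rewrite ltry.
- apply: measurable_funS mf => //; apply: subset_itv; by rewrite bnd_simp.
- exists M; split=> [|x Mx t /=]; first exact: num_real.
   rewrite in_itv /= => /andP[ct td].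
  by apply: le_trans (ltW Mx); apply: fM; rewrite (le_trans ac) // (le_trans td).
Qed.

(** The indefinite integral of [f] cut off outside the interval; its
    derivative is given by the Lebesgue differentiation theorem. *)
Lemma bmeas_primitive f a b : bmeas f a b -> exists F : R -> R,
  [/\ lip F a b, aei a b (fun t => dat F t (f t)) &
   forall x y, a <= x -> x <= y -> y <= b ->
     F y - F x = \int[mu]_(t in `[x, y]) f t].
Proof.
move=> bf; have [mf [M fM]] := bf.
pose g := f \_ `[a, b].
have gint : mu.-integrable setT (EFin \o g).
  have := bmeas_integrable bf (lexx a) (lexx b).
  have [H _] := @integrable_mkcond _ _ _ mu `[a, b]%classic (EFin \o f) (measurable_itv _).
  by move=> /H; rewrite restrict_EFin.
have gi (D : set R) : measurable D -> mu.-integrable D (EFin \o g).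
  by move=> mD; apply: integrableS gint.
have mg : measurable_fun setT g by apply/(measurable_restrictT _ _).1.
have lg : locally_integrable setT g.
  split => //; first exact: openT.
  move=> K _ /measurable_realfun.compact_measurable mK.
  by have /integrableP[_] := gi _ mK.
pose F x := \int[mu]_(t in `[a, x]) g t.
have FE x y : a <= x -> x <= y -> y <= b -> F y - F x = \int[mu]_(t in `[x, y]) f t.
  move=> ax xy yb; rewrite /F Rintegral_itvB ?bnd_simp //; last exact: gi.
  rewrite Rintegral_itv_obnd_cbnd; last exact: gi.
  apply: eq_Rintegral => t; rewrite inE /= in_itv /= => /andP[xt ty].
  by rewrite /g patchE mem_set // /= in_itv /= (le_trans ax) // (le_trans ty).
exists F; split=> //.
- exists M => t u.
  wlog tu : t u / t <= u => [H|].
    by case: (leP t u) => [|/ltW] h h1 h2; [|rewrite distrC [`|t - u|]distrC]; exact: H.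
  move=> /andP[at_ tb] /andP[au ub].
  rewrite distrC FE // [`|t - u|]distrC (ger0_norm (x := u - t)) ?subr_ge0 //.
  have fi := bmeas_integrable bf at_ ub.
  apply: le_trans (le_normr_Rintegral _ fi) _ => //.
  have -> : M * (u - t) = \int[mu]_(x in `[t, u]) (cst M x).
    rewrite Rintegral_cst //= lebesgue_measure_itv /= lte_fin.
    by case: ltgtP tu => //= -> _; rewrite subrr mulr0.
  apply: le_Rintegral => //.
  - by have /integrable_norm := fi.
  - apply: (@bmeas_integrable (cst M) t u) => //; split; first exact: measurable_cst.
    by exists `|M|.
  - move=> x /=; rewrite in_itv /= => /andP[tx xu].
    by apply: fM; rewrite (le_trans at_) // (le_trans xu).
- have := FTC1 (f := g) (a := BLeft a) (fun y => gi _ (measurable_itv _)) lg.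
  apply: (@filterS _ _ (ae_filter_ringOfSetsType mu)) => t H /andP[at_ tb].
  have [|h1 h2] := H; first by rewrite lte_fin.
  apply/dat_derive; split; first exact: h1.
  rewrite -derive1E h2 /g patchE mem_set //= in_itv /= !ltW //.
Qed.

Lemma bmeas_cst c a b : bmeas (fun=> c) a b.
Proof. by split; [exact: measurable_cst|exists `|c|]. Qed.

Lemma bmeasD f g a b : bmeas f a b -> bmeas g a b -> bmeas (fun t => f t + g t) a b.
Proof.
move=> [mf [M hM]] [mg [N hN]]; split; first exact: measurable_funD.
exists (M + N) => t ht; apply: le_trans (ler_normD _ _) _.
by rewrite lerD ?hM ?hN.
Qed.

Lemma bmeasM f g a b : bmeas f a b -> bmeas g a b -> bmeas (fun t => f t * g t) a b.
Proof.
move=> [mf [M hM]] [mg [N hN]]; split; first exact: measurable_funM.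
by exists (M * N) => t ht; rewrite normrM ler_pM ?hM ?hN.
Qed.

Lemma bmeas_sum n (f : 'I_n -> R -> R) a b :
  (forall i, bmeas (f i) a b) -> bmeas (fun t => \sum_i f i t) a b.
Proof.
move=> h; elim: n f h => [|n IH] f h.
  by under eq_fun do rewrite big_ord0; exact: bmeas_cst.
under eq_fun do rewrite big_ord_recl.
by apply: bmeasD => //; apply: IH.
Qed.

Lemma bmeas_sub f a b c d : a <= c -> d <= b -> bmeas f a b -> bmeas f c d.
Proof.
move=> ac db [mf [M hM]]; split.
  by apply: measurable_funS mf => //; apply: subset_itv; rewrite bnd_simp.
by exists M => t /andP[ct td]; apply: hM; rewrite (le_trans ac) // (le_trans td).
Qed.

Lemma bmeas_ext f g a b : (forall t, a <= t <= b -> f t = g t) -> bmeas f a b -> bmeas g a b.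
Proof.
move=> fg [mf [M hM]]; split; last by exists M => t ht; rewrite -fg // hM.
apply: eq_measurable_fun mf => t; rewrite inE /= in_itv /=; exact: fg.
Qed.

End primitives.

Section lipschitz.
Context {R : realType}.

Lemma lip_sub {V : normedModType R} (f : R -> V) a b c d :
  a <= c -> d <= b -> lip f a b -> lip f c d.
Proof.
move=> ac db [K hK]; exists K => t u /andP[ct td] /andP[cu ud].
by apply: hK; apply/andP; split; [exact: le_trans ct|exact: le_trans db|
  exact: le_trans cu|exact: le_trans db].
Qed.

Lemma lip_cst {V : normedModType R} (c : V) a b : lip (fun=> c) a b.
Proof. by exists 0 => *; rewrite subrr normr0 mul0r. Qed.

Lemma lip_id a b : lip (fun x : R => x) a b.
Proof. by exists 1 => *; rewrite mul1r. Qed.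

Lemma lipD {V : normedModType R} (f g : R -> V) a b :
  lip f a b -> lip g a b -> lip (fun t => f t + g t) a b.
Proof.
move=> [K hK] [L hL]; exists (K + L) => t u ht hu; rewrite opprD addrACA.
by apply: le_trans (ler_normD _ _) _; rewrite mulrDl lerD ?hK ?hL.
Qed.

Lemma lipN {V : normedModType R} (f : R -> V) a b : lip f a b -> lip (fun t => - f t) a b.
Proof.
by move=> [K hK]; exists K => t u ht hu; rewrite -opprD normrN; exact: hK.
Qed.

Lemma lip_bounded {V : normedModType R} (f : R -> V) a b : lip f a b ->
  exists2 M, 0 <= M & forall t, a <= t <= b -> `|f t| <= M.
Proof.
move=> [K hK]; have [ab|ba] := leP a b; last first.
  exists 0 => // t /andP[h1 h2]; move: (le_trans h1 h2); rewrite leNgt ba //.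
exists (`|f a| + `|K| * (b - a)) => [|t /andP[at_ tb]].
  by rewrite addr_ge0 // mulr_ge0 // subr_ge0.
rewrite -[f t](subrK (f a)) addrC; apply: le_trans (ler_normD _ _) _.
rewrite lerD2l; apply: le_trans (hK t a _ _) _; rewrite ?lexx ?at_ ?tb //.
rewrite ger0_norm ?subr_ge0 //.
apply: le_trans (ler_wpM2r _ (ler_norm K)) _; first by rewrite subr_ge0.
by rewrite ler_wpM2l // lerD2r.
Qed.

Lemma lip_mxP p q (f : R -> 'M[R]_(p, q)) a b :
  lip f a b <-> forall i j, lip (fun t => f t i j) a b.
Proof.
split=> [[K hK] i j|h].
  exists K => t u ht hu; apply: le_trans (hK _ _ ht hu).
  by have := norm_entry (f t - f u) i j; rewrite !mxE.
have [K hK] := choice (fun ij : 'I_p * 'I_q => h ij.1 ij.2).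
exists (\sum_ij `|K ij|) => t u ht hu; apply: norm_mx_le => [|i j].
  by rewrite mulr_ge0 // sumr_ge0.
rewrite !mxE; apply: le_trans (hK (i, j) _ _ ht hu) _; rewrite ler_wpM2r //.
apply: le_trans (ler_norm _) _; rewrite (bigD1 (i, j)) //= lerDl sumr_ge0 //.
Qed.

(** Covers products of matrices and scalar multiplication alike. *)
Lemma lip_bilin {U V W : normedModType R} (B : U -> V -> W) (C : R)
  (BBl : forall x y z, B (x - y) z = B x z - B y z)
  (BBr : forall x y z, B x (y - z) = B x y - B x z)
  (BC : forall x y, `|B x y| <= C * `|x| * `|y|) (f : R -> U) (g : R -> V) a b :
  lip f a b -> lip g a b -> lip (fun t => B (f t) (g t)) a b.
Proof.
move=> lf lg; have [M M0 hM] := lip_bounded lf; have [N N0 hN] := lip_bounded lg.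
have [K hK] := lf; have [L hL] := lg.
pose C' := `|C|.
have BC' x y : `|B x y| <= C' * `|x| * `|y|.
  apply: le_trans (BC x y) _; rewrite -!mulrA ler_wpM2r ?mulr_ge0 //; exact: ler_norm.
exists (C' * K * N + C' * M * L) => t u ht hu.
have -> : B (f t) (g t) - B (f u) (g u) = B (f t - f u) (g t) + B (f u) (g t - g u).
  by rewrite BBl BBr addrA subrK.
apply: le_trans (ler_normD _ _) _; rewrite mulrDl; apply: lerD.
  rewrite (_ : C' * K * N * _ = C' * ((K * `|t - u|) * N)); last by ring.
  apply: le_trans (BC' _ _) _; rewrite -(mulrA C'); apply: ler_wpM2l; first exact: normr_ge0.
  by apply: ler_pM => //; [exact: hK|exact: hN].
rewrite (_ : C' * M * L * _ = C' * (M * (L * `|t - u|))); last by ring.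
apply: le_trans (BC' _ _) _; rewrite -(mulrA C'); apply: ler_wpM2l; first exact: normr_ge0.
by apply: ler_pM => //; [exact: hM|exact: hL].
Qed.

Lemma lip_mulmx p q r (f : R -> 'M[R]_(p, q)) (g : R -> 'M[R]_(q, r)) a b :
  lip f a b -> lip g a b -> lip (fun t => f t *m g t) a b.
Proof.
move=> lf lg; apply: (lip_bilin (B := @mulmx R p q r) (C := q%:R) _ _ _ lf lg) => *.
- exact: mulmxBl.
- exact: mulmxBr.
- exact: norm_mulmx.
Qed.

Lemma lip_scale {V : normedModType R} (f : R -> R) (g : R -> V) a b :
  lip f a b -> lip g a b -> lip (fun t => f t *: g t) a b.
Proof.
move=> lf lg; apply: (lip_bilin (B := fun (x : R) (y : V) => x *: y) (C := 1) _ _ _ lf lg) => *.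
- exact: scalerBl.
- exact: scalerBr.
- by rewrite mul1r normrZ.
Qed.

Lemma lipM (f g : R -> R) a b : lip f a b -> lip g a b -> lip (fun t => f t * g t) a b.
Proof. by move=> lf lg; exact: (lip_scale lf lg). Qed.

Lemma lip_sum {V : normedModType R} n (f : 'I_n -> R -> V) a b :
  (forall i, lip (f i) a b) -> lip (fun t => \sum_i f i t) a b.
Proof.
move=> h; elim: n f h => [|n IH] f h.
  by under eq_fun do rewrite big_ord0; exact: lip_cst.
under eq_fun do rewrite big_ord_recl.
by apply: lipD => //; apply: IH.
Qed.

Lemma lipX (f : R -> R) n a b : lip f a b -> lip (fun t => f t ^+ n) a b.
Proof.
move=> lf; elim: n => [|n IH]; first by under eq_fun do rewrite expr0; exact: lip_cst.
by under eq_fun do rewrite exprS; exact: lipM.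
Qed.

Lemma lip_bmeas (f : R -> R) a b : lip f a b -> bmeas f a b.
Proof.
move=> lf; have [M _ hM] := lip_bounded lf; split; last by exists M.
apply: subspace_continuous_measurable_fun => //.
apply/subspace_continuousP => x; rewrite /= in_itv /= => hx.
apply/cvgrPdist_le => e e0; have [K hK] := lf.
have K1 : 0 < `|K| + 1 by rewrite ltr_wpDl.
rewrite near_withinE; near=> y => hy; rewrite /= in_itv /= in hy.
apply: le_trans (hK _ _ hx hy) _.
apply: (@le_trans _ _ ((`|K| + 1) * `|x - y|)).
  by rewrite ler_wpM2r // (le_trans (ler_norm _)) // lerDl.
rewrite mulrC -ler_pdivlMr //; near: y.
apply: cvgr_dist_le => //; exact: divr_gt0.
Unshelve. all: by end_near. Qed.

(** Monotonicity of the indefinite integral, in the form in which integrals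
    are estimated below: no integrand is mentioned, only derivatives. *)
Lemma lip_le (f g : R -> R) a b : a <= b -> lip f a b -> lip g a b ->
  aei a b (fun t => exists v w, [/\ dat f t v, dat g t w & v <= w]) ->
  f b - f a <= g b - g a.
Proof.
move=> ab lf lg h.
suff : f b - g b <= f a - g a by lra.
apply: (@lip_nonincreasing _ (fun t => f t - g t)) => //.
  by apply: lipD => //; exact: lipN.
apply: aei_imp h => t _ [v [w [h1 h2 vw]]].
by exists (v - w); [rewrite subr_le0|exact: datB].
Qed.

Lemma lip_const p q (f : R -> 'M[R]_(p, q)) a b : a <= b -> lip f a b ->
  aei a b (fun t => dat f t 0) -> f b = f a.
Proof.
move=> ab /lip_mxP lf h; apply/matrixP => i j.
have h1 : aei a b (fun t => dat (fun t => f t i j) t 0).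
  by apply: aei_imp h => t _ /dat_mxP /(_ i j); rewrite mxE.
apply: le_anti; apply/andP; split; rewrite -subr_le0.
  have /= := @lip_le (fun t => f t i j) (fun=> 0) _ _ ab (lf i j) (lip_cst _ _ _).
  rewrite subrr; apply; apply: aei_imp h1 => t _ h1.
  by exists 0, 0; split=> //; exact: dat_cst.
have /= := @lip_le (fun=> 0) (fun t => f t i j) _ _ ab (lip_cst _ _ _) (lf i j).
rewrite subrr subr_le0 subr_ge0; apply; apply: aei_imp h1 => t _ h1.
by exists 0, 0; split=> //; exact: dat_cst.
Qed.

End lipschitz.

(** * Graded matrices *)

Section graded_matrices.
Context {R : realType} {n : nat} (wt : 'I_n.+1 -> nat).
Local Notation M := 'M[R]_n.+1.
Implicit Types a b m : M.

(** The basis vectors of R^(n+1) carry the weights [wt]. Matrices which raise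
    the weight by at least, respectively by exactly, [j] form a decreasing
    filtration, respectively a grading, of the algebra of matrices; [Fil 1]
    consists of nilpotent matrices. *)
Definition Fil (j : nat) (m : M) := forall k l, (wt k < wt l + j)%N -> m k l = 0.
Definition Hom (j : nat) (m : M) := forall k l, wt k != (wt l + j)%N -> m k l = 0.

Lemma Hom_Fil j m : Hom j m -> Fil j m.
Proof. by move=> h k l kl; apply: h; rewrite neq_ltn kl. Qed.

Lemma Fil_le i j m : (j <= i)%N -> Fil i m -> Fil j m.
Proof. by move=> ji h k l kl; apply: h; apply: leq_trans kl _; rewrite leq_add2l. Qed.

Lemma Fil_zero j : Fil j 0.
Proof. by move=> k l _; rewrite mxE. Qed.

Lemma Fil_one : Fil 0 1.
Proof.
move=> k l; rewrite addn0 => kl; rewrite mxE; case: eqP => // klE.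
by rewrite klE ltnn in kl.
Qed.

Lemma FilD j a b : Fil j a -> Fil j b -> Fil j (a + b).
Proof. by move=> ha hb k l kl; rewrite mxE ha // hb // addr0. Qed.

Lemma FilN j a : Fil j a -> Fil j (- a).
Proof. by move=> ha k l kl; rewrite mxE ha // oppr0. Qed.

Lemma FilB j a b : Fil j a -> Fil j b -> Fil j (a - b).
Proof. by move=> ha hb; apply: FilD => //; exact: FilN. Qed.

Lemma FilZ j c a : Fil j a -> Fil j (c *: a).
Proof. by move=> ha k l kl; rewrite mxE ha // mulr0. Qed.

Lemma FilM i j a b : Fil i a -> Fil j b -> Fil (i + j) (a * b).
Proof.
move=> ha hb k l kl; rewrite mxE big1 // => p _.
have [h|h] := ltnP (wt k) (wt p + i); first by rewrite ha // mul0r.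
rewrite hb ?mulr0 // -(ltn_add2r i); apply: leq_ltn_trans h _.
by rewrite -addnA [(j + i)%N]addnC.
Qed.

Lemma Fil_sum (I : Type) (r : seq I) j (F : I -> M) :
  (forall i, Fil j (F i)) -> Fil j (\sum_(i <- r) F i).
Proof. by move=> h; elim/big_ind: _ => //; [exact: Fil_zero|exact: FilD]. Qed.

Lemma FilX m i : Fil 1 m -> Fil i (m ^+ i).
Proof. by move=> h; elim: i => [|i IH]; [exact: Fil_one|rewrite exprS; exact: (FilM h IH)]. Qed.

Lemma Fil_unipotent m : Fil 1 (m - 1) -> Fil 0 m.
Proof.
by move=> h; rewrite -[m](subrK 1); apply: FilD; [exact: Fil_le h|exact: Fil_one].
Qed.

(** Conjugation by the diagonal matrix with entries [t ^+ wt k], a ring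
    automorphism which plays the role of the dilations of the Carnot group. *)
Definition scl (t : R) (m : M) : M := \matrix_(k, l) (t ^+ wt k / t ^+ wt l * m k l).

Lemma sclD t a b : scl t (a + b) = scl t a + scl t b.
Proof. by apply/matrixP => k l; rewrite !mxE mulrDr. Qed.

Lemma sclB t a b : scl t (a - b) = scl t a - scl t b.
Proof. by apply/matrixP => k l; rewrite !mxE mulrBr. Qed.

Lemma sclZ t c a : scl t (c *: a) = c *: scl t a.
Proof. by apply/matrixP => k l; rewrite !mxE mulrCA. Qed.

Lemma scl_zero t : scl t 0 = 0.
Proof. by apply/matrixP => k l; rewrite !mxE mulr0. Qed.

Lemma scl_one t : t != 0 -> scl t 1 = 1.
Proof.
move=> t0; apply/matrixP => k l; rewrite !mxE.
by case: eqP => [->|_]; rewrite ?mulr0 // divff ?mul1r // expf_neq0.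
Qed.

Lemma sclM t a b : t != 0 -> scl t (a * b) = scl t a * scl t b.
Proof.
move=> t0; apply/matrixP => k l; rewrite !mxE mulr_sumr; apply: eq_bigr => p _.
rewrite !mxE; have : t ^+ wt p != 0 by rewrite expf_neq0.
have : t ^+ wt l != 0 by rewrite expf_neq0.
by move: (t ^+ wt p) (t ^+ wt l) => x y y0 x0; field; rewrite x0 y0.
Qed.

Lemma scl_comp t u m : t != 0 -> u != 0 -> scl t (scl u m) = scl (t * u) m.
Proof.
move=> t0 u0; apply/matrixP => k l; rewrite !mxE !exprMn.
have : t ^+ wt l != 0 by rewrite expf_neq0.
have : u ^+ wt l != 0 by rewrite expf_neq0.
by move: (t ^+ wt l) (u ^+ wt l) => x y y0 x0; field; rewrite x0 y0.
Qed.

Lemma scl1 m : scl 1 m = m.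
Proof. by apply/matrixP => k l; rewrite !mxE !expr1n divr1 mul1r. Qed.

Lemma sclK t m : t != 0 -> scl t (scl t^-1 m) = m.
Proof. by move=> t0; rewrite scl_comp ?invr_neq0 // divff // scl1. Qed.

Lemma sclX t m i : t != 0 -> scl t (m ^+ i) = scl t m ^+ i.
Proof.
by move=> t0; elim: i => [|i IH]; [rewrite scl_one|rewrite !exprS sclM // IH].
Qed.

Lemma scl_sum (I : Type) (r : seq I) t (F : I -> M) :
  scl t (\sum_(i <- r) F i) = \sum_(i <- r) scl t (F i).
Proof.
elim: r => [|i r IH]; first by rewrite !big_nil scl_zero.
by rewrite !big_cons sclD IH.
Qed.

Lemma scl_Hom t j m : t != 0 -> Hom j m -> scl t m = t ^+ j *: m.
Proof.
move=> t0 h; apply/matrixP => k l; rewrite !mxE.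
have [kl|kl] := eqVneq (wt k) (wt l + j)%N; last by rewrite h // !mulr0.
by rewrite kl exprD [_ * t ^+ j]mulrC mulfK // expf_neq0.
Qed.

Lemma Fil_scl t j m : Fil j m -> Fil j (scl t m).
Proof. by move=> h k l kl; rewrite mxE h // mulr0. Qed.

Lemma scl_unit t m : t != 0 -> m \is a GRing.unit -> scl t m \is a GRing.unit.
Proof.
move=> t0 um; apply/unitrP; exists (scl t m^-1).
by rewrite -!sclM // mulVr // mulrV // scl_one.
Qed.

Lemma sclV t m : t != 0 -> m \is a GRing.unit -> scl t m^-1 = (scl t m)^-1.
Proof.
move=> t0 um; apply: (mulrI (scl_unit t0 um)).
by rewrite -sclM // !mulrV ?scl_one // scl_unit.
Qed.

Lemma norm_scl_le t m : 0 < t <= 1 -> Fil 0 m -> `|scl t m| <= `|m|.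
Proof.
move=> /andP[t0 t1] h; apply: norm_mx_le => // k l; rewrite mxE.
have [kl|kl] := ltnP (wt k) (wt l).
  by rewrite h ?addn0 // mulr0 normr0.
rewrite -(subnK kl) exprD mulfK ?expf_neq0 ?gt_eqF // normrM.
apply: le_trans (norm_entry m k l); have t0' := ltW t0.
by rewrite ler_piMl // ger0_norm ?exprn_ge0 // exprn_ile1.
Qed.

Lemma norm_mulr a b : `|a * b| <= n.+1%:R * `|a| * `|b|.
Proof. exact: norm_mulmx. Qed.

Lemma norm1_le : `|1 : M| <= 1.
Proof.
apply: norm_mx_le => // k l; rewrite mxE; case: (_ == _); rewrite ?normr0 //.
by rewrite normr1.
Qed.

Context (s : nat) (wt_s : forall k, (wt k <= s)%N).

Lemma Fil_top m : Fil s.+1 m -> m = 0.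
Proof.
move=> h; apply/matrixP => k l; rewrite mxE h //.
by rewrite addnS ltnS; apply: leq_trans (wt_s k) (leq_addl _ _).
Qed.

(** The exponential series, which terminates because matrices in [Fil 1] have
    a vanishing power of exponent [s + 1]. *)
Definition nexp (m : M) : M := \sum_(i < s.+1) (i`!%:R)^-1 *: m ^+ i.

Lemma scl_nexp t m : t != 0 -> scl t (nexp m) = nexp (scl t m).
Proof.
by move=> t0; rewrite /nexp scl_sum; apply: eq_bigr => i _; rewrite sclZ sclX.
Qed.

Lemma nexp0 : nexp 0 = 1.
Proof.
rewrite /nexp big_ord_recl fact0 invr1 scale1r expr0 big1 ?addr0 // => i _.
by rewrite expr0n /= scaler0.
Qed.

Lemma dat_nexp m t : Fil 1 m -> dat (fun x : R => nexp (x *: m)) t (m * nexp (t *: m)).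
Proof.
move=> hm.
have E x : nexp (x *: m) = \sum_(i < s.+1) (x ^+ i / i`!%:R) *: m ^+ i.
  by apply: eq_bigr => i _; rewrite exprZn scalerA mulrC.
have top : m ^+ s.+1 = 0 by apply: Fil_top; exact: FilX.
have -> : m * nexp (t *: m) =
    \sum_(i < s.+1) ((i%:R * t ^+ i.-1) / i`!%:R) *: m ^+ i.
  rewrite E mulr_sumr big_ord_recr /= -scalerAr -exprS top scaler0 addr0.
  rewrite [RHS]big_ord_recl /= !mul0r scale0r add0r.
  apply: eq_bigr => i _; rewrite -scalerAr -exprS /= /bump /= add1n; congr (_ *: _).
  rewrite factS natrM; have : i`!%:R != 0 :> R by rewrite pnatr_eq0 -lt0n fact_gt0.
  have : i.+1%:R != 0 :> R by rewrite pnatr_eq0.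
  by move: (i.+1%:R) (i`!%:R) => x y x0 y0 /=; field; rewrite x0 y0.
apply: dat_ext ltr01 (fun u _ => esym (E u)) _.
apply: (dat_sum (f := fun (i : 'I_s.+1) x => (x ^+ i / i`!%:R) *: m ^+ i)) => i.
apply/dat_mxP => k l.
have h : dat (fun x : R => x ^+ i) t (i%:R * t ^+ i.-1).
  elim: {k l} (i : nat) => [|j IH].
    by rewrite mul0r; under eq_fun do rewrite expr0; exact: dat_cst.
  under eq_fun do rewrite exprS.
  apply: dat_eq (datM (dat_id t) IH) _.
  by case: j {IH} => [|j]; rewrite /= ?expr0 ?expr1 ?exprS -?natr1; ring.
have := datM h (dat_cst ((i`!%:R)^-1 * (m ^+ i) k l) t).
rewrite mulr0 addr0 mulrA => /dat_eq /(_ (_ : _ = _)) h2.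
apply: (dat_ext ltr01 _ (h2 _ _)); last by rewrite !mxE.
by move=> u _; rewrite !mxE mulrA.
Qed.

Lemma lip_nexp m (x : R -> R) c d : lip x c d -> lip (fun t => nexp (x t *: m)) c d.
Proof.
move=> lx; have E t : nexp (x t *: m) = \sum_(i < s.+1) (x t ^+ i / i`!%:R) *: m ^+ i.
  by apply: eq_bigr => i _; rewrite exprZn scalerA mulrC.
under eq_fun do rewrite E.
apply: (lip_sum (f := fun (i : 'I_s.+1) t => (x t ^+ i / i`!%:R) *: m ^+ i)) => i.
apply: lip_scale (lip_cst _ _ _); apply: lipM (lip_cst _ _ _).
exact: lipX.
Qed.

Lemma nexp_comm a m : a * m = m * a -> a * nexp m = nexp m * a.
Proof.
move=> h; rewrite mulr_sumr mulr_suml; apply: eq_bigr => i _.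
by rewrite -scalerAr -scalerAl; congr (_ *: _); exact: (commrX i h).
Qed.

(** The product [exp (t m) exp (- t m)] has vanishing derivative. *)
Lemma nexp_mulN m : Fil 1 m -> nexp m * nexp (- m) = 1.
Proof.
move=> hm; pose f (t : R) := nexp (t *: m) * nexp (t *: - m).
have f1 : f 1 = f 0.
  apply: lip_const => //.
    by apply: lip_mulmx; apply: lip_nexp; exact: lip_id.
  apply: aei_all => t _.
  apply: dat_eq (dat_mulmx (dat_nexp t hm) (dat_nexp t (FilN hm))) _.
  rewrite -!mulmxE mulNmx mulmxN !mulmxE.
  rewrite mulrA -(nexp_comm (a := m)) ?subrr //.
  by rewrite -scalerAl -scalerAr.
by move: f1; rewrite /f !scale1r !scale0r nexp0 mulr1.
Qed.

Lemma nexp_unit m : Fil 1 m -> nexp m \is a GRing.unit.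
Proof.
move=> hm; apply/unitrP; exists (nexp (- m)); split; last exact: nexp_mulN.
by have := nexp_mulN (FilN hm); rewrite opprK.
Qed.

Lemma nexpV m : Fil 1 m -> (nexp m)^-1 = nexp (- m).
Proof.
move=> hm; apply: (mulrI (nexp_unit hm)).
by rewrite nexp_mulN // mulrV // nexp_unit.
Qed.

Lemma nexp_tail m : (1 <= s)%N -> nexp m - 1 - m =
  \sum_(i < s.-1) ((i.+2)`!%:R)^-1 *: m ^+ i.+2.
Proof.
have E q (f : nat -> M) : (1 <= q)%N ->
    \sum_(i < q.+1) f i = f 0%N + (f 1%N + \sum_(i < q.-1) f i.+2).
  by case: q => // q _; rewrite 2!big_ord_recl.
move=> s1; rewrite /nexp (E s (fun i => i`!%:R^-1 *: m ^+ i)) //.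
have f1 : (1`!)%N = 1%N by [].
rewrite f1 fact0 invr1 !scale1r expr0 expr1.
by rewrite [1 + _]addrC addrK [m + _]addrC addrK.
Qed.

Lemma Fil_nexp m : (1 <= s)%N -> Fil 1 m -> Fil 2 (nexp m - 1 - m).
Proof.
move=> s1 hm; rewrite nexp_tail //; apply: Fil_sum => i; apply: FilZ.
by apply: (@Fil_le i.+2) => //; exact: FilX.
Qed.

Lemma norm_exprn_le m i : `|m ^+ i| <= (n.+1%:R * `|m|) ^+ i.
Proof.
elim: i => [|i IH]; first by rewrite !expr0 norm1_le.
rewrite !exprS; apply: le_trans (norm_mulr _ _) _.
by rewrite ler_wpM2l // mulr_ge0.
Qed.

Lemma norm_nexp_tail B : (1 <= s)%N -> 0 <= B -> exists2 C, 0 <= C & forall m, `|m| <= B ->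
  `|nexp m - 1 - m| <= C * `|m| ^+ 2.
Proof.
move=> s1 B0; pose q := n.+1%:R * B.
exists (n.+1%:R ^+ 2 * \sum_(i < s.-1) q ^+ i) => [|m mB].
  by rewrite mulr_ge0 // sumr_ge0 // => i _; rewrite exprn_ge0 // mulr_ge0.
rewrite nexp_tail //; apply: le_trans (ler_norm_sum _ _ _) _.
rewrite mulrAC -exprMn mulr_sumr; apply: ler_sum => i _.
rewrite normrZ; apply: (@le_trans _ _ (1 * `|m ^+ i.+2|)).
  rewrite ler_wpM2r // normfV ger0_norm ?ler0n // invf_le1 ?ltr0n ?fact_gt0 //.
  by rewrite ler1n fact_gt0.
rewrite mul1r; apply: le_trans (norm_exprn_le _ _) _.
rewrite -addn2 addnC exprD ler_wpM2l ?exprn_ge0 ?mulr_ge0 //.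
by rewrite lerXn2r ?nnegrE ?mulr_ge0 // ler_wpM2l.
Qed.

End graded_matrices.

(** * Words of segments in a graded group of matrices *)

Section euclid.
Context {R : realType} {r : nat}.
Implicit Types u v : 'rV[R]_r.

Definition dotr u v := \sum_a u 0 a * v 0 a.
Definition nrm v := Num.sqrt (dotr v v).

Lemma dotrC u v : dotr u v = dotr v u.
Proof. by apply: eq_bigr => a _; rewrite mulrC. Qed.

Lemma dotrD u v w : dotr u (v + w) = dotr u v + dotr u w.
Proof. by rewrite -big_split; apply: eq_bigr => a _; rewrite mxE mulrDr. Qed.

Lemma dotrZ c u v : dotr u (c *: v) = c * dotr u v.
Proof. by rewrite mulr_sumr; apply: eq_bigr => a _; rewrite mxE mulrCA. Qed.

Lemma dotrB u v w : dotr u (v - w) = dotr u v - dotr u w.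
Proof. by rewrite -scaleN1r dotrD dotrZ mulN1r. Qed.

Lemma dotr0 u : dotr u 0 = 0.
Proof. by rewrite -(scale0r 0) dotrZ mul0r. Qed.

Lemma dotr_ge0 v : 0 <= dotr v v.
Proof. by apply: sumr_ge0 => a _; rewrite -expr2 sqr_ge0. Qed.

Lemma dotr_sum (I : Type) (q : seq I) u (F : I -> 'rV[R]_r) :
  dotr u (\sum_(i <- q) F i) = \sum_(i <- q) dotr u (F i).
Proof.
elim: q => [|i q IH]; first by rewrite !big_nil dotr0.
by rewrite !big_cons dotrD IH.
Qed.

Lemma dotr_eq0 v : dotr v v = 0 -> v = 0.
Proof.
move=> h; apply/rowP => a; rewrite mxE.
have := @psumr_eq0P R _ predT (fun a => v 0 a * v 0 a).
move=> /(_ (fun a _ => _) h) H; apply/eqP; rewrite -sqrf_eq0 expr2; apply/eqP.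
by apply: H => // i; rewrite -expr2 sqr_ge0.
Qed.

Lemma nrm_ge0 v : 0 <= nrm v.
Proof. exact: sqrtr_ge0. Qed.

Lemma nrm_sqr v : nrm v ^+ 2 = dotr v v.
Proof. by rewrite sqr_sqrtr // dotr_ge0. Qed.

Lemma nrmZ c v : nrm (c *: v) = `|c| * nrm v.
Proof.
rewrite /nrm dotrZ dotrC dotrZ mulrA -expr2 sqrtrM ?sqr_ge0 // sqrtr_sqr //.
Qed.

Lemma nrmN v : nrm (- v) = nrm v.
Proof. by rewrite -scaleN1r nrmZ normrN1 mul1r. Qed.

Lemma cauchy_schwarz_sqr u v : dotr u v ^+ 2 <= dotr u u * dotr v v.
Proof.
have [v0|v0] := eqVneq (dotr v v) 0.
  by rewrite (dotr_eq0 v0) !dotr0 expr0n mulr0.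
have vp : 0 < dotr v v by rewrite lt_neqAle eq_sym v0 dotr_ge0.
have := dotr_ge0 (dotr v v *: u - dotr u v *: v).
rewrite dotrB !dotrZ [dotr (_ - _) u]dotrC [dotr (_ - _) v]dotrC !dotrB !dotrZ [dotr v u]dotrC.
move=> h; rewrite -subr_ge0 -(pmulr_rge0 _ vp).
by apply: le_trans h _; rewrite le_eqVlt; apply/orP; left; apply/eqP; ring.
Qed.

Lemma cauchy_schwarz u v : `|dotr u v| <= nrm u * nrm v.
Proof.
rewrite -(ler_pXn2r (_ : 0 < 2)%N) ?nnegrE ?mulr_ge0 ?nrm_ge0 //.
by rewrite real_normK ?num_real // exprMn !nrm_sqr cauchy_schwarz_sqr.
Qed.

Lemma entry_le_nrm v a : `|v 0 a| <= nrm v.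
Proof.
rewrite -(ler_pXn2r (_ : 0 < 2)%N) ?nnegrE ?nrm_ge0 // nrm_sqr real_normK ?num_real //.
by rewrite /dotr (bigD1 a) //= -expr2 lerDl sumr_ge0 // => i _; rewrite -expr2 sqr_ge0.
Qed.

Lemma nrm_le_norm v : nrm v <= r%:R * `|v|.
Proof.
rewrite -(ler_pXn2r (_ : 0 < 2)%N) ?nnegrE ?mulr_ge0 ?nrm_ge0 // nrm_sqr exprMn.
apply: (@le_trans _ _ (r%:R * `|v| ^+ 2)).
  rewrite -[r%:R]/(r%:R) mulr_natl -[X in _ *+ X](card_ord r) -sumr_const.
  apply: ler_sum => a _; rewrite -expr2 -real_normK ?num_real //.
  by rewrite lerXn2r ?nnegrE // norm_entry.
rewrite ler_wpM2r ?sqr_ge0 // -natrX ler_nat; case: r => // q.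
by rewrite expnS expn1 leq_pmulr.
Qed.

(** Cauchy-Schwarz against the constant vector. *)
Lemma sqr_sum_le N (x : 'I_N -> R) : (\sum_i x i) ^+ 2 <= N%:R * \sum_i x i ^+ 2.
Proof.
elim: N x => [|N IH] x; first by rewrite !big_ord0 expr0n mul0r.
rewrite !big_ord_recl; move: (IH (fun i => x (lift ord0 i))).
set S := \sum_(i < N) _; set Q := \sum_(i < N) _ ^+ 2 => h.
have h2 : forall y, 2 * y * S <= N%:R * y ^+ 2 + Q.
  move=> y; have : 0 <= \sum_(i < N) (x (lift ord0 i) - y) ^+ 2.
    by apply: sumr_ge0 => i _; rewrite sqr_ge0.
  have -> : \sum_(i < N) (x (lift ord0 i) - y) ^+ 2 = Q - 2 * y * S + N%:R * y ^+ 2.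
    have -> : N%:R * y ^+ 2 = \sum_(i < N) y ^+ 2 by rewrite sumr_const card_ord mulr_natl.
    rewrite mulr_sumr -sumrN -!big_split /=.
    by apply: eq_bigr => i _; ring.
  by move=> ?; lra.
have := h2 (x ord0); rewrite -natr1; move: (x ord0) => y; nra.
Qed.

End euclid.

(** The data through which the group enters the main argument. [Gam] is a
    group of unipotent matrices, whose Lie algebra has the homogeneous parts
    [g j]. The part of degree 1 is spanned by the [Xb a], and each part by the
    brackets of the [Xb a] with the previous one, with control of the norms.
    The last hypothesis identifies the leading term of an element of the group
    with an element of its Lie algebra. *)
Section words.
Context {R : realType} {n r s : nat} (wt : 'I_n.+1 -> nat).
Local Notation M := 'M[R]_n.+1.
Local Notation Fil := (Fil (R := R) wt).
Local Notation Hom := (Hom (R := R) wt).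
Local Notation scl := (scl (R := R) wt).
Local Notation nexp := (nexp (R := R) (n := n) s).
Context (wt_s : forall k, (wt k <= s)%N) (s_gt0 : (1 <= s)%N).
Context (Xb : 'I_r -> M) (g : nat -> {vspace M}) (Gam : M -> Prop).
Definition hor (v : 'rV[R]_r) : M := \sum_a v 0 a *: Xb a.
Context (Xb_g : forall a, Xb a \in g 1%N).
Context (g_hom : forall j m, m \in g j -> Hom j m).
Context (g1_hor : exists2 C, 0 <= C & forall m, m \in g 1%N -> exists2 v, m = hor v & nrm v <= C * `|m|).
Context (g_succ : forall j, (1 <= j < s)%N -> exists2 C, 0 <= C & forall m, m \in g j.+1 ->
  exists2 y : 'I_r -> M, forall a, y a \in g j /\ `|y a| <= C * `|m| &
    m = \sum_a (y a * Xb a - Xb a * y a)).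
Context (Gam1 : Gam 1) (GamM : forall a b, Gam a -> Gam b -> Gam (a * b)).
Context (GamV : forall a, Gam a -> exists b, [/\ Gam b, a * b = 1 & b * a = 1]).
Context (Gam_Fil : forall a, Gam a -> Fil 1 (a - 1)).
Context (Gam_hor : forall v, Gam (nexp (hor v))).
Context (Gam_lead : forall j a, (1 <= j)%N -> Gam a -> Fil j (a - 1) ->
  exists2 x, x \in g j & Fil j.+1 (a - 1 - x)).

Lemma Gam_unit a : Gam a -> a \is a GRing.unit.
Proof. by case/GamV => b [_ h1 h2]; apply/unitrP; exists b. Qed.

Lemma Gam_inv a : Gam a -> Gam a^-1.
Proof.
move=> Ga; have [b [Gb h1 h2]] := GamV Ga.
suff -> : a^-1 = b by [].
by apply: (mulrI (Gam_unit Ga)); rewrite mulrV ?Gam_unit.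
Qed.

Lemma Gam_Fil0 a : Gam a -> Fil 0 a.
Proof. by move/Gam_Fil; exact: Fil_unipotent. Qed.

Lemma Gam_prod (I : Type) (q : seq I) (F : I -> M) : (forall i, Gam (F i)) ->
  Gam (\prod_(i <- q) F i).
Proof. by move=> h; elim/big_ind: _. Qed.

Lemma hor_g v : hor v \in g 1%N.
Proof. by apply: memv_suml => a _; exact: memvZ. Qed.

Lemma hor_Fil v : Fil 1 (hor v).
Proof. by apply/Hom_Fil/g_hom/hor_g. Qed.

Lemma horZ c v : hor (c *: v) = c *: hor v.
Proof. by rewrite /hor scaler_sumr; apply: eq_bigr => a _; rewrite mxE scalerA. Qed.

Lemma horN v : hor (- v) = - hor v.
Proof. by rewrite -scaleN1r horZ scaleN1r. Qed.

Lemma hor_delta a : hor (delta_mx 0 a) = Xb a.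
Proof.
rewrite /hor (bigD1 a) //= mxE !eqxx scale1r big1 ?addr0 // => i ia.
by rewrite mxE (negPf ia) andbF scale0r.
Qed.

Lemma scl_hor t v : t != 0 -> scl t (hor v) = hor (t *: v).
Proof. by move=> t0; rewrite (scl_Hom t0 (g_hom (hor_g v))) expr1 horZ. Qed.

Lemma norm_hor : exists2 C, 0 <= C & forall v, `|hor v| <= C * nrm v.
Proof.
exists (\sum_a `|Xb a|) => [|v]; first exact: sumr_ge0.
rewrite mulr_suml; apply: le_trans (ler_norm_sum _ _ _) _.
by apply: ler_sum => a _; rewrite normrZ mulrC ler_wpM2l // entry_le_nrm.
Qed.

(** The element [m] is the endpoint of a polygonal horizontal path of length
    at most [l]: a factor [nexp (hor v)] is a segment of length [nrm v]. *)
Definition W (l : R) (m : M) := exists vs : seq 'rV[R]_r,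
  m = \prod_(v <- vs) nexp (hor v) /\ \sum_(v <- vs) nrm v <= l.

Lemma W1 : W 0 1.
Proof. by exists [::]; rewrite !big_nil. Qed.

Lemma WM l l' a b : W l a -> W l' b -> W (l + l') (a * b).
Proof.
move=> [vs [-> h]] [ws [-> k]]; exists (vs ++ ws); rewrite !big_cat /=; split=> //.
exact: lerD.
Qed.

Lemma W_le l l' a : l <= l' -> W l a -> W l' a.
Proof. by move=> ll' [vs [-> h]]; exists vs; split=> //; exact: le_trans ll'. Qed.

Lemma W_seg v : W (nrm v) (nexp (hor v)).
Proof. by exists [:: v]; rewrite !big_seq1. Qed.

Lemma W_scl t l a : 0 < t -> W l a -> W (t * l) (scl t a).
Proof.
move=> t0 [vs [-> h]]; exists [seq t *: v | v <- vs]; rewrite !big_map; split.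
  have t0' : t != 0 by rewrite gt_eqF.
  elim: vs {h} => [|v vs IH]; first by rewrite !big_nil scl_one.
  by rewrite !big_cons sclM // IH scl_nexp // scl_hor.
rewrite (eq_bigr (fun v => t * nrm v)); last by move=> v _; rewrite nrmZ gtr0_norm.
by rewrite -mulr_sumr ler_wpM2l // ltW.
Qed.

Lemma W_scl_inv t l a : 0 < t -> W l (scl t^-1 a) -> W (t * l) a.
Proof. by move=> t0 /(W_scl t0); rewrite sclK // gt_eqF. Qed.

Lemma W_prod N (l : 'I_N -> R) (F : 'I_N -> M) : (forall i, W (l i) (F i)) ->
  W (\sum_i l i) (\prod_i F i).
Proof. by move=> h; elim/big_ind2: _ => //; [exact: W1|move=> x a y b; exact: WM]. Qed.

(** The inverse is bounded together with the element because the words built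
    below are commutators. *)
Definition cheap C m := [/\ Gam m, `|m| <= C, `|m^-1| <= C, W C m & W C m^-1].

Lemma cheap1 : cheap 1 1.
Proof.
by split; rewrite ?invr1 ?norm1_le //; apply: (W_le ler01 W1).
Qed.

Lemma cheap_inv C m : cheap C m -> cheap C m^-1.
Proof.
by case=> h1 h2 h3 h4 h5; split; rewrite ?invrK //; exact: Gam_inv.
Qed.

Lemma cheap_le C C' m : C <= C' -> cheap C m -> cheap C' m.
Proof.
by move=> CC' [h1 h2 h3 h4 h5]; split=> //; [exact: le_trans CC'|exact: le_trans CC'|
  exact: W_le CC' _|exact: W_le CC' _].
Qed.

Lemma cheapM C C' a b : cheap C a -> cheap C' b ->
  cheap (n.+1%:R * C * C' + (C + C')) (a * b).
Proof.
move=> [h1 h2 h3 h4 h5] [k1 k2 k3 k4 k5].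
have C0 : 0 <= C by apply: le_trans h2.
have C0' : 0 <= C' by apply: le_trans k2.
have E : 0 <= n.+1%:R * C * C' by rewrite !mulr_ge0.
have P (x y : M) : `|x| <= C -> `|y| <= C' -> n.+1%:R * `|x| * `|y| <= n.+1%:R * C * C'.
  by move=> hx hy; apply: ler_pM => //; rewrite ?mulr_ge0 // ler_wpM2l.
rewrite /cheap invrM ?Gam_unit //; split.
- exact: GamM.
- by apply: le_trans (norm_mulr _ _) _; apply: le_trans (P _ _ h2 k2) _; lra.
- apply: le_trans (norm_mulr _ _) _; rewrite mulrAC.
  by apply: le_trans (P _ _ h3 k3) _; lra.
- by apply: W_le (WM h4 k4); lra.
- by apply: W_le (WM k5 h5); lra.
Qed.

Lemma cheap_prod N C : exists C', forall F : 'I_N -> M, (forall i, cheap C (F i)) ->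
  cheap C' (\prod_i F i).
Proof.
elim: N => [|N [C' IH]].
  by exists 1 => F _; rewrite big_ord0; exact: cheap1.
exists (n.+1%:R * C * C' + (C + C')) => F h; rewrite big_ord_recl.
by apply: cheapM => //; exact: IH.
Qed.

Lemma nexp_horV v : (nexp (hor v))^-1 = nexp (hor (- v)).
Proof. by rewrite (nexpV wt_s) ?horN //; exact: hor_Fil. Qed.

(** The leading term of a commutator is the bracket of the leading terms.
    Differences [a * b - b * a] are used instead of group commutators, from
    which they differ by a right factor in the unipotent group. *)
Lemma Fil_conj_lead i j a b x y : (1 <= i)%N -> (1 <= j)%N ->
  Fil i x -> Fil j y -> Fil i.+1 (a - 1 - x) -> Fil j.+1 (b - 1 - y) ->
  Fil (i + j).+1 (a * b - b * a - (x * y - y * x)).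
Proof.
move=> i1 j1 hx hy ha hb.
pose a' := a - 1 - x; pose b' := b - 1 - y.
have aE : a = 1 + x + a' by apply/matrixP => k l; rewrite !mxE; ring.
have bE : b = 1 + y + b' by apply/matrixP => k l; rewrite !mxE; ring.
rewrite -/a' in ha; rewrite -/b' in hb.
have -> : a * b - b * a - (x * y - y * x) =
  x * b' + a' * y + a' * b' - (b' * x + y * a' + b' * a').
  rewrite aE bE !mulrDl !mulrDr !mul1r !mulr1.
  move: (x * y) (y * x) (x * b') (b' * x) (a' * y) (y * a') (a' * b') (b' * a') =>
    xy yx xb bx ay ya ab ba.
  by apply/matrixP => k l; rewrite !mxE; ring.
have e1 : Fil (i + j).+1 (x * b') by rewrite -addnS; exact: FilM.
have e2 : Fil (i + j).+1 (a' * y) by rewrite -addSn; exact: FilM.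
have e3 : Fil (i + j).+1 (a' * b').
  by apply: Fil_le (FilM ha hb); rewrite addSn addnS.
have e4 : Fil (i + j).+1 (b' * x) by rewrite -addnS addnC; exact: FilM.
have e5 : Fil (i + j).+1 (y * a') by rewrite -addSn addnC; exact: FilM.
have e6 : Fil (i + j).+1 (b' * a').
  by apply: Fil_le (FilM hb ha); rewrite addSn addnS addnC.
by apply: FilB; apply: FilD => //; apply: FilD.
Qed.

(** The leading term, in degree [q], of an element which is the identity up to
    this degree. *)
Definition lead q m z := Fil q z /\ Fil q.+1 (m - 1 - z).

(** In the first degree where the factors differ from the identity, the
    product is additive. *)
Lemma lead_prod N q (F z : 'I_N -> M) : (1 <= q)%N -> (forall i, lead q (F i) (z i)) ->
  lead q (\prod_i F i) (\sum_i z i).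
Proof.
move=> q1 h; elim/big_ind2: _ => //.
  by rewrite /lead subrr subr0; split; exact: Fil_zero.
move=> x a y b [hx ha] [hy hb]; split; first exact: FilD.
have -> : a * b - 1 - (x + y) =
    (a - 1 - x) + (b - 1 - y) + (a - 1) * (b - 1).
  rewrite mulrBl mulrBr !mul1r mulr1.
  by move: (a * b) => ab; apply/matrixP => k l; rewrite !mxE; ring.
apply: FilD; first exact: FilD.
have E c w : Fil q w -> Fil q.+1 (c - 1 - w) -> Fil q (c - 1).
  move=> hw hc; rewrite -[c - 1](subrK w); apply: FilD => //.
  exact: Fil_le hc.
apply: Fil_le (FilM (E _ _ hx ha) (E _ _ hy hb)).
by rewrite -addn1 leq_add2l.
Qed.

Lemma segment_cheap A : exists C, forall v, nrm v <= A -> cheap C (nexp (hor v)).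
Proof.
have [K K0 hK] := norm_hor.
have B0 : 0 <= K * `|A| by rewrite mulr_ge0.
have [D D0 hD] := norm_nexp_tail (n := n) s_gt0 B0.
set B := K * `|A| in B0 hD.
exists (D * B ^+ 2 + B + 1 + `|A|) => v vA.
have lv : nrm v <= `|A| by apply: le_trans vA (ler_norm _).
have lB u : nrm u = nrm v -> `|nexp (hor u)| <= D * B ^+ 2 + B + 1.
  move=> uv; have hu : `|hor u| <= B.
    by apply: le_trans (hK u) _; rewrite ler_wpM2l // uv.
  have -> : nexp (hor u) = (nexp (hor u) - 1 - hor u) + hor u + 1.
    by rewrite !subrK.
  apply: le_trans (ler_normD _ _) _; apply: lerD norm1_le.
  apply: le_trans (ler_normD _ _) _; apply: lerD => //.
  by apply: le_trans (hD _ hu) _; rewrite ler_wpM2l // lerXn2r ?nnegrE //.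
have p0 : 0 <= `|A| by [].
have p1 : 0 <= D * B ^+ 2 by rewrite mulr_ge0 // exprn_ge0.
have h1 := lB v erefl; have h2 := lB (- v) (nrmN v).
rewrite /cheap nexp_horV; split=> //.
- by lra.
- by lra.
- by apply: W_le (W_seg v); lra.
- by apply: W_le (W_seg (- v)); rewrite nrmN; lra.
Qed.

(** By induction on the degree: the bracket of [y] with [Xb a] is the leading
    term of the commutator of a word with leading term [y] and of a unit
    segment, and commutators are multiplied to add up leading terms. *)
Lemma layer_word j : (1 <= j <= s)%N -> forall A, exists C, forall w, w \in g j -> `|w| <= A ->
  exists2 k, lead j k w & cheap C k.
Proof.
elim: j => // j IH /andP[_ js] A.
case: j IH js => [|j] IH js.
  have [C C0 hC] := g1_hor; have [D hD] := segment_cheap (C * A).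
  exists D => w /hC[v -> vA] wA; exists (nexp (hor v)).
      by split; [exact: hor_Fil|exact: Fil_nexp s_gt0 (hor_Fil v)].
  by apply: hD; apply: le_trans vA _; rewrite ler_wpM2l.
have [C C0 hC] := g_succ (j := j.+1) js.
have [D hD] := IH (ltnW js) (C * A).
have [E hE] := segment_cheap (\sum_(a < r) nrm (delta_mx 0 a : 'rV[R]_r)).
(* The constant of [cheapM], applied twice, for a commutator. *)
pose q := n.+1%:R * (n.+1%:R * D * E + (D + E)) * (n.+1%:R * D * E + (D + E)) + ((n.+1%:R * D * E + (D + E)) + (n.+1%:R * D * E + (D + E))).
have [F hF] := cheap_prod r q.
exists F => w /hC[y hy wE] wA.
have Hk a : exists k, lead j.+1 k (y a) /\ cheap D k.
  have [ya yA] := hy a; have [|k k1 k2] := hD _ ya.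
    by apply: le_trans yA _; rewrite ler_wpM2l.
  by exists k.
have [k hk] := choice Hk.
pose e a := nexp (hor (delta_mx 0 a)).
have ce a : cheap E (e a).
  apply: hE; rewrite (bigD1 a) //= lerDl sumr_ge0 // => i _; exact: nrm_ge0.
pose c a := (k a * e a) * ((k a)^-1 * (e a)^-1).
exists (\prod_a c a); last first.
  apply: hF => a; apply: cheapM; apply: cheapM => //; try exact: cheap_inv.
  - by case: (hk a).
  - by apply: cheap_inv; case: (hk a).
rewrite wE; apply: lead_prod => // a.
have [[hy1 hy2] [Gk _ _ _ _]] := hk a; have [Ge _ _ _ _] := ce a.
have uk := Gam_unit Gk; have ue := Gam_unit Ge.
have hX : Fil 1 (Xb a) by rewrite -hor_delta; exact: hor_Fil.
have he : Fil 2 (e a - 1 - Xb a).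
  by rewrite -hor_delta; exact: Fil_nexp s_gt0 (hor_Fil _).
have hz : Fil j.+2 (y a * Xb a - Xb a * y a).
  by apply: FilB; [rewrite -addn1|rewrite -add1n]; exact: FilM.
split=> //.
set z := y a * Xb a - Xb a * y a in hz *.
have h := Fil_conj_lead (i := j.+1) (j := 1) isT isT hy1 hX hy2 he.
rewrite addn1 -/z in h.
have Gi := GamM (Gam_inv Gk) (Gam_inv Ge).
have -> : c a - 1 - z = (k a * e a - e a * k a - z) * ((k a)^-1 * (e a)^-1) +
   z * ((k a)^-1 * (e a)^-1 - 1).
  rewrite mulrBl mulrBl -/(c a) [e a * k a * _]mulrA mulrK // mulrV //.
  by rewrite mulrBr mulr1 addrA subrK.
apply: FilD.
  by rewrite -[j.+3]addn0; apply: FilM => //; exact: Gam_Fil0.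
by rewrite -[j.+3]addn1; apply: FilM => //; exact: Gam_Fil.
Qed.

(** A rough form of the ball-box theorem. The leading term of the element is
    cancelled by a word from [layer_word], which increases the degree of the
    first error; after degree [s] nothing is left. Bounds on matrices are kept
    at each step. *)
Lemma bounded_word A : exists C, forall m, Gam m -> `|m| <= A -> W C m.
Proof.
suff H d : forall A, (d <= s)%N -> exists C, forall m, Gam m -> Fil (s.+1 - d) (m - 1) ->
    `|m| <= A -> W C m.
  have [C hC] := H s A (leqnn _); exists C => m Gm mA; apply: hC => //.
  by rewrite subSnn; exact: Gam_Fil.
elim: d => [|d IH] {}A ds.
  exists 0 => m _; rewrite subn0 => /(Fil_top wt_s) /eqP; rewrite subr_eq0 => /eqP -> _.
  exact: W1.
have j1 : (1 <= s - d <= s)%N by rewrite subn_gt0 ds leq_subr.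
have [C hC] := layer_word j1 (A + 1).
have [C' hC'] := IH (n.+1%:R * C * A) (ltnW ds).
exists (C + C') => m Gm; rewrite subSS => Fm mA.
have [x xg xF] := Gam_lead (proj1 (andP j1)) Gm Fm.
have xA : `|x| <= A + 1.
  apply: le_trans (_ : `|m - 1| <= _); last first.
    by apply: le_trans (ler_normB _ _) _; apply: lerD mA norm1_le.
  apply: norm_mx_le => // k l; have [kl|kl] := eqVneq (wt k) (wt l + (s - d))%N.
    have := xF k l; rewrite kl addnS ltnS leqnn => /(_ isT).
    by rewrite mxE [X in _ + X]mxE => /eqP; rewrite subr_eq0 => /eqP <-; exact: norm_entry.
  by rewrite (g_hom xg kl) normr0.
have [k [_ k1] [Gk k2 k3 k4 k5]] := hC _ xg xA.
have uk := Gam_unit Gk.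
rewrite -[m](mulVKr uk); apply: WM k4 _; apply: hC'.
- exact: GamM (Gam_inv Gk) Gm.
- rewrite -(mulVr uk) -mulrBr subSn 1?ltnW // -[(s - d).+1]add0n.
  apply: FilM; first exact/Gam_Fil0/Gam_inv.
  have -> : m - k = (m - 1 - x) - (k - 1 - x) by apply/matrixP => i l; rewrite !mxE; ring.
  exact: FilB.
- by apply: le_trans (norm_mulr _ _) _; apply: ler_pM; rewrite ?mulr_ge0 // ler_wpM2l.
Qed.

(** ** Length-minimizing curves in a graded group of matrices *)

(** The curve is recorded by [m a b], the increment of its lift between the times
    [a] and [b], and [D a b], the increment of its horizontal coordinates. The first
    is controlled by the second at every scale [eta]; the curve has unit speed and is
    minimizing. *)
Context (Gam_scl : forall t a, 0 < t -> Gam a -> Gam (scl t a)).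
Context (T : R) (m : R -> R -> M) (D : R -> R -> 'rV[R]_r) (E : 'rV[R]_r -> R -> R -> R).
Context (m_Gam : forall a b, - T <= a -> a <= b -> b <= T -> Gam (m a b)).
Context (m_cat : forall a b c, - T <= a -> a <= b -> b <= c -> c <= T -> m a b * m b c = m a c).
Context (m_est : forall B, 0 <= B -> exists2 C, 0 <= C & forall eta a b, 0 < eta ->
  - T <= a -> a <= b -> b <= T -> b - a <= B * eta ->
  `|scl eta^-1 (m a b) - 1 - hor (eta^-1 *: D a b)| <= C * ((b - a) / eta) ^+ 2).
Context (D_le : forall a b, - T <= a -> a <= b -> b <= T -> nrm (D a b) <= b - a).
Context (m_min : forall l, W l (m (- T) T) -> 2 * T <= l).

Definition grid (a b : R) (N i : nat) : R := a + (b - a) * (i%:R / N%:R).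

Lemma grid0 a b N : grid a b N 0 = a.
Proof. by rewrite /grid mul0r mulr0 addr0. Qed.

Lemma gridN a b N : (0 < N)%N -> grid a b N N = b.
Proof. by move=> N0; rewrite /grid divff ?pnatr_eq0 -?lt0n // mulr1 addrC subrK. Qed.

Lemma gridS a b N i : grid a b N i.+1 - grid a b N i = (b - a) / N%:R.
Proof. by rewrite /grid -natr1; ring. Qed.

Lemma grid_le a b N i : a <= b -> grid a b N i <= grid a b N i.+1.
Proof. by move=> ab; rewrite -subr_ge0 gridS divr_ge0 // subr_ge0. Qed.

Lemma grid_ge a b N i : a <= b -> a <= grid a b N i.
Proof. by move=> ab; rewrite lerDl mulr_ge0 ?subr_ge0 // divr_ge0. Qed.

Lemma grid_le_end a b N i : a <= b -> (i <= N)%N -> grid a b N i <= b.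
Proof.
move=> ab; case: N => [|N] iN; first by rewrite /grid invr0 !mulr0 addr0.
rewrite /grid -[leRHS](subrK a b) addrC lerD2r ler_piMr ?subr_ge0 //.
by rewrite ler_pdivrMr ?ltr0n // mul1r ler_nat.
Qed.

Lemma m_refl a : - T <= a -> a <= T -> m a a = 1.
Proof.
move=> h1 h2; have Gm := m_Gam h1 (lexx a) h2.
by apply: (mulrI (Gam_unit Gm)); rewrite m_cat // mulr1.
Qed.

(** The estimate is applied at a scale [eta] tending to infinity: the entry of
    degree [d] of the rescaled error is [eta ^- d] times that of the error,
    whereas the bound is of order [eta ^- 2], so the entries of degree at most
    1 vanish. *)
Lemma m_lead a b : - T <= a -> a <= b -> b <= T -> lead 1 (m a b) (hor (D a b)).
Proof.
move=> Ta ab bT; split; first exact: hor_Fil.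
have ba : 0 <= b - a by rewrite subr_ge0.
have [C C0 hC] := m_est ba.
move=> k l kl; set z := m a b - 1 - hor (D a b).
apply/eqP; rewrite -normr_eq0; apply/eqP/le_anti; rewrite normr_ge0 andbT.
apply/ler_addgt0Pl => e e0; rewrite addr0.
pose q := C * (b - a) ^+ 2.
have q0 : 0 <= q by rewrite mulr_ge0 // sqr_ge0.
pose eta := 1 + q / e.
have qe : 0 <= q / e by rewrite divr_ge0 // ltW.
have eta1 : 1 <= eta by rewrite lerDl.
have eta0 : 0 < eta by lra.
have etan : eta^-1 != 0 by rewrite invr_neq0 // gt_eqF.
have := hC eta a b eta0 Ta ab bT; rewrite ler_peMr // => /(_ isT) h.
have zE : scl eta^-1 (m a b) - 1 - hor (eta^-1 *: D a b) = scl eta^-1 z.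
  by rewrite /z !sclB scl_one // scl_hor.
rewrite zE in h.
have := le_trans (norm_entry _ k l) h; rewrite mxE normrM.
have pk : 0 < eta ^+ wt k by rewrite exprn_gt0.
have pl : 0 < eta ^+ wt l by rewrite exprn_gt0.
have kl' : eta ^+ wt k <= eta ^+ wt l * eta.
  by rewrite -exprSr ler_weXn2l // -ltnS -addn2.
rewrite !exprVn invrK; move: (eta ^+ wt k) (eta ^+ wt l) pk pl kl' => P L pk pl kl' {}h.
rewrite normrM normfV (gtr0_norm pk) (gtr0_norm pl) in h.
have {h} : `|z k l| * L <= q / eta ^+ 2 * P.
  rewrite -(ler_pM2l (_ : 0 < P^-1)) ?invr_gt0 //.
  have -> : P^-1 * (`|z k l| * L) = P^-1 * L * `|z k l| by ring.
  apply: le_trans h _; rewrite le_eqVlt; apply/orP; left; apply/eqP.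
  by rewrite /q; field; rewrite !gt_eqF.
move=> /le_trans /(_ (ler_wpM2l (divr_ge0 q0 (sqr_ge0 _)) kl')).
rewrite mulrCA -mulrA [L * _]mulrC mulrA ler_pM2r // => h; apply: le_trans h _.
have -> : q / eta ^+ 2 * eta = q / eta by field; rewrite gt_eqF.
rewrite ler_pdivrMr // /eta mulrDr mulr1 [e * _]mulrC divfK ?gt_eqF // lerDr.
exact: ltW.
Qed.

Lemma m_bound B : 0 <= B -> exists C, [/\ 0 <= C,
  forall eta a b, 0 < eta -> - T <= a -> a <= b -> b <= T -> b - a <= B * eta ->
    `|scl eta^-1 (m a b) - 1| <= C * ((b - a) / eta) &
  forall eta a b, 0 < eta -> - T <= a -> a <= b -> b <= T -> b - a <= B * eta ->
    `|scl eta^-1 (m a b)| <= C].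
Proof.
move=> B0; have [C C0 hC] := m_est B0; have [K K0 hK] := norm_hor.
have P eta a b : 0 < eta -> - T <= a -> a <= b -> b <= T -> b - a <= B * eta ->
    `|scl eta^-1 (m a b) - 1| <= (C * B + K) * ((b - a) / eta).
  move=> eta0 Ta ab bT ba; have h := hC _ _ _ eta0 Ta ab bT ba.
  have p0 : 0 <= (b - a) / eta by rewrite divr_ge0 ?subr_ge0 // ltW.
  have pB : (b - a) / eta <= B by rewrite ler_pdivrMr.
  rewrite -[_ - 1](subrK (hor (eta^-1 *: D a b))).
  apply: le_trans (ler_normD _ _) _; rewrite mulrDl; apply: lerD.
    apply: le_trans h _; rewrite -mulrA ler_wpM2l // expr2 ler_wpM2r //.
  apply: le_trans (hK _) _; rewrite ler_wpM2l // nrmZ gtr0_norm ?invr_gt0 //.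
  have e0' : 0 <= eta^-1 by rewrite invr_ge0 ltW.
  by rewrite mulrC ler_wpM2r // D_le.
exists ((C * B + K) * (1 + B) + 1); split.
- by rewrite addr_ge0 // mulr_ge0 // addr_ge0 // mulr_ge0.
- move=> eta a b eta0 Ta ab bT ba; apply: le_trans (P _ _ _ eta0 Ta ab bT ba) _.
  rewrite ler_wpM2r ?divr_ge0 ?subr_ge0 ?(ltW eta0) //.
  have : 0 <= (C * B + K) * B by rewrite !mulr_ge0 // addr_ge0 // mulr_ge0.
  by rewrite mulrDr mulr1; lra.
- move=> eta a b eta0 Ta ab bT ba; rewrite -[scl _ _](subrK 1).
  apply: le_trans (ler_normD _ _) _; apply: lerD (norm1_le).
  apply: le_trans (P _ _ _ eta0 Ta ab bT ba) _.
  have q0 : 0 <= C * B + K by rewrite addr_ge0 // mulr_ge0.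
  rewrite ler_wpM2l //; have : (b - a) / eta <= B by rewrite ler_pdivrMr.
  lra.
Qed.

Lemma norm_mul_near1 (a b : M) (c : R) : `|a - 1| <= c -> `|a * b| <= (1 + n.+1%:R * c) * `|b|.
Proof.
have -> : a * b = b + (a - 1) * b by rewrite mulrBl mul1r addrC subrK.
move=> ac; rewrite [leRHS]mulrDl mul1r.
apply: le_trans (ler_normD _ _) _; rewrite lerD2l.
apply: le_trans (norm_mulr _ _) _; rewrite ler_wpM2r // ler_wpM2l //.
Qed.

Lemma norm_mul_near1r (a b : M) (c : R) : `|a - 1| <= c -> `|b * a| <= (1 + n.+1%:R * c) * `|b|.
Proof.
have -> : b * a = b + b * (a - 1) by rewrite mulrBr mulr1 addrC subrK.
move=> ac; rewrite [leRHS]mulrDl mul1r.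
apply: le_trans (ler_normD _ _) _; rewrite lerD2l.
apply: le_trans (norm_mulr _ _) _; rewrite mulrAC ler_wpM2r // ler_wpM2l //.
Qed.

(** Bounds the accumulated factors of a product of [N] matrices at distance
    [O(1 / N)] from the identity. *)
Lemma one_plus_pow (x : R) N : 0 <= x -> (0 < N)%N -> (1 + x / N%:R) ^+ N <= expR x.
Proof.
move=> x0 N0; have N0' : N%:R != 0 :> R by rewrite pnatr_eq0 -lt0n.
have -> : expR x = expR (x / N%:R) ^+ N by rewrite -expRM_natl mulrC divfK.
by rewrite lerXn2r ?nnegrE ?expR_ge0 ?expR_ge1Dx // addr_ge0 // divr_ge0.
Qed.

(** The segment and the arc over a part of the grid agree up to the square of
    their relative length [1 / N]. The [N] errors add up, amplified by a
    bounded factor. *)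
Lemma polygon_defect : exists2 C, 0 <= C & forall a b N, - T <= a -> a < b -> b <= T -> (0 < N)%N ->
  let P := \prod_(i < N) nexp (hor ((b - a)^-1 *: D (grid a b N i) (grid a b N i.+1))) in
  `|P^-1 * scl (b - a)^-1 (m a b) - 1| <= C / N%:R.
Proof.
have [C1 C10 h1] := m_est (ler01 : 0 <= 1 :> R).
have [C2 [C20 h2 _]] := m_bound (ler01 : 0 <= 1 :> R).
have [K K0 hK] := norm_hor.
have [C3 C30 h3] := norm_nexp_tail (n := n) s_gt0 K0.
pose c := n.+1%:R * (C2 + C3 * K ^+ 2 + K).
have c0 : 0 <= c by rewrite mulr_ge0 // !addr_ge0 // mulr_ge0 // exprn_ge0.
pose d := (1 + c) * (C1 + C3 * K ^+ 2).
have d0 : 0 <= d by rewrite mulr_ge0 ?addr_ge0 // mulr_ge0 // exprn_ge0.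
exists (d * expR c ^+ 2) => [|a b N Ta ab bT N0].
  by rewrite mulr_ge0 // exprn_ge0 // expR_ge0.
have ba : 0 < b - a by rewrite subr_gt0.
have N1 : 0 < N%:R :> R by rewrite ltr0n.
set t := grid a b N.
have tT i : (i < N)%N -> [/\ - T <= t i, t i <= t i.+1, t i.+1 <= T & (t i.+1 - t i) / (b - a) = N%:R^-1].
  move=> iN; have ab' := ltW ab; split.
  - exact: le_trans (grid_ge _ _ ab').
  - exact: grid_le.
  - exact: le_trans (grid_le_end ab' iN) bT.
  - by rewrite gridS; field; rewrite !gt_eqF.
pose e i := nexp (hor ((b - a)^-1 *: D (t i) (t i.+1))).
pose f i := scl (b - a)^-1 (m (t i) (t i.+1)).
have ban : (b - a)^-1 != 0 by rewrite invr_neq0 // gt_eqF.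
have Vle : N%:R^-1 <= 1 :> R by rewrite invf_le1 // ler1n.
have V0 : 0 <= N%:R^-1 :> R by rewrite invr_ge0 ltW.
have hn i : (i < N)%N -> nrm ((b - a)^-1 *: D (t i) (t i.+1)) <= N%:R^-1.
  move=> /tT[k1 k2 k3 <-]; rewrite nrmZ gtr0_norm ?invr_gt0 // mulrC.
  by rewrite ler_wpM2r ?D_le // invr_ge0 ltW.
have len i : (i < N)%N -> t i.+1 - t i <= 1 * (b - a).
  by move=> /tT[_ _ _ h]; rewrite -ler_pdivrMr // h.
have tail v : nrm v <= N%:R^-1 -> `|nexp (hor v) - 1 - hor v| <= C3 * K ^+ 2 * N%:R^-1 ^+ 2.
  move=> hv; have hk : `|hor v| <= K * N%:R^-1 by apply: le_trans (hK v) _; rewrite ler_wpM2l.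
  have hk1 : `|hor v| <= K by apply: le_trans hk _; rewrite ler_piMr.
  apply: le_trans (h3 _ hk1) _; rewrite -mulrA -exprMn ler_wpM2l // lerXn2r ?nnegrE ?mulr_ge0 //.
have fe i : (i < N)%N -> `|f i - e i| <= (C1 + C3 * K ^+ 2) * N%:R^-1 ^+ 2.
  move=> iN; have [k1 k2 k3 k4] := tT _ iN.
  have := h1 _ _ _ ba k1 k2 k3 (len _ iN); rewrite k4 => q1.
  have q2 := tail _ (hn _ iN).
  have -> : f i - e i = (f i - 1 - hor ((b - a)^-1 *: D (t i) (t i.+1)))
     - (e i - 1 - hor ((b - a)^-1 *: D (t i) (t i.+1))).
    by apply/matrixP => k l; rewrite !mxE; ring.
  by apply: le_trans (ler_normB _ _) _; rewrite mulrDl; exact: lerD.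
have ue i : e i \is a GRing.unit by exact/Gam_unit/Gam_hor.
have near1 v : nrm v <= N%:R^-1 -> `|nexp (hor v) - 1| <= (C3 * K ^+ 2 + K) * N%:R^-1.
  move=> hv; rewrite -[_ - 1](subrK (hor v)); apply: le_trans (ler_normD _ _) _.
  rewrite mulrDl; apply: lerD; last by apply: le_trans (hK v) _; rewrite ler_wpM2l.
  apply: le_trans (tail _ hv) _; rewrite ler_wpM2l ?mulr_ge0 ?exprn_ge0 //.
  by rewrite expr2 ler_piMr.
pose q := 1 + c / N%:R.
have q1 : 1 <= q by rewrite lerDl mulr_ge0.
have CKle x : x <= C2 + C3 * K ^+ 2 + K -> 1 + n.+1%:R * (x * N%:R^-1) <= q.
  by move=> hx; rewrite lerD2l mulrA ler_wpM2r // ler_wpM2l.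
have p3 : 0 <= C3 * K ^+ 2 by rewrite mulr_ge0 // exprn_ge0.
have hf i (b' : M) : (i < N)%N -> `|b' * f i| <= q * `|b'|.
  move=> iN; have [k1 k2 k3 k4] := tT _ iN.
  have := h2 _ _ _ ba k1 k2 k3 (len _ iN); rewrite k4 => h.
  apply: le_trans (norm_mul_near1r _ h) _; rewrite ler_wpM2r // CKle //; lra.
have he i (b' : M) : (i < N)%N -> `|(e i)^-1 * b'| <= q * `|b'|.
  move=> iN; rewrite nexp_horV.
  have /near1 h : nrm (- ((b - a)^-1 *: D (t i) (t i.+1))) <= N%:R^-1 by rewrite nrmN hn.
  apply: le_trans (norm_mul_near1 _ h) _; rewrite ler_wpM2r // CKle //; lra.
(* The defect after [j] sides, whose recursion is that of a product with
   perturbed factors. *)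
pose k j := (\prod_(i < j) e i)^-1 * scl (b - a)^-1 (m (t 0%N) (t j)).
have uP j : \prod_(i < j) e i \is a GRing.unit by apply: Gam_unit; apply: Gam_prod => i; exact: Gam_hor.
have Ta' : - T <= t 0%N by rewrite /t grid0.
have kS j : (j < N)%N -> k j.+1 - 1 = (e j)^-1 * ((k j - 1) * f j) + (e j)^-1 * (f j - e j).
  move=> jN; have [k1 k2 k3 k4] := tT _ jN.
  have mE : m (t 0%N) (t j.+1) = m (t 0%N) (t j) * m (t j) (t j.+1).
    by rewrite m_cat // /t grid0 grid_ge // ltW.
  have -> : k j.+1 = (e j)^-1 * k j * f j.
    rewrite /k mE sclM // big_ord_recr /= invrM; [|exact: uP|exact: ue].
    by rewrite -/(f j) !mulrA.
  by rewrite mulrBl mul1r !mulrBr mulVr // !mulrA addrA subrK.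
have kle j : (j <= N)%N -> `|k j - 1| <= j%:R * (d * N%:R^-1 ^+ 2) * (q ^+ 2) ^+ j.
  elim: j => [|j IH] jN.
    rewrite /k big_ord0 invr1 mul1r m_refl // ?scl_one // ?subrr ?normr0 ?mul0r //.
    by rewrite /t grid0 (le_trans (ltW ab)).
  rewrite kS //; apply: le_trans (ler_normD _ _) _.
  have dN : 0 <= d * N%:R^-1 ^+ 2 by rewrite mulr_ge0 // exprn_ge0.
  have a1 : `|(e j)^-1 * ((k j - 1) * f j)| <= q ^+ 2 * `|k j - 1|.
    apply: le_trans (he _ _ jN) _; rewrite expr2 -mulrA ler_wpM2l ?hf //; lra.
  have a2 : `|(e j)^-1 * (f j - e j)| <= d * N%:R^-1 ^+ 2.
    apply: le_trans (he _ _ jN) _; rewrite /d -mulrA.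
    apply: ler_pM; rewrite ?fe //; first by lra.
    by rewrite /q lerD2l ler_piMr.
  have qq : 1 <= (q ^+ 2) ^+ j.+1 by rewrite exprn_ege1 // exprn_ege1.
  rewrite -natr1 (_ : (j%:R + 1) * _ * _ = j%:R * (d * N%:R^-1 ^+ 2) * (q ^+ 2) ^+ j.+1 +
    d * N%:R^-1 ^+ 2 * (q ^+ 2) ^+ j.+1); last by rewrite !mulrDl mul1r.
  apply: lerD.
    apply: le_trans a1 _; rewrite [(q ^+ 2) ^+ j.+1]exprS mulrCA ler_wpM2l ?sqr_ge0 //.
    by apply: IH; exact: ltnW.
  by apply: le_trans a2 _; rewrite ler_peMr.
have := kle N (leqnn _); rewrite /k /t grid0 gridN // => h.
apply: le_trans h _.
have -> : N%:R * (d * N%:R^-1 ^+ 2) = d / N%:R by field; rewrite gt_eqF.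
rewrite mulrAC ler_wpM2r // ler_wpM2l // -exprM mulnC exprM lerXn2r ?nnegrE ?expR_ge0 //.
  by rewrite exprn_ge0 //; lra.
exact: one_plus_pow.
Qed.

(** The polygon is closed up to the endpoint of the curve. The defect, of size
    [O(p ^- s)], becomes bounded when dilated by [p]: its entries of degree at
    most [s] are multiplied by at most [p ^ s], and [bounded_word] then closes
    it at a cost [O(1 / p)]. *)
Lemma polygon_word : exists2 C, 0 <= C & forall a b p, - T <= a -> a < b -> b <= T -> (0 < p)%N ->
  W (\sum_(i < p ^ s) nrm (D (grid a b (p ^ s) i) (grid a b (p ^ s) i.+1)) + C * (b - a) / p%:R) (m a b).
Proof.
have [C C0 hC] := polygon_defect; have [C' hC'] := bounded_word (C + 1).
exists `|C'| => // a b p Ta ab bT p0; have ba : 0 < b - a by rewrite subr_gt0.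
have ban : b - a != 0 by rewrite gt_eqF.
have p0' : 0 < p%:R :> R by rewrite ltr0n.
have N0 : (0 < p ^ s)%N by rewrite expn_gt0 p0.
have := hC a b _ Ta ab bT N0.
set P := \prod_(i < _) _; set Q := scl _ _ => h.
have GP : Gam P by apply: Gam_prod => i; exact: Gam_hor.
have GQ : Gam Q by apply: Gam_scl; rewrite ?invr_gt0 //; apply: m_Gam => //; exact: ltW.
pose k := P^-1 * Q; have Gk : Gam k by exact: GamM (Gam_inv GP) GQ.
have QE : Q = P * k by rewrite /k mulVKr // Gam_unit.
have WP : W (\sum_(i < p ^ s) (b - a)^-1 * nrm (D (grid a b (p ^ s) i) (grid a b (p ^ s) i.+1))) P.
  apply: W_prod => i; have := W_seg ((b - a)^-1 *: D (grid a b (p ^ s) i) (grid a b (p ^ s) i.+1)).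
  by rewrite nrmZ gtr0_norm ?invr_gt0.
have Wk : W (p%:R^-1 * `|C'|) k.
  apply: W_scl_inv; rewrite ?invr_gt0 // invrK; apply: W_le (ler_norm _) _; apply: hC'.
    exact: Gam_scl.
  apply: norm_mx_le => [|i j]; first by rewrite addr_ge0.
  have kE : k i j = (k - 1) i j + (1 : M) i j by rewrite !mxE subrK.
  rewrite mxE kE mulrDr; apply: le_trans (ler_normD _ _) _; apply: lerD.
    have [ij|ij] := ltnP (wt i) (wt j + 1).
      by rewrite (Gam_Fil Gk ij) mulr0 normr0.
    rewrite normrM; apply: (@le_trans _ _ (p%:R ^+ s * (C / (p ^ s)%:R))); last first.
      by rewrite natrX mulrC divfK // expf_neq0 // gt_eqF.
    apply: ler_pM => //; last exact: le_trans (norm_entry _ _ _) h.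
    rewrite addn1 in ij.
    rewrite -(subnK (ltnW ij)) exprD mulfK ?expf_neq0 ?gt_eqF // ger0_norm ?exprn_ge0 ?(ltW p0') //.
    rewrite ler_weXn2l ?ler1n //.
    by apply: leq_trans (wt_s i); exact: leq_subr.
  have [ij|ij] := eqVneq i j.
    by rewrite ij divff ?expf_neq0 ?gt_eqF // mul1r mxE eqxx normr1.
  by rewrite mxE (negPf ij) mulr0 normr0.
rewrite (_ : _ + _ = (b - a) * ((b - a)^-1 * \sum_(i < p ^ s) nrm (D (grid a b (p ^ s) i) (grid a b (p ^ s) i.+1)) + p%:R^-1 * `|C'|)).
  by apply: (W_scl_inv ba); rewrite -/Q QE mulr_sumr; exact: WM.
by move: (\sum_(i < _) _) => S; field; rewrite ban gt_eqF.
Qed.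

(** Inscribed polygons are not longer than the arc, and the closing cost of
    [polygon_word] is as small as wanted. *)
Lemma curve_word a b l : - T <= a -> a <= b -> b <= T -> b - a < l -> W l (m a b).
Proof.
move=> Ta ab bT bl; have [aE|ab'] := eqVneq a b.
  rewrite -aE subrr in bl; rewrite -aE m_refl //; last by rewrite aE.
  by apply: W_le W1; exact: ltW.
have {}ab' : a < b by rewrite lt_neqAle ab' ab.
have [C C0 hC] := polygon_word.
have [p p0 hp] : exists2 p, (0 < p)%N & C * (b - a) / p%:R <= l - (b - a).
  pose x := C * (b - a) / (l - (b - a)).
  have lb : 0 < l - (b - a) by rewrite subr_gt0.
  have x0 : 0 <= x by rewrite divr_ge0 ?mulr_ge0 ?subr_ge0 // ltW.
  exists (Num.truncn x).+1 => //; rewrite ler_pdivrMr ?ltr0n // [leRHS]mulrC -ler_pdivrMr //.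
  by apply: ltW; exact: truncnS_gt.
apply: W_le (hC _ _ _ Ta ab' bT p0).
have N0 : (0 < p ^ s)%N by rewrite expn_gt0 p0.
have : \sum_(i < p ^ s) nrm (D (grid a b (p ^ s) i) (grid a b (p ^ s) i.+1)) <=
    \sum_(i < p ^ s) (b - a) / (p ^ s)%:R.
  apply: ler_sum => i _; rewrite -(gridS a b (p ^ s) i); apply: D_le.
  - exact: le_trans (grid_ge _ _ ab).
  - exact: grid_le.
  - exact: le_trans (grid_le_end ab (ltn_ord i)) bT.
rewrite sumr_const card_ord -[leRHS]mulr_natr divfK ?pnatr_eq0 -?lt0n // => h.
by lra.
Qed.

(** An arc of a minimizer is minimizing: a shorter word would be completed by
    words for the two remaining arcs. *)
Lemma arc_min a b l : - T <= a -> a <= b -> b <= T -> W l (m a b) -> b - a <= l.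
Proof.
move=> Ta ab bT Wl; apply/ler_addgt0Pl => e e0.
have e2 : 0 < e / 2 by rewrite divr_gt0.
have W1' : W (a + T + e / 2) (m (- T) a) by apply: curve_word => //; lra.
have W2' : W (T - b + e / 2) (m b T) by apply: curve_word => //; lra.
have := WM (WM W1' Wl) W2'; rewrite m_cat // m_cat //; last by rewrite (le_trans Ta).
by move=> /m_min; lra.
Qed.

Lemma polygon_length : exists2 C, 0 <= C & forall a b p, - T <= a -> a < b -> b <= T -> (0 < p)%N ->
  (b - a) * (1 - C / p%:R) <=
    \sum_(i < p ^ s) nrm (D (grid a b (p ^ s) i) (grid a b (p ^ s) i.+1)).
Proof.
have [C C0 hC] := polygon_word; exists C => // a b p Ta ab bT p0.
have := arc_min Ta (ltW ab) bT (hC _ _ _ Ta ab bT p0).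
move: (\sum_(i < _) _) => S; have -> : (b - a) * (1 - C / p%:R) = b - a - C * (b - a) / p%:R by ring.
lra.
Qed.

(** *** Consequences of a lower bound on the excess *)

(** [E v a b] is the integral of the square of the component along [v] of the
    velocity. Its upper bound expands the integral over the interval of
    [|u - w|^2 - <v, u - w>^2 >= 0], where [u] is the velocity and [w] its mean. *)

Context (E_cat : forall v a b c, - T <= a -> a <= b -> b <= c -> c <= T -> E v a b + E v b c = E v a c).
Context (E_le : forall v a b, nrm v = 1 -> - T <= a -> a < b -> b <= T ->
  E v a b <= dotr v (D a b) ^+ 2 / (b - a) + (b - a) - nrm (D a b) ^+ 2 / (b - a)).
Context (eps eta0 : R) (eps_gt0 : 0 < eps) (eta0_gt0 : 0 < eta0) (eta0_T : eta0 <= T).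
Context (exc : forall v eta, nrm v = 1 -> 0 < eta <= eta0 -> 2 * eta * eps ^+ 2 <= E v (- eta) eta).
Context (r_ge2 : (2 <= r)%N).

Lemma E_grid v a b N : - T <= a -> a <= b -> b <= T -> (0 < N)%N ->
  E v a b = \sum_(i < N) E v (grid a b N i) (grid a b N i.+1).
Proof.
move=> Ta ab bT N0.
have E0 : E v a a = 0.
  have aT := le_trans ab bT.
  by apply: (addrI (E v a a)); rewrite E_cat // addr0.
suff H j : (j <= N)%N -> E v a (grid a b N j) = \sum_(i < j) E v (grid a b N i) (grid a b N i.+1).
  by rewrite -H // gridN.
elim: j => [|j IH] jN; first by rewrite grid0 big_ord0.
rewrite big_ord_recr /= -IH ?E_cat //; [exact: grid_ge|exact: grid_le| |exact: ltnW].
exact: le_trans (grid_le_end ab jN) bT.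
Qed.

(** The sides of a polygon almost as long as the curve have directions close
    to the velocity in mean square, by [E_le] summed over the grid, so they
    inherit half of the lower bound [exc]. The polygon is long enough when its
    number of sides is large, whatever the scale [zeta]. *)
Lemma spanning_grid : exists p, [/\ (0 < p)%N, odd p & forall zeta v, 0 < zeta <= eta0 ->
  2 * zeta ^+ 2 * eps ^+ 2 / (p ^ s)%:R * dotr v v <=
  \sum_(i < p ^ s) dotr v (D (grid (- zeta) zeta (p ^ s) i) (grid (- zeta) zeta (p ^ s) i.+1)) ^+ 2].
Proof.
have [C C0 hC] := polygon_length.
(* With [p] above [x], the polygon is shorter than the curve by at most a
   fraction [eps ^+ 2 / 4]; [p] is odd so that the grid has a central part. *)
pose x := (4 * C + 1) / eps ^+ 2.
have e2 : 0 < eps ^+ 2 by rewrite exprn_gt0.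
have x0 : 0 < x by rewrite divr_gt0 //; lra.
pose p := (Num.truncn x).*2.+1.
have xp : x <= p%:R.
  apply: ltW; apply: (lt_le_trans (truncnS_gt x)); rewrite ler_nat ltnS -addnn leq_addr.
  done.
have p0 : 0 < p%:R :> R by rewrite ltr0n.
exists p; split=> //; first by rewrite /= odd_double.
move=> zeta v /andP[z0 z1].
have N0 : (0 < p ^ s)%N by rewrite expn_gt0.
set N := (p ^ s)%N in N0 *.
have N1 : 0 < N%:R :> R by rewrite ltr0n.
pose t := grid (- zeta) zeta N.
have zT : zeta <= T by exact: le_trans eta0_T.
have Tz : - T <= - zeta by rewrite lerN2.
have zz : - zeta < zeta by lra.
have zz' := ltW zz.
have zE : zeta - - zeta = 2 * zeta by lra.
have tS i : t i.+1 - t i = 2 * zeta / N%:R by rewrite gridS zE.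
pose l := 2 * zeta / N%:R; have l0 : 0 < l by rewrite divr_gt0 // mulr_gt0.
have := hC _ _ p Tz zz zT isT; rewrite -/N -/t zE.
set S := \sum_(i < N) _ => hS.
pose Q := \sum_(i < N) nrm (D (t i) (t i.+1)) ^+ 2.
have hQ : S ^+ 2 <= N%:R * Q by exact: sqr_sum_le.
have Cp : 4 * C / p%:R <= eps ^+ 2.
  rewrite ler_pdivrMr // [leRHS]mulrC -ler_pdivrMr //; apply: le_trans xp.
  by rewrite /x ler_pM2r ?invr_gt0 //; lra.
have gap : 2 * zeta - Q / l <= 2 * zeta * eps ^+ 2 / 2.
  have Cp0 : 0 <= C / p%:R by rewrite divr_ge0 // ltW.
  have S2 : (2 * zeta) ^+ 2 * (1 - 2 * (C / p%:R)) <= S ^+ 2.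
    have [h|h] := leP (C / p%:R) 1.
      apply: (@le_trans _ _ ((2 * zeta * (1 - C / p%:R)) ^+ 2)).
        rewrite [leRHS]exprMn ler_wpM2l ?sqr_ge0 //.
        by have := sqr_ge0 (C / p%:R); rewrite !expr2; lra.
      rewrite lerXn2r ?nnegrE //; first by rewrite mulr_ge0 //; lra.
      by apply: sumr_ge0 => i _; exact: nrm_ge0.
    apply: le_trans (sqr_ge0 _); rewrite mulr_ge0_le0 ?sqr_ge0 //; lra.
  have -> : Q / l = N%:R * Q / (2 * zeta).
    by rewrite /l; field; rewrite !gt_eqF.
  have : (2 * zeta) * (1 - 2 * (C / p%:R)) <= N%:R * Q / (2 * zeta).
    rewrite ler_pdivlMr ?mulr_gt0 //; apply: le_trans hQ; apply: le_trans S2.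
    by rewrite expr2 le_eqVlt; apply/orP; left; apply/eqP; ring.
  have : 2 * zeta * (4 * (C / p%:R)) <= 2 * zeta * eps ^+ 2.
    by rewrite ler_pM2l ?mulr_gt0 // mulrA.
  lra.
have unit_case w : nrm w = 1 -> 2 * zeta ^+ 2 * eps ^+ 2 / N%:R <=
    \sum_(i < N) dotr w (D (t i) (t i.+1)) ^+ 2.
  move=> w1; have := exc w1 (introT andP (conj z0 z1)).
  rewrite (E_grid w Tz zz' zT N0) -/t => h.
  have h2 : \sum_(i < N) E w (t i) (t i.+1) <=
      (\sum_(i < N) dotr w (D (t i) (t i.+1)) ^+ 2) / l + (2 * zeta - Q / l).
    have -> : 2 * zeta - Q / l = \sum_(i < N) (l - nrm (D (t i) (t i.+1)) ^+ 2 / l).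
      rewrite sumrB sumr_const card_ord /Q mulr_suml; congr (_ - _).
      by rewrite -[RHS]mulr_natr divfK // gt_eqF.
    rewrite mulr_suml -big_split /=; apply: ler_sum => i _; rewrite addrA /l -(tS i).
    have tt : t i < t i.+1 by rewrite -subr_gt0 tS.
    apply: E_le => //.
      exact: le_trans (grid_ge _ _ zz').
    exact: le_trans (grid_le_end zz' (ltn_ord i)) zT.
  have {h h2 gap} : 2 * zeta * eps ^+ 2 / 2 <= (\sum_(i < N) dotr w (D (t i) (t i.+1)) ^+ 2) / l by lra.
  rewrite ler_pdivlMr //; apply: le_trans.
  by rewrite /l le_eqVlt; apply/orP; left; apply/eqP; field; rewrite gt_eqF.
have [v0|v0] := eqVneq (nrm v) 0.
  by rewrite -nrm_sqr v0 expr0n mulr0; apply: sumr_ge0 => i _; exact: sqr_ge0.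
have vp : 0 < nrm v by rewrite lt_neqAle eq_sym v0 nrm_ge0.
have w1 : nrm ((nrm v)^-1 *: v) = 1 by rewrite nrmZ gtr0_norm ?invr_gt0 // mulVf.
have := unit_case _ w1.
rewrite (eq_bigr (fun i : 'I_N => (nrm v)^-1 ^+ 2 * dotr v (D (t i) (t i.+1)) ^+ 2)); last first.
  by move=> i _; rewrite dotrC dotrZ dotrC exprMn.
rewrite -mulr_sumr exprVn [leRHS]mulrC -ler_pdivrMr ?invr_gt0 ?exprn_gt0 // invrK.
by rewrite nrm_sqr.
Qed.

(** The Gram matrix of the family is bounded below by [c], hence invertible,
    with inverse bounded by [1 / c]. *)
Lemma gram_solve N (d : 'I_N -> 'rV[R]_r) c x : 0 < c ->
  (forall v, c * dotr v v <= \sum_i dotr v (d i) ^+ 2) ->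
  exists2 z, \sum_i dotr z (d i) *: d i = x & nrm z <= nrm x / c.
Proof.
move=> c0 h; pose Q := \sum_i (d i)^T *m d i.
have QE z : z *m Q = \sum_i dotr z (d i) *: d i.
  rewrite mulmx_sumr; apply: eq_bigr => i _; rewrite mulmxA.
  have -> : z *m (d i)^T = (dotr z (d i))%:M.
    apply/matrixP => a b; rewrite !ord1 !mxE eqxx mulr1n; apply: eq_bigr => k _.
    by rewrite !mxE.
  by rewrite mul_scalar_mx.
have zQ z : dotr z (z *m Q) = \sum_i dotr z (d i) ^+ 2.
  by rewrite QE dotr_sum; apply: eq_bigr => i _; rewrite dotrZ expr2.
have Qu : Q \in unitmx.
  rewrite -row_free_unit; apply: inj_row_free => v vQ.
  apply: dotr_eq0; apply/le_anti; rewrite dotr_ge0 andbT -(ler_pM2l c0) mulr0.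
  by apply: le_trans (h v) _; rewrite -zQ vQ dotr0.
exists (x *m invmx Q); first by rewrite -QE mulmxKV.
set z := x *m _.
have zx : z *m Q = x by rewrite mulmxKV.
have := h z; rewrite -zQ zx => h1.
have h2 := le_trans h1 (le_trans (ler_norm _) (cauchy_schwarz z x)).
rewrite ler_pdivlMr //; have [z0|z0] := eqVneq (nrm z) 0; first by rewrite z0 mul0r nrm_ge0.
have zp : 0 < nrm z by rewrite lt_neqAle eq_sym z0 nrm_ge0.
by rewrite -(ler_pM2l zp) mulrA [nrm z * nrm z]mulrC -expr2 nrm_sqr mulrC.
Qed.

(** *** Cut and correct *)

(** Perturbations of degree [q] of unipotent factors add up to leading order. *)
Lemma prod_perturb N q (G F z : 'I_N -> M) : (forall i, Fil 1 (G i - 1)) ->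
  (forall i, Fil 1 (F i - 1)) ->
  (forall i, Fil q (z i)) -> (forall i, Fil q.+1 (F i - G i - z i)) ->
  Fil q.+1 (\prod_i F i - \prod_i G i - \sum_i z i).
Proof.
elim: N G F z => [|N IH] G F z hG hF hz h.
  by rewrite !big_ord0 subrr subr0; exact: Fil_zero.
rewrite !big_ord_recl.
set G' := \prod_(i < N) G _; set F' := \prod_(i < N) F _; set z' := \sum_(i < N) _.
have {}IH : Fil q.+1 (F' - G' - z') by exact: IH.
have hF' : Fil 1 (F' - 1).
  rewrite /F'; elim/big_ind: _ => [|x y hx hy|i _]; rewrite ?subrr; [exact: Fil_zero| |exact: hF].
  have -> : x * y - 1 = (x - 1) * y + (y - 1) by rewrite mulrBl mul1r addrA subrK.
  apply: FilD => //; rewrite -[1%N]addn0; apply: FilM => //; exact: Fil_unipotent.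
have -> : F ord0 * F' - G ord0 * G' - (z ord0 + z') =
  (F ord0 - G ord0 - z ord0) * F' + G ord0 * (F' - G' - z') + z ord0 * (F' - 1) + (G ord0 - 1) * z'.
  rewrite !mulrBl !mulrBr mulr1 mul1r.
  move: (F ord0 * F') (G ord0 * G') (G ord0 * F') (z ord0 * F') (G ord0 * z') => a b c d e.
  by apply/matrixP => k l; rewrite !mxE; ring.
have hz' : Fil q z' by apply: Fil_sum => i; exact: hz.
apply: FilD; first apply: FilD; first apply: FilD.
- by rewrite -[q.+1]addn0; apply: FilM => //; exact: Fil_unipotent.
- by rewrite -[q.+1]add0n; apply: FilM => //; exact: Fil_unipotent.
- by rewrite -addn1; exact: FilM.
- by rewrite -add1n; exact: FilM.
Qed.

Lemma norm_prod_le N B (F : 'I_N -> M) : (forall i, `|F i| <= B) ->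
  `|\prod_i F i| <= (n.+1%:R * B) ^+ N.
Proof.
elim: N F => [|N IH] F h; first by rewrite big_ord0 expr0 norm1_le.
rewrite big_ord_recl exprS; apply: le_trans (norm_mulr _ _) _.
have B0 : 0 <= B by apply: le_trans (h ord0).
apply: ler_pM => //; rewrite ?mulr_ge0 //; first by rewrite ler_wpM2l.
by apply: IH => i.
Qed.

(** The arc between the times [- Lam * eta] and [Lam * eta] can be replaced by
    a path shorter by [gain * eta] whose endpoint is correct up to degree [j].
    The constants do not depend on the scale [eta], so that the next step can
    choose a larger scale in terms of them. *)
Definition shortcut j := exists Lam C gain : R, [/\ 1 <= Lam, 0 < gain &
  forall eta, 0 < eta -> Lam * eta <= eta0 -> exists a, [/\ Gam a,
    W (2 * (Lam * eta) - gain * eta) a,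
    Fil j.+1 (a - m (- (Lam * eta)) (Lam * eta)) & `|scl eta^-1 a| <= C]].

(** Cut. The lower bound on the excess is applied in a direction orthogonal to
    the chord, which exists in rank at least two: the velocity has a component
    off the chord, so the chord is shorter than the arc. *)
Lemma shortcut_chord : shortcut 1.
Proof.
have [C hC] := segment_cheap 2.
have e2 : 0 < eps ^+ 2 by rewrite exprn_gt0.
exists 1, C, (eps ^+ 2); split=> // eta h0; rewrite mul1r => h1.
set v := D (- eta) eta.
have eT : eta <= T by exact: le_trans eta0_T.
have Te : - T <= - eta by rewrite lerN2.
have ee : - eta < eta by lra.
exists (nexp (hor v)); split.
- exact: Gam_hor.
- apply: W_le (W_seg v).
  have [w w1 wv] : exists2 w, nrm w = 1 & dotr w v = 0.
    have [w w0 wv] : exists2 w, w != 0 & dotr w v = 0.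
      pose a0 : 'I_r := Ordinal (ltnW r_ge2); pose a1 : 'I_r := Ordinal r_ge2.
      have dd a : dotr (delta_mx 0 a) v = v 0 a.
        rewrite /dotr (bigD1 a) //= mxE !eqxx mul1r big1 ?addr0 // => i ia.
        by rewrite mxE (negPf ia) andbF mul0r.
      have [v0|v0] := eqVneq (v 0 a0) 0.
        exists (delta_mx 0 a0); last by rewrite dd.
        apply/eqP => /matrixP /(_ 0 a0); rewrite !mxE !eqxx => /eqP.
        by rewrite oner_eq0.
      exists (v 0 a1 *: delta_mx 0 a0 - v 0 a0 *: delta_mx 0 a1).
        apply/eqP => /matrixP /(_ 0 a1); rewrite !mxE !eqxx /= mulr0 mulr1 sub0r.
        by move/eqP; rewrite oppr_eq0 (negPf v0).
      by rewrite dotrC dotrB !dotrZ ![dotr v _]dotrC !dd mulrC subrr.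
    have wp : 0 < nrm w.
      rewrite lt_neqAle nrm_ge0 andbT eq_sym; apply: contra_neq w0 => h.
      by apply: dotr_eq0; rewrite -nrm_sqr h expr0n.
    exists ((nrm w)^-1 *: w); first by rewrite nrmZ gtr0_norm ?invr_gt0 // mulVf // gt_eqF.
    by rewrite dotrC dotrZ dotrC wv mulr0.
  have := exc w1 (introT andP (conj h0 h1)).
  have := E_le w1 Te ee eT; rewrite -/v wv expr0n mul0r add0r opprK.
  have -> : eta + eta = 2 * eta by ring.
  move=> k1 k2.
  have {k1 k2} k : nrm v ^+ 2 <= (2 * eta) ^+ 2 * (1 - eps ^+ 2).
    have {k1 k2} : nrm v ^+ 2 / (2 * eta) <= 2 * eta * (1 - eps ^+ 2).
      by rewrite mulrBr mulr1; lra.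
    rewrite ler_pdivrMr ?mulr_gt0 // => k; apply: le_trans k _.
    by rewrite le_eqVlt; apply/orP; left; apply/eqP; ring.
  have e1 : eps ^+ 2 <= 1.
    have := le_trans (sqr_ge0 _) k; rewrite pmulr_rge0 ?subr_ge0 //.
    by rewrite exprn_gt0 // mulr_gt0.
  rewrite -(ler_pXn2r (_ : 0 < 2)%N) ?nnegrE ?nrm_ge0 //; last first.
    have : eps ^+ 2 * eta <= eta by rewrite ler_piMl // ltW.
    lra.
  apply: le_trans k _.
  have -> : (2 * eta - eps ^+ 2 * eta) ^+ 2 = (2 * eta) ^+ 2 * (1 - eps ^+ 2) + (eps ^+ 2 * eta) ^+ 2.
    by ring.
  by rewrite lerDl sqr_ge0.
- have -> : nexp (hor v) - m (- eta) eta = (nexp (hor v) - 1 - hor v) - (m (- eta) eta - 1 - hor v).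
    by apply/matrixP => k l; rewrite !mxE; ring.
  apply: FilB; first exact: Fil_nexp s_gt0 (hor_Fil v).
  by have [_] := m_lead Te (ltW ee) eT.
- have en : eta^-1 != 0 by rewrite invr_neq0 // gt_eqF.
  rewrite scl_nexp // scl_hor //.
  have [] // := hC (eta^-1 *: v) _; rewrite nrmZ gtr0_norm ?invr_gt0 //.
  rewrite mulrC ler_pdivrMr //; apply: le_trans (D_le Te (ltW ee) eT) _; lra.
Qed.

Lemma scl_prod N t (F : 'I_N -> M) : t != 0 ->
  \prod_i scl t (F i) = scl t (\prod_i F i).
Proof.
move=> t0; elim/big_ind2: _ => //; first by rewrite scl_one.
by move=> x1 x2 y1 y2 -> ->; rewrite sclM.
Qed.

Lemma hor_sum N (c : 'I_N -> R) (d : 'I_N -> 'rV[R]_r) :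
  hor (\sum_i c i *: d i) = \sum_i c i *: hor (d i).
Proof.
rewrite /hor; under eq_bigr => a _ do rewrite summxE scaler_suml.
rewrite exchange_big; apply: eq_bigr => i _; rewrite scaler_sumr.
by apply: eq_bigr => a _; rewrite mxE scalerA.
Qed.

Lemma cost_balance (u1 u2 u3 d z : R) : u1 <= u2 / 8 -> u3 + d = u2 / 4 ->
  u1 + (2 * z + u3 + (d - u2)) + u1 <= 2 * z - u2 / 2.
Proof. by move=> h1 h2; lra. Qed.

(** Correct. The error of degree [j + 1] is a sum of brackets of elements
    [y b] of degree [j] with the [Xb b]. At a scale [zeta], a large multiple
    of [eta], the [Xb b] are combinations of the increments [D] along a grid,
    with coefficients of order [1 / zeta] by [spanning_grid]; so the error is
    a sum of brackets [br i] of elements [w i] with these increments, and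
    conjugating the [i]-th arc of the grid by an element with leading term
    [w i] produces its bracket. As [w i] is of order [eta ^ (j + 1) / zeta], a
    word for it has a length of order [eta] times [(eta / zeta) ^ (1 / j)],
    short compared with the gain once [zeta / eta] is large. *)
Lemma shortcut_succ j : (1 <= j < s)%N -> shortcut j -> shortcut j.+1.
Proof.
move=> js [Lam [C [gain [Lam1 gain0 H]]]].
have j1 : (1 <= j)%N by case/andP: js.
have Lam0 : 0 < Lam by lra.
have [p [p0 podd hp]] := spanning_grid.
set N := (p ^ s)%N in hp.
have N0 : (0 < N)%N by rewrite expn_gt0 p0.
have N1 : 1 <= N%:R :> R by rewrite ler1n.
have Nr0 : 0 < N%:R :> R by rewrite ltr0n.
have Nodd : odd N by rewrite oddX podd orbT.
pose h := N./2; have Nh : N = h.*2.+1 by rewrite -[LHS]odd_double_half Nodd.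
have hN : (h < N)%N by rewrite [X in (_ < X)%N]Nh ltnS -addnn leq_addr.
have Nh' : N%:R = 2 * h%:R + 1 :> R by rewrite {1}Nh -natr1 -mul2n natrM.
have [Cg Cg0 hg] := g_succ js.
have [Ew hw] := layer_word (j := j) (ltac:(by case/andP: js => -> /ltnW)) 1.
have [Cm [Cm0 _ hm]] := m_bound (B := 2 * Lam) (ltac:(lra)).
have C0 : 0 <= `|C| by [].
pose c0 := 2 * eps ^+ 2 / N%:R.
have c00 : 0 < c0 by rewrite divr_gt0 ?mulr_gt0 ?exprn_gt0 //; lra.
pose A2 := r%:R * (2 / c0 * (Cg * (`|C| + Cm))).
have A20 : 0 <= A2 by rewrite !mulr_ge0 ?addr_ge0 ?invr_ge0 // ltW.
pose Ew' := Num.max Ew 1.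
have Ew1 : 1 <= Ew' by rewrite le_max lexx orbT.
have hw' w : w \in g j -> `|w| <= 1 -> exists2 k, lead j k w & cheap Ew' k.
  move=> wg w1; have [k k1 k2] := hw _ wg w1; exists k => //.
  by apply: cheap_le k2; rewrite le_max lexx.
(* The words used for the correction live at scale [sig * eta]; their total
   cost is at most a quarter of the gain. *)
pose sig := Num.min 1 (gain / (8 * N%:R * Ew')).
have NE0 : 0 < 8 * N%:R * Ew' by rewrite !mulr_gt0 //; lra.
have sig0 : 0 < sig by rewrite lt_min ltr01 divr_gt0.
have sig1 : sig <= 1 by rewrite ge_min lexx.
have sigg : sig * (8 * N%:R * Ew') <= gain.
  by rewrite -ler_pdivlMr // ge_min lexx orbT.
have sj0 : 0 < sig ^+ j by rewrite exprn_gt0.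
(* Large enough for the elements [w i] to be bounded at scale [sig * eta]. *)
pose K := (Num.truncn (A2 / sig ^+ j)).+1.
have KA : A2 / sig ^+ j <= K%:R by apply: ltW; exact: truncnS_gt.
have K1 : 1 <= K%:R :> R by rewrite ler1n.
(* The central part of the grid at scale [Lam' * eta] must contain the
   interval of the shortcut. *)
pose Lam' := Lam * N%:R * K%:R.
have Lam'N : Lam' / N%:R = Lam * K%:R by rewrite /Lam'; field; lra.
have LamK : Lam <= Lam * K%:R by rewrite ler_peMr // ltW.
have Lam'1 : 1 <= Lam'.
  by rewrite -[1]mulr1 -[X in X * 1]mulr1 /Lam' !ler_pM // ?mulr_ge0 //; lra.
have Lam'0 : 0 < Lam' by lra.
have LamLam' : Lam <= Lam'.
  by rewrite /Lam' mulrAC; apply: le_trans LamK _; rewrite ler_peMr // ltW // mulr_gt0 //; lra.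
have [Cm' [Cm'0 _ hm']] := m_bound (B := 2 * Lam') (ltac:(lra)).
pose Bmid := n.+1%:R * (n.+1%:R * Cm' * `|C|) * Cm'.
pose Bp := n.+1%:R * (n.+1%:R * Ew' * (Cm' + Bmid)) * Ew'.
exists Lam', ((n.+1%:R * Bp) ^+ N), (gain / 2); split; [by []|by rewrite divr_gt0|].
move=> eta e0 eL; set zeta := Lam' * eta in eL *.
have z0 : 0 < zeta by rewrite mulr_gt0.
have en : eta != 0 by rewrite gt_eqF.
have evn : eta^-1 != 0 by rewrite invr_neq0.
have Le : Lam * eta <= zeta / N%:R.
  by rewrite /zeta mulrAC Lam'N ler_wpM2r // ltW.
have zN : zeta / N%:R <= zeta by rewrite ler_pdivrMr // ler_peMr // ltW.
have Leta0 : Lam * eta <= eta0 by apply: le_trans eL; rewrite ler_wpM2r // ltW.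
have [a [Ga Wa Fa Na]] := H eta e0 Leta0.
set mL := m (- (Lam * eta)) (Lam * eta) in Fa.
have zT : zeta <= T by exact: le_trans eta0_T.
have Tz : - T <= - zeta by rewrite lerN2.
have zz : - zeta <= zeta by lra.
have Le0 : 0 < Lam * eta by rewrite mulr_gt0.
pose t := grid (- zeta) zeta N.
have tS i : t i.+1 - t i = 2 * zeta / N%:R by rewrite gridS; congr (_ / _); ring.
have tT i : (i < N)%N -> [/\ - T <= t i, t i <= t i.+1 & t i.+1 <= T].
  move=> iN; split.
  - exact: le_trans (grid_ge _ _ zz).
  - exact: grid_le.
  - exact: le_trans (grid_le_end zz iN) zT.
have th : t h = - (zeta / N%:R).
  have Nn : N%:R != 0 :> R by rewrite gt_eqF.
  have hE : h%:R = (N%:R - 1) / 2 :> R by rewrite Nh' addrK mulrAC divff ?mul1r // pnatr_eq0.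
  by rewrite /t /grid hE; field.
have thS : t h.+1 = zeta / N%:R.
  rewrite -[t h.+1](subrK (t h)) tS th mulrDl; ring.
(* The error of degree [j + 1] on the inner interval. *)
have zzN : Lam * eta <= zeta := le_trans Le zN.
have LT : Lam * eta <= T := le_trans zzN zT.
have TL : - T <= - (Lam * eta) by rewrite lerN2.
have LL : - (Lam * eta) <= Lam * eta by rewrite ge0_cp // ltW.
have LT' : - (Lam * eta) <= T := le_trans LL LT.
have TL' : - T <= Lam * eta := le_trans TL LL.
have zNT : zeta / N%:R <= T := le_trans zN zT.
have TzN : - T <= - (zeta / N%:R) by rewrite lerN2.
have LzN : - (zeta / N%:R) <= - (Lam * eta) by rewrite lerN2.
have GmL : Gam mL by exact: m_Gam.
have [x xg xF] : exists2 x, x \in g j.+1 & Fil j.+2 (a - mL - x).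
  have Gq : Gam (mL^-1 * a) by exact: GamM (Gam_inv GmL) Ga.
  have q1 : mL^-1 * a - 1 = mL^-1 * (a - mL) by rewrite mulrBr mulVr // Gam_unit.
  have [||x xg xF] := Gam_lead (j := j.+1) _ Gq; rewrite ?q1 //.
    by rewrite -[j.+1]add0n; apply: FilM => //; exact/Gam_Fil0/Gam_inv.
  exists x => //; rewrite q1 in xF.
  have -> : a - mL - x = mL * (mL^-1 * (a - mL) - x) + (mL - 1) * x.
    by rewrite mulrBr mulVKr ?Gam_unit // mulrBl mul1r addrA subrK.
  apply: FilD; first by rewrite -[j.+2]add0n; apply: FilM => //; exact: Gam_Fil0.
  rewrite -[j.+2]add1n; apply: FilM; first exact: Gam_Fil.
  exact/Hom_Fil/g_hom.
have xH := g_hom xg; have xFil : Fil j.+1 x by exact: Hom_Fil.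
pose x' := - scl eta^-1 x.
have x'E : x' = - (eta^-1 ^+ j.+1 *: x) by rewrite /x' (scl_Hom evn xH).
have x'g : x' \in g j.+1 by rewrite x'E memvN memvZ.
have x'N : `|x'| <= `|C| + Cm.
  rewrite normrN; apply: (@le_trans _ _ `|scl eta^-1 (a - mL)|).
    apply: norm_mx_le => // k l; have [kl|kl] := eqVneq (wt k) (wt l + j.+1)%N.
      have := xF k l; rewrite kl ltn_add2l ltnSn => /(_ isT) /eqP.
      rewrite mxE [X in _ + X]mxE subr_eq0 => /eqP hx.
      by apply: le_trans (norm_entry _ k l); rewrite !mxE -hx !mxE.
    by rewrite mxE xH // mulr0 normr0.
  rewrite sclB; apply: le_trans (ler_normB _ _) _; apply: lerD.
    exact: le_trans (ler_norm _).
  apply: hm => //; rewrite opprK le_eqVlt; apply/orP; left; apply/eqP; ring.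
have [y hy yE] := hg _ x'g.
have Hz (b : 'I_r) : exists z : 'rV[R]_r,
    \sum_(i < N) dotr z (D (t i) (t i.+1)) *: D (t i) (t i.+1) = delta_mx 0 b /\
    nrm z <= 1 / (c0 * zeta ^+ 2).
  have [||z z1 z2] := @gram_solve N (fun i => D (t i) (t i.+1)) (c0 * zeta ^+ 2) (delta_mx 0 b).
  - by rewrite mulr_gt0 // exprn_gt0.
  - move=> v; have := hp zeta v (introT andP (conj z0 eL)).
    by rewrite (_ : 2 * zeta ^+ 2 * eps ^+ 2 / N%:R = c0 * zeta ^+ 2) // /c0; ring.
  - exists z; split=> //; apply: le_trans z2 _; rewrite ler_wpM2r ?invr_ge0 //.
      by rewrite mulr_ge0 ?exprn_ge0 // ltW.
    rewrite /nrm /dotr (bigD1 b) //= !mxE !eqxx mulr1 big1 ?addr0 ?sqrtr1 // => i ib.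
    by rewrite !mxE (negPf ib) andbF mulr0.
have [z hz] := choice Hz.
(* By the choice of [z], the brackets of the [w i] with the sides add up to
   minus the error. *)
pose w (i : 'I_N) := eta ^+ j.+1 *: \sum_b dotr (z b) (D (t i) (t i.+1)) *: y b.
have wg i : w i \in g j.
  by rewrite memvZ // memv_suml // => b _; rewrite memvZ //; case: (hy b).
have wN i : `|w i| <= (sig * eta) ^+ j.
  have [k1 k2 k3] := tT _ (ltn_ord i).
  have Dz : nrm (D (t i) (t i.+1)) <= 2 * zeta.
    by apply: le_trans (D_le k1 k2 k3) _; rewrite tS ler_pdivrMr // ler_peMr // mulr_ge0 // ltW.
  rewrite normrZ ger0_norm ?exprn_ge0 ?(ltW e0) //.
  have hs : `|\sum_b dotr (z b) (D (t i) (t i.+1)) *: y b| <= A2 / zeta.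
    apply: le_trans (ler_norm_sum _ _ _) _.
    have -> : A2 / zeta = \sum_(b < r) ((2 / (c0 * zeta)) * (Cg * (`|C| + Cm))).
      by rewrite sumr_const card_ord -mulr_natl /A2; field; rewrite !gt_eqF.
    apply: ler_sum => b _; rewrite normrZ; apply: ler_pM => //; last first.
      by have [_ yb] := hy b; apply: le_trans yb _; rewrite ler_wpM2l.
    apply: le_trans (cauchy_schwarz _ _) _; have [_ zb] := hz b.
    have -> : 2 / (c0 * zeta) = 1 / (c0 * zeta ^+ 2) * (2 * zeta) by field; rewrite !gt_eqF.
    by apply: ler_pM => //; exact: nrm_ge0.
  rewrite exprS -mulrA mulrCA exprMn [sig ^+ j * _]mulrC; apply: ler_wpM2l.
    by rewrite exprn_ge0 // ltW.
  apply: le_trans (ler_wpM2l (ltW e0) hs) _.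
  have -> : eta * (A2 / zeta) = A2 / Lam' by rewrite /zeta; field; rewrite !gt_eqF.
  rewrite ler_pdivrMr //; rewrite ler_pdivrMr // in KA; apply: le_trans KA _.
  rewrite mulrC ler_wpM2l ?(ltW sj0) // /Lam' ler_peMl //.
  by apply: le_trans Lam1 _; rewrite ler_peMr // ltW.
pose tau := sig * eta.
have tau0 : 0 < tau by rewrite mulr_gt0.
have taun : tau != 0 by rewrite gt_eqF.
have tauvn : tau^-1 != 0 by rewrite invr_neq0.
have Hk i : exists k, [/\ lead j k (w i), Gam k, W (tau * Ew') k, W (tau * Ew') k^-1 &
    `|scl eta^-1 k| <= Ew' /\ `|scl eta^-1 k^-1| <= Ew'].
  have [||k [_ k1] [Gk k2 k3 k4 k5]] := hw' (scl tau^-1 (w i)).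
  - by rewrite (scl_Hom tauvn (g_hom (wg i))) memvZ.
  - rewrite (scl_Hom tauvn (g_hom (wg i))) normrZ exprVn normfV ger0_norm ?exprn_ge0 ?(ltW tau0) //.
    by rewrite mulrC ler_pdivrMr ?exprn_gt0 // mul1r.
  - have uk := Gam_unit Gk.
    have skE : scl eta^-1 (scl tau k) = scl sig k.
      by rewrite scl_comp // /tau mulrCA mulVf // mulr1.
    have skE' : scl eta^-1 (scl tau k^-1) = scl sig k^-1.
      by rewrite scl_comp // /tau mulrCA mulVf // mulr1.
    exists (scl tau k); rewrite -(sclV wt taun uk) skE skE'; split.
    + split; first exact/Hom_Fil/g_hom.
      rewrite -(sclK wt (w i) taun) -(scl_one wt taun) -!sclB; exact: Fil_scl.
    + exact: Gam_scl.
    + exact: W_scl.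
    + exact: W_scl.
    + have sg : 0 < sig <= 1 by rewrite sig0.
      split; (apply: le_trans (norm_scl_le sg _) _; [|by []]); apply: Gam_Fil0 => //.
      exact: Gam_inv.
have [k hk] := choice Hk.
(* The arcs of the grid, the central one being replaced by the shortcut. *)
pose m1 := m (t h) (- (Lam * eta)); pose m2 := m (Lam * eta) (t h.+1).
have Gm1 : Gam m1 by apply: m_Gam; rewrite ?th.
have Gm2 : Gam m2 by apply: m_Gam; rewrite ?thS.
have mh : m (t h) (t h.+1) = m1 * mL * m2.
  by rewrite /m1 /mL /m2 th thS m_cat // m_cat // (le_trans LzN).
pose G (i : 'I_N) := m (t i) (t i.+1).
pose G' (i : 'I_N) := if val i == h then m1 * a * m2 else G i.
have GG i : Gam (G i) by have [k1 k2 k3] := tT _ (ltn_ord i); exact: m_Gam.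
have GG' i : Gam (G' i) by rewrite /G'; case: ifP => // _; apply: GamM => //; exact: GamM.
pose xi (i : 'I_N) := if val i == h then x else 0.
have G'E i : Fil j.+2 (G' i - G i - xi i).
  rewrite /G' /xi; case: eqP => [ih|_]; last by rewrite subrr subr0; exact: Fil_zero.
  rewrite /G ih mh -mulrBl -mulrBr.
  have -> : m1 * (a - mL) * m2 - x = m1 * (a - mL - x) * m2 + (m1 - 1) * x * m2 + x * (m2 - 1).
    rewrite !mulrBr !mulrBl !mulr1 !mul1r.
    move: (m1 * a * m2) (m1 * mL * m2) (m1 * x * m2) (x * m2) => q1 q2 q3 q4.
    by apply/matrixP => i1 i2; rewrite !mxE; ring.
  apply: FilD; first apply: FilD.
  - rewrite -[j.+2]addn0; apply: FilM; last exact: Gam_Fil0.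
    by rewrite -[j.+2]add0n; apply: FilM => //; exact: Gam_Fil0.
  - rewrite -[j.+2]addn0; apply: FilM; last exact: Gam_Fil0.
    by rewrite -[j.+2]add1n; apply: FilM => //; exact: Gam_Fil.
  - by rewrite -[j.+2]addn1; apply: FilM => //; exact: Gam_Fil.
have xiF i : Fil j.+1 (xi i) by rewrite /xi; case: ifP => // _; exact: Fil_zero.
pose br (i : 'I_N) := w i * hor (D (t i) (t i.+1)) - hor (D (t i) (t i.+1)) * w i.
pose F (i : 'I_N) := k i * G' i * (k i)^-1.
have wF i : Fil j (w i) by exact/Hom_Fil/g_hom.
have brF i : Fil j.+1 (br i).
  by apply: FilB; [rewrite -addn1|rewrite -add1n]; apply: FilM => //; exact: hor_Fil.
have FE i : Fil j.+2 (F i - G i - (br i + xi i)).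
  have [[_ k1] Gk _ _ _] := hk i; have uk := Gam_unit Gk.
  have lG : Fil 2 (G' i - 1 - hor (D (t i) (t i.+1))).
    have [q1 q2 q3] := tT _ (ltn_ord i); have [_ hl] := m_lead q1 q2 q3.
    have -> : G' i - 1 - hor (D (t i) (t i.+1)) = (G' i - G i - xi i) + xi i +
        (m (t i) (t i.+1) - 1 - hor (D (t i) (t i.+1))).
      by rewrite subrK -/(G i); apply/matrixP => i1 i2; rewrite !mxE; ring.
    apply: FilD => //; apply: FilD; first exact: Fil_le (G'E i).
    exact: Fil_le (xiF i).
  have := Fil_conj_lead (i := j) (j := 1) j1 isT (wF i) (hor_Fil _) k1 lG.
  rewrite addn1 -/(br i) => hc.
  have -> : F i - G i - (br i + xi i) = (k i * G' i - G' i * k i - br i) * (k i)^-1 +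
      br i * ((k i)^-1 - 1) + (G' i - G i - xi i).
    move: (br i) => b0; rewrite !mulrBl mulrBr mulr1 mulrK // -/(F i).
    move: (b0 * (k i)^-1) => q1.
    by apply/matrixP => i1 i2; rewrite !mxE; ring.
  apply: FilD => //; apply: FilD.
    by rewrite -[j.+2]addn0; apply: FilM => //; apply: Gam_Fil0; exact: Gam_inv.
  by rewrite -[j.+2]addn1; apply: FilM => //; apply: Gam_Fil; exact: Gam_inv.
have GF i : Gam (F i).
  have [_ Gk _ _ _] := hk i; apply: GamM; last exact: Gam_inv.
  exact: GamM.
exists (\prod_i F i); split.
- exact: Gam_prod.
- have d0 : 0 < gain * eta / (4 * (N%:R + 1)).
    by rewrite divr_gt0 ?mulr_gt0 // addr_gt0.
  (* The excess length allowed to each of the [N + 1] words which replace the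
     arcs left in place. *)
  set d := gain * eta / (4 * (N%:R + 1)) in d0.
  pose c i : R := 2 * zeta / N%:R + d + (if i == h then d - gain * eta else 0).
  have WG' i : W (c (val i)) (G' i).
    rewrite /G' /c; case: eqP => [ih|_].
      have w1 : W (zeta / N%:R - Lam * eta + d) m1.
        by apply: curve_word; rewrite ?th // opprK addrC ltrDl.
      have w2 : W (zeta / N%:R - Lam * eta + d) m2.
        by apply: curve_word; rewrite ?thS // ltrDl.
      by apply: W_le (WM (WM w1 Wa) w2); rewrite le_eqVlt; apply/orP; left; apply/eqP; ring.
    rewrite addr0; have [q1 q2 q3] := tT _ (ltn_ord i).
    by apply: curve_word => //; rewrite tS ltrDl.
  have WF i : W (tau * Ew' + c (val i) + tau * Ew') (F i).
    by have [_ _ k4 k5 _] := hk i; apply: WM => //; exact: WM.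
  apply: W_le (W_prod WF).
  have cE : \sum_(i < N) c i = 2 * zeta + N%:R * d + (d - gain * eta).
    rewrite big_split /= sumr_const card_ord -[_ *+ N]mulr_natr (bigD1 (Ordinal hN)) //= eqxx.
    rewrite big1 ?addr0 => [|i ih]; last by rewrite ifF //; apply: negbTE.
    by field; rewrite gt_eqF.
  clearbody c; rewrite 2!big_split /= cE !sumr_const !card_ord -!(mulr_natr (tau * Ew')).
  have dE : (N%:R + 1) * d = gain * eta / 4 by rewrite /d; field; rewrite gt_eqF // addr_gt0.
  have te : tau * Ew' * N%:R <= gain * eta / 8.
    have := ler_wpM2r (ltW e0) sigg.
    have -> : sig * (8 * N%:R * Ew') * eta = 8 * (tau * Ew' * N%:R) by rewrite /tau; ring.
    by rewrite ler_pdivlMr // mulrC.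
  move: te dE; rewrite mulrDl mul1r (_ : gain / 2 * eta = gain * eta / 2); last by ring.
  exact: cost_balance.
- have -> : m (- zeta) zeta = \prod_i G i.
    suff GE i : (i <= N)%N -> \prod_(l < i) m (t l) (t l.+1) = m (- zeta) (t i).
      by rewrite /G GE // /t gridN.
    elim: i => [|i IHi] iN.
      by rewrite big_ord0 /t grid0 m_refl //; exact: le_trans zz zT.
    have [q1 q2 q3] := tT _ iN.
    rewrite big_ord_recr /= IHi ?(ltnW iN) // m_cat //; exact: grid_ge.
  have hP := prod_perturb (G := G) (F := F) (z := fun i => br i + xi i) (q := j.+1)
    (fun i => Gam_Fil (GG i)) (fun i => Gam_Fil (GF i)) (fun i => FilD (brF i) (xiF i)) FE.
  suff S0 : \sum_i (br i + xi i) = 0 by rewrite S0 subr0 in hP.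
  rewrite big_split /= [X in _ + X](bigD1 (Ordinal hN)) //= /xi eqxx.
  rewrite [X in _ + (_ + X)]big1 ?addr0; last by move=> i ih; rewrite ifF //; apply: negbTE.
  have -> : x = - (eta ^+ j.+1 *: x').
    by rewrite x'E scalerN opprK scalerA -exprMn divff // expr1n scale1r.
  apply/eqP; rewrite subr_eq0; apply/eqP; rewrite yE scaler_sumr.
  have brE i : br i = eta ^+ j.+1 *: \sum_b (dotr (z b) (D (t i) (t i.+1)) *:
      (y b * hor (D (t i) (t i.+1)) - hor (D (t i) (t i.+1)) * y b)).
    rewrite /br /w -scalerAl -scalerAr -scalerBr mulr_suml mulr_sumr -sumrB; congr (_ *: _).
    by apply: eq_bigr => b _; rewrite -scalerAl -scalerAr -scalerBr.
  under eq_bigr => i _ do rewrite brE.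
  rewrite -!scaler_sumr; congr (_ *: _); rewrite exchange_big; apply: eq_bigr => b _.
  have [zE _] := hz b; rewrite -!hor_delta -zE hor_sum mulr_sumr mulr_suml -sumrB.
  by apply: eq_bigr => i _; rewrite -scalerAr -scalerAl -scalerBr.
- rewrite -(scl_prod _ evn); apply: norm_prod_le => i.
  have [_ _ _ _ [ka kb]] := hk i; have [q1 q2 q3] := tT _ (ltn_ord i).
  have GB : `|scl eta^-1 (G' i)| <= Cm' + Bmid.
    have Bm0 : 0 <= Bmid by rewrite !mulr_ge0.
    have B2 : zeta - - zeta = 2 * Lam' * eta by rewrite /zeta; ring.
    have tb i1 i2 : - zeta <= i1 -> i2 <= zeta -> i2 - i1 <= 2 * Lam' * eta.
      by move=> u1 u2; rewrite -B2 lerB.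
    have le_m u1 u2 : - zeta <= u1 -> u1 <= u2 -> u2 <= zeta -> `|scl eta^-1 (m u1 u2)| <= Cm'.
      move=> l1 l2 l3; apply: hm' => //; [exact: le_trans l1|exact: le_trans zT|exact: tb].
    rewrite /G'; case: eqP => _.
      apply: le_trans (_ : Bmid <= _); last by rewrite lerDr.
      rewrite !sclM //; apply: le_trans (norm_mulr _ _) _; rewrite /Bmid.
      have z1' : - zeta <= - (zeta / N%:R) by rewrite lerN2.
      have z2' : - zeta <= Lam * eta by apply: le_trans (ltW Le0); rewrite oppr_le0 ltW.
      have z3' : - (Lam * eta) <= zeta by apply: le_trans (ltW z0); rewrite oppr_le0 ltW.
      apply: ler_pM; rewrite ?mulr_ge0 //.
        rewrite ler_wpM2l //; apply: le_trans (norm_mulr _ _) _; apply: ler_pM; rewrite ?mulr_ge0 //.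
          by rewrite ler_wpM2l // /m1 th le_m.
        exact: le_trans (ler_norm _).
      by rewrite /m2 thS le_m.
    apply: le_trans (_ : Cm' <= _); last by rewrite lerDl.
    by apply: le_m => //; [exact: grid_ge|exact: grid_le_end].
  rewrite /F !sclM //; apply: le_trans (norm_mulr _ _) _; rewrite /Bp.
  apply: ler_pM; rewrite ?mulr_ge0 // ler_wpM2l //.
  apply: le_trans (norm_mulr _ _) _; apply: ler_pM; rewrite ?mulr_ge0 // ler_wpM2l //.
Qed.

(** A shortcut that is correct up to degree [s] has the same endpoints as the
    arc, and it is shorter. *)
Theorem no_excess_bound : False.
Proof.
have [Lam [C [gain [Lam1 gain0 H]]]] : shortcut s.
  suff Hj j : (1 <= j <= s)%N -> shortcut j by apply: Hj; rewrite s_gt0 leqnn.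
  elim: j => // j IH /andP[_ js]; case: j IH js => [|j] IH js; first exact: shortcut_chord.
  by apply: shortcut_succ => //; apply: IH; exact: ltnW.
pose eta := eta0 / Lam; have Lam0 : 0 < Lam by lra.
have e0 : 0 < eta by rewrite divr_gt0.
have eL : Lam * eta = eta0 by rewrite /eta mulrC divfK // gt_eqF.
have [|a [_ Wa Fa _]] := H eta e0; first by rewrite eL.
move: Wa; have /eqP := Fil_top wt_s Fa; rewrite subr_eq0 eL => /eqP ->.
move=> /arc_min; rewrite opprK lerN2 => /(_ eta0_T) h.
have : 0 < gain * eta by rewrite mulr_gt0.
have : eta0 + eta0 <= 2 * eta0 - gain * eta by apply: h => //; rewrite ge0_cp // ltW.
lra.
Qed.

End words.

(** * Strict differentiability *)

Section strict_differentiability.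
Context {R : realType}.

Lemma nbhs_eps {V : normedModType R} (x : V) (U : set V) :
  nbhs x U <-> exists2 d, 0 < d & forall y, `|y - x| < d -> U y.
Proof.
split=> [/nbhs_ballP[d /= d0 hd]|[d d0 hd]].
  by exists d => // y yd; apply: hd; rewrite -ball_normE /ball_ /= distrC.
by apply/nbhs_ballP; exists d => // y; rewrite -ball_normE /ball_ /= distrC; exact: hd.
Qed.

Lemma continuous_eps {V W : normedModType R} (f : V -> W) (x : V) :
  {for x, continuous f} <->
  forall e, 0 < e -> exists2 d, 0 < d & forall y, `|y - x| < d -> `|f y - f x| <= e.
Proof.
split=> [/cvgrPdist_le h e /h /nbhs_eps[d d0 hd]|h].
  by exists d => // y /hd; rewrite distrC.
apply/cvgrPdist_le => e /h[d d0 hd]; apply/nbhs_eps; exists d => // y /hd.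
by rewrite distrC.
Qed.

(** Strict differentiability composes, and restricts to Lipschitz estimates
    between any two nearby points, without reference to a neighbourhood where
    derivatives exist. *)
Definition sdiff {p q} (F : 'rV[R]_p -> 'rV[R]_q) (x0 : 'rV[R]_p) (J : 'M[R]_(p, q)) :=
  forall e, 0 < e -> exists2 d, 0 < d & forall x y,
    `|x - x0| < d -> `|y - x0| < d -> `|F x - F y - (x - y) *m J| <= e * `|x - y|.

Lemma norm_mulmx_le p q (v : 'rV[R]_p) (J : 'M[R]_(p, q)) : `|v *m J| <= p%:R * `|J| * `|v|.
Proof. by rewrite mulrAC; exact: norm_mulmx. Qed.

Lemma sdiff_lip {p q} (F : 'rV[R]_p -> 'rV[R]_q) x0 J : sdiff F x0 J ->
  exists d K, [/\ 0 < d, 0 <= K & forall x y, `|x - x0| < d -> `|y - x0| < d ->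
    `|F x - F y| <= K * `|x - y|].
Proof.
move=> /(_ 1 ltr01)[d d0 hd]; exists d, (1 + p%:R * `|J|); split=> //.
move=> x y hx hy; rewrite -[F x - F y](subrK ((x - y) *m J)).
apply: le_trans (ler_normD _ _) _; rewrite mulrDl; apply: lerD; first exact: hd.
exact: norm_mulmx_le.
Qed.

Lemma sdiff_affine {p q} (F : 'rV[R]_p -> 'rV[R]_q) x0 J :
  (forall x y, F x - F y = (x - y) *m J) -> sdiff F x0 J.
Proof.
by move=> h e e0; exists 1 => // x y _ _; rewrite h subrr normr0 mulr_ge0 // ltW.
Qed.

Lemma sdiff_ext {p q} (F G : 'rV[R]_p -> 'rV[R]_q) x0 J d0 : 0 < d0 ->
  (forall x, `|x - x0| < d0 -> F x = G x) -> sdiff F x0 J -> sdiff G x0 J.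
Proof.
move=> d00 FG h e /h[d d1 hd]; exists (Num.min d0 d); first by rewrite lt_min d00.
by move=> x y; rewrite !lt_min => /andP[x0' xd] /andP[y0 yd]; rewrite -!FG //; exact: hd.
Qed.

Lemma sdiff_comp {p q r} (F : 'rV[R]_p -> 'rV[R]_q) (G : 'rV[R]_q -> 'rV[R]_r) x0 J K :
  sdiff F x0 J -> sdiff G (F x0) K -> sdiff (fun x => G (F x)) x0 (J *m K).
Proof.
move=> hF hG e e0; have [d0 [L [d00 L0 hL]]] := sdiff_lip hF.
pose e1 := e / (2 * (L + 1)); pose e2 := e / (2 * (q%:R * `|K| + 1)).
have LK : 0 < 2 * (L + 1) by lra.
have qK : 0 <= q%:R * `|K| by rewrite mulr_ge0.
have qK' : 0 < 2 * (q%:R * `|K| + 1) by lra.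
have e10 : 0 < e1 by rewrite divr_gt0.
have e20 : 0 < e2 by rewrite divr_gt0.
have [d1 d10 h1] := hG _ e10; have [d2 d20 h2] := hF _ e20.
exists (Num.min (Num.min d0 (d1 / (L + 1))) d2).
  by rewrite !lt_min d00 d20 divr_gt0 //; lra.
have xx : `|x0 - x0| < d0 by rewrite subrr normr0.
have near x : `|x - x0| < d0 -> `|x - x0| < d1 / (L + 1) -> `|F x - F x0| < d1.
  move=> k1 k2; apply: le_lt_trans (hL _ _ k1 xx) _.
  rewrite ltr_pdivlMr in k2; last by lra.
  by apply: le_lt_trans k2; have := normr_ge0 (x - x0); move: (`|x - x0|) => u u0; lra.
move=> x y; rewrite !lt_min => /andP[/andP[x1 x2] x3] /andP[/andP[y1 y2] y3].
have k1 := h1 _ _ (near _ x1 x2) (near _ y1 y2); have k2 := h2 _ _ x3 y3.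
have k3 := hL _ _ x1 y1.
have -> : G (F x) - G (F y) - (x - y) *m (J *m K) =
   (G (F x) - G (F y) - (F x - F y) *m K) + (F x - F y - (x - y) *m J) *m K.
  by rewrite mulmxA [X in _ = _ + X]mulmxBl addrA subrK.
apply: le_trans (ler_normD _ _) _.
have pxy := normr_ge0 (x - y).
have a1 : e1 * `|F x - F y| <= e / 2 * `|x - y|.
  apply: le_trans (ler_wpM2l (ltW e10) k3) _; rewrite mulrA ler_wpM2r //.
  rewrite /e1 mulrAC ler_pdivrMr // (_ : e / 2 * _ = e * (L + 1)); last by field.
  by rewrite ler_wpM2l ?(ltW e0) //; lra.
have a2 : `|(F x - F y - (x - y) *m J) *m K| <= e / 2 * `|x - y|.
  apply: le_trans (norm_mulmx_le _ _) _; apply: le_trans (ler_wpM2l qK k2) _.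
  rewrite mulrA ler_wpM2r // /e2 mulrA ler_pdivrMr //.
  rewrite (_ : e / 2 * _ = e * (q%:R * `|K| + 1)); last by field.
  by rewrite mulrC ler_wpM2l ?(ltW e0) //; lra.
lra.
Qed.

Lemma sdiff_dat {p q} (F : 'rV[R]_p -> 'rV[R]_q) (f : R -> 'rV[R]_p) t v J :
  sdiff F (f t) J -> dat f t v -> dat (fun s => F (f s)) t (v *m J).
Proof.
move=> hF hf e e0; have [d0 d00 hL] := dat_lip hf.
have pv := normr_ge0 v; set L := `|v| + 1 in hL.
have L0 : 0 < L by rewrite /L; lra.
have pK : 0 <= p%:R * `|J| by rewrite mulr_ge0.
have pK' : 0 < 2 * (p%:R * `|J| + 1) by lra.
pose e1 := e / (2 * L); pose e2 := e / (2 * (p%:R * `|J| + 1)).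
have e10 : 0 < e1 by rewrite divr_gt0 // mulr_gt0.
have e20 : 0 < e2 by rewrite divr_gt0.
have [d1 d10 h1] := hF _ e10; have [d2 d20 h2] := hf _ e20.
exists (Num.min (Num.min d0 (d1 / L)) d2); first by rewrite !lt_min d00 d20 divr_gt0.
move=> u; rewrite !lt_min => /andP[/andP[u0 u1] u2].
have k3 := hL _ u0; have k2 := h2 _ u2.
have k1 : `|F (f u) - F (f t) - (f u - f t) *m J| <= e1 * `|f u - f t|.
  apply: h1; last by rewrite subrr normr0.
  by apply: le_lt_trans k3 _; rewrite mulrC -ltr_pdivlMr.
have -> : F (f u) - F (f t) - (u - t) *: (v *m J) =
  (F (f u) - F (f t) - (f u - f t) *m J) + (f u - f t - (u - t) *: v) *m J.
  by rewrite scalemxAl [X in _ = _ + X]mulmxBl addrA subrK.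
apply: le_trans (ler_normD _ _) _.
have put := normr_ge0 (u - t).
have a1 : e1 * `|f u - f t| <= e / 2 * `|u - t|.
  apply: le_trans (ler_wpM2l (ltW e10) k3) _; rewrite mulrA ler_wpM2r //.
  by rewrite /e1 le_eqVlt; apply/orP; left; apply/eqP; field; rewrite gt_eqF.
have a2 : `|(f u - f t - (u - t) *: v) *m J| <= e / 2 * `|u - t|.
  apply: le_trans (norm_mulmx_le _ _) _; apply: le_trans (ler_wpM2l pK k2) _.
  rewrite mulrA ler_wpM2r // /e2 mulrA ler_pdivrMr //.
  rewrite (_ : e / 2 * _ = e * (p%:R * `|J| + 1)); last by field.
  by rewrite mulrC ler_wpM2l ?(ltW e0) //; lra.
lra.
Qed.

Lemma dat_line {p} (x0 v : 'rV[R]_p) t : dat (fun s : R => x0 + s *: v) t v.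
Proof.
move=> e e0; exists 1 => // u _.
by rewrite opprD addrACA subrr add0r -scalerBl subrr normr0 mulr_ge0 // (ltW e0).
Qed.

Lemma sdiff_derive {p q} (F : 'rV[R]_p -> 'rV[R]_q) x0 J v : sdiff F x0 J ->
  derivable F x0 v /\ 'D_v F x0 = v *m J.
Proof.
move=> hF; have h0 : x0 + 0 *: v = x0 by rewrite scale0r addr0.
have : dat (fun s : R => F (x0 + s *: v)) 0 (v *m J).
  by apply: (sdiff_dat (f := fun s : R => x0 + s *: v)); rewrite ?h0 //; exact: dat_line.
move=> /dat_derive[d1 d2].
have E : (fun h : R => h^-1 *: (((fun s : R => F (x0 + s *: v)) \o shift 0) (h *: 1) - F (x0 + 0 *: v))) =
    (fun h => h^-1 *: ((F \o shift x0) (h *: v) - F x0)).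
  apply/funext => h; by rewrite h0 /= addr0 [x0 + _]addrC (_ : h%:A = h) // [LHS]mulr1.
by split; [move: d1|move: d2]; rewrite /derivable /derive E.
Qed.

Lemma sdiff_unique {p q} (F : 'rV[R]_p -> 'rV[R]_q) x0 J K :
  sdiff F x0 J -> sdiff F x0 K -> J = K.
Proof.
move=> hJ hK; apply/row_matrixP => i; rewrite !rowE.
by have [_ <-] := sdiff_derive (delta_mx 0 i) hJ; have [_ <-] := sdiff_derive (delta_mx 0 i) hK.
Qed.

Lemma derive_dat {p q} (F : 'rV[R]_p -> 'rV[R]_q) x0 v : derivable F x0 v ->
  dat (fun s : R => F (x0 + s *: v)) 0 ('D_v F x0).
Proof.
move=> h; apply/dat_derive.
have E : (fun h : R => h^-1 *: (((fun s : R => F (x0 + s *: v)) \o shift 0) (h *: 1) - F (x0 + 0 *: v))) =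
    (fun h => h^-1 *: ((F \o shift x0) (h *: v) - F x0)).
  apply/funext => h'; by rewrite scale0r addr0 /= addr0 [x0 + _]addrC (_ : h'%:A = h') // [LHS]mulr1.
by split; rewrite /derivable /derive E.
Qed.

Lemma derive_dat_at {p q} (F : 'rV[R]_p -> 'rV[R]_q) x0 v t : derivable F (x0 + t *: v) v ->
  dat (fun s : R => F (x0 + s *: v)) t ('D_v F (x0 + t *: v)).
Proof.
move=> /derive_dat h; have hd : dat (fun s : R => s - t) t 1.
  by have := datB (dat_id t) (dat_cst t t); rewrite subr0.
have h0 : dat (fun s : R => F (x0 + t *: v + s *: v)) (t - t) ('D_v F (x0 + t *: v)).
  by rewrite subrr.
have := dat_comp (g := fun s => s - t) h0 hd; rewrite scale1r; apply: dat_ext ltr01 _ => u _.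
by rewrite -addrA -scalerDl [t + _]addrC subrK.
Qed.

(** The infinitesimal estimate is propagated by [local_to_global]. *)
Lemma mvt_bound {p q} (f : R -> 'M[R]_(p, q)) a b C : a <= b -> 0 <= C ->
  (forall t, a <= t <= b -> exists2 v, dat f t v & `|v| <= C) -> `|f b - f a| <= C * (b - a).
Proof.
move=> ab C0 h; apply/ler_addgt0Pl => e e0.
pose e1 := e / (b - a + 1); have ba : 0 < b - a + 1 by lra.
have e10 : 0 < e1 by rewrite divr_gt0.
suff H : `|f b - f a| <= (C + e1) * (b - a).
  apply: le_trans H _; rewrite mulrDl addrC lerD2r /e1 mulrAC ler_pdivrMr //.
  by rewrite ler_wpM2l ?(ltW e0) //; lra.
apply: (@local_to_global _ (fun u v => `|f v - f u| <= (C + e1) * (v - u))) => //.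
  move=> u v w _ _ h1 h2.
  have -> : f w - f u = (f w - f v) + (f v - f u) by rewrite addrA subrK.
  by apply: le_trans (ler_normD _ _) _; lra.
move=> t /h[v dv vC]; have [d d0 hd] := dv _ e10.
exists d => // u w _ _ tu ut tw wt.
have E (x : R) : `|x - t| < d -> `|f x - f t| <= (C + e1) * `|x - t|.
  move=> /hd hx; rewrite -[f x - f t](subrK ((x - t) *: v)).
  apply: le_trans (ler_normD _ _) _; rewrite mulrDl addrC lerD // normrZ mulrC.
  by rewrite ler_wpM2r.
have h1 : `|f w - f t| <= (C + e1) * (w - t).
  have := E w; rewrite ger0_norm ?subr_ge0 //; apply; lra.
have h2 : `|f t - f u| <= (C + e1) * (t - u).
  have := E u; rewrite distrC (distrC (f u)) ger0_norm ?subr_ge0 //; apply; lra.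
have -> : f w - f u = (f w - f t) + (f t - f u) by rewrite addrA subrK.
by apply: le_trans (ler_normD _ _) _; lra.
Qed.

Lemma delta_sum p (v : 'rV[R]_p) : v = \sum_i v 0 i *: delta_mx 0 i.
Proof. by rewrite {1}(matrix_sum_delta v) big_ord1. Qed.

(** The increment is cut into increments along the coordinate directions,
    through the points [z k] whose first [k] coordinates are those of [x] and
    the others those of [y]. *)
Lemma sdiff_C1 {p q} (F : 'rV[R]_p -> 'rV[R]_q) (U : set 'rV[R]_p) x0 :
  nbhs x0 U -> Ck_on 1 U F -> sdiff F x0 (\matrix_i 'D_(delta_mx 0 i) F x0).
Proof.
move=> Ux0 [_ hF] e e0.
set J := \matrix_i _.
have rJ i : delta_mx 0 i *m J = 'D_(delta_mx 0 i) F x0 by rewrite -rowE rowK.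
pose e1 := e / (p%:R + 1); have p1 : 0 < p%:R + 1 :> R by rewrite ltr_wpDl.
have e10 : 0 < e1 by rewrite divr_gt0.
have Ux00 : U x0 by exact: nbhs_singleton.
have [d1 d10 hd1] : exists2 d, 0 < d & forall x, `|x - x0| < d -> U x.
  exact/nbhs_eps.
have cont i : exists2 d, 0 < d & forall x, `|x - x0| < d ->
    `|'D_(delta_mx 0 i) F x - 'D_(delta_mx 0 i) F x0| <= e1.
  have [_ [hc _]] := hF (delta_mx 0 i).
  exact: (continuous_eps _ _).1 (hc _ Ux00) _ e10.
have [d2 d20 hd2] : exists2 d, 0 < d & forall i x, `|x - x0| < d ->
    `|'D_(delta_mx 0 i) F x - 'D_(delta_mx 0 i) F x0| <= e1.
  have [d hd] := choice (fun i => let: ex_intro2 d a b := cont i in ex_intro _ d (conj a b)).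
  exists (\big[Num.min/1]_i d i).
    by elim/big_ind: _ => // [x y a b|i _]; [rewrite lt_min a|case: (hd i)].
  move=> i x xd; apply: (proj2 (hd i)); apply: lt_le_trans xd _.
  exact: (bigmin_le_cond _ d (j := i)).
exists (Num.min d1 d2) => [|x y]; first by rewrite lt_min d10.
rewrite !lt_min => /andP[x1 x2] /andP[y1 y2].
pose v := x - y.
pose z (k : nat) : 'rV[R]_p := \row_i (if (i < k)%N then x 0 i else y 0 i).
have z0E : z 0%N = y by apply/rowP => i; rewrite mxE.
have zpE : z p = x by apply/rowP => i; rewrite mxE ltn_ord.
have zS (k : 'I_p) s : z k + s *: delta_mx 0 k =
    \row_i (if (i < k)%N then x 0 i else if i == k then y 0 i + s else y 0 i).
  apply/rowP => i; rewrite !mxE eqxx /=; case: ltngtP => [ik|ik|/val_inj ->]; rewrite ?eqxx.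
  - by rewrite (_ : i == k = false) ?mulr0 ?addr0 //; apply/negbTE/eqP => E; rewrite E ltnn in ik.
  - by rewrite (_ : i == k = false) ?mulr0 ?addr0 //; apply/negbTE/eqP => E; rewrite E ltnn in ik.
  - by rewrite mulr1.
have zSv (k : 'I_p) : z k + v 0 k *: delta_mx 0 k = z k.+1.
  rewrite zS; apply/rowP => i; rewrite !mxE ltnS.
  case: ltngtP => [ik|ik|/val_inj ->] /=; rewrite ?eqxx //.
  - by rewrite (_ : i == k = false) //; apply/negbTE/eqP => E; rewrite E ltnn in ik.
  - by ring.
have zin (k : 'I_p) s : 0 <= s <= 1 -> `|z k + (s * v 0 k) *: delta_mx 0 k - x0| < Num.min d1 d2.
  move=> /andP[s0 s1]; rewrite zS.
  pose mm := Num.max `|x - x0| `|y - x0|.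
  apply: (@le_lt_trans _ _ mm); last by rewrite gt_max !lt_min x1 x2 y1 y2.
  have mx i : `|x 0 i - x0 0 i| <= mm.
    by rewrite le_max; apply/orP; left; have := norm_entry (x - x0) 0 i; rewrite !mxE.
  have my i : `|y 0 i - x0 0 i| <= mm.
    by rewrite le_max; apply/orP; right; have := norm_entry (y - x0) 0 i; rewrite !mxE.
  apply: norm_mx_le => [|a i]; first by rewrite le_max normr_ge0.
  rewrite ord1 !mxE; case: ifP => _ //; case: eqP => [ik|_] //; rewrite ik.
  have -> : y 0 k + s * (x 0 k - y 0 k) - x0 0 k = s * (x 0 k - x0 0 k) + (1 - s) * (y 0 k - x0 0 k).
    by ring.
  have s1' : 0 <= 1 - s by lra.
  apply: le_trans (ler_normD _ _) _; rewrite !normrM (ger0_norm s0) (ger0_norm s1').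
  have := ler_wpM2l s0 (mx k); have := ler_wpM2l s1' (my k); lra.
have step (k : 'I_p) : `|F (z k.+1) - F (z k) - v 0 k *: 'D_(delta_mx 0 k) F x0| <= e1 * `|v|.
  pose g (s : R) := F (z k + (s * v 0 k) *: delta_mx 0 k) - (s * v 0 k) *: 'D_(delta_mx 0 k) F x0.
  have -> : F (z k.+1) - F (z k) - v 0 k *: 'D_(delta_mx 0 k) F x0 = g 1 - g 0.
    by rewrite /g mul0r mul1r !scale0r addr0 subr0 zSv addrAC.
  rewrite -[leRHS]mulr1 -[X in _ * X]subr0.
  apply: mvt_bound => //; first by rewrite mulr_ge0 // ltW.
  move=> s s01; have := zin k s s01; rewrite lt_min => /andP[w1 w2].
  exists (v 0 k *: ('D_(delta_mx 0 k) F (z k + (s * v 0 k) *: delta_mx 0 k) - 'D_(delta_mx 0 k) F x0)).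
    have [hdk _] := hF (delta_mx 0 k).
    have hs : dat (fun s : R => s * v 0 k) s (v 0 k).
      by have := datM (dat_id s) (dat_cst (v 0 k) s); rewrite mul1r mulr0 addr0.
    rewrite scalerBr; apply: datB.
      have hF1 := derive_dat_at (hdk _ (hd1 _ w1)).
      exact: (dat_comp (f := fun s : R => F (z k + s *: delta_mx 0 k))
        (g := fun s => s * v 0 k) hF1 hs).
    have hz : dat (fun s : R => s *: 'D_(delta_mx 0 k) F x0) (s * v 0 k) ('D_(delta_mx 0 k) F x0).
      have := dat_line 0 ('D_(delta_mx 0 k) F x0) (s * v 0 k); apply: dat_ext ltr01 _ => ? _.
      by rewrite add0r.
    exact: (dat_comp (f := fun s : R => s *: 'D_(delta_mx 0 k) F x0)
      (g := fun s => s * v 0 k) hz hs).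
  rewrite normrZ mulrC; apply: ler_pM => //; [exact: hd2|exact: norm_entry].
have -> : F x - F y - (x - y) *m J =
    \sum_(k < p) (F (z k.+1) - F (z k) - v 0 k *: 'D_(delta_mx 0 k) F x0).
  rewrite sumrB; congr (_ - _).
    by rewrite -(big_mkord xpredT (fun k => F (z k.+1) - F (z k))) telescope_sumr // zpE z0E.
  rewrite {1}(delta_sum (x - y)) mulmx_suml; apply: eq_bigr => k _.
  by rewrite -scalemxAl rJ.
apply: le_trans (ler_norm_sum _ _ _) _.
apply: (@le_trans _ _ (\sum_(k < p) e1 * `|v|)); first by apply: ler_sum => k _; exact: step.
rewrite sumr_const card_ord -mulr_natl mulrA ler_wpM2r // /e1 mulrA ler_pdivrMr //.
by rewrite mulrC ler_wpM2l ?(ltW e0) // lerDl.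
Qed.

(** Both mixed derivatives are limits of the same second difference quotient. *)
Lemma schwarz {p q} (F : 'rV[R]_p -> 'rV[R]_q) (U : set 'rV[R]_p) x0 u v Ju Jv :
  nbhs x0 U -> (forall x, U x -> derivable F x u) -> (forall x, U x -> derivable F x v) ->
  sdiff ('D_u F) x0 Ju -> sdiff ('D_v F) x0 Jv -> v *m Ju = u *m Jv.
Proof.
wlog suff H : u v Ju Jv / nbhs x0 U -> (forall x, U x -> derivable F x v) ->
    sdiff ('D_v F) x0 Jv -> forall e, 0 < e -> exists2 d, 0 < d & forall h, 0 < h < d ->
    `|F (x0 + h *: u + h *: v) - F (x0 + h *: u) - F (x0 + h *: v) + F x0 - h ^+ 2 *: (u *m Jv)|
      <= e * h ^+ 2.
  move=> Ux0 du dv hu hv; apply/eqP; rewrite -subr_eq0 -normr_eq0; apply/eqP/le_anti.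
  rewrite normr_ge0 andbT; apply/ler_addgt0Pl => e e0; rewrite addr0.
  have e2 : 0 < e / 2 by rewrite divr_gt0.
  have [d1 d10 h1] := H u v Ju Jv Ux0 dv hv _ e2.
  have [d2 d20 h2] := H v u Jv Ju Ux0 du hu _ e2.
  pose h := Num.min d1 d2 / 2.
  have m0 : 0 < Num.min d1 d2 by rewrite lt_min d10.
  have hh : 0 < h by rewrite divr_gt0.
  have hm : h < Num.min d1 d2 by rewrite /h; lra.
  have {}h1 := h1 h; have {}h2 := h2 h; move: hm; rewrite lt_min hh /= in h1 h2 *.
  move=> /andP[/h1 {}h1 /h2 {}h2].
  have hsq : 0 < h ^+ 2 by rewrite exprn_gt0.
  rewrite -(ler_pM2l hsq) -[X in X * _](gtr0_norm hsq) -normrZ.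
  set a := F (x0 + _ + _) - _ - _ + _ in h1.
  have h2' : `|a - h ^+ 2 *: (v *m Ju)| <= e / 2 * h ^+ 2.
    apply: le_trans h2; rewrite /a [x0 + h *: v + h *: u]addrAC.
    by rewrite [_ - F (x0 + h *: v) - _]addrAC.
  have -> : h ^+ 2 *: (v *m Ju - u *m Jv) = (a - h ^+ 2 *: (u *m Jv)) - (a - h ^+ 2 *: (v *m Ju)).
    by rewrite scalerBr; apply/matrixP => i j; rewrite !mxE; ring.
  by apply: le_trans (ler_normB _ _) _; lra.
move=> Ux0 dv hv e e0.
pose c := `|u| + `|v| + 1; have c0 : 0 < c by rewrite ltr_wpDl // addr_ge0.
have ec : 0 < e / c by rewrite divr_gt0.
have [d1 d10 hd1] : exists2 d, 0 < d & forall x, `|x - x0| < d -> U x.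
  exact/nbhs_eps.
have [d2 d20 hd2] := hv _ ec.
exists (Num.min d1 d2 / c); first by rewrite divr_gt0 // lt_min d10.
move=> h /andP[h0]; rewrite ltr_pdivlMr // lt_min => /andP[hc1 hc2].
have in0 (s r : R) : 0 <= s <= h -> 0 <= r <= h -> `|x0 + r *: u + s *: v - x0| <= h * c.
  move=> /andP[s0 sh] /andP[r0 rh]; rewrite [x0 + _ + _]addrAC [x0 + _ + _]addrAC -addrA addrC addrK.
  apply: le_trans (ler_normD _ _) _; rewrite !normrZ !ger0_norm //.
  have pu := normr_ge0 u; have pv := normr_ge0 v.
  have := ler_wpM2r pu rh; have := ler_wpM2r pv sh; rewrite /c !mulrDr mulr1; lra.
pose g (s : R) := F (x0 + h *: u + s *: v) - F (x0 + s *: v) - s *: (h *: (u *m Jv)).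
have -> : F (x0 + h *: u + h *: v) - F (x0 + h *: u) - F (x0 + h *: v) + F x0 - h ^+ 2 *: (u *m Jv) = g h - g 0.
  rewrite /g !scale0r !addr0 subr0 scalerA -expr2.
  by apply/matrixP => i j; rewrite !mxE; ring.
have -> : e * h ^+ 2 = (e * h) * (h - 0) by rewrite subr0 expr2 mulrA.
apply: mvt_bound; [exact: ltW|by rewrite mulr_ge0 // ltW|move=> s hs].
have hh : 0 <= h <= h by rewrite lexx ltW.
have h00 : 0 <= (0 : R) <= h by rewrite lexx ltW.
have p1 := in0 s h hs hh; have p2 := in0 s 0 hs h00; rewrite scale0r addr0 in p2.
exists ('D_v F (x0 + h *: u + s *: v) - 'D_v F (x0 + s *: v) - h *: (u *m Jv)).
  apply: datB; first apply: datB.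
  - by apply: derive_dat_at; apply/dv/hd1; exact: le_lt_trans hc1.
  - by apply: derive_dat_at; apply/dv/hd1; exact: le_lt_trans hc1.
  - have := dat_line 0 (h *: (u *m Jv)) s; apply: dat_ext ltr01 _ => ? _.
    by rewrite add0r.
have := hd2 _ _ (le_lt_trans p1 hc2) (le_lt_trans p2 hc2).
have -> : x0 + h *: u + s *: v - (x0 + s *: v) = h *: u.
  by apply/matrixP => i j; rewrite !mxE; ring.
rewrite -scalemxAl => /le_trans; apply.
rewrite normrZ (gtr0_norm h0) mulrA -[e * h]mulrC -mulrA mulrCA ler_wpM2l ?(ltW h0) //.
rewrite mulrAC ler_pdivrMr // ler_wpM2l ?(ltW e0) //.
by rewrite /c; have := normr_ge0 v; lra.
Qed.

End strict_differentiability.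

(** * Calculus on a Lie group *)

Section lie_calculus.
Context {R : realType} {n : nat} (G : lie_group R n).
Local Notation phi := (chart1 G).
Local Notation psi := (chart_inv (chart1 G)).
Local Notation o := (chart1 G 1%g).
Implicit Types (p q : G) (c : chart R n G).

Definition jac {k l} (F : 'rV[R]_k -> 'rV[R]_l) (x : 'rV[R]_k) : 'M[R]_(k, l) :=
  \matrix_i 'D_(delta_mx 0 i) F x.

Lemma jac_sdiff {k l} (F : 'rV[R]_k -> 'rV[R]_l) x J : sdiff F x J -> jac F x = J.
Proof.
move=> h; apply/row_matrixP => i; rewrite rowK rowE.
by have [_ ->] := sdiff_derive (delta_mx 0 i) h.
Qed.

Lemma sdiff_jac {k l} (F : 'rV[R]_k -> 'rV[R]_l) x J : sdiff F x J -> sdiff F x (jac F x).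
Proof. by move=> h; rewrite (jac_sdiff h). Qed.

Lemma sdiff_near {k l} (F F' : 'rV[R]_k -> 'rV[R]_l) x J :
  (\forall y \near x, F y = F' y) -> sdiff F x J -> sdiff F' x J.
Proof. by move=> /nbhs_eps[d d0 hd]; exact: sdiff_ext d0 hd. Qed.

Lemma sdiff_eq {k l} (F F' : 'rV[R]_k -> 'rV[R]_l) x J :
  (forall y, F y = F' y) -> sdiff F x J -> sdiff F' x J.
Proof. by move=> FF'; apply: sdiff_ext ltr01 _ => y _. Qed.

Lemma contM {T : topologicalType} (f g : T -> G) (x : T) :
  {for x, continuous f} -> {for x, continuous g} ->
  {for x, continuous (fun y => f y * g y)%g}.
Proof.
move=> hf hg.
apply: (@continuous2_cvg T G G G (nbhs x) _ f g (fun p q : G => (p * q)%g) (f x) (g x)) => //.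
exact: (@mulg_continuous _ _ G (f x, g x)).
Qed.

Lemma cont_cst {T U : topologicalType} (p : U) (x : T) : {for x, continuous (fun _ : T => p)}.
Proof. exact: cvg_cst. Qed.

Lemma near_open {T U : topologicalType} (f : T -> U) (x : T) (D : set U) : open D -> D (f x) ->
  {for x, continuous f} -> \forall y \near x, D (f y).
Proof. by move=> oD Dx; apply; exact: open_nbhs_nbhs. Qed.

Lemma chart_imgP c p : chart_dom c p -> chart_img c (c p).
Proof. by move=> cp; exists p. Qed.

Lemma chart_inv_near c p : chart_dom c p -> \forall x \near c p, c (chart_inv c x) = x.
Proof.
move=> cp; have : nbhs (c p) (chart_img c).
  by apply: (near_open (f := id)) (chart_imgP cp) _ => //; exact: open_chart_img.
by apply: filterS => x [q cq <-]; rewrite chart_mapK.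
Qed.

Lemma chart_inv_for c p : chart_dom c p -> {for c p, continuous (chart_inv c)}.
Proof. by move=> cp; apply: chart_inv_continuous; exact: chart_imgP. Qed.

Lemma dom1 : chart_dom phi (1%g : G). Proof. exact: chart1_dom1. Qed.

Lemma psi_o : psi o = 1%g. Proof. by rewrite chart_mapK //; exact: dom1. Qed.

Lemma row_mx_aff {k k1 k2} (f : 'rV[R]_k -> 'rV[R]_k1) (g : 'rV[R]_k -> 'rV[R]_k2) x J K :
  sdiff f x J -> sdiff g x K -> sdiff (fun y => row_mx (f y) (g y)) x (row_mx J K).
Proof.
move=> hf hg e e0; have [d1 d10 h1] := hf _ e0; have [d2 d20 h2] := hg _ e0.
exists (Num.min d1 d2); first by rewrite lt_min d10.
move=> y z; rewrite !lt_min => /andP[y1 y2] /andP[z1 z2].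
rewrite mul_mx_row opp_row_mx add_row_mx opp_row_mx add_row_mx.
apply: norm_mx_le => [|i j]; first by rewrite mulr_ge0 // ltW.
rewrite mxE; case: (fintype.split j) => j'.
  by apply: le_trans (h1 _ _ y1 z1); exact: norm_entry.
by apply: le_trans (h2 _ _ y2 z2); exact: norm_entry.
Qed.

Lemma sdiff_cst {k l} (v : 'rV[R]_l) (x : 'rV[R]_k) : sdiff (fun=> v) x 0.
Proof. by apply: sdiff_affine => y z; rewrite mulmx0 subrr. Qed.

Lemma sdiff_id {k} (x : 'rV[R]_k) : sdiff (fun y => y) x 1%:M.
Proof. by apply: sdiff_affine => y z; rewrite mulmx1. Qed.

Lemma sdiff_lsub {k l} (x : 'rV[R]_(k + l)) : sdiff lsubmx x (col_mx 1%:M 0).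
Proof.
by apply: sdiff_affine => y z; rewrite -linearB -[X in _ = X *m _]hsubmxK mul_row_col mulmx1 mulmx0 addr0.
Qed.

Lemma sdiff_rsub {k l} (x : 'rV[R]_(k + l)) : sdiff rsubmx x (col_mx 0 1%:M).
Proof.
by apply: sdiff_affine => y z; rewrite -linearB -[X in _ = X *m _]hsubmxK mul_row_col mulmx1 mulmx0 add0r.
Qed.

Lemma sdiff_cont {k l} (F : 'rV[R]_k -> 'rV[R]_l) x J : sdiff F x J -> {for x, continuous F}.
Proof.
move=> /sdiff_lip[d [K [d0 K0 hK]]]; apply/continuous_eps => e e0.
exists (Num.min d (e / (K + 1))); first by rewrite lt_min d0 divr_gt0 //; lra.
move=> y; rewrite lt_min ltr_pdivlMr => [/andP[yd ye]|]; last by lra.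
apply: le_trans (hK _ _ yd _) _; first by rewrite subrr normr0.
by have := normr_ge0 (y - x); lra.
Qed.

(** Spelled as in the smoothness axiom of [lie_group], which then applies as it is. *)
Definition mul_dom (a b c : chart R n G) : set 'rV[R]_(n + n) :=
  [set z | [/\ chart_img a (lsubmx z), chart_img b (rsubmx z) &
     chart_dom c (chart_inv a (lsubmx z) * chart_inv b (rsubmx z))%g]].

Definition mul_chart (a b c : chart R n G) (z : 'rV[R]_(n + n)) :=
  c (chart_inv a (lsubmx z) * chart_inv b (rsubmx z))%g.

Lemma mul_dom_near (a b c : chart R n G) p q : chart_dom a p -> chart_dom b q -> chart_dom c (p * q)%g ->
  nbhs (row_mx (a p) (b q)) (mul_dom a b c).
Proof.
move=> ap bq cpq; set z := row_mx _ _.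
have zl : lsubmx z = a p by rewrite row_mxKl.
have zr : rsubmx z = b q by rewrite row_mxKr.
have cl := sdiff_cont (sdiff_lsub z); have cr := sdiff_cont (sdiff_rsub z).
have al : \forall y \near z, chart_img a (lsubmx y).
  apply: near_open cl; [exact: open_chart_img|rewrite zl; exact: chart_imgP].
have br : \forall y \near z, chart_img b (rsubmx y).
  apply: near_open cr; [exact: open_chart_img|rewrite zr; exact: chart_imgP].
have cc : \forall y \near z, chart_dom c (chart_inv a (lsubmx y) * chart_inv b (rsubmx y))%g.
  apply: (near_open (f := fun y => chart_inv a (lsubmx y) * chart_inv b (rsubmx y))%g).
  - exact: open_chart_dom.
  - by rewrite zl zr !chart_mapK.
  - apply: contM.
      apply: (continuous_comp (f := lsubmx)) => //; rewrite zl; exact: chart_inv_for.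
    apply: (continuous_comp (f := rsubmx)) => //; rewrite zr; exact: chart_inv_for.
by apply: filterS3 al br cc => y; split.
Qed.

Lemma mul_chart_sdiff (a b c : chart R n G) p q : atlas a -> atlas b -> atlas c ->
  chart_dom a p -> chart_dom b q -> chart_dom c (p * q)%g ->
  sdiff (mul_chart a b c) (row_mx (a p) (b q)) (jac (mul_chart a b c) (row_mx (a p) (b q))).
Proof.
move=> ha hb hc ap bq cpq; apply: sdiff_C1 (mul_dom_near ap bq cpq) _.
exact: (mulg_smooth ha hb hc 1).
Qed.

Lemma left_sdiff (b c : chart R n G) p q : atlas b -> atlas c -> chart_dom b q -> chart_dom c (p * q)%g ->
  exists J, sdiff (fun x => c (p * chart_inv b x)%g) (b q) J.
Proof.
move=> hb hc bq cpq; have [a ha ap] := atlas_cover p; eexists.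
have := sdiff_comp (G := mul_chart a b c)
  (row_mx_aff (sdiff_cst (a p) (b q)) (sdiff_id (b q))) (mul_chart_sdiff ha hb hc ap bq cpq).
apply: sdiff_eq => x.
by rewrite /mul_chart row_mxKl row_mxKr chart_mapK.
Qed.

Lemma right_sdiff (a c : chart R n G) p q : atlas a -> atlas c -> chart_dom a p -> chart_dom c (p * q)%g ->
  exists J, sdiff (fun x => c (chart_inv a x * q)%g) (a p) J.
Proof.
move=> ha hc ap cpq; have [b hb bq] := atlas_cover q; eexists.
have := sdiff_comp (G := mul_chart a b c)
  (row_mx_aff (sdiff_id (a p)) (sdiff_cst (b q) (a p))) (mul_chart_sdiff ha hb hc ap bq cpq).
apply: sdiff_eq => x.
by rewrite /mul_chart row_mxKl row_mxKr chart_mapK.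
Qed.

Let hphi : atlas phi := @atlas_chart1 _ _ G.

(** The differential at the identity of the left translation by [p];
    derivatives act on row vectors on the right. *)
Definition JL c p := jac (fun x => c (p * psi x)%g) o.

Lemma JL_sdiff c p : atlas c -> chart_dom c p -> sdiff (fun x => c (p * psi x)%g) o (JL c p).
Proof.
move=> hc cp; have [|J hJ] := @left_sdiff phi c p 1%g hphi hc dom1; first by rewrite mulg1.
exact: sdiff_jac hJ.
Qed.

Lemma lvfE v c p : atlas c -> chart_dom c p -> lvf v c p = v *m JL c p.
Proof. by move=> hc cp; have [_] := sdiff_derive v (JL_sdiff hc cp). Qed.

(** The differential of the inverse translation, back to the identity. *)
Definition JLV c p := jac (fun x => phi (p^-1 * chart_inv c x)%g) (c p).

Lemma JLV_sdiff c p : atlas c -> chart_dom c p ->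
  sdiff (fun x => phi (p^-1 * chart_inv c x)%g) (c p) (JLV c p).
Proof.
move=> hc cp; have [|J hJ] := @left_sdiff c phi p^-1%g p hc hphi cp.
  by rewrite mulVg; exact: dom1.
exact: sdiff_jac hJ.
Qed.

Lemma cont_Mpsi p : {for o, continuous (fun x => p * psi x)%g}.
Proof. by apply: contM; [exact: cont_cst|apply: chart_inv_for; exact: dom1]. Qed.

Lemma left_near c p : chart_dom c p -> \forall x \near o, chart_dom c (p * psi x)%g.
Proof.
move=> cp; apply: (@near_open _ _ (fun x => p * psi x)%g o _ (open_chart_dom c)).
  by rewrite psi_o mulg1.
exact: cont_Mpsi.
Qed.

Lemma JLK c p : atlas c -> chart_dom c p -> JL c p *m JLV c p = 1%:M.
Proof.
move=> hc cp; have E : c (p * psi o)%g = c p by rewrite psi_o mulg1.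
have hV := JLV_sdiff hc cp; rewrite -E in hV.
have := sdiff_comp (JL_sdiff hc cp) hV => h.
apply: sdiff_unique h (sdiff_near _ (sdiff_id o)).
apply: filterS2 (left_near cp) (chart_inv_near dom1) => x cx hx.
by rewrite chart_mapK // mulKg hx.
Qed.

(** The adjoint action of [q]. As it acts on rows, products are reversed. The
    definition is sealed to keep conversion from unfolding derivatives. *)
Definition A := locked (fun q => jac (fun x => phi (q * psi x * q^-1)%g) o).

Lemma conj_cont q : {for o, continuous (fun x => q * psi x * q^-1)%g}.
Proof. by apply: contM; [exact: cont_Mpsi|exact: cont_cst]. Qed.

Lemma A_sdiff q : sdiff (fun x => phi (q * psi x * q^-1)%g) o (A q).
Proof.
rewrite /A -lock; have [c hc cq] := atlas_cover q.
have [|K hK] := @right_sdiff c phi q q^-1%g hc hphi cq; first by rewrite mulgV; exact: dom1.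
have hK' : sdiff (fun x => phi (chart_inv c x * q^-1)%g) (c (q * psi o)%g) K.
  by rewrite psi_o mulg1.
apply: sdiff_jac; apply: sdiff_near (sdiff_comp (JL_sdiff hc cq) hK').
by apply: filterS (left_near cq) => x cx; rewrite chart_mapK.
Qed.

Lemma conj_near q : \forall x \near o, chart_dom phi (q * psi x * q^-1)%g.
Proof.
apply: (@near_open _ _ (fun x => q * psi x * q^-1)%g o _ (open_chart_dom phi)).
  by rewrite psi_o mulg1 mulgV; exact: dom1.
exact: conj_cont.
Qed.

Lemma conj_o q : phi (q * psi o * q^-1)%g = o.
Proof. by rewrite psi_o mulg1 mulgV. Qed.

Lemma AM p q : A (p * q)%g = A q *m A p.
Proof.
have hp := A_sdiff p; rewrite -(conj_o q) in hp.
apply: sdiff_unique (A_sdiff _) (sdiff_near _ (sdiff_comp (A_sdiff q) hp)).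
by apply: filterS (conj_near q) => x dx; rewrite chart_mapK // invgM !mulgA.
Qed.

Lemma A1 : A 1%g = 1%:M.
Proof.
apply: sdiff_unique (A_sdiff _) (sdiff_near _ (sdiff_id o)).
by apply: filterS (chart_inv_near dom1) => x hx; rewrite mul1g invg1 mulg1 hx.
Qed.

Lemma AK q : A q *m A q^-1%g = 1%:M.
Proof. by rewrite -AM mulVg A1. Qed.

(** The map expressing the increment of a product in terms of those of the factors:
    [(x y)^-1 (x' y') = (y^-1 (x^-1 x') y) (y^-1 y')]. *)
Definition incr q (z : 'rV[R]_(n + n)) : G := (q^-1 * psi (lsubmx z) * q * psi (rsubmx z))%g.

Local Notation oo := (row_mx o o : 'rV[R]_(n + n)).

Lemma incr_oo q : incr q oo = 1%g.
Proof. by rewrite /incr row_mxKl row_mxKr psi_o !mulg1 mulVg. Qed.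

Lemma incr_near q : \forall z \near oo, chart_dom phi (incr q z).
Proof.
apply: near_open; [exact: open_chart_dom|rewrite incr_oo; exact: dom1|].
have zl : lsubmx oo = o by rewrite row_mxKl.
have zr : rsubmx oo = o by rewrite row_mxKr.
have cl := sdiff_cont (sdiff_lsub oo); have cr := sdiff_cont (sdiff_rsub oo).
apply: contM; first apply: contM; first apply: contM.
- exact: cont_cst.
- by apply: (continuous_comp (f := lsubmx)) => //; rewrite zl; exact: chart_inv_for dom1.
- exact: cont_cst.
- by apply: (continuous_comp (f := rsubmx)) => //; rewrite zr; exact: chart_inv_for dom1.
Qed.

Lemma dom11 : chart_dom phi (1 * 1 : G)%g. Proof. by rewrite mulg1; exact: dom1. Qed.

Lemma mul_jac : jac (mul_chart phi phi phi) oo = col_mx 1%:M 1%:M.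
Proof.
have := mul_chart_sdiff hphi hphi hphi dom1 dom1 dom11.
set J := jac _ _ => hJ; rewrite -[J]vsubmxK; congr col_mx.
  have h := sdiff_comp (G := mul_chart phi phi phi) (row_mx_aff (sdiff_id o) (sdiff_cst o o)) hJ.
  rewrite -{1}[J]vsubmxK mul_row_col mul1mx mul0mx addr0 in h.
  apply: sdiff_unique h (sdiff_near _ (sdiff_id o)).
  apply: filterS (chart_inv_near dom1) => x hx.
  by rewrite /mul_chart row_mxKl row_mxKr psi_o mulg1.
have h := sdiff_comp (G := mul_chart phi phi phi) (row_mx_aff (sdiff_cst o o) (sdiff_id o)) hJ.
rewrite -{1}[J]vsubmxK mul_row_col mul1mx mul0mx add0r in h.
apply: sdiff_unique h (sdiff_near _ (sdiff_id o)).
apply: filterS (chart_inv_near dom1) => x hx.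
by rewrite /mul_chart row_mxKl row_mxKr psi_o mul1g.
Qed.

Lemma mul_sdiff : sdiff (mul_chart phi phi phi) oo (col_mx 1%:M 1%:M).
Proof. by rewrite -mul_jac; apply: mul_chart_sdiff hphi hphi hphi dom1 dom1 dom11. Qed.

Lemma incr_sdiff q : sdiff (fun z => phi (incr q z)) oo (col_mx (A q^-1%g) 1%:M).
Proof.
have hl := sdiff_lsub oo; have hr := sdiff_rsub oo.
have zl : lsubmx oo = o by rewrite row_mxKl.
have zr : rsubmx oo = o by rewrite row_mxKr.
have hA := A_sdiff q^-1%g; rewrite -zl invgK in hA.
have hM := mul_sdiff.
have E : row_mx (phi (q^-1 * psi (lsubmx oo) * q)%g) (rsubmx oo) = oo.
  by rewrite zl zr psi_o mulg1 mulVg.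
rewrite -{1}E in hM.
have := sdiff_comp (row_mx_aff (sdiff_comp hl hA) hr) hM.
rewrite mul_row_col !mulmx1 mul_col_mx mul1mx mul0mx add_col_mx addr0 add0r.
apply: sdiff_near.
have : \forall z \near oo, chart_dom phi (q^-1 * psi (lsubmx z) * q)%g.
  apply: (near_open (f := fun z => q^-1 * psi (lsubmx z) * q)%g); first exact: open_chart_dom.
    by rewrite zl psi_o mulg1 mulVg; exact: dom1.
  apply: contM; last exact: cont_cst.
  apply: contM; first exact: cont_cst.
  apply: (continuous_comp (f := lsubmx)); [exact: sdiff_cont (sdiff_lsub oo)|].
  by rewrite zl; exact: chart_inv_for dom1.
by apply: filterS => z hz; rewrite /mul_chart row_mxKl row_mxKr chart_mapK.
Qed.

(** The logarithmic derivative of a curve, in the Lie algebra: the derivative of the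
    increment [(gam t)^-1 * gam u] read in the chart at the identity. Continuity is
    required because the chart means nothing outside its domain. *)
Definition lgd (gam : R -> G) (t : R) (v : 'rV[R]_n) :=
  {for t, continuous gam} /\ dat (fun u => phi ((gam t)^-1 * gam u)%g) t v.

Lemma near_dom (gam : R -> G) t (D : set G) : open D -> {for t, continuous gam} -> D (gam t) ->
  exists2 d, 0 < d & forall u, `|u - t| < d -> D (gam u).
Proof. by move=> oD hg Dt; apply/(nbhs_eps (V := R)); exact: near_open oD Dt hg. Qed.

Lemma incr_cont (gam : R -> G) t : {for t, continuous gam} ->
  {for t, continuous (fun u => (gam t)^-1 * gam u)%g}.
Proof. by apply: contM; exact: cont_cst. Qed.

Lemma near_incr (gam : R -> G) t : {for t, continuous gam} ->
  exists2 d, 0 < d & forall u, `|u - t| < d -> chart_dom phi ((gam t)^-1 * gam u)%g.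
Proof.
move=> /incr_cont hg; apply: (near_dom (gam := fun u => (gam t)^-1 * gam u)%g) hg _.
  exact: open_chart_dom.
by rewrite mulVg; exact: dom1.
Qed.

Lemma dat_row_mx k l (f : R -> 'rV[R]_k) (g : R -> 'rV[R]_l) t v w :
  dat f t v -> dat g t w -> dat (fun u => row_mx (f u) (g u)) t (row_mx v w).
Proof.
move=> /dat_mxP hf /dat_mxP hg; apply/dat_mxP => i j.
rewrite mxE; case E: (fintype.split j) => [j'|j'].
  by apply: dat_ext ltr01 _ (hf i j') => u _; rewrite mxE E.
by apply: dat_ext ltr01 _ (hg i j') => u _; rewrite mxE E.
Qed.

(** The product rule. The increment of the product is [incr] of the two
    increments. *)
Lemma lgdM x y t u v : lgd x t u -> lgd y t v ->
  lgd (fun s => x s * y s)%g t (u *m A (y t)^-1%g + v).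
Proof.
move=> [cx dx] [cy dy]; split; first exact: contM.
have [d1 d10 h1] := near_incr cx; have [d2 d20 h2] := near_incr cy.
have hE : row_mx (phi ((x t)^-1 * x t)%g) (phi ((y t)^-1 * y t)%g) = oo by rewrite !mulVg.
have hF := incr_sdiff (y t); rewrite -hE in hF.
have := sdiff_dat (f := fun s => row_mx (phi ((x t)^-1 * x s)%g) (phi ((y t)^-1 * y s)%g))
  hF (dat_row_mx dx dy).
rewrite mul_row_col mulmx1; apply: (@dat_ext _ _ _ _ _ _ (Num.min d1 d2)).
  by rewrite lt_min d10.
move=> s; rewrite lt_min => /andP[/h1 s1 /h2 s2].
by rewrite /incr row_mxKl row_mxKr !chart_mapK // invgM !mulgA mulgK.
Qed.

Lemma lgd_cst q t : lgd (fun=> q) t 0.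
Proof. by split; [exact: cont_cst|exact: dat_cst]. Qed.

Lemma lgd_left q x t v : lgd x t v -> lgd (fun s => q * x s)%g t v.
Proof. by move=> h; have := lgdM (lgd_cst q t) h; rewrite mul0mx add0r. Qed.

Lemma lgd_right q x t v : lgd x t v -> lgd (fun s => x s * q)%g t (v *m A q^-1%g).
Proof. by move=> h; have := lgdM h (lgd_cst q t); rewrite addr0. Qed.

Lemma lgd_eq x t v w : lgd x t v -> v = w -> lgd x t w. Proof. by move=> h <-. Qed.

Lemma lgd_ext x y t v d : 0 < d -> (forall u, `|u - t| < d -> x u = y u) -> lgd x t v -> lgd y t v.
Proof.
move=> d0 xy [cx dx]; have xyt : x t = y t by apply: xy; rewrite subrr normr0.
split; last by apply: dat_ext d0 _ dx => u ud; rewrite xyt xy.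
have h : \forall u \near t, x u = y u by apply/(nbhs_eps (V := R)); exists d.
have {}cx : x @ t --> y t by rewrite -xyt.
apply: cvg_trans cx.
by apply: near_eq_cvg.
Qed.

Lemma lgd_comp x (f : R -> R) t v w : lgd x (f t) v -> dat f t w -> lgd (fun u => x (f u)) t (w *: v).
Proof.
move=> [cx dx] df; split; last exact: (dat_comp (f := fun u => phi ((x (f t))^-1 * x u)%g)) dx df.
exact: continuous_comp (dat_continuous df) cx.
Qed.

Lemma lgd_chart c x t v : atlas c -> chart_dom c (x t) -> lgd x t v ->
  dat (fun u => c (x u)) t (v *m JL c (x t)).
Proof.
move=> hc cx [kx dx]; have [d d0 hd] := near_incr kx.
have hJ := JL_sdiff hc cx; rewrite -{1}(mulVg (x t)) in hJ.
apply: (dat_ext d0 _ (sdiff_dat (f := fun u => phi ((x t)^-1 * x u)%g) hJ dx)) => u ud.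
by rewrite chart_mapK ?mulVKg //; exact: hd.
Qed.

Lemma chart_lgd c x t v : atlas c -> chart_dom c (x t) -> {for t, continuous x} ->
  dat (fun u => c (x u)) t (v *m JL c (x t)) -> lgd x t v.
Proof.
move=> hc cx kx dx; split=> //.
have [d d0 hd] := near_dom (open_chart_dom c) kx cx.
have := sdiff_dat (f := fun u => c (x u)) (JLV_sdiff hc cx) dx.
rewrite -mulmxA JLK // mulmx1; apply: dat_ext d0 _ => u ud.
by rewrite chart_mapK //; exact: hd.
Qed.

Lemma lgd_psi v : lgd (fun s => psi (o + s *: v)) 0 v.
Proof.
have h0 : o + 0 *: v = o by rewrite scale0r addr0.
have dl := dat_line o v 0.
have cpsi : {for 0, continuous (fun s : R => psi (o + s *: v))}.
  apply: (continuous_comp (f := fun s : R => o + s *: v)); first exact: dat_continuous dl.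
  by rewrite h0; exact: chart_inv_for dom1.
split=> //; rewrite h0 psi_o.
have [d d0 hd] : exists2 d, 0 < d & forall y, `|y - o| < d -> phi (psi y) = y.
  by apply/nbhs_eps; exact: chart_inv_near dom1.
have [d' d'0 hd'] := dat_lip dl.
have v1 : 0 < `|v| + 1 by rewrite ltr_wpDl.
apply: (@dat_ext _ _ _ _ _ _ (Num.min d' (d / (`|v| + 1))) _ _ dl).
  by rewrite lt_min d'0 divr_gt0.
move=> u; rewrite lt_min ltr_pdivlMr // => /andP[u1 u2].
rewrite invg1 mul1g hd //; apply: le_lt_trans u2; rewrite mulrC; have := hd' _ u1.
by rewrite h0.
Qed.

(** Local Lipschitz continuity in the chart at the identity moved along the
    curve by left translations; in this form it passes to products. *)
Definition gLip (x : R -> G) (a b : R) := forall t0, a <= t0 <= b -> exists d K, 0 < d /\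
  forall t u, a <= t <= b -> a <= u <= b -> `|t - t0| < d -> `|u - t0| < d ->
    chart_dom phi ((x t0)^-1 * x t)%g /\
    `|phi ((x t0)^-1 * x t)%g - phi ((x t0)^-1 * x u)%g| <= K * `|t - u|.

(** The increments can moreover be kept in any neighbourhood of the identity. *)
Lemma gLip_incr x a b t0 : gLip x a b -> a <= t0 <= b ->
  forall d1, 0 < d1 -> exists d K, [/\ 0 < d, 0 <= K &
  forall t u, a <= t <= b -> a <= u <= b -> `|t - t0| < d -> `|u - t0| < d ->
    [/\ chart_dom phi ((x t0)^-1 * x t)%g, `|phi ((x t0)^-1 * x t)%g - o| < d1 &
    `|phi ((x t0)^-1 * x t)%g - phi ((x t0)^-1 * x u)%g| <= K * `|t - u|]].
Proof.
move=> hx ht0 d1 d10; have [d [K [d0 hd]]] := hx _ ht0.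
pose K' := Num.max K 0; have K'0 : 0 <= K' by rewrite le_max lexx orbT.
have K1 : 0 < K' + 1 by lra.
exists (Num.min d (d1 / (K' + 1))), K'; split; rewrite ?lt_min ?d0 ?divr_gt0 //.
move=> t u ht hu; rewrite !lt_min !ltr_pdivlMr // => /andP[t1 t2] /andP[u1 u2].
have KK' (z : R) : K * `|z| <= K' * `|z| by rewrite ler_wpM2r // le_max lexx.
have t00 : `|t0 - t0| < d by rewrite subrr normr0.
have [k1 k2] := hd _ _ ht hu t1 u1; have [_ k3] := hd _ _ ht ht0 t1 t00.
split=> //; last exact: le_trans (KK' _).
rewrite mulVg in k3; apply: le_lt_trans (le_trans k3 (KK' _)) _; apply: le_lt_trans t2.
by rewrite mulrC ler_wpM2l //; lra.
Qed.

Lemma gLip_cont x a b t : gLip x a b -> a < t < b -> {for t, continuous x}.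
Proof.
move=> hx /andP[ta tb]; have ht : a <= t <= b by rewrite !ltW.
have [d [K [d0 K0 hd]]] := gLip_incr hx ht ltr01.
have E : \forall u \near t, chart_dom phi ((x t)^-1 * x u)%g /\
    `|phi ((x t)^-1 * x u)%g - o| <= K * `|u - t|.
  apply/(nbhs_eps (V := R)); exists (Num.min d (Num.min (t - a) (b - t))).
    by rewrite !lt_min d0 !subr_gt0 ta.
  move=> u; rewrite !lt_min => /andP[u1 /andP[u2 u3]].
  have hu : a <= u <= b by move: u2 u3; rewrite !ltr_norml; lra.
  have t0 : `|t - t| < d by rewrite subrr normr0.
  by have [h1 _ h3] := hd _ _ hu ht u1 t0; rewrite mulVg in h3.
have cphi : {for t, continuous (fun u => phi ((x t)^-1 * x u)%g)}.
  apply/(continuous_eps (V := R)) => e e0; rewrite mulVg; apply/(nbhs_eps (V := R)).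
  have E2 : \forall u \near t, `|u - t| < e / (K + 1).
    by apply/(nbhs_eps (V := R)); exists (e / (K + 1)) => //; rewrite divr_gt0 //; lra.
  apply: filterS2 E E2 => u [_ h1]; rewrite ltr_pdivlMr => [h2|]; last by lra.
  by apply: le_trans h1 _; have := normr_ge0 (u - t); lra.
have h : {for t, continuous (fun u => x t * psi (phi ((x t)^-1 * x u)))%g}.
  apply: contM; first exact: cont_cst.
  apply: (continuous_comp cphi); rewrite mulVg; exact: chart_inv_for dom1.
have K1 : (x t * psi (phi ((x t)^-1 * x t)))%g = x t by rewrite mulVg psi_o mulg1.
have {}h : (fun u => x t * psi (phi ((x t)^-1 * x u)))%g @ t --> x t.
  exact: (eq_ind _ (fun z => _ @ t --> z) h _ K1).
apply: cvg_trans h; apply: near_eq_cvg.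
by apply: filterS E => u [hu _] /=; rewrite chart_mapK // mulVKg.
Qed.

End lie_calculus.

(** * Derivatives of the adjoint action and the Jacobi identity *)

Section adjoint.
Context {R : realType} {n : nat} (G : lie_group R n).
Local Notation phi := (chart1 G).
Local Notation psi := (chart_inv (chart1 G)).
Local Notation o := (chart1 G 1%g).
Local Notation M := (mul_chart phi phi phi).
Local Notation oo := (row_mx o o : 'rV[R]_(n + n)).
Implicit Types (p q : G) (u v w : 'rV[R]_n).

Let mul_dom_oo : nbhs oo (mul_dom phi phi phi) := mul_dom_near (dom1 G) (dom1 G) (dom11 G).

Let mul_smooth (k : nat) : Ck_on k (mul_dom phi phi phi) M.
Proof. exact: mulg_smooth (atlas_chart1 G) (atlas_chart1 G) (atlas_chart1 G) k. Qed.

Lemma mul_sdiff_near : \forall z \near oo, sdiff M z (jac M z).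
Proof.
have : \forall z \near oo, nbhs z (mul_dom phi phi phi).
  exact: (near_join mul_dom_oo).
by apply: filterS => z hz; exact: sdiff_C1 hz (mul_smooth 1).
Qed.

(** The second derivative of the multiplication at the identity. *)
Definition hess z := jac ('D_z M) oo.

Lemma hess_sdiff z : sdiff ('D_z M) oo (hess z).
Proof.
apply: sdiff_C1 mul_dom_oo _; have [_ h] := mul_smooth 2.
by have [_] := h z.
Qed.

Lemma mul_derivable z : \forall y \near oo, derivable M y z.
Proof. by apply: filterS mul_sdiff_near => y /(sdiff_derive z)[]. Qed.

Lemma hessC z z' : z *m hess z' = z' *m hess z.
Proof.
have [d d0 hd] := (nbhs_eps _ _).1 (filterI (mul_derivable z) (mul_derivable z')).
have hU : nbhs oo [set y | `|y - oo| < d].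
  by apply/nbhs_eps; exists d.
apply: (schwarz hU _ _ (hess_sdiff z') (hess_sdiff z)).
- by move=> x /hd[].
- by move=> x /hd[].
Qed.

Lemma sdiffD {k l} (f g : 'rV[R]_k -> 'rV[R]_l) x J K :
  sdiff f x J -> sdiff g x K -> sdiff (fun y => f y + g y) x (J + K).
Proof.
move=> hf hg.
have ha : sdiff (fun z => lsubmx z + rsubmx z) (row_mx (f x) (g x)) (col_mx 1%:M 1%:M).
  apply: sdiff_affine => y z; rewrite -[y - z]hsubmxK mul_row_col !mulmx1 !linearB.
  by rewrite opprD addrACA.
have := sdiff_comp (row_mx_aff hf hg) ha; rewrite mul_row_col !mulmx1.
by apply: sdiff_eq => y; rewrite row_mxKl row_mxKr.
Qed.

Lemma sdiffZ {k l} (f : 'rV[R]_k -> 'rV[R]_l) x J (c : R) :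
  sdiff f x J -> sdiff (fun y => c *: f y) x (c *: J).
Proof.
move=> hf.
have ha : sdiff (fun z => c *: z) (f x) (c%:M : 'M[R]_l).
  by apply: sdiff_affine => y z; rewrite mul_mx_scalar scalerBr.
by have := sdiff_comp hf ha; rewrite mul_mx_scalar.
Qed.

Lemma sdiff_sum {m k l} (f : 'I_m -> 'rV[R]_k -> 'rV[R]_l) x J :
  (forall i, sdiff (f i) x (J i)) -> sdiff (fun y => \sum_i f i y) x (\sum_i J i).
Proof.
move=> h; rewrite (_ : (fun y => _) = \sum_i f i); last by rewrite fct_sumE.
elim/big_ind2: _ => [|f1 J1 f2 J2|i _]; [exact: sdiff_cst|exact: sdiffD|exact: h].
Qed.

Lemma hess_lin z : hess z = \sum_i z 0 i *: hess (delta_mx 0 i).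
Proof.
have h := sdiff_sum (fun i => sdiffZ (z 0 i) (hess_sdiff (delta_mx 0 i))).
apply: jac_sdiff; apply: sdiff_near h; apply: filterS mul_sdiff_near => y hy.
have [_ ->] := sdiff_derive z hy; rewrite [in RHS](delta_sum z) mulmx_suml.
apply: eq_bigr => i _; rewrite -scalemxAl; congr (_ *: _).
by have [_ ->] := sdiff_derive (delta_mx 0 i) hy.
Qed.

Lemma hessD z z' : hess (z + z') = hess z + hess z'.
Proof.
rewrite !(hess_lin (_ + _)) (hess_lin z) (hess_lin z') -big_split /=.
by apply: eq_bigr => i _; rewrite mxE scalerDl.
Qed.

Lemma hessZ (c : R) z : hess (c *: z) = c *: hess z.
Proof.
rewrite (hess_lin (c *: z)) (hess_lin z) scaler_sumr.
by apply: eq_bigr => i _; rewrite mxE scalerA.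
Qed.

Lemma near_left (P : 'rV[R]_(n + n) -> Prop) :
  (\forall z \near oo, P z) -> \forall x \near o, P (row_mx x o).
Proof.
move=> hP; have := sdiff_cont (row_mx_aff (sdiff_id o) (sdiff_cst o o)).
exact.
Qed.

Lemma near_right (P : 'rV[R]_(n + n) -> Prop) :
  (\forall z \near oo, P z) -> \forall x \near o, P (row_mx o x).
Proof.
move=> hP; have := sdiff_cont (row_mx_aff (sdiff_cst o o) (sdiff_id o)).
exact.
Qed.

(** The partial derivatives of the multiplication: the differentials at the
    identity of a left and of a right translation. *)
Definition dleft x := row_mx 0 1%:M *m jac M (row_mx x o).
Definition dright x := row_mx 1%:M 0 *m jac M (row_mx o x).

Lemma dleft_sdiff : \forall x \near o, sdiff (fun y => phi (psi x * psi y)%g) o (dleft x).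
Proof.
apply: filterS (near_left mul_sdiff_near) => x hx.
have := sdiff_comp (row_mx_aff (sdiff_cst x o) (sdiff_id o)) hx.
by apply: sdiff_eq => y; rewrite /mul_chart row_mxKl row_mxKr.
Qed.

Lemma dright_sdiff : \forall x \near o, sdiff (fun y => phi (psi y * psi x)%g) o (dright x).
Proof.
apply: filterS (near_right mul_sdiff_near) => x hx.
have := sdiff_comp (row_mx_aff (sdiff_id o) (sdiff_cst x o)) hx.
by apply: sdiff_eq => y; rewrite /mul_chart row_mxKl row_mxKr.
Qed.

Lemma dleft_D u : \forall x \near o, u *m dleft x = 'D_(row_mx 0 u) M (row_mx x o).
Proof.
apply: filterS (near_left mul_sdiff_near) => x hx.
have [_ ->] := sdiff_derive (row_mx 0 u) hx.
by rewrite /dleft mulmxA mul_mx_row mulmx1 mulmx0.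
Qed.

Lemma dright_D u : \forall x \near o, u *m dright x = 'D_(row_mx u 0) M (row_mx o x).
Proof.
apply: filterS (near_right mul_sdiff_near) => x hx.
have [_ ->] := sdiff_derive (row_mx u 0) hx.
by rewrite /dright mulmxA mul_mx_row mulmx1 mulmx0.
Qed.

Lemma dleft_o : dleft o = 1%:M.
Proof. by rewrite /dleft mul_jac mul_row_col mul0mx mul1mx add0r. Qed.

Lemma dright_o : dright o = 1%:M.
Proof. by rewrite /dright mul_jac mul_row_col mul0mx mul1mx addr0. Qed.

(** The mixed part of the second derivative of the multiplication. *)
Definition bil u v := row_mx u 0 *m hess (row_mx 0 v).

Lemma dleft_hess u : sdiff (fun x => u *m dleft x) o (row_mx 1%:M 0 *m hess (row_mx 0 u)).
Proof.
have := sdiff_comp (row_mx_aff (sdiff_id o) (sdiff_cst o o)) (hess_sdiff (row_mx 0 u)).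
by apply: sdiff_near; apply: filterS (dleft_D u) => x ->.
Qed.

Lemma dright_hess u : sdiff (fun x => u *m dright x) o (row_mx 0 1%:M *m hess (row_mx u 0)).
Proof.
have := sdiff_comp (row_mx_aff (sdiff_cst o o) (sdiff_id o)) (hess_sdiff (row_mx u 0)).
by apply: sdiff_near; apply: filterS (dright_D u) => x ->.
Qed.

(** The value at [psi x] of the left-invariant field extending [v] is
    [v *m dleft x], and the derivative of [dleft] at the identity is the mixed
    part of the Hessian. *)
Lemma lie_bracketE u v : lie_bracket G u v = bil u v - bil v u.
Proof.
have E w : \forall x \near o, w *m dleft x = lvf w phi (psi x).
  by apply: filterS dleft_sdiff => x /(sdiff_derive w)[_ <-].
have Eo w : lvf w phi (psi o) = w.
  by rewrite -(nbhs_singleton (E w)) dleft_o mulmx1.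
have D w : sdiff (fun x => lvf w phi (psi x)) o (row_mx 1%:M 0 *m hess (row_mx 0 w)).
  by apply: sdiff_near (dleft_hess w); exact: E.
have B w z : w *m (row_mx 1%:M 0 *m hess (row_mx 0 z)) = bil w z.
  by rewrite mulmxA mul_mx_row mulmx1 mulmx0.
rewrite /lie_bracket /vf_bracket !Eo.
have [_ ->] := sdiff_derive u (D v); have [_ ->] := sdiff_derive v (D u).
by rewrite !B.
Qed.

(** The bracket, sealed so that comparing two of its values does not unfold it. *)
Definition lb := locked (lie_bracket G).

Lemma lbE u v : lie_bracket G u v = lb u v.
Proof. by rewrite /lb -lock. Qed.

Lemma lb_bil u v : lb u v = bil u v - bil v u.
Proof. by rewrite -lbE lie_bracketE. Qed.

Lemma bilDl u u' v : bil (u + u') v = bil u v + bil u' v.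
Proof. by rewrite /bil -mulmxDl add_row_mx addr0. Qed.

Lemma bilDr u v v' : bil u (v + v') = bil u v + bil u v'.
Proof. by rewrite /bil -mulmxDr -hessD add_row_mx addr0. Qed.

Lemma bilZl c u v : bil (c *: u) v = c *: bil u v.
Proof. by rewrite /bil scalemxAl scale_row_mx scaler0. Qed.

Lemma bilZr c u v : bil u (c *: v) = c *: bil u v.
Proof. by rewrite /bil scalemxAr -hessZ scale_row_mx scaler0. Qed.

Lemma lieC u v : lb u v = - (lb v u).
Proof. by rewrite !lb_bil opprB. Qed.

Lemma lie_self u : lb u u = 0. Proof. by rewrite lb_bil subrr. Qed.

Lemma lieDr u v v' : (lb u (v + v')) = (lb u v) + (lb u v').
Proof. by rewrite !lb_bil bilDl bilDr opprD addrACA. Qed.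

Lemma lieZr c u v : (lb u (c *: v)) = c *: (lb u v).
Proof. by rewrite !lb_bil bilZl bilZr scalerBr. Qed.

Lemma lieZl c u v : (lb (c *: u) v) = c *: (lb u v).
Proof. by rewrite !(lieC _ v) lieZr scalerN. Qed.

Lemma lie0r u : lb u 0 = 0. Proof. by rewrite -(scale0r 0) lieZr !scale0r. Qed.

Lemma lie0l u : lb 0 u = 0. Proof. by rewrite lieC lie0r oppr0. Qed.

Lemma lie_sumr (I : finType) u (f : I -> 'rV[R]_n) : (lb u (\sum_i f i)) = \sum_i (lb u (f i)).
Proof. by apply: (big_morph (lb u)) => [v v'|]; [exact: lieDr|exact: lie0r]. Qed.

Lemma lie_suml (I : finType) u (f : I -> 'rV[R]_n) : (lb (\sum_i f i) u) = \sum_i (lb (f i) u).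
Proof. by rewrite lieC lie_sumr -sumrN; apply: eq_bigr => i _; rewrite lieC opprK. Qed.

Definition ad := locked (fun u => \matrix_i lb u (delta_mx 0 i) : 'M[R]_n).

Lemma row_ad u i : row i (ad u) = lb u (delta_mx 0 i).
Proof. by rewrite /ad -lock rowK. Qed.

Lemma adE u w : w *m ad u = (lb u w).
Proof.
rewrite {2}(delta_sum w) lie_sumr {1}(delta_sum w) mulmx_suml.
by apply: eq_bigr => i _; rewrite -scalemxAl -rowE row_ad lieZr.
Qed.

Lemma adl u : ad u = \sum_i u 0 i *: ad (delta_mx 0 i).
Proof.
apply/row_matrixP => j; rewrite row_ad {1}(delta_sum u) lie_suml linear_sum.
by apply: eq_bigr => i _; rewrite linearZ /= row_ad lieZl.
Qed.

Lemma dat_ad (f : R -> 'rV[R]_n) t v : dat f t v -> dat (fun s => ad (f s)) t (ad v).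
Proof.
move=> /dat_mxP hf; rewrite adl.
have h i : dat (fun s => f s 0 i *: ad (delta_mx 0 i)) t (v 0 i *: ad (delta_mx 0 i)).
  apply: (dat_comp (f := fun x : R => x *: ad (delta_mx 0 i))) (hf 0 i) => e e0.
  by exists 1 => // u _; rewrite -scalerBl subrr normr0 mulr_ge0 // (ltW e0).
by apply: dat_ext ltr01 _ (dat_sum h) => s _; rewrite -adl.
Qed.

(** Near [t], the relation between the three curves bounds [h - 1] by the
    increments of [f] and [g] and by a small multiple of [h - 1] itself. *)
Lemma dat_quot m (f g h : R -> 'M[R]_m) t f' g' d0 : 0 < d0 ->
  (forall s, `|s - t| < d0 -> f s = h s *m g s) -> f t = 1%:M -> g t = 1%:M ->
  dat f t f' -> dat g t g' -> dat h t (f' - g').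
Proof.
move=> d00 fhg ft gt df dg.
have ht : h t = 1%:M.
  by have := fhg t; rewrite subrr normr0 gt mulmx1 ft => /(_ d00) <-.
have E s : `|s - t| < d0 -> h s - 1%:M = (f s - f t) - (g s - g t) - (h s - 1%:M) *m (g s - g t).
  move=> sd; rewrite mulmxBl mul1mx {1}mulmxBr -fhg // ft gt mulmx1.
  by apply/matrixP => i j; rewrite !mxE; ring.
have [d1 d10 h1] := dat_lip df; have [d2 d20 h2] := dat_lip dg.
set Kf := `|f'| + 1 in h1; set Kg := `|g'| + 1 in h2.
have pKf : 0 <= Kf by rewrite addr_ge0.
have pKg : 0 <= Kg by rewrite addr_ge0.
pose m1 : R := m%:R; have pm : 0 <= m1 by rewrite /m1.
pose d3 := (2 * (m1 * Kg + 1))^-1.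
have pd : 0 < 2 * (m1 * Kg + 1) by have := mulr_ge0 pm pKg; lra.
have d30 : 0 < d3 by rewrite invr_gt0.
have B s : `|s - t| < d0 -> `|s - t| < d1 -> `|s - t| < d2 -> `|s - t| < d3 ->
    `|h s - 1%:M| <= 2 * (Kf + Kg) * `|s - t|.
  move=> s0 /h1 s1 /h2 s2 s3; have := E s s0.
  set a := h s - _; set b := f s - _ in s1 *; set c := g s - _ in s2 *.
  move=> Ea; have ha : `|a| <= `|b| + `|c| + m1 * `|a| * `|c|.
    rewrite {1}Ea; apply: le_trans (ler_normB _ _) _; apply: lerD; first exact: ler_normB.
    exact: norm_mulmx.
  have pa := normr_ge0 a.
  have hc : m1 * `|a| * `|c| <= `|a| / 2.
    apply: (@le_trans _ _ (m1 * `|a| * (Kg * d3))).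
      rewrite ler_wpM2l ?mulr_ge0 //; apply: le_trans s2 _.
      by rewrite ler_wpM2l // (ltW s3).
    have -> : m1 * `|a| * (Kg * d3) = `|a| * ((m1 * Kg) * d3) by ring.
    apply: ler_wpM2l => //; rewrite /d3 ler_pdivrMr //.
    by have := mulr_ge0 pm pKg; lra.
  rewrite -mulrA mulrDl; lra.
move=> e e0.
pose K := 2 * (Kf + Kg) * m1 * Kg.
have pK : 0 <= K by rewrite /K; apply: mulr_ge0 => //; apply: mulr_ge0 => //; lra.
have e4 : 0 < e / 4 by lra.
have [d4 d40 h4] := df _ e4; have [d5 d50 h5] := dg _ e4.
pose d6 := e / (2 * (K + 1)); have d60 : 0 < d6 by rewrite divr_gt0 //; lra.
exists (Num.min d0 (Num.min d1 (Num.min d2 (Num.min d3 (Num.min d4 (Num.min d5 d6)))))).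
  by rewrite !lt_min d00 d10 d20 d30 d40 d50 d60.
move=> s; rewrite !lt_min => /andP[s0 /andP[s1 /andP[s2 /andP[s3 /andP[s4 /andP[s5 s6]]]]]].
have hB := B s s0 s1 s2 s3; have k4 := h4 _ s4; have k5 := h5 _ s5.
rewrite ht E // scalerBr.
have -> : f s - f t - (g s - g t) - (h s - 1%:M) *m (g s - g t) - ((s - t) *: f' - (s - t) *: g')
  = (f s - f t - (s - t) *: f') - (g s - g t - (s - t) *: g') - (h s - 1%:M) *m (g s - g t).
  by apply/matrixP => i j; rewrite !mxE; ring.
have k6 : `|(h s - 1%:M) *m (g s - g t)| <= e / 2 * `|s - t|.
  apply: le_trans (norm_mulmx _ _) _.
  apply: (@le_trans _ _ (m1 * (2 * (Kf + Kg) * `|s - t|) * (Kg * `|s - t|))).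
    by apply: ler_pM; rewrite ?mulr_ge0 // ?ler_wpM2l // h2.
  have -> : m1 * (2 * (Kf + Kg) * `|s - t|) * (Kg * `|s - t|) = (K * `|s - t|) * `|s - t|.
    by rewrite /K; ring.
  rewrite ler_wpM2r //; apply: (@le_trans _ _ ((K + 1) * d6)).
    by apply: ler_pM => //; [lra|exact: ltW].
  rewrite /d6 mulrA ler_pdivrMr; lra.
by apply: le_trans (ler_normB _ _) _; have := ler_normB (f s - f t - (s - t) *: f') (g s - g t - (s - t) *: g'); lra.
Qed.

Lemma dat_rows k l (f : R -> 'M[R]_(k, l)) t (v : 'M[R]_(k, l)) :
  (forall i, dat (fun s => delta_mx 0 i *m f s : 'rV_l) t (delta_mx 0 i *m v)) -> dat f t v.
Proof.
move=> h; apply/dat_mxP => i j; have /dat_mxP/(_ 0 j) := h i.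
by rewrite -rowE mxE; apply: dat_ext ltr01 _ => s _; rewrite -rowE mxE.
Qed.

Lemma rowsB k l (f g : 'I_k -> 'rV[R]_l) :
  \matrix_i (f i - g i) = \matrix_i f i - \matrix_i g i.
Proof. by apply/matrixP => i j; rewrite !mxE. Qed.

(** It suffices to differentiate at the identity. There [x y = (x y x^-1) x]
    says that the adjoint action is the quotient of the differentials of left
    and right translations, whose derivatives are the two mixed parts of the
    Hessian; their difference is the bracket. *)
Lemma dat_A (x : R -> G) t v : lgd x t v -> dat (fun s => A (x s)) t (ad v *m A (x t)).
Proof.
move=> [cx dx]; pose z s := phi ((x t)^-1 * x s)%g.
have zt : z t = o by rewrite /z mulVg.
have dz : dat z t v by [].
suff H : dat (fun s => A (psi (z s))) t (ad v).
  have [d d0 hd] := near_incr cx.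
  have := dat_mulmx H (dat_cst (A (x t)) t); rewrite mulmx0 addr0.
  apply: dat_ext d0 _ => s sd; rewrite -AM chart_mapK; last exact: hd.
  by rewrite mulVKg.
have hz (P : 'rV[R]_n -> Prop) : (\forall y \near o, P y) ->
    exists2 d, 0 < d & forall s, `|s - t| < d -> P (z s).
  move=> hP; apply/(nbhs_eps (V := R)); have := dat_continuous dz.
  by rewrite /prop_for /continuous_at zt; apply.
have LR : \forall y \near o, dleft y = A (psi y) *m dright y.
  apply: filterS2 dleft_sdiff dright_sdiff => y hl hr.
  have hA := A_sdiff (psi y); rewrite -(conj_o (psi y)) in hr.
  apply: sdiff_unique hl (sdiff_near _ (sdiff_comp hA hr)).
  by apply: filterS (conj_near (psi y)) => w hw; rewrite chart_mapK // mulgVK.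
have [d d0 hd] := hz _ LR.
have -> : ad v = (\matrix_i bil v (delta_mx 0 i)) - \matrix_i bil (delta_mx 0 i) v.
  by rewrite -rowsB; apply/row_matrixP => i; rewrite row_ad rowK lb_bil.
apply: (@dat_quot _ (fun s => dleft (z s)) (fun s => dright (z s)) _ _ _ _ d) => //.
- by rewrite zt dleft_o.
- by rewrite zt dright_o.
- apply: dat_rows => i; rewrite -rowE rowK.
  have hs := dleft_hess (delta_mx 0 i); rewrite -zt in hs.
  have := sdiff_dat hs dz.
  by rewrite mulmxA mul_mx_row mulmx1 mulmx0.
- apply: dat_rows => i; rewrite -rowE rowK.
  have hs := dright_hess (delta_mx 0 i); rewrite -zt in hs.
  have := sdiff_dat hs dz.
  by rewrite mulmxA mul_mx_row mulmx1 mulmx0 hessC.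
Qed.

Lemma ex_lgd v : exists2 x : R -> G, x 0 = 1%g & lgd x 0 v.
Proof.
exists (fun s => psi (o + s *: v)); last exact: lgd_psi.
by rewrite scale0r addr0 psi_o.
Qed.

(** Conjugation is an automorphism: both sides are the derivative at 0 of the
    adjoint action along the conjugate of a curve. *)
Lemma A_ad q u : ad (u *m A q) = A q^-1%g *m ad u *m A q.
Proof.
have [x x0 h] := ex_lgd u.
have h1 := dat_A (lgd_right q^-1%g (lgd_left q h)).
rewrite invgK x0 mulg1 mulgV A1 mulmx1 in h1.
have h2 := dat_mulmx (dat_mulmx (dat_cst (A q^-1%g) 0) (dat_A h)) (dat_cst (A q) 0).
rewrite x0 A1 (mulmx1 (ad u)) (mulmx1 (A _)) (mul0mx _ 1%:M) add0r (mulmx0 _ (A _)) addr0 in h2.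
apply: dat_unique h1 _; apply: dat_ext ltr01 _ h2 => s _.
by rewrite !AM mulmxA.
Qed.

Lemma A_lie q u v : (lb (u *m A q) (v *m A q)) = (lb u v) *m A q.
Proof. by rewrite -adE A_ad -!mulmxA (mulmxA (A q)) AK mul1mx mulmxA adE. Qed.

(** The derivative at the identity of the fact that the adjoint action
    preserves brackets. *)
Lemma jacobi w u v : (lb w (lb u v)) = lb (lb w u) v + lb u (lb w v).
Proof.
have [x x0 h0] := ex_lgd w.
have h := dat_A h0; rewrite x0 A1 mulmx1 in h.
have D y : dat (fun s => y *m A (x s)) 0 (lb w y).
  by have := dat_mulmx (dat_cst y 0) h; rewrite mul0mx add0r adE.
have h1 := D (lb u v).
have h2 := dat_mulmx (D v) (dat_ad (D u)).
apply: dat_unique h1 _; apply: (dat_eq (v := lb w v *m ad u + v *m ad (lb w u))).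
  have E s : v *m A (x s) *m ad (u *m A (x s)) = lb u v *m A (x s).
    by rewrite adE A_lie.
  apply: dat_ext ltr01 _ (dat_eq h2 _) => [s _|]; first exact: E.
  by rewrite x0 A1 (mulmx1 u) (mulmx1 v).
rewrite (adE u) (adE (lb w u)).
exact: addrC.
Qed.

End adjoint.

(** * Curves and one-parameter subgroups *)

Section group_curves.
Context {R : realType} {n : nat} (G : lie_group R n).
Local Notation phi := (chart1 G).
Local Notation psi := (chart_inv (chart1 G)).
Local Notation o := (chart1 G 1%g).
Local Notation lb := (lb G).
Local Notation oo := (row_mx o o : 'rV[R]_(n + n)).
Implicit Types (p q : G) (x y : R -> G) (Y : 'rV[R]_n).

Lemma gLip_near x a b t0 (P : 'rV[R]_n -> Prop) : gLip x a b -> a <= t0 <= b ->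
  (\forall z \near o, P z) -> exists2 d, 0 < d & forall t, a <= t <= b -> `|t - t0| < d ->
    P (phi ((x t0)^-1 * x t)%g).
Proof.
move=> hx ht0 /nbhs_eps[d1 d10 h1]; have [d [K [d0 _ hd]]] := gLip_incr hx ht0 d10.
exists d => // t ht td; apply: h1.
by have [] := hd _ _ ht ht0 td _; rewrite ?subrr ?normr0.
Qed.

Lemma gLip_sdiff x a b t0 l (F : 'rV[R]_n -> 'rV[R]_l) J : gLip x a b -> a <= t0 <= b ->
  sdiff F o J -> exists d K, [/\ 0 < d, 0 <= K &
  forall t u, a <= t <= b -> a <= u <= b -> `|t - t0| < d -> `|u - t0| < d ->
    chart_dom phi ((x t0)^-1 * x t)%g /\
    `|F (phi ((x t0)^-1 * x t)%g) - F (phi ((x t0)^-1 * x u)%g)| <= K * `|t - u|].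
Proof.
move=> hx ht0 /sdiff_lip[d1 [K1 [d10 K10 h1]]].
have [d [K [d0 K0 hd]]] := gLip_incr hx ht0 d10.
exists d, (K1 * K); split; rewrite ?mulr_ge0 //.
move=> t u ht hu td ud; have [k1 k2 k3] := hd _ _ ht hu td ud.
have [_ k4 _] := hd _ _ hu ht ud td; split=> //.
by apply: le_trans (h1 _ _ k2 k4) _; rewrite -mulrA ler_wpM2l.
Qed.

Lemma norm_row_mx k l (u : 'rV[R]_k) (v : 'rV[R]_l) c : `|u| <= c -> `|v| <= c -> `|row_mx u v| <= c.
Proof.
move=> uc vc; apply: norm_mx_le => [|i j]; first exact: le_trans (normr_ge0 u) uc.
rewrite mxE; case: (fintype.split j) => j'.
  exact: le_trans (norm_entry u i j') uc.
exact: le_trans (norm_entry v i j') vc.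
Qed.

Lemma gLipM x y a b : gLip x a b -> gLip y a b -> gLip (fun t => x t * y t)%g a b.
Proof.
move=> hx hy t0 ht0.
have [d1 [K1 [d10 K10 h1]]] := sdiff_lip (incr_sdiff (y t0)).
have /nbhs_eps[d2 d20 h2] := incr_near (y t0).
have m0 : 0 < Num.min d1 d2 / 2 by rewrite divr_gt0 // lt_min d10.
have mlt : Num.min d1 d2 / 2 < Num.min d1 d2.
  have : 0 < Num.min d1 d2 by rewrite lt_min d10.
  by lra.
have [dx [Kx [dx0 Kx0 hX]]] := gLip_incr hx ht0 m0.
have [dy [Ky [dy0 Ky0 hY]]] := gLip_incr hy ht0 m0.
pose z t := row_mx (phi ((x t0)^-1 * x t)%g) (phi ((y t0)^-1 * y t)%g).
have hz t : a <= t <= b -> `|t - t0| < Num.min dx dy ->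
    [/\ `|z t - oo| < d1, `|z t - oo| < d2 &
    ((x t0 * y t0)^-1 * (x t * y t))%g = incr (y t0) (z t)].
  move=> ht; rewrite lt_min => /andP[tx ty].
  have [a1 a2 _] := hX _ _ ht ht tx tx; have [b1 b2 _] := hY _ _ ht ht ty ty.
  have : `|z t - oo| < Num.min d1 d2.
    by apply: le_lt_trans mlt; rewrite opp_row_mx add_row_mx; apply: norm_row_mx; apply: ltW.
  rewrite lt_min => /andP[-> ->]; split=> //.
  by rewrite /z /incr row_mxKl row_mxKr !chart_mapK // invgM !mulgA mulgK.
exists (Num.min dx dy), (K1 * Num.max Kx Ky); split; first by rewrite lt_min dx0.
move=> t u ht hu td ud; have [z1 z2 ->] := hz _ ht td; have [w1 w2 ->] := hz _ hu ud.
split; first exact: h2.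
apply: le_trans (h1 _ _ z1 w1) _; rewrite -mulrA ler_wpM2l //.
move: td ud; rewrite !lt_min => /andP[tx ty] /andP[ux uy].
have [_ _ a3] := hX _ _ ht hu tx ux; have [_ _ b3] := hY _ _ ht hu ty uy.
rewrite opp_row_mx add_row_mx; apply: norm_row_mx.
  by apply: le_trans a3 _; rewrite ler_wpM2r // le_max lexx.
by apply: le_trans b3 _; rewrite ler_wpM2r // le_max lexx orbT.
Qed.

Lemma gLip_cst q a b : gLip (fun=> q) a b.
Proof.
move=> t0 _; exists 1, 0; split=> // t u _ _ _ _.
by rewrite mulVg subrr normr0 mul0r; split=> //; exact: dom1.
Qed.

Lemma gLip_left q x a b : gLip x a b -> gLip (fun t => q * x t)%g a b.
Proof. by move=> h; apply: (gLipM (x := fun=> q)); [exact: gLip_cst|]. Qed.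

Lemma gLip_sub x a b c d : a <= c -> d <= b -> gLip x a b -> gLip x c d.
Proof.
move=> ac db h t0 /andP[ct td]; have [|e [K [e0 hK]]] := h t0.
  by rewrite (le_trans ac ct) (le_trans td db).
exists e, K; split=> // t u /andP[t1 t2] /andP[u1 u2]; apply: hK.
  by rewrite (le_trans ac t1) (le_trans t2 db).
by rewrite (le_trans ac u1) (le_trans u2 db).
Qed.

Lemma gLip_ext x y a b : (forall t, a <= t <= b -> x t = y t) -> gLip x a b -> gLip y a b.
Proof.
move=> xy h t0 ht0; have [d [K [d0 hd]]] := h _ ht0; exists d, K; split=> // t u ht hu.
by rewrite -!xy //; exact: hd.
Qed.

(** Constancy is read locally in the chart, and propagated by
    [local_to_global]. *)
Lemma lgd_const x a b : a <= b -> gLip x a b -> aei a b (fun t => lgd x t 0) -> x b = x a.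
Proof.
move=> ab hx h0; apply: (@local_to_global _ (fun u v : R => x v = x u)) => //.
  by move=> u v w _ _ h1 h2; rewrite h2.
move=> t0 ht0; have [d [K [d0 hd]]] := hx _ ht0; exists d => // u v au vb tu ut tv vt.
pose f s := phi ((x t0)^-1 * x s)%g.
have ok s : u <= s <= v -> a <= s <= b /\ `|s - t0| < d.
  move=> /andP[us sv]; split; first by rewrite (le_trans au us) (le_trans sv vb).
  by rewrite ltr_norml; lra.
have uv : u <= v by exact: le_trans tv.
have [u1 u2] : a <= u <= b /\ `|u - t0| < d by apply: ok; rewrite lexx.
have [v1 v2] : a <= v <= b /\ `|v - t0| < d by apply: ok; rewrite lexx uv.
have fuv : f v = f u.
  apply: (@lip_const _ 1 n f u v) => //.
    by exists K => s s' /ok[k1 k2] /ok[k3 k4]; case: (hd _ _ k1 k3 k2 k4).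
  apply: aei_imp (aei_sub au vb h0) => s /andP[us sv] hs.
  have [k1 k2] : a <= s <= b /\ `|s - t0| < d by apply: ok; rewrite !ltW.
  have [k3 _] := hd _ _ k1 k1 k2 k2.
  by have := lgd_chart (atlas_chart1 G) k3 (lgd_left (x t0)^-1%g hs); rewrite mul0mx.
have [k1 _] := hd _ _ u1 u1 u2 u2; have [k2 _] := hd _ _ v1 v1 v2 v2.
have : ((x t0)^-1 * x v)%g = ((x t0)^-1 * x u)%g by rewrite -(chart_mapK k2) -[RHS](chart_mapK k1) -/(f v) fuv.
exact: mulgI.
Qed.

Lemma gLip_lipschitz x a b t0 (c : chart R n G) : gLip x a b -> a <= t0 <= b ->
  atlas c -> chart_dom c (x t0) -> exists e K : R, 0 < e /\ forall t u,
    a <= t <= b -> a <= u <= b -> `|t - t0| < e -> `|u - t0| < e ->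
    [/\ chart_dom c (x t), chart_dom c (x u) & `|c (x t) - c (x u)| <= K * `|t - u|].
Proof.
move=> hx ht0 hc cx.
have [d [K [d0 K0 hd]]] := gLip_sdiff hx ht0 (JL_sdiff hc cx).
have [d1 d10 h1] := gLip_near hx ht0 (left_near cx).
exists (Num.min d d1), K; split; first by rewrite lt_min d0.
move=> t u ht hu; rewrite !lt_min => /andP[t1 t2] /andP[u1 u2].
have [k1 k2] := hd _ _ ht hu t1 u1; have [k3 _] := hd _ _ hu ht u1 t1.
have k4 := h1 _ ht t2; have k5 := h1 _ hu u2.
by move: k2 k4 k5; rewrite !chart_mapK // !mulVKg.
Qed.

Lemma JLV_near (c : chart R n G) p : chart_dom c p ->
  \forall y \near c p, chart_dom phi (p^-1 * chart_inv c y)%g.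
Proof.
move=> cp.
apply: (@near_open _ _ (fun z => p^-1 * chart_inv c z)%g (c p) _ (open_chart_dom phi)).
  by rewrite chart_mapK // mulVg; exact: dom1.
by apply: contM; [exact: cont_cst|exact: chart_inv_for].
Qed.

Lemma lipschitz_gLip x a b : (forall t0 (c : chart R n G), a <= t0 <= b ->
  atlas c -> chart_dom c (x t0) -> exists e K : R, 0 < e /\ forall t u,
    a <= t <= b -> a <= u <= b -> `|t - t0| < e -> `|u - t0| < e ->
    [/\ chart_dom c (x t), chart_dom c (x u) & `|c (x t) - c (x u)| <= K * `|t - u|]) ->
  gLip x a b.
Proof.
move=> h t0 ht0; have [c hc cx] := atlas_cover (x t0).
have [d [K [d0 hd]]] := h _ _ ht0 hc cx.
have [d1 [K1 [d10 K10 h1]]] := sdiff_lip (JLV_sdiff hc cx).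
have /nbhs_eps[d2 d20 h2] := JLV_near cx.
pose K' := Num.max K 0; have K'0 : 0 <= K' by rewrite le_max lexx orbT.
have K'1 : 0 < K' + 1 by lra.
exists (Num.min d (Num.min d1 d2 / (K' + 1))), (K1 * K'); split.
  by rewrite lt_min d0 divr_gt0 // lt_min d10.
have KK' (s : R) : K * `|s| <= K' * `|s| by rewrite ler_wpM2r // le_max lexx.
have ok t : a <= t <= b -> `|t - t0| < d -> `|t - t0| < Num.min d1 d2 / (K' + 1) ->
    [/\ chart_dom c (x t), `|c (x t) - c (x t0)| < d1 & `|c (x t) - c (x t0)| < d2].
  move=> ht t1; rewrite ltr_pdivlMr // => t2.
  have [|k1 _ k2] := hd _ _ ht ht0 t1; first by rewrite subrr normr0.
  have : `|c (x t) - c (x t0)| < Num.min d1 d2.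
    apply: le_lt_trans (le_trans k2 (KK' _)) _; apply: le_lt_trans t2.
    by rewrite mulrC ler_wpM2l //; lra.
  by rewrite lt_min => /andP[].
move=> t u ht hu; rewrite !(lt_min _ d) => /andP[t1 t2] /andP[u1 u2].
have [a1 a2 a3] := ok _ ht t1 t2; have [b1 b2 b3] := ok _ hu u1 u2.
have k1 := h2 _ a3; have k2 := h1 _ _ a2 b2; rewrite !chart_mapK // in k1 k2.
split=> //; apply: le_trans k2 _; rewrite -mulrA ler_wpM2l //.
by have [_ _ k3] := hd _ _ ht hu t1 u1; exact: le_trans (KK' _).
Qed.

Lemma dat0_const k l (f : R -> 'M[R]_(k, l)) a b : (forall t, Num.min a b <= t <= Num.max a b -> dat f t 0) ->
  f a = f b.
Proof.
wlog ab : a b / a <= b.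
  move=> H h; have [ab|/ltW ba] := leP a b; first by apply: H.
  by apply/esym/H => // t; rewrite minC maxC; exact: h.
rewrite min_l // max_r // => h; apply/esym/eqP; rewrite -subr_eq0 -normr_le0.
rewrite -(mul0r (b - a)); apply: mvt_bound => // t ht.
by exists 0; rewrite ?normr0 //; exact: h.
Qed.

Lemma lgd0_const x a b : (forall t, Num.min a b <= t <= Num.max a b -> lgd x t 0) -> x a = x b.
Proof.
wlog ab : a b / a <= b.
  move=> H h; have [ab|/ltW ba] := leP a b; first by apply: H.
  by apply/esym/H => // t; rewrite minC maxC; exact: h.
rewrite min_l // max_r // => h; apply/esym.
apply: (@local_to_global _ (fun u v : R => x v = x u)) => //.
  by move=> u v w _ _ h1 h2; rewrite h2.
move=> t0 ht0; have [cx _] := h _ ht0; have [d d0 hd] := near_incr cx.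
exists d => // u v au vb tu ut tv vt.
have ok s : u <= s <= v -> a <= s <= b /\ chart_dom phi ((x t0)^-1 * x s)%g.
  move=> /andP[us sv]; split; first by rewrite (le_trans au us) (le_trans sv vb).
  by apply: hd; rewrite ltr_norml; lra.
have uv : u <= v by exact: le_trans tv.
have [_ ku] := ok u (introT andP (conj (lexx u) uv)).
have [_ kv] := ok v (introT andP (conj uv (lexx v))).
have : phi ((x t0)^-1 * x u)%g = phi ((x t0)^-1 * x v)%g.
  apply: (dat0_const (f := fun s => phi ((x t0)^-1 * x s)%g)) => s; rewrite min_l // max_r // => /ok[k1 k2].
  by have := lgd_chart (atlas_chart1 G) k2 (lgd_left (x t0)^-1%g (h _ k1)); rewrite mul0mx.
move=> E; apply: (mulgI (x t0)^-1%g).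
by rewrite -(chart_mapK kv) -E chart_mapK.
Qed.

End group_curves.

(** * Existence of integral curves *)

Section picard.
Context {R : realType}.

(** Takes limits in inequalities with a geometric error. *)
Lemma le_geom (a b C : R) : (forall k : nat, a <= b + C / 2 ^+ k) -> a <= b.
Proof.
move=> h; apply/ler_addgt0Pr => e e0.
pose C' := `|C|; have C'0 : 0 <= C' by exact: normr_ge0.
pose k := Num.bound (C' / e).
have hk : C' / e < k%:R.
  by apply: archi_boundP; rewrite divr_ge0 // ltW.
have k2 : k%:R <= 2 ^+ k :> R by rewrite -natrX ler_nat ltnW // ltn_expl.
apply: le_trans (h k) _; rewrite lerD2l ler_pdivrMr ?exprn_gt0 //.
rewrite ltr_pdivrMr // in hk.
apply: le_trans (ler_norm C) _; apply: le_trans (ltW hk) _.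
by rewrite mulrC ler_wpM2l // ltW.
Qed.

(** The nested intervals around [u k] whose radius is the sum of the remaining
    increments. *)
Lemma geom_limit (u : nat -> R) (C : R) : (forall k, `|u k.+1 - u k| <= C / 2 ^+ k) ->
  exists l, forall k, `|u k - l| <= 2 * C / 2 ^+ k.
Proof.
move=> h.
have C0 : 0 <= C by have := h 0%N; rewrite expr0 divr1; apply: le_trans; exact: normr_ge0.
pose a k := u k - 2 * C / 2 ^+ k; pose b k := u k + 2 * C / 2 ^+ k.
have E k : 2 * C / 2 ^+ k.+1 = C / 2 ^+ k by rewrite exprS; field; rewrite expf_neq0.
have E' k : 2 * C / 2 ^+ k = C / 2 ^+ k + C / 2 ^+ k by field; rewrite expf_neq0.
have aS k : a k <= a k.+1 by rewrite /a E E'; have := h k; rewrite ler_norml; lra.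
have bS k : b k.+1 <= b k by rewrite /b E E'; have := h k; rewrite ler_norml; lra.
have ab k : a k <= b k.
  by have : 0 <= 2 * C / 2 ^+ k by [rewrite divr_ge0 ?mulr_ge0 ?exprn_ge0]; rewrite /a /b; lra.
have am k l : (k <= l)%N -> a k <= a l.
  by move=> /subnK <-; elim: (l - k)%N => // i; move=> /le_trans; apply; rewrite addSn.
have bm k l : (k <= l)%N -> b l <= b k.
  by move=> /subnK <-; elim: (l - k)%N => // i ih; rewrite addSn; apply: le_trans ih.
have abkl k l : a k <= b l.
  apply: le_trans (am _ _ (leq_maxl k l)) _; apply: le_trans (ab _) _; apply: bm.
  exact: leq_maxr.
pose S := range a.
have Sub : has_ubound S by exists (b 0%N) => _ [k _ <-].
exists (sup S) => k.
have h1 : a k <= sup S by apply: ub_le_sup => //; exists k.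
have h2 : sup S <= b k.
  by apply: ge_sup; [exists (a 0%N); exists 0%N|move=> _ [l _ <-]].
by rewrite ler_norml; move: h1 h2; rewrite /a /b; lra.
Qed.

Lemma geom_limit_mx m (u : nat -> 'rV[R]_m) (C : R) : (forall k, `|u k.+1 - u k| <= C / 2 ^+ k) ->
  exists l, forall k, `|u k - l| <= 2 * C / 2 ^+ k.
Proof.
move=> h.
have C0 : 0 <= C by have := h 0%N; rewrite expr0 divr1; apply: le_trans; exact: normr_ge0.
have hi i : exists l, forall k, `|u k 0 i - l| <= 2 * C / 2 ^+ k.
  apply: geom_limit => k; apply: le_trans (h k).
  by have := norm_entry (u k.+1 - u k) 0 i; rewrite !mxE.
have [l hl] := choice hi; exists (\row_i l i) => k.
apply: norm_mx_le => [|j i]; first by rewrite divr_ge0 ?mulr_ge0 ?exprn_ge0.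
by rewrite ord1 !mxE.
Qed.

(** The quadratic remainder is what passes to the limit of the Picard
    iterates; differentiability alone would not. *)
Lemma lip_primitive (f : R -> R) (a b K : R) : a <= b ->
  (forall t u, a <= t <= b -> a <= u <= b -> `|f t - f u| <= K * `|t - u|) ->
  exists F : R -> R, F 0 = 0 /\ forall t u, a <= t <= b -> a <= u <= b ->
    `|F t - F u - (t - u) * f u| <= K * (t - u) ^+ 2.
Proof.
move=> ab hf; have fl : lip f a b by exists K.
have [F [Fl Fd _]] := bmeas_primitive (lip_bmeas fl).
exists (fun t => F t - F 0); split; first by rewrite subrr.
have key u v w : a <= u -> u <= v -> v <= b -> u <= w <= v ->
    `|F v - F u - (v - u) * f w| <= K * (v - u) ^+ 2.
  move=> au uv vb /andP[uw wv].
  have Fl' : lip F u v by apply: lip_sub Fl.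
  have hw : a <= w <= b by rewrite (le_trans au uw) (le_trans wv vb).
  have ll c : lip (fun t : R => c * t) u v.
    by apply: lipM; [exact: lip_cst|exact: lip_id].
  have dc c (t : R) : dat (fun t : R => c * t) t c.
    by have := datMc c (dat_id t); rewrite mulr1.
  have K0 t : u < t < v -> `|f t - f w| <= K * (v - u).
    move=> /andP[ut tv]; have ht : a <= t <= b.
      by rewrite (le_trans au (ltW ut)) (le_trans (ltW tv) vb).
    apply: le_trans (hf _ _ ht hw) _.
    have [->|tw] := eqVneq t w.
      rewrite subrr normr0 mulr0.
      have := hf u v; rewrite !(le_trans au uv, lexx, uv, au, vb, (le_trans uv vb)) => /(_ isT isT).
      by rewrite distrC => h0; have := le_trans (normr_ge0 _) h0; rewrite distrC ger0_norm ?subr_ge0.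
    have K00 : 0 <= K.
      have := le_trans (normr_ge0 _) (hf _ _ ht hw).
      by rewrite pmulr_lge0 // normr_gt0 subr_eq0.
    by rewrite ler_wpM2l // ler_norml; lra.
  rewrite ler_norml; apply/andP; split.
    have := lip_le uv (ll (f w - K * (v - u))) Fl'.
    have -> : K * (v - u) ^+ 2 = K * (v - u) * (v - u) by rewrite expr2 mulrA.
    move=> H; suff : (f w - K * (v - u)) * v - (f w - K * (v - u)) * u <= F v - F u by lra.
    apply: H; apply: aei_imp (aei_sub au vb Fd) => t ht Ft.
    exists (f w - K * (v - u)), (f t); split=> //.
    by have := K0 _ ht; rewrite ler_norml; lra.
  have := lip_le uv Fl' (ll (f w + K * (v - u))).
  have -> : K * (v - u) ^+ 2 = K * (v - u) * (v - u) by rewrite expr2 mulrA.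
  move=> H; suff : F v - F u <= (f w + K * (v - u)) * v - (f w + K * (v - u)) * u by lra.
  apply: H; apply: aei_imp (aei_sub au vb Fd) => t ht Ft.
  exists (f t), (f w + K * (v - u)); split=> //.
  by have := K0 _ ht; rewrite ler_norml; lra.
move=> t u /andP[at_ tb] /andP[au ub]; rewrite opprB addrA subrK.
have [ut|/ltW tu] := leP u t.
  by apply: key; rewrite ?lexx.
have := key t u u at_ tu ub; rewrite lexx tu => /(_ isT).
by rewrite -normrN -(sqrrN (t - u)) opprB; congr (`|_| <= _); ring.
Qed.

Lemma lip_primitive_mx m (f : R -> 'rV[R]_m) (a b K : R) : a <= b ->
  (forall t u, a <= t <= b -> a <= u <= b -> `|f t - f u| <= K * `|t - u|) ->
  exists F : R -> 'rV[R]_m, F 0 = 0 /\ forall t u, a <= t <= b -> a <= u <= b ->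
    `|F t - F u - (t - u) *: f u| <= `|K| * (t - u) ^+ 2.
Proof.
move=> ab hf.
have hi i : exists F : R -> R, F 0 = 0 /\ forall t u, a <= t <= b -> a <= u <= b ->
    `|F t - F u - (t - u) * f u 0 i| <= K * (t - u) ^+ 2.
  apply: lip_primitive => // t u ht hu; apply: le_trans (hf _ _ ht hu).
  by have := norm_entry (f t - f u) 0 i; rewrite !mxE.
have [F hF] := choice hi; exists (fun t => \row_i F i t); split.
  by apply/rowP => i; rewrite !mxE; case: (hF i).
move=> t u ht hu; apply: norm_mx_le => [|j i]; first by rewrite mulr_ge0 ?sqr_ge0.
rewrite ord1 !mxE; have [_ h] := hF i; apply: le_trans (h _ _ ht hu) _.
by rewrite ler_wpM2r ?sqr_ge0 // ler_norm.
Qed.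

Lemma dat_quad m (f : R -> 'rV[R]_m) t v C d : 0 < d ->
  (forall u, `|u - t| < d -> `|f u - f t - (u - t) *: v| <= C * (u - t) ^+ 2) -> dat f t v.
Proof.
move=> d0 h e e0; pose C' := `|C|; have C'0 : 0 <= C' by exact: normr_ge0.
exists (Num.min d (e / (C' + 1))); first by rewrite lt_min d0 divr_gt0 //; lra.
move=> u; rewrite lt_min ltr_pdivlMr => [/andP[u1 u2]|]; last by lra.
apply: le_trans (h _ u1) _; rewrite -real_normK ?num_real // expr2 mulrA ler_wpM2r //.
apply: le_trans (ltW u2); rewrite mulrC ler_wpM2l //.
by apply: le_trans (ler_norm C) _; rewrite lerDl.
Qed.

(** The Picard iterates converge pointwise, and the quadratic estimate on the
    increments of the iterates passes to the limit. *)
Lemma picard m (X : 'rV[R]_m -> 'rV[R]_m) (p : 'rV[R]_m) (d L : R) : 0 < d -> 0 <= L ->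
  (forall z w, `|z - p| < d -> `|w - p| < d -> `|X z - X w| <= L * `|z - w|) ->
  exists dl, 0 < dl /\ exists z : R -> 'rV[R]_m, z 0 = p /\
    forall t, `|t| < dl -> `|z t - p| < d /\ dat z t (X (z t)).
Proof.
move=> d0 L0 hX.
pose B := `|X p| + L * d + 1.
have Xp := normr_ge0 (X p).
have Ld : 0 <= L * d by rewrite mulr_ge0 // ltW.
have B0 : 0 < B by rewrite /B; lra.
have pp : `|p - p| < d by rewrite subrr normr0.
have XB z : `|z - p| < d -> `|X z| <= B - 1.
  move=> zd; have := hX _ _ zd pp; have := ler_normB (X z - X p) (- X p).
  rewrite opprK subrK normrN => h1 h2; apply: le_trans h1 _.
  have : L * `|z - p| <= L * d by rewrite ler_wpM2l // ltW.
  by rewrite /B; lra.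
pose dl := Num.min 1 (Num.min (d / (2 * B)) (Num.min (1 / (2 * L + 1)) (1 / (2 * (L * B) + 1)))).
have LB0 : 0 <= L * B by rewrite mulr_ge0 // ltW.
have dl0 : 0 < dl by rewrite !lt_min ltr01 !divr_gt0 ?mulr_gt0 //; lra.
have [dl1 dlB dlL dlLB] : [/\ dl <= 1, B * dl <= d / 2, L * dl <= 1 / 2 & 2 * (L * B) * dl <= 1].
  have : dl <= dl by []; rewrite {2}/dl !le_min => /and4P[-> k1 k2 k3]; split=> //.
  - move: k1; rewrite ler_pdivlMr; lra.
  - move: k2; rewrite ler_pdivlMr; lra.
  - move: k3; rewrite ler_pdivlMr; lra.
(* Invariant of the iteration; together with the choice of [dl] it keeps the
   iterates in the ball where [X] is Lipschitz. *)
pose inv (y : R -> 'rV[R]_m) := y 0 = p /\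
  forall t u, `|t| <= dl -> `|u| <= dl -> `|y t - y u| <= B * `|t - u|.
have z00 : `|0 : R| <= dl by rewrite normr0 ltW.
have invp y t : inv y -> `|t| <= dl -> `|y t - p| <= d / 2.
  move=> [y0 hy] ht; rewrite -y0; apply: le_trans (hy _ _ ht z00) _.
  by rewrite subr0; apply: le_trans dlB; rewrite ler_wpM2l // ltW.
have d2 : d / 2 < d by lra.
have step y : exists y', inv y -> inv y' /\ forall t u, `|t| <= dl -> `|u| <= dl ->
    `|y' t - y' u - (t - u) *: X (y u)| <= L * B * (t - u) ^+ 2.
  have [iy|niy] := pselect (inv y); last by exists y.
  have yd t : `|t| <= dl -> `|y t - p| < d by move=> /(invp _ _ iy) /le_lt_trans; apply.
  have nd : - dl <= dl by lra.
  have [|F [F0 hF]] := @lip_primitive_mx m (fun t => X (y t)) (- dl) dl (L * B) nd.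
    move=> t u; rewrite -!ler_norml => ht hu.
    apply: le_trans (hX _ _ (yd _ ht) (yd _ hu)) _; rewrite -mulrA ler_wpM2l //.
    by have [_ h] := iy; exact: h.
  exists (fun t => p + F t) => _.
  have hQ t u : `|t| <= dl -> `|u| <= dl ->
      `|p + F t - (p + F u) - (t - u) *: X (y u)| <= L * B * (t - u) ^+ 2.
    move=> ht hu; rewrite opprD addrACA subrr add0r -[X in X * _](ger0_norm LB0).
    by apply: hF; rewrite -ler_norml.
  split=> //; split; first by rewrite F0 addr0.
  move=> t u ht hu; rewrite opprD addrACA subrr add0r.
  have := hQ t u ht hu; rewrite (_ : p + F t - (p + F u) = F t - F u) => [h|]; last by rewrite opprD addrACA subrr add0r.
  rewrite -[F t - F u](subrK ((t - u) *: X (y u))).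
  apply: le_trans (ler_normD _ _) _; rewrite normrZ.
  apply: (@le_trans _ _ (`|t - u| * 1 + `|t - u| * (B - 1))); last first.
    by rewrite le_eqVlt; apply/orP; left; apply/eqP; ring.
  apply: lerD; last by rewrite ler_wpM2l // XB // yd.
  apply: le_trans h _; rewrite -real_normK ?num_real // expr2 mulrCA ler_wpM2l //.
  apply: le_trans dlLB.
  apply: (@le_trans _ _ (L * B * (2 * dl))); last by rewrite mulrCA mulrA.
  by rewrite ler_wpM2l //; apply: le_trans (ler_normB _ _) _; lra.
have [S hS] := choice step.
pose y k := iter k S (fun=> p).
have iy k : inv (y k).
  elim: k => [|k ih]; last by have [] := hS _ ih.
  by split=> // t u _ _; rewrite subrr normr0 mulr_ge0 // ltW.
have yq k t u : `|t| <= dl -> `|u| <= dl ->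
    `|y k.+1 t - y k.+1 u - (t - u) *: X (y k u)| <= L * B * (t - u) ^+ 2.
  by have [_ h] := hS _ (iy k); exact: h.
have yd k t : `|t| < dl -> dat (y k.+1) t (X (y k t)).
  move=> ht; apply: (@dat_quad _ _ _ _ (L * B) (dl - `|t|)); first by rewrite subr_gt0.
  move=> u ut; apply: yq; last exact: ltW.
  by have := ler_normD (u - t) t; rewrite subrK; lra.
have yp k t : `|t| < dl -> `|y k t - p| < d.
  by move=> /ltW /(invp _ _ (iy k)) /le_lt_trans; apply.
have y0 k : y k 0 = p by case: (iy k).
have yc k t : `|t| < dl -> `|y k.+1 t - y k t| <= d / 2 ^+ k.
  elim: k t => [|k ih] t ht.
    rewrite expr0 divr1 (_ : y 0%N t = p) //; exact/ltW/yp.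
  have G : `|(y k.+2 t - y k.+1 t) - (y k.+2 0 - y k.+1 0)| <= L * (d / 2 ^+ k) * `|t|.
    have dd s : `|s| < dl -> exists2 v, dat (fun s => y k.+2 s - y k.+1 s) s v & `|v| <= L * (d / 2 ^+ k).
      move=> hs; exists (X (y k.+1 s) - X (y k s)); first by apply: datB; exact: yd.
      by apply: le_trans (hX _ _ (yp _ _ hs) (yp _ _ hs)) _; rewrite ler_wpM2l // ih.
    have C0 : 0 <= L * (d / 2 ^+ k) by rewrite mulr_ge0 // divr_ge0 ?exprn_ge0 // ltW.
    have [t0|/ltW t0] := leP 0 t.
      have := mvt_bound (f := fun s => y k.+2 s - y k.+1 s) t0 C0.
      rewrite subr0 (ger0_norm t0); apply=> s /andP[s0 st]; apply: dd.
      by rewrite ger0_norm //; apply: le_lt_trans st _; rewrite -(ger0_norm t0).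
    have := mvt_bound (f := fun s => y k.+2 s - y k.+1 s) t0 C0.
    rewrite sub0r (ler0_norm t0) distrC; apply=> s /andP[st s0]; apply: dd.
    rewrite ler0_norm //; apply: le_lt_trans (_ : - t < _); first by rewrite lerN2.
    by rewrite -(ler0_norm t0).
  move: G; rewrite !y0 subrr subr0 => /le_trans; apply.
  have -> : d / 2 ^+ k.+1 = (d / 2 ^+ k) * (1 / 2) by rewrite exprS; field; rewrite expf_neq0.
  rewrite -mulrA mulrCA ler_wpM2l ?divr_ge0 ?exprn_ge0 ?(ltW d0) //.
  by apply: le_trans dlL; rewrite ler_wpM2l // ltW.
have hl t : exists l, `|t| < dl -> forall k, `|y k t - l| <= 2 * d / 2 ^+ k.
  have [ht|nt] := pselect (`|t| < dl); last by exists 0 => h; case: nt.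
  have [l hl] := geom_limit_mx (fun k => yc k t ht); by exists l.
have [z hz] := choice hl.
have d02 k : 0 <= 2 * d / 2 ^+ k by rewrite divr_ge0 ?mulr_ge0 ?exprn_ge0 ?(ltW d0).
have zp t : `|t| < dl -> `|z t - p| < d.
  move=> ht; apply: le_lt_trans d2; apply: (@le_geom _ _ (2 * d)) => k.
  have := hz t ht k; have := invp _ _ (iy k) (ltW ht).
  have -> : z t - p = (y k t - p) - (y k t - z t) by rewrite opprB [RHS]addrC addrA subrK.
  by move=> h1 h2; apply: le_trans (ler_normB _ _) _; exact: lerD.
exists dl; split=> //; exists z; split.
  apply/eqP; rewrite -subr_eq0 -normr_le0; apply: (@le_geom _ _ (2 * d)) => k.
  by rewrite add0r; have := hz 0 _ k; rewrite y0 distrC normr0; apply.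
move=> t ht; split; first exact: zp.
apply: (@dat_quad _ _ _ _ (L * B) (dl - `|t|)); first by rewrite subr_gt0.
move=> u ut; have hu : `|u| < dl by have := ler_normD (u - t) t; rewrite subrK; lra.
apply: (@le_geom _ _ (2 * d + 2 * d + 2 * dl * (L * (2 * d)))) => k.
have q := yq k _ _ (ltW hu) (ltW ht).
have -> : z u - z t - (u - t) *: X (z t) =
   (y k.+1 u - y k.+1 t - (u - t) *: X (y k t)) - (y k.+1 u - z u) + (y k.+1 t - z t)
   + (u - t) *: (X (y k t) - X (z t)).
  by apply/matrixP => i j; rewrite !mxE; ring.
have a1 : `|y k.+1 u - z u| <= 2 * d / 2 ^+ k.
  apply: le_trans (hz u hu k.+1) _; rewrite ler_wpM2l ?mulr_ge0 ?(ltW d0) //.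
  by rewrite lef_pV2 ?posrE ?exprn_gt0 // exprS ler_peMl ?exprn_ge0 //; lra.
have a2 : `|y k.+1 t - z t| <= 2 * d / 2 ^+ k.
  apply: le_trans (hz t ht k.+1) _; rewrite ler_wpM2l ?mulr_ge0 ?(ltW d0) //.
  by rewrite lef_pV2 ?posrE ?exprn_gt0 // exprS ler_peMl ?exprn_ge0 //; lra.
have a3 : `|(u - t) *: (X (y k t) - X (z t))| <= 2 * dl * (L * (2 * d)) / 2 ^+ k.
  rewrite normrZ -mulrA; apply: ler_pM => //.
    by apply: le_trans (ler_normB _ _) _; lra.
  apply: le_trans (hX _ _ (yp _ _ ht) (zp _ ht)) _; rewrite -mulrA ler_wpM2l //.
  exact: hz.
apply: le_trans (ler_normD _ _) _; apply: le_trans (lerD (ler_normD _ _) (lexx _)) _.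
apply: le_trans (lerD (lerD (ler_normB _ _) (lexx _)) (lexx _)) _.
rewrite !(mulrDl _ _ (2 ^+ k)^-1); lra.
Qed.

End picard.

Section one_parameter_subgroups.
Context {R : realType} {n : nat} (G : lie_group R n).
Local Notation phi := (chart1 G).
Local Notation psi := (chart_inv (chart1 G)).
Local Notation o := (chart1 G 1%g).
Local Notation lb := (lb G).
Implicit Types (p q : G) (Y : 'rV[R]_n) (e : R -> G).

Definition oneparam e (d : R) Y := e 0 = 1%g /\ forall t, `|t| < d -> lgd e t Y.

(** The field extending [Y] is [Y *m dleft], which is Lipschitz near the
    identity as it is strictly differentiable there. *)
Lemma oneparam_local Y : exists d e, 0 < d /\ oneparam e d Y.
Proof.
have [d1 [L [d10 L0 hL]]] := sdiff_lip (dleft_hess G Y).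
have hnear : \forall z \near o, chart_img phi z.
  by apply: (near_open (f := id)) (chart_imgP (dom1 G)) _ => //; exact: open_chart_img.
have [d2 d20 h2] := (nbhs_eps _ _).1 (filterI hnear (dleft_sdiff G)).
have m0 : 0 < Num.min d1 d2 by rewrite lt_min d10.
have [z w|dl [dl0 [z [z0 hz]]]] := picard (X := fun z => Y *m dleft G z) (p := o) m0 L0.
  by rewrite !lt_min => /andP[zd _] /andP[wd _]; exact: hL.
exists dl, (fun t => psi (z t)); split=> //; split; first by rewrite z0 psi_o.
move=> t ht; have [zd dz] := hz _ ht.
have zd2 : `|z t - o| < d2 by move: zd; rewrite lt_min => /andP[].
have [[p dp pz] hs] := h2 _ zd2.
have domz : chart_dom phi (psi (z t)) by rewrite -pz chart_mapK.
apply: (chart_lgd (atlas_chart1 G) domz).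
  apply: (continuous_comp (dat_continuous dz)); apply: chart_inv_continuous.
  by exists p.
have -> : JL phi (psi (z t)) = dleft G (z t) by exact: jac_sdiff hs.
apply: (@dat_ext _ _ _ _ _ _ (dl - `|t|)) dz; first by rewrite subr_gt0.
move=> u ut; have hu : `|u| < dl by have := ler_normD (u - t) t; rewrite subrK; lra.
have [zu _] := hz _ hu.
have [|[q dq <-] _] := h2 (z u); first by move: zu; rewrite lt_min => /andP[].
by rewrite chart_mapK.
Qed.

Lemma between0 (t s d : R) : `|t| < d -> Num.min 0 t <= s <= Num.max 0 t -> `|s| < d.
Proof. by case: (leP 0 t) => t0; rewrite ltr_norml ltr_norml => h1 h2; lra. Qed.

(** The adjoint action along the subgroup has derivative [ad Y], which kills
    [Y]. *)
Lemma oneparam_A e d Y t : oneparam e d Y -> `|t| < d -> Y *m A (e t) = Y.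
Proof.
move=> [e0 he] td; rewrite -[RHS]mulmx1 -(A1 G) -e0; apply/esym.
apply: (dat0_const (f := fun s => Y *m A (e s))) => s /(between0 td) /he h.
have := dat_mulmx (dat_cst Y s) (dat_A h).
by rewrite mul0mx add0r mulmxA adE lie_self mul0mx.
Qed.

Lemma oneparam_AV e d Y t : oneparam e d Y -> `|t| < d -> Y *m A (e t)^-1%g = Y.
Proof. by move=> he td; rewrite -{1}(oneparam_A he td) -mulmxA AK mulmx1. Qed.

Lemma oneparam_opp e d Y t : oneparam e d Y -> `|t| < d -> lgd (fun s => e (- s)) t (- Y).
Proof.
move=> [_ he] td; rewrite -scaleN1r; apply: lgd_comp; first by apply: he; rewrite normrN.
by have := datMc (-1) (dat_id t); rewrite mulr1; apply: dat_ext ltr01 _ => s _; rewrite mulN1r.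
Qed.

Lemma oneparam_inv e e' d Y t : oneparam e d Y -> oneparam e' d Y -> `|t| < d ->
  (e t * e' (- t))%g = 1%g.
Proof.
move=> he he' td; have e0 : (e 0 * e' (- 0))%g = 1%g by rewrite oppr0 he.1 he'.1 mulg1.
rewrite -e0; apply/esym; apply: (lgd0_const (x := fun s => e s * e' (- s))%g) => s /(between0 td) sd.
apply: lgd_eq (lgdM (he.2 _ sd) (oneparam_opp he' sd)) _.
by rewrite (oneparam_AV he') ?normrN // subrr.
Qed.

Lemma oneparam_uniq e e' d Y t : oneparam e d Y -> oneparam e' d Y -> `|t| < d -> e t = e' t.
Proof.
move=> he he' td; apply: (mulIg (e' (- t))).
by rewrite (oneparam_inv he he' td) (oneparam_inv he' he' td).
Qed.

(** The square of [e (t / 2)] has derivative [Y], because the adjoint action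
    of [e] fixes [Y]; the interval of definition doubles. *)
Lemma oneparam_double e d Y : oneparam e d Y ->
  oneparam (fun t => e (t / 2)%R * e (t / 2)%R)%g (2 * d) Y.
Proof.
move=> he; split=> [|t]; first by rewrite mul0r he.1 mulg1.
rewrite -[t in `|t|](@divfK _ 2) // normrM (ger0_norm (_ : 0 <= 2)) // mulrC ltr_pM2l // => td.
have h : lgd (fun s => e (s / 2)) t (2^-1 *: Y).
  apply: lgd_comp; first exact: he.2.
  have := datMc 2^-1 (dat_id t); rewrite mulr1; apply: dat_ext ltr01 _ => s _.
  by rewrite mulrC.
apply: lgd_eq (lgdM h h) _.
by rewrite -scalemxAl (oneparam_AV he) // -scalerDl -[RHS]scale1r; congr (_ *: _); lra.
Qed.

Lemma oneparam_large Y (T : R) : exists e, oneparam e T Y.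
Proof.
have [d [e [d0 he]]] := oneparam_local Y.
have H k : exists e, oneparam e (2 ^+ k * d) Y.
  elim: k => [|k [e' he']]; first by exists e; rewrite expr0 mul1r.
  by exists (fun t => e' (t / 2)%R * e' (t / 2)%R)%g; rewrite exprS -mulrA; exact: oneparam_double.
have Td : 0 <= `|T| / d by rewrite divr_ge0 // ltW.
have [e' [e'0 he']] := H (Num.bound (`|T| / d)); exists e'; split=> // t tT; apply: he'.
apply: lt_le_trans tT _; rewrite -ler_pdivrMr //.
apply: le_trans (_ : `|T| / d <= _); first by rewrite ler_wpM2r ?ler_norm // invr_ge0 ltW.
apply: le_trans (ltW (archi_boundP Td)) _.
by rewrite -natrX ler_nat ltnW // ltn_expl.
Qed.

Lemma oneparam_global Y : exists e, forall d, oneparam e d Y.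
Proof.
have [f hf] := choice (oneparam_large Y).
exists (fun t => f (`|t| + 1) t) => d; split; first by rewrite normr0 add0r (hf 1).1.
move=> t _; have t2 : `|t| < `|t| + 2 by lra.
apply: lgd_ext ltr01 _ ((hf (`|t| + 2)).2 _ t2) => u ut.
have u1 : `|u| < `|u| + 1 by lra.
have u2 : `|u| + 1 <= `|t| + 2 by have := ler_normD (u - t) t; rewrite subrK; lra.
apply: (oneparam_uniq (d := `|u| + 1) (Y := Y)) => //.
by split; [case: (hf (`|t| + 2))|move=> s su; apply: (hf _).2; exact: lt_le_trans u2].
Qed.

(** The one-parameter subgroup generated by [Y]. *)
Definition expo Y : R -> G := projT1 (cid (oneparam_global Y)).

Lemma expoP Y d : oneparam (expo Y) d Y.
Proof. by rewrite /expo; case: cid. Qed.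

Lemma expo0 Y : expo Y 0 = 1%g. Proof. by case: (expoP Y 1). Qed.

Lemma lgd_expo Y t : lgd (expo Y) t Y.
Proof. by apply: (expoP Y (`|t| + 1)).2; lra. Qed.

Lemma expo_uniq e Y t : e 0 = 1%g -> (forall s, lgd e s Y) -> e t = expo Y t.
Proof.
move=> e0 he; apply: (@oneparam_uniq _ _ (`|t| + 1) Y); [by split|exact: expoP|lra].
Qed.

Lemma expoN Y t : expo Y (- t) = (expo Y t)^-1%g.
Proof.
apply: (mulgI (expo Y t)); rewrite mulgV.
by apply: (@oneparam_inv _ _ (`|t| + 1) Y); [exact: expoP|exact: expoP|lra].
Qed.

Lemma dat_shift (c t : R) : dat (fun s => c + s) t 1.
Proof. by have := datD (dat_cst c t) (dat_id t); rewrite add0r. Qed.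

Lemma expoD Y s t : expo Y (s + t) = (expo Y s * expo Y t)%g.
Proof.
rewrite -(@expo_uniq (fun t => (expo Y s)^-1 * expo Y (s + t)%R)%g Y t); first by rewrite mulVKg.
  by rewrite addr0 mulVg.
move=> u; apply: lgd_left; rewrite -[Y in lgd _ _ Y]scale1r.
by apply: lgd_comp (dat_shift s u); exact: lgd_expo.
Qed.

Lemma expoZ (c : R) Y t : expo (c *: Y) t = expo Y (c * t).
Proof.
apply/esym; apply: (@expo_uniq (fun t => expo Y (c * t))); first by rewrite mulr0 expo0.
move=> u; apply: lgd_comp; first exact: lgd_expo.
by have := datMc c (dat_id u); rewrite mulr1.
Qed.

Lemma expo_A Y t : Y *m A (expo Y t) = Y.
Proof. by apply: (oneparam_A (expoP Y (`|t| + 1))); lra. Qed.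

(** The derivative of the exponential in the chart is bounded near the
    identity. *)
Lemma expo_local Y : exists d K, [/\ 0 < d, 0 <= K & forall s t, `|s| < d -> `|t| < d ->
  chart_dom phi (expo Y s) /\ `|phi (expo Y s) - phi (expo Y t)| <= K * `|s - t|].
Proof.
have h1 : \forall z \near o, `|Y *m dleft G z| <= `|Y| + 1.
  have := sdiff_cont (dleft_hess G Y); rewrite continuous_eps => /(_ 1 ltr01) /nbhs_eps.
  apply: filterS => z; rewrite dleft_o mulmx1 => h.
  by rewrite -[_ *m _](subrK Y); apply: le_trans (ler_normD _ _) _; lra.
have [d1 d10 h2] := (nbhs_eps _ _).1 (filterI h1 (dleft_sdiff G)).
have cE : {for 0, continuous (expo Y)} by case: (lgd_expo Y 0).
have domE : \forall t \near (0 : R), chart_dom phi (expo Y t).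
  apply: (near_open (f := expo Y) (open_chart_dom phi)) cE.
  by rewrite expo0; exact: dom1.
have cphi : {for 0, continuous (fun t => phi (expo Y t))}.
  by apply: (continuous_comp cE); rewrite expo0; apply: chart_map_continuous; exact: dom1.
move: cphi; rewrite continuous_eps => /(_ (d1 / 2)); rewrite divr_gt0 // => /(_ isT)[d2 d20 h3].
have /nbhs_eps[d3 d30 h4] := domE.
exists (Num.min d2 d3), (`|Y| + 1); split; rewrite ?lt_min ?d20 ?addr_ge0 //.
have D r : `|r| < d2 -> `|r| < d3 -> exists2 v, dat (fun t => phi (expo Y t)) r v & `|v| <= `|Y| + 1.
  move=> r2 r3; have dr : chart_dom phi (expo Y r) by apply: h4; rewrite subr0.
  have [|k1 k2] := h2 (phi (expo Y r)).
    have := h3 r; rewrite subr0 expo0 => /(_ r2) h; apply: le_lt_trans h _; lra.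
  rewrite chart_mapK // in k2.
  exists (Y *m JL phi (expo Y r)); first exact: lgd_chart (atlas_chart1 G) dr (lgd_expo Y r).
  by rewrite /JL (jac_sdiff k2).
move=> s t; rewrite !lt_min => /andP[s2 s3] /andP[t2 t3].
split; first by apply: h4; rewrite subr0.
have Y0 : 0 <= `|Y| + 1 by rewrite addr_ge0.
wlog st : s t s2 s3 t2 t3 / t <= s.
  move=> H; have [ts|/ltW st] := leP t s; first by apply: H.
  by rewrite distrC (distrC s); apply: H.
rewrite (ger0_norm (_ : 0 <= s - t)) ?subr_ge0 //.
apply: (mvt_bound (f := fun t => phi (expo Y t)) st Y0) => r /andP[tr rs].
by apply: D; move: s2 s3 t2 t3; rewrite !ltr_norml; lra.
Qed.

Lemma gLip_expo (f : R -> R) Y a b : lip f a b -> gLip (fun t => expo Y (f t)) a b.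
Proof.
move=> [K0 hf]; pose K := `|K0|; have pK : 0 <= K by exact: normr_ge0.
have {}hf t u : a <= t <= b -> a <= u <= b -> `|f t - f u| <= K * `|t - u|.
  by move=> ht hu; apply: le_trans (hf _ _ ht hu) _; rewrite ler_wpM2r // ler_norm.
have [d [K1 [d0 K10 h]]] := expo_local Y.
move=> t0 ht0; exists (d / (K + 1)), (K1 * K); split; first by rewrite divr_gt0 //; lra.
have E t : ((expo Y (f t0))^-1 * expo Y (f t))%g = expo Y (f t - f t0).
  by rewrite [f t - f t0]addrC expoD expoN.
have B t : a <= t <= b -> `|t - t0| < d / (K + 1) -> `|f t - f t0| < d.
  move=> ht; rewrite ltr_pdivlMr => [td|]; last by lra.
  apply: le_lt_trans (hf _ _ ht ht0) _; apply: le_lt_trans td.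
  by rewrite mulrC ler_wpM2l //; lra.
move=> t u ht hu /(B _ ht) td /(B _ hu) ud; rewrite !E.
have [k1 k2] := h _ _ td ud; split=> //; apply: le_trans k2 _.
by rewrite opprB addrA subrK -mulrA ler_wpM2l // hf.
Qed.

End one_parameter_subgroups.

(** * The graded matrix representation of the Lie algebra *)

Section stratified_algebra.
Context {R : realType} {n s r : nat} (G : carnot_group R n s r).
Local Notation lb := (lb G).
Implicit Types (u v w : 'rV[R]_n).

(** Zero above the degree [s], so that brackets of layers have no exceptional
    case. *)
Definition lay (j : nat) : {vspace 'rV[R]_n} := if (1 <= j <= s)%N then layer G j else 0%VS.

Lemma layE j : (1 <= j <= s)%N -> lay j = layer G j.
Proof. by rewrite /lay => ->. Qed.

Lemma lay_big j : (s < j)%N -> lay j = 0%VS.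
Proof. by rewrite /lay ltnNge andbC => /negPf ->. Qed.

Lemma lay1 : lay 1 = layer G 1.
Proof. by rewrite layE // (leq_trans _ (cg_step G)). Qed.

Lemma lb_lay1 j u v : (1 <= j)%N -> u \in lay 1 -> v \in lay j -> lb u v \in lay j.+1.
Proof.
move=> j1; rewrite lay1 => hu; have [js|sj] := leqP j s; last first.
  by rewrite (lay_big sj) memv0 => /eqP ->; rewrite lie0r mem0v.
rewrite layE ?j1 // => hv; have [jl|] := ltnP j s.
  rewrite layE //; rewrite -lbE; have [h _] := @layer_bracket _ _ _ _ G j.+1 (introT andP (conj j1 jl)).
  exact: h.
rewrite leq_eqVlt ltnNge js orbF => /eqP sj; rewrite lay_big ?sj //.
rewrite -lbE; have [h _] := layer_last G; apply: h; first exact: memvf.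
by rewrite -sj in hv.
Qed.

(** By induction on [i], as the layers are generated by the first one: the
    Jacobi identity moves a bracket with the first layer outside. *)
Lemma lb_lay i j u v : (1 <= i)%N -> (1 <= j)%N -> u \in lay i -> v \in lay j -> lb u v \in lay (i + j).
Proof.
elim: i j u v => [//|[|i] IH] j u v _ j1; first by rewrite add1n; exact: lb_lay1.
have [si|is_] := ltnP s i.+2; first by rewrite (lay_big si) memv0 => /eqP ->; rewrite lie0l mem0v.
rewrite layE // => hu hv.
have [_ h] := @layer_bracket _ _ _ _ G i.+2 (introT andP (conj (isT : 2 <= i.+2)%N is_)).
pose f := linfun (mulmxr (ad G v) : 'rV[R]_n -> 'rV[R]_n).
have fE w : f w = lb v w by rewrite lfunE /= adE.
suff : (layer G i.+2 <= f @^-1: lay (i.+2 + j))%VS.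
  by move=> /subvP /(_ _ hu); rewrite -memv_preim fE lieC memvN.
apply: h => a b ha hb; rewrite -memv_preim fE lbE.
have {}ha : a \in lay 1 by rewrite lay1.
have {}hb : b \in lay i.+1 by rewrite layE // (ltnW is_).
rewrite jacobi; apply: memvD.
  rewrite lieC memvN (_ : (i.+2 + j)%N = (i.+1 + j.+1)%N); last by rewrite addSnnS.
  by apply: IH => //; rewrite lieC memvN; exact: lb_lay1.
rewrite (_ : (i.+2 + j)%N = (i.+1 + j).+1) //; apply: lb_lay1 => //.
by rewrite lieC memvN; exact: IH.
Qed.

(** Bases of the layers are put together and sorted by degree; the order
    matters in [lb_Y_crd], hence in the ordered products of [Gm]. *)
Lemma adapted_basis : exists (P : 'M[R]_n) (d : 'I_n -> nat),
  [/\ P \in unitmx, forall k, (1 <= d k <= s)%N, forall k, row k P \in layer G (d k) &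
      forall k l : 'I_n, (k <= l)%N -> (d k <= d l)%N].
Proof.
pose X := \big[cat/[::]]_(j < s) (vbasis (layer G j.+1) : seq 'rV[R]_n).
have bX : basis_of fullv X.
  rewrite -(layer_total G); apply: bigcat_basis; first exact: layer_direct.
  by move=> j _; exact: vbasisP.
pose w (y : 'rV[R]_n) := if [pick j : 'I_s | y \in layer G j.+1] is Some j then (val j).+1 else 0%N.
have hw y : y \in X -> (1 <= w y <= s)%N /\ y \in layer G (w y).
  move=> yX; have [j hj] : exists j : 'I_s, y \in layer G j.+1.
    move: yX; rewrite /X; elim/big_ind: _ => // [a b ha hb|j _ hy].
      by rewrite mem_cat => /orP[]; [exact: ha|exact: hb].
    by exists j; exact: vbasis_mem hy.
  by rewrite /w; case: pickP => [k hk|/(_ j)]; [rewrite ltn_ord|rewrite hj].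
pose le : rel 'rV[R]_n := fun a b => (w a <= w b)%N.
have le_total : total le by move=> a b; exact: leq_total.
have le_trans : transitive le by move=> a b c; exact: leq_trans.
pose X' := sort le X.
have pX : perm_eq X' X by rewrite perm_sort.
have bX' : basis_of fullv X' by rewrite (perm_basis _ pX).
have szX : size X' == n.
  have /andP[/eqP sX fX] := bX'; move: fX; rewrite /free sX dimvf => /eqP <-.
  by rewrite /dim /= mul1n.
pose T := Tuple szX.
have freeT : free T by have /andP[] := bX'.
have Tk (k : 'I_n) : X'`_k \in X by rewrite -(perm_mem pX) mem_nth // (eqP szX).
exists (\matrix_k X'`_k), (fun k => w X'`_k); split.
- rewrite -row_free_unit; apply: inj_row_free => v hv; apply/rowP => k; rewrite mxE.
  move/freeP: freeT => hf; apply: (hf (fun k => v 0 k)); rewrite -[RHS]hv mulmx_sum_row.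
  by apply: eq_bigr => l _; rewrite rowK.
- by move=> k; case: (hw _ (Tk k)).
- by move=> k; rewrite rowK; case: (hw _ (Tk k)).
- move=> k l kl; apply: (sorted_leq_nth le_trans _ 0 (sort_sorted le_total X)) => //.
  + by move=> y; exact: leqnn.
  + by rewrite inE (eqP szX).
  + by rewrite inE (eqP szX).
Qed.

Context (P : 'M[R]_n) (d : 'I_n -> nat).
Context (P_unit : P \in unitmx) (d_s : forall k, (1 <= d k <= s)%N).
Context (P_lay : forall k, row k P \in layer G (d k)).
Context (d_mono : forall k l : 'I_n, (k <= l)%N -> (d k <= d l)%N).

Local Notation Y k := (row k P).

(** The coordinates in the adapted basis. *)
Definition crd u : 'rV[R]_n := u *m invmx P.

Lemma crdK u : crd u *m P = u. Proof. by rewrite /crd mulmxKV. Qed.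

Lemma crdD u v : crd (u + v) = crd u + crd v. Proof. exact: mulmxDl. Qed.
Lemma crdZ (c : R) u : crd (c *: u) = c *: crd u. Proof. by rewrite /crd scalemxAl. Qed.

Lemma crd_sum u : u = \sum_k crd u 0 k *: Y k.
Proof. by rewrite -{1}(crdK u) mulmx_sum_row. Qed.

Lemma crd_Y k : crd (Y k) = delta_mx 0 k.
Proof. by rewrite /crd rowE -mulmxA mulmxV // mulmx1. Qed.

Lemma Y_lay k : Y k \in lay (d k). Proof. by rewrite layE. Qed.

(** The components of [u] in the layers are unique, since the sum of the
    layers is direct. *)
Lemma lay_crd j u k : u \in lay j -> d k != j -> crd u 0 k = 0.
Proof.
have [js|nj] := boolP (1 <= j <= s)%N; last first.
  by rewrite /lay (negPf nj) memv0 => /eqP -> _; rewrite /crd mul0mx mxE.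
rewrite layE // => hu dk.
have dlt l : ((d l).-1 < s)%N by have /andP[] := d_s l; case: (d l).
pose pk l : 'I_s := Ordinal (dlt l).
have pkE l : (pk l).+1 = d l by rewrite /=; have /andP[] := d_s l; case: (d l).
pose wt_ i := \sum_(l | pk l == i) crd u 0 l *: Y l.
have jlt : (j.-1 < s)%N by case: (j) js.
pose j0 : 'I_s := Ordinal jlt; have j0E : j0.+1 = j by rewrite /=; case: (j) js.
have E : \sum_(i < s) wt_ i = \sum_(i < s) (if i == j0 then u else 0).
  rewrite -big_mkcond big_pred1_eq [RHS](crd_sum u).
  by rewrite (partition_big pk xpredT).
have H : forall i, true -> wt_ i = if i == j0 then u else 0.
  have /directv_sum_unique hu2 := layer_direct G.
  have := hu2 wt_ (fun i => if i == j0 then u else 0); rewrite E eqxx.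
  move=> /(_ _ _)/esym H i _; apply/eqP; move: i (erefl true); apply/forall_inP; apply: H.
  - by move=> i _; apply: memv_suml => l /eqP <-; rewrite pkE; apply: memvZ.
  - by move=> i _; case: eqP => [->|_]; [rewrite j0E|exact: mem0v].
have {H} := H (pk k) isT; case: eqP => [pkj|_ h]; first by move: dk; rewrite -pkE pkj j0E eqxx.
pose m : 'rV[R]_n := \row_l (if pk l == pk k then crd u 0 l else 0).
have mP : m *m P = 0.
  rewrite -h mulmx_sum_row [RHS]big_mkcond; apply: eq_bigr => l _; rewrite mxE.
  by case: ifP => _; rewrite ?scale0r.
have : m 0 k = 0 by rewrite -[m]mulmx1 -(mulmxV P_unit) mulmxA mP mul0mx mxE.
by rewrite mxE eqxx.
Qed.

Definition degs : 'rV[R]_n := \row_k (d k)%:R.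

(** The derivation which multiplies the layer of degree [j] by [j], the
    generator of the dilations. *)
Definition der : 'M[R]_n := invmx P *m diag_mx degs *m P.

Lemma der_crd u : crd (u *m der) = crd u *m diag_mx degs.
Proof. by rewrite /crd /der !mulmxA mulmxK. Qed.

Lemma der_lay j u : u \in lay j -> u *m der = j%:R *: u.
Proof.
move=> hu; rewrite -[LHS]crdK der_crd -[in RHS](crdK u) scalemxAl; congr (_ *m _).
apply/rowP => k; rewrite mul_mx_diag [LHS]mxE [RHS]mxE [degs _ _]mxE.
have [->|dk] := eqVneq (d k) j; first by rewrite mulrC.
by rewrite (lay_crd hu dk) mul0r mulr0.
Qed.

Lemma der_lb u v : lb u v *m der = lb (u *m der) v + lb u (v *m der).
Proof.
have dY k : Y k *m der = (d k)%:R *: Y k by apply/der_lay/Y_lay.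
have d1 k : (1 <= d k)%N by case/andP: (d_s k).
rewrite [in RHS](crd_sum u) [in LHS](crd_sum u) !mulmx_suml !lie_suml mulmx_suml -big_split.
apply: eq_bigr => k _; rewrite (crd_sum v) !mulmx_suml !lie_sumr mulmx_suml -big_split.
apply: eq_bigr => l _ /=.
rewrite -!scalemxAl !dY !(lieZl, lieZr) -!scalemxAl.
rewrite (der_lay (lb_lay (d1 k) (d1 l) (Y_lay k) (Y_lay l))).
rewrite !scalerA -scalerDl natrD; congr (_ *: _); ring.
Qed.

(** The first basis vector of R^(n+1), of weight 0, stands for the derivation
    [der]; the others, for the adapted basis. *)
Definition wt (i : 'I_n.+1) : nat := if fintype.split (i : 'I_(1 + n)) is inr k then d k else 0%N.

Definition ie0 : 'I_n.+1 := @lshift 1 n ord0.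
Definition ie (k : 'I_n) : 'I_n.+1 := @rshift 1 n k.

Lemma wt_e0 : wt ie0 = 0%N. Proof. by rewrite /wt (unsplitK (inl _ ord0)). Qed.
Lemma wt_e k : wt (ie k) = d k. Proof. by rewrite /wt (unsplitK (inr _ k)). Qed.

Lemma idxP (i : 'I_n.+1) : i = ie0 \/ exists k, i = ie k.
Proof.
rewrite -(splitK (i : 'I_(1 + n))); case: fintype.split => k; last by right; exists k.
by left; rewrite (ord1 k).
Qed.

Lemma wt_s i : (wt i <= s)%N.
Proof.
by case: (idxP i) => [->|[k ->]]; rewrite ?wt_e0 // wt_e; case/andP: (d_s k).
Qed.

(** The adjoint representation of the Lie algebra extended by the derivation
    [der], restricted to the algebra itself. Its kernel is trivial, whereas
    the adjoint representation kills the centre: the first column of [rho u]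
    contains [u *m der]. Matrices act on columns. *)
Definition rho u : 'M[R]_n.+1 :=
  block_mx (0 : 'M[R]_1) 0 (crd (u *m der))^T (P *m ad G u *m invmx P)^T.

Lemma rho_e0 u j : rho u ie0 j = 0.
Proof.
case: (idxP j) => [->|[k ->]]; first by rewrite /rho /ie0 (@block_mxEul _ 1 n 1 n) mxE.
by rewrite /rho /ie0 /ie (@block_mxEur _ 1 n 1 n) mxE.
Qed.

Lemma rho_col u k : rho u (ie k) ie0 = (d k)%:R * crd u 0 k.
Proof.
rewrite /rho /ie /ie0 (@block_mxEdl _ 1 n 1 n) mxE der_crd mul_mx_diag !mxE mulrC.
by [].
Qed.

Lemma rho_entry u k l : rho u (ie k) (ie l) = crd (lb u (Y l)) 0 k.
Proof.
rewrite /rho /ie (@block_mxEdr _ 1 n 1 n) mxE -adE /crd -!row_mul [RHS]mxE.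
by [].
Qed.

Lemma adD u v : ad G (u + v) = ad G u + ad G v.
Proof.
rewrite (adl G (u + v)) (adl G u) (adl G v) -big_split; apply: eq_bigr => i _.
by rewrite mxE scalerDl.
Qed.

Lemma adZ (c : R) u : ad G (c *: u) = c *: ad G u.
Proof. by rewrite (adl G (c *: u)) (adl G u) scaler_sumr; apply: eq_bigr => i _; rewrite mxE scalerA. Qed.

Lemma rhoD u v : rho (u + v) = rho u + rho v.
Proof.
rewrite /rho mulmxDl crdD adD mulmxDr mulmxDl !linearD /=.
by rewrite [RHS](@add_block_mx _ 1 n 1 n) !addr0.
Qed.

Lemma rhoZ (c : R) u : rho (c *: u) = c *: rho u.
Proof.
rewrite /rho -scalemxAl crdZ adZ -scalemxAr -scalemxAl !linearZ /=.
by rewrite [RHS](@scale_block_mx _ 1 n 1 n) !scaler0.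
Qed.

Lemma rho0 : rho 0 = 0. Proof. by rewrite -(scale0r 0) rhoZ !scale0r. Qed.

Lemma rhoN u : rho (- u) = - rho u. Proof. by rewrite -scaleN1r rhoZ scaleN1r. Qed.

Lemma rhoB u v : rho (u - v) = rho u - rho v. Proof. by rewrite rhoD rhoN. Qed.

Lemma rho_sum (I : finType) (F : I -> 'rV[R]_n) : rho (\sum_i F i) = \sum_i rho (F i).
Proof. by apply: (big_morph rho) => [u v|]; [exact: rhoD|exact: rho0]. Qed.

Lemma ad_lb u v : ad G (lb u v) = ad G v *m ad G u - ad G u *m ad G v.
Proof.
apply/row_matrixP => i; rewrite rowE [RHS]rowE; move: (delta_mx 0 i) => w.
by rewrite mulmxBr !mulmxA !adE (jacobi G u v) addrK.
Qed.

Lemma block_comm m (a a' : 'M[R]_(m, 1)) (b b' : 'M[R]_m) :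
  block_mx (0 : 'M[R]_1) 0 a b *m block_mx 0 0 a' b' - block_mx 0 0 a' b' *m block_mx 0 0 a b =
  block_mx 0 0 (b *m a' - b' *m a) (b *m b' - b' *m b).
Proof.
rewrite !mulmx_block opp_block_mx add_block_mx; congr block_mx;
  by rewrite !(mul0mx, mulmx0, addr0, add0r, oppr0).
Qed.

Lemma rho_lb u v : rho (lb u v) = rho u * rho v - rho v * rho u.
Proof.
apply: etrans (esym (block_comm _ _ _ _)); rewrite -!trmx_mul -!linearB /=.
congr (block_mx 0 0 (_^T) (_^T)).
  rewrite der_lb crdD /crd !mulmxA !mulmxKV // !adE addrC; congr (_ + _).
  by rewrite lieC mulNmx.
by rewrite ad_lb mulmxBr mulmxBl !mulmxA !mulmxKV.
Qed.

Lemma rho_Hom j u : (1 <= j)%N -> u \in lay j -> Hom wt j (rho u).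
Proof.
move=> j1 hu k l.
have d1 i : (1 <= d i)%N by case/andP: (d_s i).
case: (idxP k) => [->|[k' ->]]; first by rewrite rho_e0.
case: (idxP l) => [->|[l' ->]]; rewrite wt_e ?wt_e0 ?wt_e.
  by rewrite add0n rho_col => h; rewrite (lay_crd hu h) mulr0.
rewrite rho_entry addnC => h.
exact: lay_crd (lb_lay j1 (d1 l') hu (Y_lay l')) h.
Qed.

Lemma rho_Fil u : Fil wt 1 (rho u).
Proof.
rewrite (crd_sum u) rho_sum; apply: Fil_sum => k; rewrite rhoZ; apply: FilZ.
have /andP[d1 _] := d_s k.
exact: Fil_le d1 (Hom_Fil (rho_Hom d1 (Y_lay k))).
Qed.

(** A left inverse of [rho], read off the first column. *)
Definition unrho (m : 'M[R]_n.+1) : 'rV[R]_n := (\row_k (m (ie k) ie0 / (d k)%:R)) *m P.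

Lemma rhoK u : unrho (rho u) = u.
Proof.
rewrite -[RHS]crdK; congr (_ *m _); apply/rowP => k; rewrite mxE rho_col mulrC mulKf //.
by rewrite pnatr_eq0 -lt0n; case/andP: (d_s k).
Qed.

Lemma norm_unrho : exists2 C, 0 <= C & forall m, `|unrho m| <= C * `|m|.
Proof.
exists (n%:R * `|P|); first by rewrite mulr_ge0.
move=> m; apply: le_trans (norm_mulmx _ _) _; rewrite mulrAC ler_wpM2l ?mulr_ge0 //.
apply: norm_mx_le => [|i k]; first exact: normr_ge0.
rewrite mxE normrM (ger0_norm (_ : 0 <= (d k)%:R^-1)) ?invr_ge0 ?ler0n //.
rewrite ler_pdivrMr ?ltr0n; last by case/andP: (d_s k).
apply: le_trans (norm_entry m (ie k) ie0) _.
by rewrite ler_peMr // ler1n; case/andP: (d_s k).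
Qed.

(** A bracket with [Y i] has degree larger than [d i], hence no component
    along the vectors up to [Y i] in the sorted basis. *)
Lemma lb_Y_crd (i k : 'I_n) w : (k <= i)%N -> crd (lb (Y i) w) 0 k = 0.
Proof.
move=> ki; rewrite (crd_sum w) lie_sumr /crd mulmx_suml summxE big1 // => l _.
rewrite lieZr -scalemxAl mxE -/(crd _).
have d1 j : (1 <= d j)%N by case/andP: (d_s j).
rewrite (lay_crd (lb_lay (d1 i) (d1 l) (Y_lay i) (Y_lay l))) ?mulr0 //.
rewrite neq_ltn; apply/orP; left; apply: leq_ltn_trans (d_mono ki) _.
by rewrite -addn1 leq_add2l.
Qed.

(** * The group of matrices of the Carnot group *)

Local Notation M := 'M[R]_n.+1.
Local Notation nexp := (nexp (R := R) (n := n) s).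
Local Notation expo := (expo G).

Lemma rho_ext u : rho u = \sum_i u 0 i *: rho (delta_mx 0 i).
Proof. by rewrite {1}(delta_sum u) rho_sum; apply: eq_bigr => i _; rewrite rhoZ. Qed.

Lemma dat_rho (f : R -> 'rV[R]_n) t v : dat f t v -> dat (fun x => rho (f x)) t (rho v).
Proof.
move=> /dat_mxP hf; rewrite (rho_ext v).
have h i : dat (fun x => f x 0 i *: rho (delta_mx 0 i)) t (v 0 i *: rho (delta_mx 0 i)).
  apply: (dat_comp (f := fun x : R => x *: rho (delta_mx 0 i))) (hf 0 i) => e e0.
  by exists 1 => // u _; rewrite -scalerBl subrr normr0 mulr_ge0 // (ltW e0).
by apply: dat_ext ltr01 _ (dat_sum h) => x _; rewrite -rho_ext.
Qed.

Lemma dat_mulr (f g : R -> M) t (v w : M) : dat f t v -> dat g t w ->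
  dat (fun x => f x * g x) t (v * g t + f t * w).
Proof. exact: dat_mulmx. Qed.

Lemma rhoFilZ (x : R) u : Fil wt 1 (x *: rho u). Proof. exact/FilZ/rho_Fil. Qed.

Lemma dat_exp u t : dat (fun x => nexp (x *: rho u)) t (rho u * nexp (t *: rho u)).
Proof. exact: (dat_nexp wt_s t (rho_Fil u)). Qed.

Lemma exp_comm u (x : R) : rho u * nexp (x *: rho u) = nexp (x *: rho u) * rho u.
Proof. by apply: nexp_comm; rewrite -scalerAr scalerAl. Qed.

Lemma expVl u (x : R) : nexp (x *: rho u) * nexp ((- x) *: rho u) = 1.
Proof. by rewrite scaleNr; exact: (nexp_mulN wt_s (rhoFilZ x u)). Qed.

Lemma expVr u (x : R) : nexp ((- x) *: rho u) * nexp (x *: rho u) = 1.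
Proof. by rewrite -{2}[x]opprK expVl. Qed.

Lemma dat_expN u t : dat (fun x => nexp ((- x) *: rho u)) t (- (nexp ((- t) *: rho u) * rho u)).
Proof.
rewrite -exp_comm -scaleN1r; apply: (dat_comp (f := fun x : R => nexp (x *: rho u))).
  exact: dat_exp.
by have := datMc (-1) (dat_id t); rewrite mulr1; apply: dat_ext ltr01 _ => x _; rewrite mulN1r.
Qed.

(** Multiplied by the exponentials on both sides, the left-hand side has
    vanishing derivative. *)
Lemma rho_A u v (x : R) :
  rho (v *m A (expo u x)) = nexp (x *: rho u) * rho v * nexp ((- x) *: rho u).
Proof.
pose F (t : R) : M := nexp ((- t) *: rho u) * rho (v *m A (expo u t)) * nexp (t *: rho u).
have dF t : dat F t 0.
  have dA : dat (fun t => v *m A (expo u t)) t (lb u (v *m A (expo u t))).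
    have := dat_mulmx (dat_cst v t) (dat_A (lgd_expo G u t)).
    by rewrite mul0mx add0r mulmxA adE -A_lie expo_A.
  have h := dat_mulr (dat_mulr (dat_expN u t) (dat_rho dA)) (dat_exp u t).
  apply: dat_eq h _; rewrite rho_lb.
  set a := nexp (- t *: _); set b := rho (_ *m _); set c := nexp (t *: _).
  by rewrite mulrBr mulNr !mulrA addKr mulNr addNr.
have F0 : F 0 = rho v.
  by rewrite /F oppr0 !scale0r nexp0 mul1r mulr1 expo0 A1 mulmx1.
have Fx : F x = rho v by rewrite -F0; apply: (@dat0_const _ _ _ F).
rewrite -Fx /F !mulrA expVl mul1r -mulrA expVl mulr1.
by [].
Qed.

(** Brackets with [Y i] have no component along the vectors up to [Y i], so
    the flow of the adjoint action of [Y i] fixes these components. *)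
Lemma crd_A (i k : 'I_n) w (x : R) : (k <= i)%N -> crd (w *m A (expo (Y i) x)) 0 k = crd w 0 k.
Proof.
move=> ki; pose C : 'M[R]_(n, 1) := invmx P *m delta_mx k 0.
have E u : crd u 0 k = (u *m C) 0 0.
  by rewrite /C mulmxA -colE [RHS]mxE.
rewrite !E; congr (fun_of_matrix _ 0 0).
pose F (t : R) := w *m A (expo (Y i) t) *m C.
have F0 : F 0 = w *m C by rewrite /F expo0 A1 mulmx1.
rewrite -F0 -/(F x); apply: (@dat0_const _ _ _ F) => t _.
have h := dat_mulmx (dat_mulmx (dat_cst w t) (dat_A (lgd_expo G (Y i) t))) (dat_cst C t).
apply: dat_eq h _; rewrite mul0mx add0r mulmx0 addr0 mulmxA adE -A_lie expo_A.
by apply/matrixP => a b; rewrite !ord1 -E lb_Y_crd // mxE.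
Qed.

Definition Yn (i : nat) : 'rV[R]_n := oapp (fun k : 'I_n => Y k) 0 (insub i).

Lemma Yn_ord (k : 'I_n) : Yn k = Y k. Proof. by rewrite /Yn valK. Qed.

(** Ordered products of exponentials of multiples of the last [k] basis
    vectors, in the group and in the group of matrices. For [k = n] it is the
    graph of an isomorphism from [G] to a group of matrices; that it is stable
    under products is seen by lifting curves. *)
Fixpoint Gm (k : nat) (q : G) (m : M) : Prop :=
  if k is k'.+1 then exists q' m' (x : R), [/\ Gm k' q' m', q = (q' * expo (Yn (n - k)) x)%g &
    m = m' * nexp (x *: rho (Yn (n - k)))]
  else q = 1%g /\ m = 1.

Lemma Gm_one k : Gm k 1%g 1.
Proof.
elim: k => [//|k IH]; exists 1%g, 1, 0; split=> //; first by rewrite expo0 mulg1.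
by rewrite scale0r nexp0 mulr1.
Qed.

Lemma unrho_crd m k : crd (unrho m) 0 k = m (ie k) ie0 / (d k)%:R.
Proof. by rewrite /unrho /crd mulmxK // mxE. Qed.

(** Shows that the coordinates are Lipschitz functions of [x]. *)
Lemma crd_rho_A v i k (x : R) : crd (v *m A (expo (Y i) x)) 0 k =
  (nexp (x *: rho (Y i)) * rho v * nexp ((- x) *: rho (Y i))) (ie k) ie0 / (d k)%:R.
Proof. by rewrite -rho_A -unrho_crd rhoK. Qed.

Lemma lip_mulr (f g : R -> M) a b : lip f a b -> lip g a b -> lip (fun x => f x * g x) a b.
Proof. exact: lip_mulmx. Qed.

Definition comb (h : 'I_n -> R -> R) (t : R) : 'rV[R]_n := (\row_i h i t) *m P.

Lemma crd_comb h t k : crd (comb h t) 0 k = h k t.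
Proof. by rewrite /comb /crd mulmxK // mxE. Qed.

Lemma comb_sum h t : comb h t = \sum_k h k t *: Y k.
Proof. by rewrite /comb mulmx_sum_row; apply: eq_bigr => k _; rewrite mxE. Qed.

(** The span of the last [k] basis vectors is an ideal. The factor along the
    first of them is found by integrating the corresponding control and
    divided out; the rest of the curve has its derivative in the smaller
    ideal, since the adjoint action of the factor leaves the first components
    unchanged, and the induction applies. *)
Lemma peel k (a b : R) (gam : R -> G) (h : 'I_n -> R -> R) (m0 : M) : (k <= n)%N -> a <= b ->
  gLip gam a b -> (forall i, bmeas (h i) a b) ->
  (forall t (i : 'I_n), (i < n - k)%N -> h i t = 0) ->
  aei a b (fun t => lgd gam t (comb h t)) -> Gm k (gam a) m0 ->
  exists2 M1 : R -> M, M1 a = m0 & [/\ lip M1 a b,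
    aei a b (fun t => dat M1 t (M1 t * rho (comb h t))) &
    forall t, a <= t <= b -> Gm k (gam t) (M1 t)].
Proof.
elim: k gam h m0 => [|k IH] gam h m0 kn ab lgam mh h0 dgam /= hm0.
  have h00 t : comb h t = 0.
    by rewrite comb_sum big1 // => i _; rewrite h0 ?scale0r // subn0.
  case: hm0 => ga m01; exists (fun=> m0) => //; split; first exact: lip_cst.
    by apply: aei_all => t _; rewrite h00 rho0 mulr0; exact: dat_cst.
  move=> t /andP[at_ tb]; split=> //; rewrite -ga; apply: (lgd_const at_).
    exact: gLip_sub lgam.
  by apply: aei_imp (aei_sub (lexx a) tb dgam) => u _; rewrite h00.
have ilt : (n - k.+1 < n)%N by rewrite -subn_gt0 subKn.
pose i0 : 'I_n := Ordinal ilt.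
have YE : Yn (n - k.+1) = Y i0 by rewrite -(Yn_ord i0).
rewrite YE in hm0; case: hm0 => q' [m' [x0 [hm' ga m0E]]].
have [F [Fl Fd _]] := bmeas_primitive (mh i0).
pose x t := x0 + (F t - F a).
have xl : lip x a b.
  by apply: lipD; [exact: lip_cst|apply: lipD => //; exact: lip_cst].
have xa : x a = x0 by rewrite /x subrr addr0.
have xd : aei a b (fun t => dat x t (h i0 t)).
  apply: aei_imp Fd => t _ Ft.
  by have := datD (dat_cst x0 t) (datB Ft (dat_cst (F a) t)); rewrite subr0 add0r.
have xNl : lip (fun t => - x t) a b by exact: lipN.
pose gam1 t := (gam t * expo (Y i0) (- x t))%g.
pose cf l j t := crd (Y l *m A (expo (Y i0) (x t))) 0 j.
have cfl l j : lip (cf l j) a b.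
  have H : lip (fun t => nexp (x t *: rho (Y i0)) * rho (Y l) * nexp ((- x t) *: rho (Y i0))) a b.
    apply: lip_mulr; last exact: (lip_nexp s (rho (Y i0)) xNl).
    by apply: lip_mulr; [exact: lip_nexp|exact: lip_cst].
  have := lipM ((lip_mxP _ _ _).1 H (ie j) ie0) (lip_cst ((d j)%:R^-1 : R) a b).
  congr (lip _ a b); apply/funext => t.
  by rewrite /cf crd_rho_A.
pose h1 j t := \sum_l h l t * cf l j t + (if j == i0 then - h i0 t else 0).
have h1b j : bmeas (h1 j) a b.
  apply: bmeasD; first by apply: bmeas_sum => l; apply: bmeasM => //; exact: lip_bmeas.
  case: eqP => _; last exact: bmeas_cst.
  have := bmeasM (bmeas_cst (-1) a b) (mh i0).
  by apply: bmeas_ext => t _; rewrite mulN1r.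
have h1E t : comb h1 t = comb h t *m A (expo (Y i0) (x t)) - h i0 t *: Y i0.
  rewrite -[LHS]crdK -[RHS]crdK; congr (_ *m _); apply/rowP => j; rewrite crd_comb.
  rewrite crdD [RHS]mxE /h1; congr (_ + _).
    rewrite comb_sum mulmx_suml {1}/crd mulmx_suml summxE; apply: eq_bigr => l _.
    by rewrite -!scalemxAl [RHS]mxE.
  rewrite -scaleNr crdZ crd_Y [RHS]mxE [X in _ = _ * X]mxE eqxx /=.
  by case: eqP; rewrite ?mulr1 ?mulr0.
have [||||M1 M1a [M1l M1d M1G]] := IH gam1 h1 m' (ltnW kn) ab _ h1b.
- by apply: gLipM => //; exact: gLip_expo.
- move=> t j; rewrite -subnSK // ltnS => ji.
  rewrite -crd_comb h1E crdD mxE crd_A // crd_comb -scaleNr crdZ mxE crd_Y mxE eqxx /=.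
  have [->|ne] := eqVneq j i0; first by rewrite mulr1 subrr.
  by rewrite mulr0 addr0 h0 // ltn_neqAle ji andbT.
- apply: aei_imp (aei_and dgam xd) => t _ [d1 d2].
  have dx : dat (fun u : R => - x u) t (- h i0 t).
    by have := datMc (-1) d2; rewrite mulN1r; apply: dat_ext ltr01 _ => u _; rewrite mulN1r.
  have d3 := lgd_comp (x := expo (Y i0)) (f := fun u : R => - x u) (lgd_expo G (Y i0) (- x t)) dx.
  apply: lgd_eq (lgdM d1 d3) _.
  by rewrite h1E expoN invgK scaleNr.
- by rewrite /gam1 ga xa -mulgA -expoD subrr expo0 mulg1.
exists (fun t => M1 t * nexp (x t *: rho (Y i0))); first by rewrite M1a xa.
split; first by apply: lip_mulr => //; exact: lip_nexp.
  apply: aei_imp (aei_and M1d xd) => t _ [d1 d2].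
  have de := dat_comp (f := fun y : R => nexp (y *: rho (Y i0))) (dat_exp (Y i0) (x t)) d2.
  apply: dat_eq (dat_mulr d1 de) _.
  rewrite h1E rhoB rhoZ rho_A -scalerAr mulrBr mulrBl !mulrA -[X in X - _]mulrA expVr mulr1.
  rewrite -scalerAr -scalerAl -!mulrA exp_comm.
  by rewrite subrK.
move=> t ht; exists (gam1 t), (M1 t), (x t); split; first exact: M1G.
  by rewrite YE /gam1 -mulgA -expoD addNr expo0 mulg1.
by rewrite YE.
Qed.

Lemma nexp_row (m : M) i j : (forall j, m i j = 0) -> nexp m i j = (i == j)%:R.
Proof.
move=> h; rewrite /nexp big_ord_recl fact0 invr1 scale1r expr0 mxE [X in X + _]mxE summxE.
rewrite big1 ?addr0 // => p _; rewrite mxE exprS mxE big1 ?mulr0 // => l _.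
by rewrite h mul0r.
Qed.

Lemma nexp_row2 (m : M) i j : (1 <= s)%N -> (forall j, (m * m) i j = 0) ->
  nexp m i j = (i == j)%:R + m i j.
Proof.
move=> s1 h; rewrite -[nexp m](subrK 1) -[nexp m - 1](subrK m) nexp_tail //.
rewrite mxE [X in X + _]mxE summxE big1 => [|p _]; first by rewrite add0r addrC mxE.
rewrite mxE !exprS mulrA mxE big1 ?mulr0 // => l _; by rewrite h mul0r.
Qed.

Lemma row_mulr (a b : M) i j : (forall j, a i j = (i == j)%:R) -> (a * b) i j = b i j.
Proof.
move=> h; rewrite mxE (bigD1 i) //= h eqxx mul1r big1 ?addr0 // => l li.
by rewrite h eq_sym (negPf li) mul0r.
Qed.

Lemma s_pos : (1 <= s)%N. Proof. exact: leq_trans _ (cg_step G). Qed.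

(** The rows indexed by the derivation and by the first [l] basis vectors. *)
Definition first_row (l : nat) (i : 'I_n.+1) := i = ie0 \/ exists2 k : 'I_n, i = ie k & (k < l)%N.

Lemma rho_Y_row (i0 : 'I_n) i j : first_row i0 i -> rho (Y i0) i j = 0.
Proof.
case=> [->|[k -> ki]]; first exact: rho_e0.
case: (idxP j) => [->|[l ->]]; last by rewrite rho_entry lb_Y_crd // ltnW.
rewrite rho_col crd_Y mxE eqxx /= (_ : k == i0 = false) ?mulr0 //.
by apply/negbTE; rewrite neq_ltn; apply/orP; left.
Qed.

Lemma rho_Y_row0 (i0 : 'I_n) j : rho (Y i0) (ie i0) j = if j == ie0 then (d i0)%:R else 0.
Proof.
case: (idxP j) => [->|[l ->]]; first by rewrite eqxx rho_col crd_Y mxE !eqxx mulr1.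
by rewrite rho_entry lb_Y_crd // (_ : ie l == ie0 = false) // -val_eqE.
Qed.

Lemma Gm_row k q m : (k <= n)%N -> Gm k q m -> forall i j, first_row (n - k) i -> m i j = (i == j)%:R.
Proof.
elim: k q m => [|k IH] q m kn /=; first by case=> _ -> i j _; rewrite mxE.
case=> q' [m' [x [hm' _ ->]]] i j hi.
have ilt : (n - k.+1 < n)%N by rewrite -subn_gt0 subKn.
rewrite -[(n - k.+1)%N]/(val (Ordinal ilt)) Yn_ord.
rewrite row_mulr.
  by apply: nexp_row => j'; rewrite mxE rho_Y_row ?mulr0.
move=> j'; apply: IH hm' _ _ _; first exact: ltnW.
case: hi => [->|[l -> hl]]; [by left|right; exists l => //].
by apply: leq_trans hl _; rewrite leq_sub2l.
Qed.

Lemma Gm_entry k q m (x : R) (i0 : 'I_n) : (k < n)%N -> val i0 = (n - k.+1)%N -> Gm k q m ->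
  (m * nexp (x *: rho (Y i0))) (ie i0) ie0 = x * (d i0)%:R.
Proof.
move=> kn iE hm; rewrite row_mulr.
  rewrite nexp_row2 ?s_pos // => [|j]; first by rewrite (_ : ie i0 == ie0 = false) // add0r mxE rho_Y_row0 eqxx.
  rewrite -scalerAl mxE -scalerAr mxE mxE big1 ?mulr0 // => l _; rewrite rho_Y_row0.
  by case: eqP => [->|_]; rewrite ?mul0r // rho_e0 mulr0.
move=> j; apply: (Gm_row (ltnW kn) hm); right; exists i0 => //.
have -> : (i0 : nat) = (n - k.+1)%N := iE.
by rewrite -(subnSK kn).
Qed.

(** In the row of the first basis vector of the product, the first column
    contains the last parameter, times a degree; the corresponding factor is
    cancelled, and so on. *)
Lemma Gm_inj k q q' m : (k <= n)%N -> Gm k q m -> Gm k q' m -> q = q'.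
Proof.
elim: k q q' m => [|k IH] q q' m kn /=; first by case=> -> _ [-> _].
case=> q1 [m1 [x1 [h1 -> mE1]]] [q2 [m2 [x2 [h2 -> mE2]]]].
have ilt : (n - k.+1 < n)%N by rewrite -subn_gt0 subKn.
pose i0 := Ordinal ilt; have YE : Yn (n - k.+1) = Y i0 by rewrite -(Yn_ord i0).
rewrite YE in mE1 mE2 *.
have e1 := @Gm_entry k q1 m1 x1 i0 kn erefl h1; have e2 := @Gm_entry k q2 m2 x2 i0 kn erefl h2.
have d0 : (d i0)%:R != 0 :> R by rewrite pnatr_eq0 -lt0n; case/andP: (d_s i0).
have x12 : x1 = x2 by apply: (mulIf d0); rewrite -e1 -e2 -mE1 mE2.
rewrite -x12 in mE2 *; congr (_ * _)%g; apply: (IH _ _ m1) h1 _; first exact: ltnW.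
have -> // : m1 = m2.
by rewrite -[m1]mulr1 -[m2]mulr1 -(expVl (Y i0) x1) !mulrA -mE1 -mE2.
Qed.

(** The curve which follows the one-parameter subgroup of [v] from [q] lifts
    by [peel], and the lift solves the equation of the exponential. *)
Lemma Gm_exp q m v (x : R) : Gm n q m -> Gm n (q * expo v x)%g (m * nexp (x *: rho v)).
Proof.
wlog x1 : v x / x = 1.
  move=> H hm; have := H (x *: v) 1 erefl hm.
  by rewrite expoZ mulr1 scale1r rhoZ.
rewrite x1 => hm; pose gam t := (q * expo v t)%g.
pose h i (t : R) := crd v 0 i.
have hE t : comb h t = v.
  rewrite -[RHS]crdK /comb; congr (_ *m _); apply/rowP => i; by rewrite mxE.
have [|||||M1 M10 [M1l M1d M1G]] := @peel n 0 1 gam h m (leqnn n) ler01.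
- by apply: gLip_left; apply: gLip_expo; exact: lip_id.
- by move=> i; exact: bmeas_cst.
- by move=> t i; rewrite subnn.
- by apply: aei_all => t _; rewrite hE; apply: lgd_left; exact: lgd_expo.
- by rewrite /gam expo0 mulg1.
suff <- : M1 1 = m * nexp (1 *: rho v) by apply: M1G; rewrite ler01 lexx.
have F10 : M1 1 * nexp ((- 1) *: rho v) = m.
  pose F t := M1 t * nexp ((- t) *: rho v).
  have -> : m = F 0 by rewrite /F oppr0 scale0r nexp0 mulr1 M10.
  apply: (@lip_const _ _ _ F 0 1 ler01).
    apply: lip_mulr => //; apply: lip_nexp; apply: lipN; exact: lip_id.
  apply: aei_imp M1d => t _ dM.
  apply: dat_eq (dat_mulr dM (dat_expN v t)) _.
  by rewrite hE mulrN -exp_comm mulrA subrr.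
by rewrite -F10 -mulrA expVr mulr1.
Qed.

Lemma GmM k q q' m m' : (k <= n)%N -> Gm n q m -> Gm k q' m' -> Gm n (q * q')%g (m * m').
Proof.
move=> kn hm; elim: k q' m' kn => [|k IH] q' m' kn /=; first by case=> -> ->; rewrite mulg1 mulr1.
case=> q1 [m1 [x [h1 -> ->]]]; rewrite mulgA mulrA; apply: Gm_exp; apply: IH => //.
exact: ltnW.
Qed.

Lemma GmV k q m : (k <= n)%N -> Gm k q m -> exists m', [/\ Gm n q^-1%g m', m * m' = 1 & m' * m = 1].
Proof.
elim: k q m => [|k IH] q m kn /=.
  by case=> -> ->; exists 1; rewrite invg1 mulr1; split=> //; exact: Gm_one.
case=> q1 [m1 [x [h1 -> ->]]]; have [m' [k1 k2 k3]] := IH _ _ (ltnW kn) h1.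
set u := Yn _; exists (nexp ((- x) *: rho u) * m'); split.
- rewrite invgM -expoN; apply: (GmM (leqnn n)) k1.
  by have := Gm_exp u (- x) (Gm_one n); rewrite mul1g mul1r.
- by rewrite mulrA -(mulrA m1) expVl mulr1.
- by rewrite mulrA -(mulrA _ m') k3 mulr1 expVr.
Qed.

Lemma exp_Fil (u : 'rV[R]_n) (x : R) : Fil wt 1 (nexp (x *: rho u) - 1).
Proof.
rewrite -[nexp _ - 1](subrK (x *: rho u)); apply: FilD (rhoFilZ x u).
exact: Fil_le (Fil_nexp s_pos (rhoFilZ x u)).
Qed.

Lemma mul_sub1 (a b : M) : a * b - 1 = (a - 1) * (b - 1) + (a - 1) + (b - 1).
Proof. by rewrite mulrBr mulr1 mulrBl mul1r subrK addrA subrK. Qed.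

Lemma Gm_Fil k q m : Gm k q m -> Fil wt 1 (m - 1).
Proof.
elim: k q m => [|k IH] q m /=; first by case=> _ ->; rewrite subrr; exact: Fil_zero.
case=> q1 [m1 [x [/IH h1 _ ->]]]; rewrite mul_sub1.
have h2 := exp_Fil (Yn (n - k.+1)) x.
by apply: FilD => //; apply: FilD => //; exact: Fil_le (FilM h1 h2).
Qed.

Lemma rho_linear : linear rho.
Proof. by move=> c u v; rewrite rhoD rhoZ. Qed.

HB.instance Definition _ := GRing.isLinear.Build R 'rV[R]_n M *:%R rho rho_linear.

Definition gl (j : nat) : {vspace M} := (linfun rho @: lay j)%VS.

Lemma glP j m : reflect (exists2 u, u \in lay j & m = rho u) (m \in gl j).
Proof.
apply: (iffP memv_imgP) => [[u hu ->]|[u hu ->]]; exists u => //; last by rewrite lfunE.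
by rewrite lfunE.
Qed.

Lemma gl_Hom j m : m \in gl j -> Hom wt j m.
Proof.
move=> /glP[u hu ->]; case: j hu => [|j]; last exact: rho_Hom.
by rewrite /lay /= memv0 => /eqP ->; rewrite rho0 => k l _; rewrite mxE.
Qed.

Definition Gam (m : M) := exists q, Gm n q m.

Lemma FilXn j (m : M) i : Fil wt j m -> Fil wt (j * i) (m ^+ i).
Proof.
move=> h; elim: i => [|i IH]; first by rewrite muln0; exact: Fil_one.
by rewrite exprS mulnS; exact: FilM.
Qed.

Lemma Fil_nexp_sub j (m : M) : (1 <= j)%N -> Fil wt j m -> Fil wt j.+1 (nexp m - 1 - m).
Proof.
move=> j1 hm; rewrite nexp_tail ?s_pos //; apply: Fil_sum => i; apply: FilZ.
apply: (@Fil_le _ _ _ (j * i.+2)%N); last exact: FilXn.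
rewrite mulnS -addn1 leq_add2l.
by rewrite muln_gt0 j1.
Qed.

Lemma Fil_nexp1 j (m : M) : (1 <= j)%N -> Fil wt j m -> Fil wt j (nexp m - 1).
Proof.
move=> j1 hm; rewrite -[nexp m - 1](subrK m); apply: FilD => //.
exact: Fil_le (Fil_nexp_sub j1 hm).
Qed.

(** Factors of degree smaller than [j] are trivial, as their parameters appear
    in the first column; those of degree [j] add up to the leading term. *)
Lemma Gm_lead k q m j : (k <= n)%N -> (1 <= j)%N -> Gm k q m -> Fil wt j (m - 1) ->
  exists2 x, x \in gl j & Fil wt j.+1 (m - 1 - x).
Proof.
elim: k q m => [|k IH] q m kn j1 /=.
  by case=> _ -> _; exists 0; [exact: mem0v|rewrite !subrr; exact: Fil_zero].
case=> q1 [m1 [x [h1 _ mE]]] hj.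
have ilt : (n - k.+1 < n)%N by rewrite -subn_gt0 subKn.
pose i0 := Ordinal ilt; have YE : Yn (n - k.+1) = Y i0 by rewrite -(Yn_ord i0).
rewrite YE in mE; have e1 := @Gm_entry k q1 m1 x i0 kn erefl h1; rewrite -mE in e1.
have d1 : (1 <= d i0)%N by case/andP: (d_s i0).
have [dj|jd] := ltnP (d i0) j.
  have x0 : x = 0.
    have := hj (ie i0) ie0; rewrite wt_e wt_e0 add0n dj => /(_ isT).
    rewrite mxE e1 mxE mxE (_ : ie i0 == ie0 = false) // oppr0 addr0 => /eqP.
    by rewrite mulf_eq0 pnatr_eq0 -(negbK (d i0 == 0)%N) -lt0n d1 orbF => /eqP.
  rewrite x0 scale0r nexp0 mulr1 in mE.
  by rewrite mE in hj *; exact: (IH q1 m1 (ltnW kn) j1 h1 hj).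
have hr : Fil wt (d i0) (rho (Y i0)) by exact: Hom_Fil (rho_Hom d1 (Y_lay i0)).
have he (y : R) : Fil wt j (nexp (y *: rho (Y i0)) - 1).
  by apply: Fil_le jd _; apply: Fil_nexp1 => //; exact: FilZ.
have m1E : m1 = m * nexp ((- x) *: rho (Y i0)) by rewrite mE -mulrA expVl mulr1.
have jj : (j.+1 <= j + j)%N by rewrite -addn1 leq_add2l.
have hm1 : Fil wt j (m1 - 1).
  rewrite m1E mul_sub1; apply: FilD => //; apply: FilD => //.
  by apply: Fil_le (FilM hj (he (- x))); rewrite leq_addr.
have [y hy1 hy2] := IH q1 m1 (ltnW kn) j1 h1 hm1.
have hex : Fil wt j.+1 (nexp (x *: rho (Y i0)) - 1 - x *: rho (Y i0)).
  apply: (@Fil_le _ _ _ (d i0).+1); first by rewrite ltnS.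
  by apply: Fil_nexp_sub => //; exact: FilZ.
have mm : Fil wt j.+1 ((m1 - 1) * (nexp (x *: rho (Y i0)) - 1)).
  exact: Fil_le jj (FilM hm1 (he x)).
have [jE|jn] := eqVneq (d i0) j.
  exists (y + x *: rho (Y i0)).
    apply: memvD => //; apply: memvZ; apply/glP; exists (Y i0) => //.
    by rewrite -jE; exact: Y_lay.
  rewrite mE mul_sub1; set a := (m1 - 1) * _ in mm *; set b := m1 - 1 in hy2 *.
  set c := nexp _ - 1 in hex *; set z := x *: _ in hex *.
  have -> : a + b + c - (y + z) = a + (b - y) + (c - z).
    by apply/matrixP => k' l'; rewrite !mxE; ring.
  by apply: FilD => //; exact: FilD.
exists y => //; rewrite mE mul_sub1; set a := (m1 - 1) * _ in mm *; set b := m1 - 1 in hy2 *.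
set z := x *: _ in hex *; set c := nexp z - 1 in hex *.
have -> : a + b + c - y = a + (b - y) + ((c - z) + z).
  by apply/matrixP => k' l'; rewrite !mxE; ring.
apply: FilD; first exact: FilD.
apply: FilD => //; apply: FilZ; apply: Fil_le hr.
by rewrite ltn_neqAle jd eq_sym jn.
Qed.

(** Dilations multiply the parameter of each factor by a power of [t], its
    degree. *)
Lemma Gm_scl k q m (t : R) : (k <= n)%N -> 0 < t -> Gm k q m -> exists q', Gm k q' (scl wt t m).
Proof.
move=> kn t0; have tn : t != 0 by rewrite gt_eqF.
elim: k q m kn => [|k IH] q m kn /=; first by case=> _ ->; exists 1%g; split=> //; exact: scl_one.
case=> q1 [m1 [x [h1 _ ->]]]; have [q' hq'] := IH _ _ (ltnW kn) h1.
have ilt : (n - k.+1 < n)%N by rewrite -subn_gt0 subKn.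
pose i0 := Ordinal ilt; have YE : Yn (n - k.+1) = Y i0 by rewrite -(Yn_ord i0).
exists (q' * expo (Y i0) (x * t ^+ d i0))%g, q', (scl wt t m1), (x * t ^+ d i0); rewrite YE.
split=> //; rewrite sclM // scl_nexp // sclZ.
have d1 : (1 <= d i0)%N by case/andP: (d_s i0).
by rewrite (scl_Hom tn (rho_Hom d1 (Y_lay i0))) scalerA.
Qed.

Lemma Gam_inj q q' m : Gm n q m -> Gm n q' m -> q = q'.
Proof. exact: Gm_inj. Qed.

Lemma Gam1 : Gam 1. Proof. by exists 1%g; exact: Gm_one. Qed.

Lemma GamM a b : Gam a -> Gam b -> Gam (a * b).
Proof. by move=> [q hq] [q' hq']; exists (q * q')%g; exact: (GmM (leqnn n)). Qed.

Lemma GamV a : Gam a -> exists b, [/\ Gam b, a * b = 1 & b * a = 1].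
Proof. by move=> [q hq]; have [b [h1 h2 h3]] := GmV (leqnn n) hq; exists b; split=> //; exists q^-1%g. Qed.

Lemma Gam_Fil a : Gam a -> Fil wt 1 (a - 1). Proof. by move=> [q]; exact: Gm_Fil. Qed.

Lemma Gam_lead j a : (1 <= j)%N -> Gam a -> Fil wt j (a - 1) ->
  exists2 x, x \in gl j & Fil wt j.+1 (a - 1 - x).
Proof. by move=> j1 [q hq]; exact: Gm_lead j1 hq. Qed.

Lemma Gam_scl t a : 0 < t -> Gam a -> Gam (scl wt t a).
Proof. by move=> t0 [q /(Gm_scl (leqnn n) t0)]. Qed.

Lemma Gam_exp u : Gam (nexp (rho u)).
Proof. by have := Gm_exp u 1 (Gm_one n); rewrite scale1r mul1r mul1g; exists (expo u 1). Qed.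

Definition hvec (v : 'rV[R]_r) : 'rV[R]_n := \sum_a v 0 a *: (hbasis G)`_a.
Definition Xb (a : 'I_r) : M := rho (hbasis G)`_a.

Lemma rho_hvec (v : 'rV[R]_r) : rho (hvec v) = hor Xb v.
Proof. by rewrite /hvec rho_sum; apply: eq_bigr => a _; rewrite rhoZ. Qed.

Lemma hbasis_lay (a : 'I_r) : (hbasis G)`_a \in lay 1.
Proof. by rewrite lay1; apply: (basis_mem (hbasisP G)); rewrite mem_nth // size_tuple. Qed.

Lemma lin_bound (V : normedModType R) (f : 'rV[R]_n -> V) :
  (forall u, f u = \sum_i u 0 i *: f (delta_mx 0 i)) -> exists2 C, 0 <= C & forall u, `|f u| <= C * `|u|.
Proof.
move=> hf; exists (\sum_i `|f (delta_mx 0 i)|) => [|u]; first exact: sumr_ge0.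
rewrite hf mulr_suml; apply: le_trans (ler_norm_sum _ _ _) _; apply: ler_sum => i _.
by rewrite normrZ mulrC ler_wpM2l // norm_entry.
Qed.

Lemma coord_bound m (X : m.-tuple 'rV[R]_n) : exists2 C, 0 <= C & forall u i, `|coord X i u| <= C * `|u|.
Proof.
have h i : exists C, 0 <= C /\ forall u, `|coord X i u| <= C * `|u|.
  have [|C C0 hC] := @lin_bound R (coord X i); last by exists C.
  by move=> u; rewrite {1}(delta_sum u) linear_sum; apply: eq_bigr => j _; rewrite linearZ.
have [C hC] := choice h; exists (\sum_i C i) => [|u i].
  by apply: sumr_ge0 => i _; case: (hC i).
apply: le_trans ((hC i).2 u) _; rewrite ler_wpM2r // (bigD1 i) //= lerDl.
by apply: sumr_ge0 => j _; case: (hC j).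
Qed.

Lemma Xb_gl a : Xb a \in gl 1. Proof. by apply/glP; exists (hbasis G)`_a => //; exact: hbasis_lay. Qed.

Lemma gl1_hor : exists2 C, 0 <= C & forall m, m \in gl 1 -> exists2 v, m = hor Xb v & nrm v <= C * `|m|.
Proof.
have [C1 C10 h1] := coord_bound (hbasis G); have [C2 C20 h2] := norm_unrho.
exists (r%:R * (C1 * C2)); first by rewrite !mulr_ge0.
move=> m /glP[u]; rewrite lay1 => hu mE; exists (\row_a coord (hbasis G) a u).
  rewrite -rho_hvec mE; congr rho; rewrite {1}(coord_basis (hbasisP G) hu).
  by apply: eq_bigr => a _; rewrite mxE.
apply: le_trans (nrm_le_norm _) _; rewrite -mulrA ler_wpM2l //.
apply: norm_mx_le => [|i a]; first by rewrite !mulr_ge0.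
rewrite mxE; apply: le_trans (h1 _ _) _; rewrite -mulrA ler_wpM2l //.
by have := h2 m; rewrite {1}mE rhoK.
Qed.

(** The sum of the images of the layer of degree [j] under the brackets with
    the basis of the first layer is a subspace which contains all the
    brackets. *)
Lemma lay_succ j u : (1 <= j < s)%N -> u \in lay j.+1 -> exists2 z : 'I_r -> 'rV[R]_n,
  forall a, z a \in lay j & u = \sum_(a < r) lb (hbasis G)`_a (z a).
Proof.
move=> /andP[j1 js]; rewrite layE // => hu.
have [_ h] := @layer_bracket _ _ _ _ G j.+1 (introT andP (conj (j1 : 2 <= j.+1)%N js)).
pose W' := (\sum_(a < r) (linfun (mulmxr (ad G (hbasis G)`_a)) @: layer G j))%VS.
have : u \in W'.
  apply: subvP hu => //; apply: h => a b ha hb.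
  rewrite lbE (coord_basis (hbasisP G) ha) lie_suml; apply: memv_sumr => i _.
  rewrite lieZl; apply: memvZ.
  rewrite (_ : lb _ b = linfun (mulmxr (ad G (hbasis G)`_i)) b); last by rewrite lfunE /= adE.
  exact: memv_img.
move=> /memv_sumP[vs hvs ->].
have hz (a : 'I_r) : exists z, z \in layer G j /\ vs a = lb (hbasis G)`_a z.
  by have /memv_imgP[z hz ->] := hvs a isT; exists z; rewrite lfunE /= adE.
have [z hz'] := choice hz; exists z => [a|].
  by rewrite layE ?j1 ?(ltnW js) //; case: (hz' a).
by apply: eq_bigr => a _; case: (hz' a).
Qed.

(** The norms are controlled by solving the problem for a basis of the layer
    once and for all. *)
Lemma gl_succ j : (1 <= j < s)%N -> exists2 C, 0 <= C & forall m, m \in gl j.+1 ->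
  exists2 y : 'I_r -> M, forall a, y a \in gl j /\ `|y a| <= C * `|m| &
    m = \sum_a (y a * Xb a - Xb a * y a).
Proof.
move=> hj; pose X := vbasis (lay j.+1).
have hz (i : 'I_(\dim (lay j.+1))) : exists z : 'I_r -> 'rV[R]_n, (forall a, z a \in lay j) /\ X`_i = \sum_(a < r) lb (hbasis G)`_a (z a).
  have [|z h1 h2] := lay_succ (u := X`_i) hj; last by exists z.
  by apply: vbasis_mem; rewrite mem_nth // size_tuple.
have [z hz'] := choice hz.
have [Cc Cc0 hc] := coord_bound X; have [Cu Cu0 hu] := norm_unrho.
have [Cr Cr0 hr] := lin_bound rho_ext.
pose S := \sum_i \sum_a `|z i a|; have S0 : 0 <= S by apply: sumr_ge0 => i _; exact: sumr_ge0.
exists (Cr * (Cc * Cu * S)); first by rewrite !mulr_ge0.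
move=> m hm; pose u := unrho m.
have [hul mE] : u \in lay j.+1 /\ m = rho u.
  by have /glP[u' hu' mE] := hm; rewrite /u mE rhoK.
pose w a := \sum_i coord X i u *: z i a.
exists (fun a => - rho (w a)) => [a|]; last first.
  have E : u = \sum_(a < r) lb (hbasis G)`_a (w a).
    rewrite {1}(coord_basis (vbasisP (lay j.+1)) hul) -/X.
    under [RHS]eq_bigr do rewrite lie_sumr.
    rewrite exchange_big; apply: eq_bigr => i _ /=; rewrite (hz' i).2 scaler_sumr.
    by apply: eq_bigr => a _; rewrite lieZr.
  rewrite {1}mE {1}E rho_sum; apply: eq_bigr => a _.
  by rewrite rho_lb mulNr mulrN opprK addrC.
split.
  rewrite memvN; apply/glP; exists (w a) => //.
  by apply: memv_suml => i _; apply: memvZ; case: (hz' i).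
rewrite normrN; apply: le_trans (hr _) _; rewrite -[leRHS]mulrA; apply: ler_wpM2l => //.
apply: le_trans (ler_norm_sum _ _ _) _.
rewrite mulrAC [_ * S]mulrC mulr_suml; apply: ler_sum => i _.
rewrite normrZ mulrC; apply: ler_pM => //.
  by apply: le_trans (hc _ _) _; rewrite -[leRHS]mulrA; apply: ler_wpM2l => //; exact: hu.
by rewrite (bigD1 a) //= lerDl; exact: sumr_ge0.
Qed.

End stratified_algebra.

(** * Quantitative estimates along horizontal curves of matrices *)

Section matrix_ode.
Context {R : realType} {n r s : nat} (wt : 'I_n.+1 -> nat) (wt_s : forall k, (wt k <= s)%N).
Context (Xb : 'I_r -> 'M[R]_n.+1) (Xb_hom : forall a, Hom wt 1 (Xb a)).
Local Notation M := 'M[R]_n.+1.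
Local Notation hor := (hor Xb).

Lemma lip_incr (f : R -> R) a b C : a <= b -> lip f a b ->
  aei a b (fun t => exists2 v, dat f t v & `|v| <= C) -> `|f b - f a| <= C * (b - a).
Proof.
move=> ab lf h.
have ll c : lip (fun t : R => c * t) a b by apply: lipM; [exact: lip_cst|exact: lip_id].
have dc c (t : R) : dat (fun t : R => c * t) t c.
  by have := datMc c (dat_id t); rewrite mulr1.
have h1 : f b - f a <= C * b - C * a.
  apply: (lip_le ab lf (ll C)); apply: aei_imp h => t _ [v dv vC].
  by exists v, C; split=> //; move: vC; rewrite ler_norml => /andP[].
have h2 : - C * b - - C * a <= f b - f a.
  apply: (lip_le ab (ll (- C)) lf); apply: aei_imp h => t _ [v dv vC].
  by exists (- C), v; split=> //; move: vC; rewrite ler_norml => /andP[].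
by rewrite ler_norml; lra.
Qed.

Lemma lip_incr_mx p q (f : R -> 'M[R]_(p, q)) a b C : a <= b -> 0 <= C -> lip f a b ->
  aei a b (fun t => exists2 v, dat f t v & `|v| <= C) -> `|f b - f a| <= C * (b - a).
Proof.
move=> ab C0 /lip_mxP lf h; apply: norm_mx_le => [|i j]; first by rewrite mulr_ge0 // subr_ge0.
rewrite !mxE; apply: (@lip_incr (fun t => f t i j)) => //.
apply: aei_imp h => t _ [v /dat_mxP dv vC]; exists (v i j) => //.
exact: le_trans (norm_entry v i j) vC.
Qed.

Lemma hor_bound : exists2 H, 0 <= H & forall v, `|hor v| <= H * `|v|.
Proof.
exists (\sum_a `|Xb a|) => [|v]; first exact: sumr_ge0.
rewrite mulr_suml; apply: le_trans (ler_norm_sum _ _ _) _; apply: ler_sum => a _.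
by rewrite normrZ mulrC ler_wpM2l // norm_entry.
Qed.

Lemma hor_hom v : Hom wt 1 (hor v).
Proof.
move=> k l kl; rewrite summxE big1 // => a _.
by rewrite mxE Xb_hom ?mulr0.
Qed.

Lemma horD u v : hor (u + v) = hor u + hor v.
Proof. by rewrite /hor -big_split; apply: eq_bigr => a _; rewrite mxE scalerDl. Qed.

Lemma horZ' (c : R) v : hor (c *: v) = c *: hor v.
Proof. by rewrite /hor scaler_sumr; apply: eq_bigr => a _; rewrite mxE scalerA. Qed.

Lemma horB u v : hor (u - v) = hor u - hor v.
Proof. by rewrite horD; congr (_ + _); rewrite -[- v]scaleN1r horZ' scaleN1r. Qed.

Lemma dat_hor (f : R -> 'rV[R]_r) t v : dat f t v -> dat (fun x => hor (f x)) t (hor v).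
Proof.
move=> /dat_mxP hf.
have h a : dat (fun x => f x 0 a *: Xb a) t (v 0 a *: Xb a).
  apply: (dat_comp (f := fun x : R => x *: Xb a)) (hf 0 a) => e e0.
  by exists 1 => // u _; rewrite -scalerBl subrr normr0 mulr_ge0 // (ltW e0).
exact: dat_sum h.
Qed.

Lemma lip_hor (f : R -> 'rV[R]_r) a b : lip f a b -> lip (fun x => hor (f x)) a b.
Proof.
move=> /lip_mxP hf; apply: lip_sum => i; apply: lip_scale; [exact: hf|exact: lip_cst].
Qed.

(** The controls are rescaled: [N] is the lift of a curve of unit speed, seen
    at scale [eta]. *)
Definition hsol (eta a b : R) (N : R -> M) (X : R -> 'rV[R]_r) (u : R -> 'rV[R]_r) :=
  [/\ N a = 1, lip N a b, forall t, a <= t <= b -> Fil wt 1 (N t - 1), lip X a b &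
   aei a b (fun t => [/\ dat X t (u t), `|u t| <= 1 & dat N t (N t * hor (eta^-1 *: u t))])].

(** By induction on the degree: a horizontal matrix raises the degree by one,
    so the derivative of an entry involves only entries of smaller degree. The
    length of the interval at scale [eta], hence the bound, does not depend on
    [eta]. *)
Lemma hsol_bounded B : 0 <= B -> exists2 C, 0 <= C & forall eta a b N X u, 0 < eta -> a <= b ->
  b - a <= B * eta -> hsol eta a b N X u -> forall t, a <= t <= b -> `|N t| <= C.
Proof.
move=> B0; have [H H0 hH] := hor_bound.
suff K j : exists2 C, 0 <= C & forall eta a b N X u, 0 < eta -> a <= b ->
    b - a <= B * eta -> hsol eta a b N X u -> forall t, a <= t <= b ->
    forall k l, (wt k <= wt l + j)%N -> `|N t k l| <= C.
  have [C C0 hC] := K s; exists C => // eta a b N X u eta0 ab bB hN t ht.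
  apply: norm_mx_le => // k l; apply: (hC eta a b N X u) => //.
  by apply: leq_trans (wt_s k) _; rewrite leq_addl.
have id1 k l : `|(1 : M) k l| <= 1.
  by rewrite mxE; case: eqP => _; rewrite ?normr1 ?normr0 ?ler01.
elim: j => [|j [C C0 IH]].
  exists 1 => // eta a b N X u eta0 ab bB [_ _ hF _ _] t ht k l; rewrite addn0 => kl.
  have := hF t ht k l; rewrite addn1 ltnS => /(_ kl); rewrite mxE [X in _ + X]mxE => /eqP.
  by rewrite subr_eq0 => /eqP ->.
exists (1 + n.+1%:R * C * H * B); first by rewrite addr_ge0 // !mulr_ge0.
move=> eta a b N X u eta0 ab bB hN t ht k l kl.
have [Na Nl NF Xl hd] := hN; have [at_ tb] := andP ht.
pose c := n.+1%:R * C * (H / eta).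
have c0 : 0 <= c by rewrite !mulr_ge0 // invr_ge0 ltW.
have : `|N t k l - N a k l| <= c * (t - a).
  apply: (@lip_incr (fun t => N t k l)) => //.
    by apply: lip_sub (lexx a) tb _; exact: (lip_mxP _ _ _).1 Nl k l.
  apply: aei_imp (aei_sub (lexx a) tb hd) => x /andP[ax xt] [_ u1 /dat_mxP/(_ k l) dN].
  have hx : a <= x <= b by rewrite (ltW ax) (le_trans (ltW xt) tb).
  exists ((N x * hor (eta^-1 *: u x)) k l) => //.
  rewrite mxE; apply: le_trans (ler_norm_sum _ _ _) _.
  apply: (@le_trans _ _ (\sum_(p < n.+1) C * (H / eta))); last first.
    by rewrite sumr_const card_ord -mulr_natl mulrA.
  apply: ler_sum => p _.
  have CH : 0 <= C * (H / eta) by rewrite !mulr_ge0 // invr_ge0 ltW.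
  have [pl|pl] := eqVneq (wt p) (wt l + 1)%N; last by rewrite (hor_hom _ pl) mulr0 normr0.
  rewrite normrM; apply: ler_pM => //.
    by apply: (IH eta a b N X u) => //; rewrite pl -addnA add1n.
  apply: le_trans (norm_entry _ p l) _; apply: le_trans (hH _) _.
  rewrite ler_wpM2l // normrZ gtr0_norm ?invr_gt0 // -[leRHS]mulr1.
  by rewrite ler_wpM2l // invr_ge0 ltW.
rewrite Na => h1.
have h2 : c * (t - a) <= n.+1%:R * C * H * B.
  have -> : n.+1%:R * C * H * B = c * (B * eta) by rewrite /c; field; rewrite gt_eqF.
  by rewrite ler_wpM2l //; lra.
have := id1 k l; have := ler_normD (N t k l - (1 : M) k l) ((1 : M) k l); rewrite subrK; lra.
Qed.

(** The difference of [N] and of its linear part has derivative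
    [(N - 1) * hor], where [N - 1] is itself bounded by the length. *)
Lemma hsol_est B : 0 <= B -> exists2 C, 0 <= C & forall eta a b N X u, 0 < eta -> a <= b ->
  b - a <= B * eta -> hsol eta a b N X u ->
  `|N b - 1 - hor (eta^-1 *: (X b - X a))| <= C * ((b - a) / eta) ^+ 2.
Proof.
move=> B0; have [H H0 hH] := hor_bound; have [C C0 hC] := hsol_bounded B0.
pose K := n.+1%:R * C * H; have K0 : 0 <= K by rewrite !mulr_ge0.
exists (n.+1%:R * K * H); first by rewrite !mulr_ge0.
move=> eta a b N X u eta0 ab bB hN; have [Na Nl NF Xl hd] := hN.
have ei : 0 <= eta^-1 by rewrite invr_ge0 ltW.
have hu v : `|v| <= 1 -> `|hor (eta^-1 *: v)| <= H / eta.
  move=> v1; apply: le_trans (hH _) _; rewrite ler_wpM2l // normrZ ger0_norm // -[leRHS]mulr1.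
  by rewrite ler_wpM2l.
have N1 t : a <= t <= b -> `|N t - 1| <= K * ((b - a) / eta).
  move=> ht; have [at_ tb] := andP ht; rewrite -Na.
  apply: (@le_trans _ _ (K / eta * (t - a))).
    apply: lip_incr_mx => //; first by rewrite mulr_ge0.
      exact: lip_sub (lexx a) tb Nl.
    apply: aei_imp (aei_sub (lexx a) tb hd) => x /andP[ax xt] [_ u1 dN].
    exists (N x * hor (eta^-1 *: u x)) => //; apply: le_trans (norm_mulr _ _) _.
    rewrite /K -[leRHS]mulrA; apply: ler_pM => //; last exact: hu.
    rewrite ler_wpM2l //; apply: (hC eta a b N X u) => //.
    by rewrite (ltW ax) (le_trans (ltW xt) tb).
  rewrite -mulrA ler_wpM2l // mulrC ler_wpM2r //; lra.
pose F t := N t - hor (eta^-1 *: X t).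
have -> : N b - 1 - hor (eta^-1 *: (X b - X a)) = F b - F a.
  rewrite /F Na scalerBr horB.
  by apply/matrixP => i j; rewrite !mxE; ring.
have -> : n.+1%:R * K * H * ((b - a) / eta) ^+ 2 =
    n.+1%:R * (K * ((b - a) / eta)) * (H / eta) * (b - a) by ring.
have ba : 0 <= (b - a) / eta by rewrite mulr_ge0 // subr_ge0.
have Kb : 0 <= K * ((b - a) / eta) by rewrite mulr_ge0.
have He : 0 <= H / eta by rewrite mulr_ge0.
apply: lip_incr_mx => //; first by apply: mulr_ge0 => //; apply: mulr_ge0.
  apply: lipD => //; apply: lipN; apply: lip_hor; apply: lip_scale => //; exact: lip_cst.
apply: aei_imp hd => x /andP[ax xb] [dX u1 dN].
exists (N x * hor (eta^-1 *: u x) - hor (eta^-1 *: u x)).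
  apply: datB => //; apply: dat_hor.
  apply/dat_mxP => i j; have /dat_mxP/(_ i j) := dX.
  move=> /(datMc eta^-1); rewrite !mxE; apply: dat_ext ltr01 _ => y _.
  by rewrite mxE.
rewrite -{2}[hor _]mul1r -mulrBl; apply: le_trans (norm_mulr _ _) _.
apply: ler_pM => //; last exact: hu.
by rewrite ler_wpM2l // N1 // !ltW.
Qed.

End matrix_ode.

(** * Horizontal curves of the Carnot group *)

Section horizontal_curves.
Context {R : realType} {n s r : nat} (G : carnot_group R n s r).
Local Notation mu := (@lebesgue_measure R).
Local Notation phi := (chart1 G).
Local Notation hb := (hbasis G).
Local Notation hvec := (hvec G).
Local Notation expo := (expo G).
Implicit Types (h : 'I_r -> R -> R) (gam : R -> G).

Let ae_S := @filterS _ _ (ae_filter_ringOfSetsType mu).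

Lemma ae_neq (c : R) : {ae mu, forall t, t != c}.
Proof.
exists [set c]; split; [exact: measurable_set1|exact: lebesgue_measure_set1|].
by move=> t /= /negP; rewrite negbK => /eqP.
Qed.

Lemma ae_aei a b (P : R -> Prop) : {ae mu, forall t, t \in `[a, b] -> P t} -> aei a b P.
Proof. by apply: ae_S => t h /andP[at_ tb]; apply: h; rewrite in_itv /= !ltW. Qed.

Lemma aei_ae a b (P : R -> Prop) : aei a b P -> {ae mu, forall t, t \in `[a, b] -> P t}.
Proof.
move=> hP; apply: (@filterS3 _ _ (ae_filter_ringOfSetsType mu) _ _ _ _ _ hP (ae_neq a) (ae_neq b)).
move=> t h ta tb; rewrite in_itv /= => /andP[at_ bt]; apply: h.
by rewrite !lt_neqAle at_ bt eq_sym ta tb.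
Qed.

Lemma aei_cat a c b (P : R -> Prop) : aei a c P -> aei c b P -> aei a b P.
Proof.
move=> h1 h2; apply: (@filterS3 _ _ (ae_filter_ringOfSetsType mu) _ _ _ _ _ h1 h2 (ae_neq c)).
move=> t k1 k2 tc /andP[at_ tb]; move: tc; rewrite neq_lt => /orP[tc|tc].
  by apply: k1; rewrite at_.
by apply: k2; rewrite tc.
Qed.

Definition ctl h (t : R) : 'rV[R]_r := \row_a h a t.

Lemma hvelocityE h t : hvelocity G h t = hvec (ctl h t).
Proof. by apply: eq_bigr => a _; rewrite mxE. Qed.

Lemma lvf_hvec h t (c : chart R n G) (p : G) : atlas c -> chart_dom c p ->
  \sum_(i < r) h i t *: lvf hb`_i c p = hvec (ctl h t) *m JL c p.
Proof.
move=> hc cp; rewrite mulmx_suml; apply: eq_bigr => i _.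
by rewrite (lvfE _ hc cp) mxE scalemxAl.
Qed.

Lemma horizontal_gLip a b gam h : horizontal a b gam h -> gLip gam a b.
Proof.
case=> hl _ _; apply: lipschitz_gLip => t0 c ht0 hc cx.
have [|e [K [e0 hK]]] := hl t0 c _ hc cx; first by rewrite in_itv.
by exists e, K; split=> // t u ht hu; apply: hK; rewrite in_itv.
Qed.

Lemma horizontal_lgd a b gam h : horizontal a b gam h ->
  aei a b (fun t => lgd gam t (hvec (ctl h t))).
Proof.
move=> hh; have hl := horizontal_gLip hh; case: hh => _ _ /ae_aei.
apply: aei_imp => t ht hd; have [c hc ct] := atlas_cover (gam t).
apply: (chart_lgd hc ct (gLip_cont hl ht)).
rewrite -lvf_hvec //; apply/dat_derive; exact: hd.
Qed.

Lemma lgd_horizontal a b gam h : gLip gam a b -> (forall i, Linfty_on a b (h i)) ->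
  aei a b (fun t => lgd gam t (hvec (ctl h t))) -> horizontal a b gam h.
Proof.
move=> hl hi hd; split=> //.
  move=> t0 c; rewrite in_itv /= => ht0 hc ct.
  have [e [K [e0 hK]]] := gLip_lipschitz hl ht0 hc ct; exists e, K; split=> //.
apply: aei_ae; apply: aei_imp hd => t _ ht c hc ct.
by rewrite lvf_hvec //; apply/dat_derive; exact: lgd_chart.
Qed.

(** At the common endpoint the two estimates are added through the value
    there. *)
Lemma gLip_cat (x : R -> G) a c b : a <= c -> c <= b -> gLip x a c -> gLip x c b -> gLip x a b.
Proof.
move=> ac cb h1 h2 t0 /andP[at0 t0b].
have near (y : R -> G) a' b' d' : gLip y a' b' -> a' <= t0 <= b' -> 0 < d' ->
    (forall t, a <= t <= b -> `|t - t0| < d' -> a' <= t <= b') ->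
    exists d K, 0 < d /\ forall t u, a <= t <= b -> a <= u <= b -> `|t - t0| < d -> `|u - t0| < d ->
      chart_dom phi ((y t0)^-1 * y t)%g /\ `|phi ((y t0)^-1 * y t)%g - phi ((y t0)^-1 * y u)%g| <= K * `|t - u|.
  move=> hy ht0 d'0 hd'; have [d [K [d0 hd]]] := hy _ ht0.
  exists (Num.min d d'), K; split; first by rewrite lt_min d0.
  move=> t u ht hu; rewrite !lt_min => /andP[t1 t2] /andP[u1 u2].
  by apply: hd => //; exact: hd'.
have [tc|ct|tE] := ltgtP t0 c.
- apply: (near x a c (c - t0)) => //; [by rewrite at0 ltW|by rewrite subr_gt0|].
  by move=> t /andP[-> _]; rewrite ltr_norml => /andP[_]; rewrite ltrD2r => /ltW.
- apply: (near x c b (t0 - c)) => //; [by rewrite t0b ltW|by rewrite subr_gt0|].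
  move=> t /andP[_ ->]; rewrite ltr_norml opprB ltrBrDr subrK => /andP[/ltW -> _].
  by [].
rewrite tE; have [d1 [K1 [d10 k1]]] := h1 c (introT andP (conj ac (lexx c))).
have [d2 [K2 [d20 k2]]] := h2 c (introT andP (conj (lexx c) cb)).
exists (Num.min d1 d2), (Num.max K1 K2); split; first by rewrite lt_min d10.
have mK1 (z : R) : K1 * `|z| <= Num.max K1 K2 * `|z| by rewrite ler_wpM2r // le_max lexx.
have mK2 (z : R) : K2 * `|z| <= Num.max K1 K2 * `|z| by rewrite ler_wpM2r // le_max lexx orbT.
have cc1 : `|c - c| < d1 by rewrite subrr normr0.
have cc2 : `|c - c| < d2 by rewrite subrr normr0.
have acc : a <= c <= c by rewrite ac lexx.
have ccb : c <= c <= b by rewrite cb lexx.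
have dom t : a <= t <= b -> `|t - c| < Num.min d1 d2 -> chart_dom phi ((x c)^-1 * x t)%g.
  move=> /andP[at_ tb]; rewrite lt_min => /andP[t1 t2]; have [tc|/ltW ct] := leP t c.
    by apply: (k1 t c _ acc t1 cc1).1; rewrite at_.
  by apply: (k2 t c _ ccb t2 cc2).1; rewrite ct.
move=> t u ht hu td ud; split; first exact: dom.
wlog tu : t u ht hu td ud / t <= u.
  move=> H; have [tu|/ltW ut] := leP t u; first exact: H.
  by rewrite distrC (distrC t); exact: H.
move: td ud; rewrite !lt_min => /andP[t1 t2] /andP[u1 u2].
have [at_ tb] := andP ht; have [au ub] := andP hu.
have [uc|/ltW cu] := leP u c.
  by apply: le_trans (mK1 _); apply: (k1 t u _ _ t1 u1).2; rewrite ?at_ ?au // (le_trans tu).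
have [ct|/ltW tc] := leP c t.
  by apply: le_trans (mK2 _); apply: (k2 t u _ _ t2 u2).2; rewrite ?ub ?cu ?ct.
have a1 : `|phi ((x c)^-1 * x t)%g - phi ((x c)^-1 * x c)%g| <= K1 * `|t - c|.
  by apply: (k1 t c _ acc t1 cc1).2; rewrite at_.
have a2 : `|phi ((x c)^-1 * x c)%g - phi ((x c)^-1 * x u)%g| <= K2 * `|c - u|.
  by apply: (k2 c u ccb _ cc2 u2).2; rewrite cu.
have -> : `|t - u| = `|t - c| + `|c - u|.
  by rewrite !ler0_norm ?subr_le0 //; ring.
rewrite mulrDr; apply: le_trans (lerD (mK1 _) (mK2 _)); apply: le_trans (lerD a1 a2).
by apply: le_trans (ler_normD _ _); rewrite addrA subrK.
Qed.

Lemma control_normE h t : control_norm h t = nrm (ctl h t).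
Proof.
rewrite /control_norm /nrm /dotr; congr Num.sqrt.
by apply: eq_bigr => a _; rewrite mxE expr2.
Qed.

Lemma measurable_glue (f g : R -> R) (a c b : R) : a <= c -> c <= b ->
  measurable_fun `[a, c] f -> measurable_fun `[c, b] g ->
  measurable_fun `[a, b] (fun t => if t <= c then f t else g t).
Proof.
move=> ac cb mf mg; apply: measurable_fun_if => //.
- exact: measurable_fun_ler.
- apply: measurable_funS mf => // t [/=]; rewrite !in_itv /= => /andP[-> _] ->.
  by [].
- apply: measurable_funS mg => // t [/=]; rewrite !in_itv /= => /andP[_ ->] /negbT.
  by rewrite -ltNge => /ltW ->.
Qed.

(** Each vector of [vs] is used as a constant control during one unit of time,
    so that the length is the sum of the norms. *)
Lemma word_curve (p : G) (vs : seq 'rV[R]_r) : exists gam h,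
  [/\ horizontal 0 (size vs)%:R gam h, gam 0 = p,
      gam (size vs)%:R = foldl (fun q v => q * expo (hvec v) 1)%g p vs,
      measurable_fun (`[0, (size vs)%:R] : set R) (control_norm h) &
      curve_length 0 (size vs)%:R h = (\sum_(v <- vs) nrm v)%:E].
Proof.
elim/last_ind: vs => [|vs v [gam [h [hh g0 gT mh hL]]]].
  exists (fun=> p), (fun _ _ => 0); split=> //.
  - apply: lgd_horizontal; first exact: gLip_cst.
      move=> i; split; first exact: measurable_cst.
      by exists 0; apply: aeW => t _; rewrite normr0.
    apply: aei_all => t; rewrite /= => /andP[t0 t1]; have := lt_trans t0 t1.
    by rewrite ltxx.
  - rewrite (_ : control_norm _ = fun=> 0); first exact: measurable_cst.
    apply/funext => t; rewrite /control_norm big1 ?sqrtr0 // => i _.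
    by rewrite expr0n.
  - rewrite /curve_length set_itv1 integral_set1 big_nil.
    by [].
rewrite size_rcons; set k : R := (size vs)%:R; have k0 : 0 <= k by rewrite /k ler0n.
have k1 : k <= (size vs).+1%:R by rewrite /k ler_nat.
have kE : (size vs).+1%:R = k + 1 :> R by rewrite /k natr1.
pose gam' t := if t <= k then gam t else (gam k * expo (hvec v) (t - k))%g.
pose h' i t := if t <= k then h i t else v 0 i.
have hl := horizontal_gLip hh; have hd := horizontal_lgd hh; have [_ hi _] := hh.
have ctl1 t : t <= k -> ctl h' t = ctl h t.
  by move=> tk; apply/rowP => i; rewrite !mxE /h' tk.
have ctl2 t : k < t -> ctl h' t = v.
  by move=> kt; apply/rowP => i; rewrite !mxE /h' leNgt kt.
exists gam', h'; split.
- apply: lgd_horizontal.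
  + apply: (gLip_cat k0 k1).
      by apply: gLip_ext hl => t /andP[_ tk]; rewrite /gam' tk.
    apply: (@gLip_ext _ _ _ (fun t => gam k * expo (hvec v) (t - k))%g).
      move=> t /andP[kt _]; rewrite /gam'; case: leP => // tk.
      have -> : t = k by apply: le_anti; rewrite tk.
      by rewrite subrr expo0 mulg1.
    by apply: gLip_left; apply: gLip_expo; apply: lipD; [exact: lip_id|exact: lip_cst].
  + move=> i; have [mi [B hB]] := hi i; split; first by apply: measurable_glue.
    exists (Num.max B `|v 0 i|); apply: ae_S hB => t hB.
    rewrite in_itv /= => /andP[t0 t1]; rewrite /h'; case: (leP t k) => tk; last by rewrite le_max lexx orbT.
    by rewrite le_max hB // in_itv /= t0.
  + apply: (@aei_cat _ k).
      apply: aei_imp hd => t /andP[t0 tk]; rewrite ctl1 ?(ltW tk) //.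
      apply: (@lgd_ext _ _ _ gam _ t _ (k - t)); first by rewrite subr_gt0.
      move=> u; rewrite ltr_norml ltrD2r => /andP[_ uk]; by rewrite /gam' (ltW uk).
    apply: aei_all => t /andP[kt t1]; rewrite ctl2 //.
    have hE : lgd (fun t => gam k * expo (hvec v) (t - k))%g t (hvec v).
      apply: lgd_left; rewrite -[X in lgd _ _ X]scale1r; apply: lgd_comp.
        exact: lgd_expo.
      by have := datB (dat_id t) (dat_cst k t); rewrite subr0.
    apply: (@lgd_ext _ _ _ _ _ t _ (t - k)) hE; first by rewrite subr_gt0.
    move=> u; rewrite ltr_norml => /andP[uk _]; rewrite /gam' leNgt.
    by rewrite (_ : k < u) //; lra.
- by rewrite /gam' k0.
- rewrite foldl_rcons -gT kE /gam' (_ : k + 1 <= k = false); last by apply/negbTE; rewrite -ltNge; lra.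
  by rewrite addrAC subrr add0r.
- have := measurable_glue k0 k1 mh (measurable_cst (nrm v)).
  congr (measurable_fun _ _); apply/funext => t; rewrite !control_normE.
  by case: (leP t k) => tk; [rewrite ctl1|rewrite ctl2].
rewrite /curve_length kE.
have m' : measurable_fun `[0, k + 1] (control_norm h').
  rewrite -kE; have := measurable_glue k0 k1 mh (measurable_cst (nrm v)).
  congr (measurable_fun _ _); apply/funext => t; rewrite !control_normE.
  by case: (leP t k) => tk; [rewrite ctl1|rewrite ctl2].
have itvE : `[0, k + 1]%classic = `[0, k]%classic `|` `]k, k + 1]%classic :> set R.
  by rewrite (@itv_bndbnd_setU _ _ _ (BRight k)) // bnd_simp; lra.
rewrite itvE ge0_integral_setU //=; last first.
- apply/disj_setPS => t [/=]; rewrite !in_itv /= => /andP[_ tk] /andP[kt _].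
  by have := lt_le_trans kt tk; rewrite ltxx.
- move=> t _; rewrite lee_fin control_normE; exact: nrm_ge0.
- rewrite -itvE; exact/measurable_EFinP.
rewrite big_rcons /= EFinD; congr (_ + _)%E.
  rewrite -hL; apply: eq_integral => t; rewrite inE /= in_itv /= => /andP[_ tk].
  by rewrite !control_normE ctl1.
rewrite (eq_integral (fun=> (nrm v)%:E)).
  transitivity ((nrm v)%:E * mu `]k, (k + 1)%R]%classic)%E; first exact: integral_cst.
  rewrite lebesgue_measure_itv /= lte_fin ltrDl ltr01 -EFinB.
  by rewrite addrAC subrr add0r mule1.
move=> t; rewrite inE /= in_itv /= => /andP[kt _].
by rewrite control_normE ctl2.
Qed.

End horizontal_curves.

(** * Minimizers *)

Section minimizer.
Context {R : realType} {n s r : nat} (G : carnot_group R n s r).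
Local Notation mu := (@lebesgue_measure R).
Local Notation hb := (hbasis G).
Local Notation hvec := (hvec G).
Local Notation expo := (expo G).
Local Notation M := 'M[R]_n.+1.
Context (P : 'M[R]_n) (d : 'I_n -> nat).
Context (P_unit : P \in unitmx) (d_s : forall k, (1 <= d k <= s)%N).
Context (P_lay : forall k, row k P \in layer G (d k)).
Context (d_mono : forall k l : 'I_n, (k <= l)%N -> (d k <= d l)%N).
Local Notation wt := (wt d).
Local Notation rho := (rho G P d).
Local Notation Gm := (Gm (G := G) P d).
Local Notation Gam := (Gam G P d).
Local Notation hor := (hor (Xb G P d)).
Local Notation nexp := (nexp (R := R) (n := n) s).
Local Notation scl := (scl (R := R) wt).

Context (T : R) (gamma : R -> G) (h : 'I_r -> R -> R) (hT : 0 < T).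
Context (hgamma : horizontal (- T) T gamma h) (harc : arclength (- T) T h).
Context (hmin : length_minimizing (- T) T gamma h).

Let TT : - T <= T. Proof. by have := hT; lra. Qed.

(** The controls are bounded almost everywhere only; truncation makes them
    bounded everywhere, and changes them on a null set. *)
Definition trunc (a : 'I_r) (t : R) : R := Num.max (-1) (Num.min 1 (h a t)).

Lemma trunc_le a t : `|trunc a t| <= 1.
Proof.
rewrite /trunc ler_norml le_max lexx /= ge_max ge_min lexx /=.
by rewrite andbT; lra.
Qed.

Lemma trunc_id a t : `|h a t| <= 1 -> trunc a t = h a t.
Proof. by rewrite ler_norml => /andP[h1 h2]; rewrite /trunc min_r // max_r. Qed.

Lemma meas_h a : measurable_fun `[- T, T] (h a).
Proof. by case: hgamma => _ /(_ a)[]. Qed.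

Lemma trunc_bmeas a : bmeas (trunc a) (- T) T.
Proof.
split; last by exists 1 => t _; exact: trunc_le.
apply: (@measurable_maxr _ _ _ _ (fun=> -1) (fun t => Num.min 1 (h a t))); first exact: measurable_cst.
by apply: (@measurable_minr _ _ _ _ (fun=> 1) (h a)); [exact: measurable_cst|exact: meas_h].
Qed.

Lemma trunc_norm t : `|ctl trunc t| <= 1.
Proof. by apply: norm_mx_le => // i a; rewrite mxE trunc_le. Qed.

Lemma ctl_trunc t : control_norm h t = 1 -> ctl h t = ctl trunc t /\ nrm (ctl trunc t) = 1.
Proof.
rewrite control_normE => ht.
have E : ctl h t = ctl trunc t.
  apply/rowP => a; rewrite !mxE trunc_id // -ht.
  by have := entry_le_nrm (ctl h t) a; rewrite mxE.
by rewrite -E.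
Qed.

Lemma ctl_ae : aei (- T) T (fun t => ctl h t = ctl trunc t /\ nrm (ctl trunc t) = 1).
Proof. by apply: aei_imp (ae_aei harc) => t _; exact: ctl_trunc. Qed.

Lemma hvec_bmeas k : bmeas (fun t => \sum_a trunc a t * crd P hb`_a 0 k) (- T) T.
Proof.
apply: bmeas_sum => a; apply: bmeasM; [exact: trunc_bmeas|exact: bmeas_cst].
Qed.

(** [peel] applies to the curve translated so as to start at the identity. *)
Lemma lift_curve : exists2 L : R -> M, L (- T) = 1 & [/\ lip L (- T) T,
  aei (- T) T (fun t => dat L t (L t * hor (ctl trunc t))) &
  forall t, - T <= t <= T -> Gm n ((gamma (- T))^-1 * gamma t)%g (L t)].
Proof.
pose hk (k : 'I_n) t := \sum_a trunc a t * crd P hb`_a 0 k.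
have hkE t : comb P hk t = hvec (ctl trunc t).
  rewrite -[RHS](crdK P_unit) /comb; congr (_ *m _); apply/rowP => k; rewrite mxE.
  rewrite /hk {2}/crd mulmx_suml summxE; apply: eq_bigr => a _.
  by rewrite -scalemxAl [RHS]mxE [ctl _ _ _ _]mxE.
have [||||L L0 [Ll Ld LG]] := @peel R n s r G P d P_unit d_s P_lay d_mono n (- T) T
    (fun t => (gamma (- T))^-1 * gamma t)%g hk 1 (leqnn n) TT _ hvec_bmeas.
- by apply: gLip_left; exact: horizontal_gLip hgamma.
- by move=> t i; rewrite subnn.
- apply: aei_imp (aei_and (horizontal_lgd hgamma) ctl_ae) => t _ [hl [E _]].
  by rewrite hkE -E; exact: lgd_left.
- by rewrite mulVg; exact: Gm_one.
exists L => //; split=> //; apply: aei_imp Ld => t _.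
by rewrite hkE rho_hvec.
Qed.

Lemma prim_trunc : exists2 X : R -> 'rV[R]_r, lip X (- T) T &
  aei (- T) T (fun t => dat X t (ctl trunc t)).
Proof.
have hX a : exists F : R -> R, lip F (- T) T /\ aei (- T) T (fun t => dat F t (trunc a t)).
  by have [F [Fl Fd _]] := bmeas_primitive (trunc_bmeas a); exists F.
have [X hX'] := choice hX; exists (fun t => \row_a X a t).
  apply/lip_mxP => i a; case: (hX' a) => + _; congr (lip _ _ _).
  by apply/funext => t; rewrite mxE.
apply: aei_imp (aei_forall (fun a => (hX' a).2)) => t _ hd; apply/dat_mxP => i a.
by rewrite mxE; apply: dat_ext ltr01 _ (hd a) => u _; rewrite mxE.
Qed.

Lemma dotr_bmeas v : bmeas (fun t => dotr v (ctl trunc t) ^+ 2) (- T) T.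
Proof.
have h1 : bmeas (fun t => dotr v (ctl trunc t)) (- T) T.
  rewrite /dotr; apply: bmeas_sum => a; apply: bmeasM; first exact: bmeas_cst.
  by apply: bmeas_ext (trunc_bmeas a) => t _; rewrite mxE.
by apply: bmeas_ext (bmeasM h1 h1) => t _; rewrite expr2.
Qed.

Lemma length_gamma : curve_length (- T) T h = (2 * T)%:E.
Proof.
rewrite /curve_length.
have mc : measurable_fun `[- T, T] (control_norm h).
  apply: (measurableT_comp (f := @Num.sqrt R)).
    by apply: continuous_measurable_fun; exact: sqrt_continuous.
  by apply: measurable_sum => i; apply: measurable_funX; exact: meas_h.
rewrite (@ge0_ae_eq_integral _ _ _ mu `[- T, T]%classic _ (fun=> 1%E)) //.
- transitivity (1%:E * mu `[(- T)%R, T]%classic)%E; first exact: integral_cst.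
  rewrite lebesgue_measure_itv /= lte_fin mul1e.
  have -> : - T < T by have := hT; lra.
  by rewrite -EFinD; congr (_%:E); ring.
- exact/measurable_EFinP.
- by move=> t _; rewrite lee_fin control_normE nrm_ge0.
- by apply: (@filterS _ _ (ae_filter_ringOfSetsType mu)) harc => t ht tT; rewrite ht.
Qed.

Lemma Gm_word (vs : seq 'rV[R]_r) :
  Gm n (foldl (fun q v => q * expo (hvec v) 1)%g 1%g vs) (\prod_(v <- vs) nexp (hor v)).
Proof.
elim/last_ind: vs => [|vs v IH]; first by rewrite big_nil; exact: Gm_one.
rewrite foldl_rcons -cats1 big_cat big_seq1 /= -rho_hvec.
by have := Gm_exp P_unit d_s P_lay d_mono (hvec v) 1 IH; rewrite scale1r.
Qed.

Lemma foldl_left (p q : G) (vs : seq 'rV[R]_r) :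
  foldl (fun q v => q * expo (hvec v) 1)%g (p * q)%g vs =
  (p * foldl (fun q v => q * expo (hvec v) 1)%g q vs)%g.
Proof. by elim: vs q => //= v vs IH q; rewrite -mulgA IH. Qed.

(** The curve of the word, started at [gamma (- T)], ends at [gamma T] because
    a matrix determines the element of the group it stands for; minimality
    compares the lengths. *)
Lemma word_min (L : M) l : Gm n ((gamma (- T))^-1 * gamma T)%g L ->
  @W R n r s (Xb G P d) l L -> 2 * T <= l.
Proof.
move=> hL [vs [LE hl]]; apply: le_trans hl.
have := Gm_word vs; rewrite -LE => hL'.
have E := Gam_inj P_unit d_s P_lay d_mono hL hL'.
have [gam [hw [hh g0 g1 _ hlen]]] := word_curve (gamma (- T)) vs.
have gT : gam (size vs)%:R = gamma T.
  by rewrite g1 -[gamma (- T)]mulg1 foldl_left -E mulVKg.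
rewrite -lee_fin -length_gamma hmin; apply: ereal_inf_lbound.
by exists 0, (size vs)%:R, gam, hw; split=> //.
Qed.

Lemma dat_dotr (f : R -> 'rV[R]_r) t w v : dat f t v -> dat (fun x => dotr w (f x)) t (dotr w v).
Proof. by move=> /dat_mxP hf; apply: dat_sum => a; apply: datMc; exact: hf. Qed.

Lemma lip_dotr (f : R -> 'rV[R]_r) a b w : lip f a b -> lip (fun x => dotr w (f x)) a b.
Proof.
by move=> /lip_mxP hf; apply: lip_sum => i; apply: lipM; [exact: lip_cst|exact: hf].
Qed.

Lemma dat_scl (f : R -> M) (c t : R) v : dat f t v -> dat (fun x => scl c (f x)) t (scl c v).
Proof.
move=> /dat_mxP hf; apply/dat_mxP => k l; rewrite mxE.
by apply: dat_ext ltr01 _ (datMc _ (hf k l)) => x _; rewrite mxE.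
Qed.

Lemma lip_scl (f : R -> M) (c : R) a b : lip f a b -> lip (fun x => scl c (f x)) a b.
Proof.
move=> /lip_mxP hf; apply/lip_mxP => k l.
have := lipM (lip_cst (c ^+ wt k / c ^+ wt l) a b) (hf k l); congr (lip _ _ _).
by apply/funext => x; rewrite mxE.
Qed.

Lemma coord_hvec (v : 'rV[R]_r) i : coord hb i (hvec v) = v 0 i.
Proof. by rewrite coord_sum_free //; exact: (basis_free (hbasisP G)). Qed.

Lemma hdot_hvec (v w : 'rV[R]_r) : hdot G (hvec v) (hvec w) = dotr v w.
Proof. by apply: eq_bigr => a _; rewrite !coord_hvec. Qed.

Lemma hvec_sphere (v : 'rV[R]_r) : nrm v = 1 -> hsphere G (hvec v).
Proof.
move=> v1; split; last by rewrite hdot_hvec -nrm_sqr v1 expr1n.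
by rewrite -lay1; apply: memv_suml => a _; apply: memvZ; exact: hbasis_lay.
Qed.

(** The infimum is tested on the direction [v]; the truncated controls give
    the same integral. *)
Lemma excess_energy eps eta (v : 'rV[R]_r) : 0 <= eps -> 0 < eta <= T -> nrm v = 1 ->
  eps <= excess G h `[- eta, eta] ->
  2 * eta * eps ^+ 2 <= \int[mu]_(t in `[- eta, eta]) (dotr v (ctl trunc t) ^+ 2).
Proof.
move=> e0 /andP[eta0 etaT] v1 he.
have muE : fine (mu `[- eta, eta]%classic) = 2 * eta.
  rewrite lebesgue_measure_itv /= lte_fin (_ : - eta < eta); last by lra.
  by rewrite -EFinD /=; ring.
pose I := \int[mu]_(t in `[- eta, eta]) (hdot G (hvec v) (hvelocity G h t) ^+ 2).
have IE : I = \int[mu]_(t in `[- eta, eta]) (dotr v (ctl trunc t) ^+ 2).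
  have [mt _] : bmeas (fun t => dotr v (ctl trunc t) ^+ 2) (- eta) eta.
    by apply: bmeas_sub (dotr_bmeas v) => //; lra.
  rewrite /I /Rintegral; congr fine; apply: ae_eq_integral => //.
  - apply/measurable_EFinP; apply: measurable_funX.
    rewrite (_ : (fun x => _) = fun t => \sum_a v 0 a * h a t); last first.
      by apply/funext => t; rewrite hvelocityE hdot_hvec; apply: eq_bigr => a _; rewrite mxE.
    apply: measurable_sum => a; apply: measurable_funM; first exact: measurable_cst.
    apply: measurable_funS (meas_h a) => //; apply: subset_itv; rewrite bnd_simp; lra.
  - exact/measurable_EFinP.
  apply: (@filterS _ _ (ae_filter_ringOfSetsType mu)) harc => t ht /=.
  rewrite in_itv /= => /andP[t1 t2]; rewrite hvelocityE hdot_hvec.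
  have [|-> //] := @ctl_trunc t; apply: ht; rewrite in_itv /=; lra.
have : eps <= Num.sqrt ((fine (mu `[- eta, eta]%classic))^-1 * I).
  apply: le_trans he _; apply: ge_inf.
    by exists 0 => _ [w _ <-]; exact: sqrtr_ge0.
  by exists (hvec v) => //; exact: hvec_sphere.
rewrite muE IE; set J := \int[_]_(_ in _) _ => hs.
have J0 : 0 <= (2 * eta)^-1 * J.
  rewrite mulr_ge0 ?invr_ge0 //; first by lra.
  by apply: Rintegral_ge0 => t _; exact: sqr_ge0.
have : eps ^+ 2 <= (2 * eta)^-1 * J.
  by rewrite -(sqr_sqrtr J0) ler_pXn2r // nnegrE ?sqrtr_ge0.
by rewrite mulrC ler_pdivlMr 1?mulrC //; lra.
Qed.

(** The data of [no_excess_bound] for the lift [L] of the curve: increments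
    [m] of the lift, [D] of the horizontal coordinates and [E] of the
    energies. *)
Lemma excess_not_bounded eps eta0 : 0 < eps -> 0 < eta0 -> eta0 <= T ->
  (forall eta, 0 < eta <= eta0 -> eps <= excess G h `[- eta, eta]) -> False.
Proof.
move=> eps0 eta00 etaT hexc.
have [L L0 [Ll Ld LG]] := lift_curve; have [X Xl Xd] := prim_trunc.
have [F hF] := choice (fun v => bmeas_primitive (dotr_bmeas v)).
have hGV := GamV P_unit d_s P_lay d_mono.
have LGam t : - T <= t <= T -> Gam (L t) by move=> /LG; exists ((gamma (- T))^-1 * gamma t)%g.
have LU t : - T <= t <= T -> L t \is a GRing.unit by move=> /LGam; exact: (Gam_unit hGV).
pose m a b := (L a)^-1 * L b; pose D a b := X b - X a; pose E v a b := F v b - F v a.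
have Xb_hom a : Hom wt 1 (Xb G P d a) := gl_Hom P_unit d_s P_lay (Xb_gl G P d a).
have m_Gam a b : - T <= a -> a <= b -> b <= T -> Gam (m a b).
  move=> Ta ab bT; apply: (GamM P_unit d_s P_lay d_mono).
    by apply: (Gam_inv hGV); apply: LGam; rewrite Ta (le_trans ab).
  by apply: LGam; rewrite bT (le_trans Ta).
have sub a b (Ta : - T <= a) (bT : b <= T) t : a <= t <= b -> - T <= t <= T.
  by move=> /andP[at_ tb]; rewrite (le_trans Ta) // (le_trans tb).
have m_est B : 0 <= B -> exists2 C, 0 <= C & forall eta a b, 0 < eta ->
    - T <= a -> a <= b -> b <= T -> b - a <= B * eta ->
    `|scl eta^-1 (m a b) - 1 - hor (eta^-1 *: D a b)| <= C * ((b - a) / eta) ^+ 2.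
  move=> B0; have [C C0 hC] := hsol_est (wt_s d_s) Xb_hom B0; exists C => //.
  move=> eta a b e0 Ta ab bT bB.
  have ei : eta^-1 != 0 by rewrite invr_eq0 gt_eqF.
  have haT : - T <= a <= T by rewrite Ta (le_trans ab).
  apply: (hC eta a b (fun t => scl eta^-1 (m a t)) X (ctl trunc)) => //; split.
  - by rewrite /m mulVr ?LU // scl_one.
  - apply: lip_scl; apply: (@lip_mulmx _ _ _ _ (fun=> (L a)^-1) L); first exact: lip_cst.
    exact: lip_sub Ll.
  - move=> t /andP[at_ tb]; rewrite -(scl_one wt ei) -sclB; apply: Fil_scl.
    by apply: (Gam_Fil P_unit d_s P_lay); apply: m_Gam => //; exact: le_trans bT.
  - exact: lip_sub Xl.
  apply: aei_imp (aei_sub Ta bT (aei_and Xd Ld)) => t _ [dX dL]; split=> //.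
    exact: trunc_norm.
  have dm : dat (m a) t (m a t * hor (ctl trunc t)).
    have := @dat_mulmx R _ _ _ (fun=> (L a)^-1) L t _ _ (dat_cst (L a)^-1 t) dL.
    by move=> /dat_eq; apply; rewrite mul0mx add0r !mulmxE mulrA.
  apply: dat_eq (dat_scl _ dm) _; rewrite sclM //; congr (_ * _).
  by rewrite (scl_Hom ei (hor_hom Xb_hom _)) expr1 horZ'.
have D_le a b : - T <= a -> a <= b -> b <= T -> nrm (D a b) <= b - a.
  move=> Ta ab bT; have H w : dotr w (D a b) <= nrm w * (b - a).
    rewrite /D dotrB mulrBr.
    apply: (@lip_le _ (fun t => dotr w (X t)) (fun t => nrm w * t) _ _ ab).
    - apply: lip_dotr; exact: lip_sub Xl.
    - apply: lipM; [exact: lip_cst|exact: lip_id].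
    apply: aei_imp (aei_sub Ta bT (aei_and Xd ctl_ae)) => t _ [dX [_ u1]].
    exists (dotr w (ctl trunc t)), (nrm w); split; first exact: dat_dotr.
      by have := datMc (nrm w) (dat_id t); rewrite mulr1.
    by apply: le_trans (ler_norm _) (le_trans (cauchy_schwarz _ _) _); rewrite u1 mulr1.
  have [D0|Dn] := eqVneq (nrm (D a b)) 0; first by rewrite D0 subr_ge0.
  have Dp : 0 < nrm (D a b) by rewrite lt_neqAle eq_sym Dn nrm_ge0.
  by rewrite -(ler_pM2l Dp) -expr2 nrm_sqr.
have E_le v a b : nrm v = 1 -> - T <= a -> a < b -> b <= T ->
    E v a b <= dotr v (D a b) ^+ 2 / (b - a) + (b - a) - nrm (D a b) ^+ 2 / (b - a).
  move=> v1 Ta ab bT; have l0 : 0 < b - a by rewrite subr_gt0.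
  (* The mean velocity. The right-hand side below is the increment of [g],
     and the derivative of [F v] is at most that of [g] by the Cauchy-Schwarz
     inequality for [v] and the deviation of the velocity from [w]. *)
  pose w := (b - a)^-1 *: D a b.
  pose g t := (1 + dotr w w - dotr v w ^+ 2) * t + (2 * dotr v w * dotr v (X t) - 2 * dotr w (X t)).
  have [Fl Fd _] := hF v.
  have gE : g b - g a = dotr v (D a b) ^+ 2 / (b - a) + (b - a) - nrm (D a b) ^+ 2 / (b - a).
    have -> : g b - g a = (1 + dotr w w - dotr v w ^+ 2) * (b - a) +
       (2 * dotr v w * dotr v (D a b) - 2 * dotr w (D a b)).
      by rewrite /g /D !dotrB; ring.
    have wE x : dotr x w = (b - a)^-1 * dotr x (D a b).
      by rewrite /w dotrZ.
    rewrite nrm_sqr !wE (dotrC w) wE.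
    by field; rewrite gt_eqF.
  rewrite -gE /E; apply: (@lip_le _ (F v) g _ _ (ltW ab)).
  - exact: lip_sub Fl.
  - apply: lipD; first by apply: lipM; [exact: lip_cst|exact: lip_id].
    apply: lipD; last apply: lipN.
      by apply: lipM; [exact: lip_cst|apply: lip_dotr; exact: lip_sub Xl].
    by apply: lipM; [exact: lip_cst|apply: lip_dotr; exact: lip_sub Xl].
  apply: aei_imp (aei_sub Ta bT (aei_and Fd (aei_and Xd ctl_ae))) => t _ [dF [dX [_ u1]]].
  set u := ctl trunc t in dF dX u1 *.
  exists (dotr v u ^+ 2), ((1 + dotr w w - dotr v w ^+ 2) + (2 * dotr v w * dotr v u - 2 * dotr w u)).
  split=> //.
    apply: datD; first by have := datMc (1 + dotr w w - dotr v w ^+ 2) (dat_id t); rewrite mulr1.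
    by apply: datB; apply: datMc; exact: dat_dotr.
  have cs : dotr v (u - w) ^+ 2 <= dotr (u - w) (u - w).
    by have := cauchy_schwarz_sqr v (u - w); rewrite -(nrm_sqr v) v1 expr1n mul1r.
  have uu : dotr u u = 1 by rewrite -nrm_sqr u1 expr1n.
  move: cs; rewrite !dotrB (dotrC (u - w) u) (dotrC (u - w) w) !dotrB uu (dotrC u w).
  by move=> cs; lra.
have Gam_hor v : Gam (nexp (hor v)).
  by rewrite -rho_hvec; exact: (Gam_exp P_unit d_s P_lay d_mono).
have m_cat a b c : - T <= a -> a <= b -> b <= c -> c <= T -> m a b * m b c = m a c.
  move=> Ta ab bc cT; rewrite /m -mulrA mulVKr //; apply: LU.
  by rewrite (le_trans Ta) // (le_trans bc).
have m_min l : @W R n r s (Xb G P d) l (m (- T) T) -> 2 * T <= l.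
  rewrite /m L0 invr1 mul1r; apply: word_min; apply: LG; by rewrite TT lexx.
have E_cat v a b c : - T <= a -> a <= b -> b <= c -> c <= T -> E v a b + E v b c = E v a c.
  by move=> *; rewrite /E; ring.
have exc v eta : nrm v = 1 -> 0 < eta <= eta0 -> 2 * eta * eps ^+ 2 <= E v (- eta) eta.
  move=> v1 /andP[e1 e2]; have eT : 0 < eta <= T by rewrite e1 (le_trans e2).
  apply: le_trans (excess_energy (ltW eps0) eT v1 (hexc _ _)) _; first by rewrite e1.
  by have [_ _ hFE] := hF v; rewrite /E hFE //; lra.
exact: (no_excess_bound (wt_s d_s) (s_pos G) (Xb_gl G P d) (gl_Hom P_unit d_s P_lay)
  (gl1_hor G P_unit d_s) (gl_succ P_unit d_s P_lay) (Gam1 G P d)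
  (GamM P_unit d_s P_lay d_mono) hGV (Gam_Fil P_unit d_s P_lay) Gam_hor
  (Gam_lead P_unit d_s P_lay d_mono) (Gam_scl P_unit d_s P_lay)
  m_Gam m_cat m_est D_le m_min E_cat E_le eps0 eta00 etaT exc (cg_rank G)).
Qed.

End minimizer.

Theorem theorem1p2 (R : realType) (n s r : nat) (G : carnot_group R n s r)
    (T : R) (gamma : R -> G) (h : 'I_r -> R -> R)
    (hT : 0 < T)
    (hgamma : horizontal (- T) T gamma h)
    (harc : arclength (- T) T h)
    (hmin : length_minimizing (- T) T gamma h) :
  exists eta : nat -> R,
    [/\ forall i, 0 < eta i <= T,
        decreasing_seq eta,
        eta i @[i --> \oo] --> (0 : R) &
        excess G h `[- eta i, eta i] @[i --> \oo] --> (0 : R)].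
Proof.
have [P [d [P_unit d_s P_lay d_mono]]] := adapted_basis G.
(* The condition on the radius is inside the existential, so that a choice
   function is defined on all pairs. *)
have small (p : R * nat) : exists eta, 0 < p.1 <= T ->
    0 < eta <= p.1 /\ excess G h `[- eta, eta] < p.2.+1%:R^-1.
  apply: contrapT => none; have p_T : 0 < p.1 <= T.
    by apply/negPn/negP => np; apply: none; exists 0 => p_T; rewrite p_T in np.
  have /andP[p0 pT] := p_T; have e0 : 0 < p.2.+1%:R^-1 :> R by rewrite invr_gt0 ltr0Sn.
  apply: (excess_not_bounded P_unit d_s P_lay d_mono hT hgamma harc hmin e0 p0 pT) => eta he.
  by rewrite leNgt; apply/negP => lt_e; apply: none; exists eta.
have [f hf] := choice small.
(* Halving the bound at each step makes the radii decrease strictly to 0. *)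
pose fix eta i : R := if i is j.+1 then f (eta j / 2, i) else f (T, 0%N).
have eta_S i : 0 < eta i <= T ->
    0 < eta i.+1 <= eta i / 2 /\ excess G h `[- eta i.+1, eta i.+1] < i.+2%:R^-1.
  by move=> /andP[e0 eT]; apply: (hf (eta i / 2, i.+1)) => /=; lra.
have [eta_0 exc_0] : 0 < eta 0%N <= T /\ excess G h `[- eta 0%N, eta 0%N] < 1%:R^-1.
  by apply: (hf (T, 0%N)); rewrite /= hT lexx.
have eta_T i : 0 < eta i <= T.
  elim: i => // i IH; have [/andP[-> half_i] _] := eta_S i IH; case/andP: IH => _ eT.
  by rewrite andTb (le_trans half_i) // ler_pdivrMr // mulr_natr mulr2n (le_trans eT) // lerDl ltW.
have eta_half i : eta i.+1 <= eta i / 2.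
  by have [/andP[]] := eta_S i (eta_T i).
have exc_lt i : excess G h `[- eta i, eta i] < i.+1%:R^-1.
  by case: i => [//|i]; have [] := eta_S i (eta_T i).
exists eta; split=> //.
- apply/decreasing_seqP => i; have := eta_half i; have /andP[] := eta_T i; lra.
- apply: (@squeeze_cvgr _ _ _ _ (fun=> 0) (geometric T (2^-1))).
  + apply: nearW => i; have /andP[/ltW -> _] /= := eta_T i.
    elim: i => [|i IH]; first by rewrite expr0 mulr1; case/andP: (eta_T 0%N).
    have := eta_half i; rewrite exprSr mulrA; lra.
  + exact: cvg_cst.
  + by apply: cvg_geometric; rewrite ger0_norm; lra.
apply: (@squeeze_cvgr _ _ _ _ (fun=> 0) harmonic).
- apply: nearW => i; rewrite (ltW (exc_lt i)) andbT.
  rewrite /excess; set E := [set _ | _ in _].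
  have [->|/set0P E0] := eqVneq E set0; first by rewrite inf0.
  by apply: lb_le_inf => // _ [v _ <-]; exact: sqrtr_ge0.
- exact: cvg_cst.
exact: cvg_harmonic.
Qed.
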